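(* Let $T\in\mathcal{K}(V)$ be injective and bisectorial of angle $\omega\in(0,\frac{\pi}{2})$, such that $T^2$ is $m$-accretive. Then $T$ has a bounded $H^\infty$-functional calculus.
   Context: **Clifford algebra and modules.** Let $n\in\mathbb{N}$ and let $\mathbb{R}_n$ be the real Clifford algebra generated by $e_1,\dots,e_n$ with $e_i^2=-1$, $e_ie_j=-e_je_i$ for $i\neq j$. $\overline{\,\cdot\,}$ is Clifford conjugation (the real-linear anti-automorphism with $\overline{e_i}=-e_i$), $\operatorname{Sc}$ is the scalar part, $|\cdot|$ is the Euclidean norm. Paravectors: $\mathbb{R}^{n+1}=\{x_0+x_1e_1+\dots+x_ne_n\mid x_i\in\mathbb{R}\}$, with $s_0=\operatorname{Sc}(s)$. $\mathbb{S}=\{x_1e_1+\dots+x_ne_n\mid x_1^2+\dots+x_n^2=1\}$; for $J\in\mathbb{S}$, $\mathbb{C}_J=\{x+Jy\mid x,y\in\mathbb{R}\}$. $V$ is a right Hilbert module: a real vector space which is a right $\mathbb{R}_n$-module (extending real scalar multiplication), with an $\mathbb{R}$-bilinear form $\langle\cdot,\cdot\rangle:V\times V\to\mathbb{R}_n$ satisfying $\langle vs,w\rangle=\overline{s}\langle v,w\rangle$, $\langle v,ws\rangle=\langle v,w\rangle s$, $\overline{\langle v,w\rangle}=\langle w,v\rangle$, and such that $(V,\operatorname{Sc}\langle\cdot,\cdot\rangle)$ is a real Hilbert space; $\|v\|^2=\operatorname{Sc}\langle v,v\rangle$. **Operators and $S$-spectrum.** $T:\operatorname{dom}T\to V$ is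 right linear if $\operatorname{dom}T$ is a right submodule, $T$ is additive and $T(vs)=(Tv)s$ for $s\in\mathbb{R}_n$. $\mathcal{K}(V)$ is the set of closed right linear operators, $\mathcal{B}(V)$ the set of everywhere defined bounded right linear operators. For $s\in\mathbb{R}^{n+1}$: $Q_s[T]=T^2-2s_0T+|s|^2$ with domain $\operatorname{dom}T^2$; $\rho_S(T)=\{s\in\mathbb{R}^{n+1}\mid Q_s[T]^{-1}\in\mathcal{B}(V)\}$, $\sigma_S(T)=\mathbb{R}^{n+1}\setminus\rho_S(T)$. $\mathcal{I}^Rs:V\to V$ is right multiplication $v\mapsto vs$. One has $s\in\rho_S(T)$ iff $\mathcal{I}^Rs-T$ is bijective from $\operatorname{dom}T$ onto $V$. **$m$-accretive.** An operator $A\in\mathcal{K}(V)$ is $m$-accretive if a) $\operatorname{Sc}\langle Av,v\rangle\ge0$ for all $v\in\operatorname{dom}A$, and b) $\overline{\operatorname{ran}}(1+A)=V$ (the closure of the range is $V$). **Bisectorial operators.** $S_\omega=\{s\in\mathbb{R}^{n+1}\setminus\{0\}\mid|\operatorname{Arg}(s)|<\omega\}$, where $\operatorname{Arg}(s)=\arccos(s_0/|s|)$; $D_\omega=S_\omega\cup(-S_\omega)$ for $\omega\in(0,\frac{\pi}{2})$. $T\in\mathcal{K}(V)$ is bisectorial of angle $\omega\in(0,\frac{\pi}{2})$ if $\sigma_S(T)\subseteq\overline{D_\omega}$ and for every $\varphi\in(\omega,\frac{\pi}{2})$ there is $C_\varphi\ge0$ with $\|(\mathcal{I}^Rs-T)^{-1}\|\le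 C_\varphi/|s|$ for all $s\in\mathbb{R}^{n+1}\setminus(D_\varphi\cup\{0\})$. **Functions.** For $U\subseteq\mathbb{R}^{n+1}$ open and axially symmetric ($x+Jy\in U$ implies $x+Iy\in U$ for all $I\in\mathbb{S}$), $f:U\to\mathbb{R}^{n+1}$ is intrinsic if $f(x+Jy)=\alpha(x,y)+J\beta(x,y)$ with real-valued $\alpha,\beta$ independent of $J$, satisfying the Cauchy–Riemann equations, $\alpha$ even and $\beta$ odd in $y$. $\mathcal{N}^0(U)$: intrinsic $f$ with $|f(s)|\le C|s|^\alpha/(1+|s|^{2\alpha})$ for some $\alpha>0$, $C\ge0$. $\mathcal{N}^\infty(U)$: bounded intrinsic $f$, with $\|f\|_\infty=\sup_U|f|$. **Functional calculus.** Let $T$ be injective and bisectorial of angle $\omega$. For $f\in\mathcal{N}^0(D_\theta)$, $\theta\in(\omega,\frac{\pi}{2})$, $$f(T)v=\frac{1}{2\pi}\int_{\partial D_\varphi\cap\mathbb{C}_J}(\mathcal{I}^Rs-T)^{-1}vf(s)\,ds_J,$$ with $\varphi\in(\omega,\theta)$ and $J\in\mathbb{S}$ arbitrary, $ds_J=ds/J$, and the boundary oriented so that the double sector lies to its left. For $f\in\mathcal{N}^\infty(D_\theta)$, $f(T)=e(T)^{-1}(ef)(T)$ (with natural domain), where $e\in\mathcal{N}^0(D_\theta)$ is any function with $ef\in\mathcal{N}^0(D_\theta)$ and $e(T)$ injective, e.g. $e(s)=\frac{s}{1+s^2}$; $f(T)$ is independent of the choice of $e$. **Bounded $H^\infty$-functional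 calculus.** An injective bisectorial operator $T$ of angle $\omega$ has a bounded $H^\infty$-functional calculus if for every $\theta\in(\omega,\frac{\pi}{2})$ there is $C_\theta\ge0$ such that $f(T)\in\mathcal{B}(V)$ and $\|f(T)\|\le C_\theta\|f\|_\infty$ for all $f\in\mathcal{N}^\infty(D_\theta)$. *)

(* Defs.v *)
(* The concrete real numbers R of Stdlib, with Coquelicot for the norms,
   derivatives and vector-valued integrals; only the finite sets and iterated
   sums of MathComp are used, for the basis of the Clifford algebra. *)
From Stdlib Require Import Reals.
From Coquelicot Require Import Coquelicot.
From mathcomp Require Import ssreflect ssrfun ssrbool eqtype ssrnat fintype.
From mathcomp Require Import finfun finset bigop.

Set Implicit Arguments.
Unset Strict Implicit.
Unset Printing Implicit Defensive.

Open Scope R_scope.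

(** * The real Clifford algebra R_n *)

(* An element x stands for the sum of the x A e_A over A \subset {0, .., n-1},
   where e_A is the product of the generators e_i, i in A, in increasing order
   of i. The generators are numbered from 0. *)
Definition Cl (n : nat) := {ffun {set 'I_n} -> R}.

(* e_A e_B = cl_sign A B e_C, with C the symmetric difference of A and B:
   sorting the product costs one sign for each pair j < i with i in A and
   j in B, and each common index contributes e_i^2 = -1. *)
Definition cl_sign n (A B : {set 'I_n}) : R :=
  (-1) ^ #|[set p : 'I_n * 'I_n | [&& p.1 \in A, p.2 \in B & (p.2 <= p.1)%N]]|.

Definition symdiff n (A B : {set 'I_n}) : {set 'I_n} :=
  (A :\: B) :|: (B :\: A).

Definition cl_add n (x y : Cl n) : Cl n := [ffun A => x A + y A].
Definition cl_opp n (x : Cl n) : Cl n := [ffun A => - x A].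
Definition cl_scal n (a : R) (x : Cl n) : Cl n := [ffun A => a * x A].
Definition cl_real n (a : R) : Cl n := [ffun A => if A == set0 then a else 0].
Definition cl_mul n (x y : Cl n) : Cl n :=
  [ffun C => \big[Rplus/0]_(A : {set 'I_n})
               \big[Rplus/0]_(B : {set 'I_n} | symdiff A B == C)
                 (cl_sign A B * (x A * y B))].

(* e_A has |A| factors: reversing their order gives (-1)^(|A|(|A|-1)/2) and the
   sign changes of the generators give (-1)^|A|. *)
Definition cl_conj n (x : Cl n) : Cl n :=
  [ffun A : {set 'I_n} => (-1) ^ (#|A| * #|A|.+1)./2 * x A].

Definition Sc n (x : Cl n) : R := x set0.
Definition cl_norm n (x : Cl n) : R :=
  sqrt (\big[Rplus/0]_(A : {set 'I_n}) (x A) ^ 2).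

(* R^{n+1}, as a subset of R_n *)
Definition paravector n (s : Cl n) : Prop :=
  forall A : {set 'I_n}, (1 < #|A|)%N -> s A = 0.

(* The sphere S of imaginary units *)
Definition im_unit n (J : Cl n) : Prop :=
  (forall A : {set 'I_n}, #|A| <> 1%N -> J A = 0) /\ cl_norm J = 1.

(* x + J y *)
Definition slice_pt n (J : Cl n) (x y : R) : Cl n :=
  cl_add (cl_real n x) (cl_scal y J).

(** * Right Hilbert modules over R_n *)

(* Completeness and the compatibility of the topology with the norm come from
   Coquelicot's [CompleteNormedModule]; [ip_norm] says that its norm is the one
   of the real inner product Sc<.,.>. *)
Record right_hilbert_module (n : nat) := RightHilbertModule {
  rhm_sort :> CompleteNormedModule R_AbsRing;
  rmul : rhm_sort -> Cl n -> rhm_sort;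
  ip : rhm_sort -> rhm_sort -> Cl n;
  rmul_addl : forall v w s, rmul (plus v w) s = plus (rmul v s) (rmul w s);
  rmul_addr : forall v s t, rmul v (cl_add s t) = plus (rmul v s) (rmul v t);
  rmul_mul : forall v s t, rmul v (cl_mul s t) = rmul (rmul v s) t;
  rmul_real : forall v (a : R), rmul v (cl_real n a) = scal a v;
  ip_addl : forall u v w, ip (plus u v) w = cl_add (ip u w) (ip v w);
  ip_addr : forall u v w, ip u (plus v w) = cl_add (ip u v) (ip u w);
  ip_scall : forall (a : R) v w, ip (scal a v) w = cl_scal a (ip v w);
  ip_scalr : forall (a : R) v w, ip v (scal a w) = cl_scal a (ip v w);
  ip_rmull : forall v w s, ip (rmul v s) w = cl_mul (cl_conj s) (ip v w);
  ip_rmulr : forall v w s, ip v (rmul w s) = cl_mul (ip v w) s;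
  ip_conj : forall v w, cl_conj (ip v w) = ip w v;
  ip_norm : forall v, Sc (ip v v) = norm v ^ 2
}.

(** * Unbounded operators *)

(* The values of [app] outside [dom] are irrelevant. *)
Record operator n (V : right_hilbert_module n) := Operator {
  dom : V -> Prop;
  app :> V -> V
}.

Section Operators.
Variables (n : nat) (V : right_hilbert_module n).
Implicit Types (A T : operator V) (F : V -> V) (s : Cl n).

Definition right_linear T : Prop :=
  [/\ dom T zero,
      forall v w, dom T v -> dom T w ->
        dom T (plus v w) /\ T (plus v w) = plus (T v) (T w) &
      forall v s, dom T v -> dom T (rmul v s) /\ T (rmul v s) = rmul (T v) s].

Definition op_graph T : V * V -> Prop := fun p => dom T p.1 /\ T p.1 = p.2.

Definition closed_rl T : Prop := right_linear T /\ closed (op_graph T).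

Definition op_injective T : Prop :=
  forall u v, dom T u -> dom T v -> T u = T v -> u = v.

Definition norm_le F (M : R) : Prop := forall v, norm (F v) <= M * norm v.

Definition bounded_rl F : Prop :=
  right_linear (Operator (fun _ => True) F) /\ exists M, norm_le F M.

Definition inv_in_B A : Prop :=
  exists2 F, bounded_rl F &
    (forall v, dom A (F v) /\ A (F v) = v) /\
    (forall v, dom A v -> F (A v) = v).

(* The inverse of A, meaningful when A is bijective from its domain onto V;
   [iota] returns the element satisfying a predicate that has exactly one. *)
Definition op_inv A : V -> V := fun v => iota (fun u => dom A u /\ A u = v).

(* T^2 *)
Definition op_sq T : operator V :=
  Operator (fun v => dom T v /\ dom T (T v)) (fun v => T (T v)).

(* Q_s[T] *)
Definition op_Q T s : operator V :=
  Operator (dom (op_sq T))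
    (fun v => plus (minus (op_sq T v) (scal (2 * Sc s) (T v)))
                   (scal (cl_norm s ^ 2) v)).

Definition S_resolvent_set T s : Prop := paravector s /\ inv_in_B (op_Q T s).
Definition S_spectrum T s : Prop := paravector s /\ ~ S_resolvent_set T s.

(* I^R s - T *)
Definition op_IR T s : operator V :=
  Operator (dom T) (fun v => minus (rmul v s) (T v)).

Definition m_accretive A : Prop :=
  [/\ closed_rl A,
      forall v, dom A v -> 0 <= Sc (ip (A v) v) &
      forall (w : V) (eps : R), 0 < eps ->
        exists v, dom A v /\ norm (minus (plus v (A v)) w) < eps].

End Operators.

(** * Bisectorial operators *)

Definition Arg n (s : Cl n) : R := acos (Sc s / cl_norm s).

Definition sector n (om : R) (s : Cl n) : Prop :=
  [/\ paravector s, s <> cl_real n 0 & Rabs (Arg s) < om].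

Definition dsector n (om : R) (s : Cl n) : Prop :=
  sector om s \/ sector om (cl_opp s).

Definition pv_closure n (D : Cl n -> Prop) (s : Cl n) : Prop :=
  paravector s /\
  forall eps : R, 0 < eps ->
    exists t, D t /\ cl_norm (cl_add t (cl_opp s)) < eps.

Definition bisectorial n (V : right_hilbert_module n) (T : operator V)
    (om : R) : Prop :=
  [/\ closed_rl T,
      0 < om < PI / 2,
      forall s, S_spectrum T s -> pv_closure (@dsector n om) s &
      forall phi, om < phi < PI / 2 ->
        exists2 C : R, 0 <= C &
          forall s, paravector s -> s <> cl_real n 0 -> ~ dsector phi s ->
            norm_le (op_inv (op_IR T s)) (C / cl_norm s)].

(** * Intrinsic functions *)

(* For U open and axially symmetric. Only the values of f on U matter. The
   partial derivatives of alpha and beta are p and q up to sign, which is the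
   Cauchy-Riemann system; alpha and beta are continuously differentiable. *)
Definition intrinsic n (U : Cl n -> Prop) (f : Cl n -> Cl n) : Prop :=
  exists alpha beta p q : R -> R -> R,
  forall x y : R, (forall J, im_unit J -> U (slice_pt J x y)) ->
    [/\ forall J, im_unit J ->
          f (slice_pt J x y) = slice_pt J (alpha x y) (beta x y),
        alpha x (- y) = alpha x y /\ beta x (- y) = - beta x y,
        is_derive (fun t => alpha t y) x (p x y) /\
          is_derive (fun t => beta x t) y (p x y),
        is_derive (fun t => alpha x t) y (q x y) /\
          is_derive (fun t => beta t y) x (- q x y) &
        continuity_2d_pt p x y /\ continuity_2d_pt q x y].

(* [Rpower r a] is r^a for r > 0; it is used for U not containing 0. *)
Definition N0 n (U : Cl n -> Prop) (f : Cl n -> Cl n) : Prop :=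
  intrinsic U f /\
  exists a C : R, [/\ 0 < a, 0 <= C &
    forall s, U s ->
      cl_norm (f s) <=
        C * Rpower (cl_norm s) a / (1 + Rpower (cl_norm s) (2 * a))].

Definition Ninf n (U : Cl n -> Prop) (f : Cl n -> Cl n) : Prop :=
  intrinsic U f /\ exists M : R, forall s, U s -> cl_norm (f s) <= M.

Definition sup_norm n (U : Cl n -> Prop) (f : Cl n -> Cl n) : R :=
  real (Lub_Rbar (fun r => exists2 s, U s & r = cl_norm (f s))).

Definition fun_mul n (e f : Cl n -> Cl n) : Cl n -> Cl n :=
  fun s => cl_mul (e s) (f s).

(** * The functional calculus *)

Section Calculus.
Variables (n : nat) (V : right_hilbert_module n) (T : operator V).
Implicit Types (e f : Cl n -> Cl n) (J u : Cl n).

(* The integral of (I^R s - T)^{-1} v f(s) ds_J along the ray s = r u, with r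
   from 0 to +oo, where u in C_J has norm 1; there
   ds_J = u J^{-1} dr = u (- J) dr. *)
Definition ray_integral J u f (v : V) : V :=
  RInt_gen
    (fun r : R =>
       rmul (op_inv (op_IR T (cl_scal r u)) v)
            (cl_mul (f (cl_scal r u)) (cl_mul u (cl_opp J))))
    (at_right 0) (Rbar_locally p_infty).

(* The boundary of D_phi in C_J consists of the four rays generated by
   e^{J phi}, e^{-J phi}, -e^{J phi} and -e^{-J phi}. With D_phi on the left, the
   first and the third are run from infinity to 0, the others from 0 to
   infinity. *)
Definition dsector_integral (phi : R) J f (v : V) : V :=
  let u := slice_pt J (cos phi) (sin phi) in
  let u' := slice_pt J (cos phi) (- sin phi) in
  scal (/ (2 * PI))
    (plus (minus (ray_integral J u' f v) (ray_integral J u f v))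
          (minus (ray_integral J (cl_opp u') f v)
                 (ray_integral J (cl_opp u) f v))).

(* The graph of f(T), for f in N^0(D_theta) and T bisectorial of angle om. *)
Definition N0_calc (om theta : R) f (v w : V) : Prop :=
  exists phi J, [/\ om < phi < theta, im_unit J & w = dsector_integral phi J f v].

(* The graph of f(T) = e(T)^{-1} (e f)(T), for f in N^oo(D_theta): no choice of
   phi, J or e is fixed, so f(T) is an operator only if it does not depend on
   these choices. *)
Definition Ninf_calc (om theta : R) f (v w : V) : Prop :=
  exists e,
    [/\ N0 (@dsector n theta) e,
        N0 (@dsector n theta) (fun_mul e f),
        (forall v1 v2 w', N0_calc om theta e v1 w' -> N0_calc om theta e v2 w' ->
           v1 = v2) &
        exists2 w', N0_calc om theta (fun_mul e f) v w' &
                    N0_calc om theta e w w'].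

Definition bounded_Hinf_calculus (om : R) : Prop :=
  forall theta, om < theta < PI / 2 ->
    exists2 C : R, 0 <= C &
      forall f, Ninf (@dsector n theta) f ->
        exists F : V -> V,
          [/\ bounded_rl F,
              forall v w, Ninf_calc om theta f v w <-> w = F v &
              norm_le F (C * sup_norm (@dsector n theta) f)].

End Calculus.

(* Main.v *)
(** Write P_t = t^2 (t^2 + T^2)^-1 and psi_t = P_t (1 - P_t). Accretivity of T^2
    makes P_t and its adjoint firmly nonexpansive, so that
    d/dt |P_t v|^2 >= (4 / t) |psi_t v|^2 and likewise for the adjoints: T
    satisfies quadratic estimates. For a polynomial q with q(0) = 0, q(1) = 1 and
    x (1 - x) q'(x) = 30 (x (1 - x))^3 one has
    d/dt <q(P_t) g(T) v, w> = (60 / t) <psi_t g(T) psi_t v, psi_t^* w>, while the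
    resolvent bounds give |psi_t g(T)| <= K sup |g|. Integrating, with
    Cauchy-Schwarz,
    |(q(P_b) - q(P_a)) g(T) v|^2 <= C^2 (sup |g|)^2 (|P_b v|^2 - |P_a v|^2).
    Hence for bounded f the vectors (f (q(p_b) - q(p_a)))(T) v, where
    p_t = t^2 / (t^2 + s^2), converge as a -> 0 and b -> oo; the limit is f(T) v,
    of norm at most C sup |f| |v|.

    A slice function is represented by its restriction to one complex half-plane,
    and the calculus is written with the real operators R1, R2 such that
    (I^R s - T)^-1 v = R1 v + (R2 v) J. That it is multiplicative follows from
    Cauchy's formula and Fubini's theorem. *)

Require Import Defs.
From Stdlib Require Import Reals Lra Psatz Classical IndefiniteDescription FunctionalExtensionality.
From Coquelicot Require Import Coquelicot.
From HB Require Import structures.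
From mathcomp Require Import ssreflect ssrfun ssrbool eqtype ssrnat.
From mathcomp Require Import fintype finfun finset bigop.

Open Scope R_scope.

(** * Integrals over the half-line *)

Definition ii {V : NormedModule R_AbsRing} (K : R -> V) (l : V) :=
  is_RInt_gen K (at_right 0) (Rbar_locally p_infty) l.

Section ImproperIntegrals.
Context {V : CompleteNormedModule R_AbsRing}.
Implicit Types (K : R -> V) (l : V).

Lemma ii_intro K l :
  (forall eps, 0 < eps -> exists2 d, 0 < d & forall a b, 0 < a < d -> / d < b ->
    exists2 I, is_RInt K a b I & norm (minus I l) < eps) ->
  ii K l.
Proof.
move=> H P [eps HP].
case: (H eps (cond_pos eps)) => d d0 Hd.
exists (fun a => 0 < a < d) (fun b => / d < b).
- exists (mkposreal d d0) => y Hy y0; split => //.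
  move: Hy; rewrite /ball /= /AbsRing_ball /abs /minus /plus /opp /= => Hy.
  move: (Rle_abs (y + - 0)); lra.
- by exists (/ d).
- move=> a b Ha Hb; case: (Hd a b Ha Hb) => I HI HIl.
  by exists I; split => //; apply: HP; apply: norm_compat1.
Qed.

Lemma ii_elim K l eps : ii K l -> 0 < eps ->
  exists2 d, 0 < d < 1 & forall a b, 0 < a < d -> / d < b ->
    exists2 I, is_RInt K a b I & norm (minus I l) < eps.
Proof.
move=> H e0.
have HP : locally l (fun y => norm (minus y l) < eps).
  apply: locally_le_locally_norm.
  by exists (mkposreal eps e0).
case: (H _ HP) => Q S [dl HQ] [M HS] Himp.
pose d := Rmin (/ 2) (Rmin dl (/ (Rabs M + 1))).
have M0 : 0 < Rabs M + 1 by move: (Rabs_pos M); lra.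
have dlp := cond_pos dl.
have iM0 := Rinv_0_lt_compat _ M0.
have d0 : 0 < d by do 2 (apply: Rmin_glb_lt; try lra).
have d1 : d <= / 2 by apply: Rmin_l.
have d2 : d <= dl by apply: Rle_trans (Rmin_r _ _) (Rmin_l _ _).
have d3 : d <= / (Rabs M + 1) by apply: Rle_trans (Rmin_r _ _) (Rmin_r _ _).
exists d; first lra.
move=> a b Ha Hb.
have Mb : M < b.
  have : Rabs M + 1 <= / d.
    rewrite -(Rinv_inv (Rabs M + 1)); exact: Rinv_le_contravar.
  move: (Rle_abs M); lra.
case: (Himp a b).
- apply: HQ; last lra.
  rewrite /ball /= /AbsRing_ball /abs /minus /plus /opp /= Rabs_pos_eq; lra.
- exact: HS.
by move=> I [H1 H2]; exists I.
Qed.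

Lemma ii_ex_RInt K l a b : ii K l -> 0 < a <= b -> ex_RInt K a b.
Proof.
move=> H ab.
case: (ii_elim _ _ 1 H Rlt_0_1) => d d1 Hd.
have m0 : 0 < Rmin a (d / 2) by apply: Rmin_glb_lt; lra.
have m1 := Rmin_l a (d / 2); have m2 := Rmin_r a (d / 2).
have M1 := Rmax_l b (/ d + 1); have M2 := Rmax_r b (/ d + 1).
case: (Hd (Rmin a (d / 2)) (Rmax b (/ d + 1))); [lra|lra|].
move=> I HI _.
apply: (@ex_RInt_Chasles_2 _ K (Rmin a (d / 2))); first by lra.
apply: (@ex_RInt_Chasles_1 _ K _ b (Rmax b (/ d + 1))); first by lra.
by exists I.
Qed.

Lemma ii_ext K1 K2 l : (forall r, 0 < r -> K1 r = K2 r) -> ii K1 l -> ii K2 l.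
Proof.
move=> E; apply: is_RInt_gen_ext.
exists (fun a => 0 < a) (fun b => 0 < b).
- by exists (mkposreal 1 Rlt_0_1).
- by exists 0.
move=> a b a0 b0 /= x [xm _]; apply: E.
have := Rmin_glb_lt _ _ _ a0 b0; lra.
Qed.

Lemma ii_plus K1 K2 l1 l2 :
  ii K1 l1 -> ii K2 l2 -> ii (fun r => plus (K1 r) (K2 r)) (plus l1 l2).
Proof. exact: is_RInt_gen_plus. Qed.

Lemma ii_minus K1 K2 l1 l2 :
  ii K1 l1 -> ii K2 l2 -> ii (fun r => minus (K1 r) (K2 r)) (minus l1 l2).
Proof. exact: is_RInt_gen_minus. Qed.

Lemma ii_scal c K l : ii K l -> ii (fun r => scal c (K r)) (scal c l).
Proof. exact: is_RInt_gen_scal. Qed.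

Lemma ii_norm K l k L : (forall r, 0 < r -> norm (K r) <= k r) ->
  ii K l -> ii k L -> norm l <= L.
Proof.
move=> H; apply: RInt_gen_norm.
- exists (fun a => a < 1) (fun b => 1 < b).
  + exists (mkposreal 1 Rlt_0_1) => y.
    rewrite /ball /= /AbsRing_ball /abs /minus /plus /opp /= => Hy _.
    move: (Rle_abs (y + - 0)); lra.
  + by exists 1.
  + by move=> a b /=; lra.
- exists (fun a => 0 < a) (fun _ => True).
  + by exists (mkposreal 1 Rlt_0_1).
  + by exists 0.
  + by move=> a b a0 _ /= x Hx; apply: H; lra.
Qed.

Lemma ii_uniq K l1 l2 : ii K l1 -> ii K l2 -> l1 = l2.
Proof. by move=> /is_RInt_gen_unique <- /is_RInt_gen_unique <-. Qed.

Lemma ii_RInt K l eps : ii K l -> 0 < eps ->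
  exists2 d, 0 < d < 1 & forall a b, 0 < a < d -> / d < b ->
    norm (minus (RInt K a b) l) < eps.
Proof.
move=> H e0; case: (ii_elim _ _ _ H e0) => d d1 Hd; exists d => // a b Ha Hb.
by case: (Hd a b Ha Hb) => I /is_RInt_unique <-.
Qed.

End ImproperIntegrals.

Lemma plus_plus_minus {G : AbelianGroup} (x y z : G) :
  minus (plus (plus x y) z) y = plus x z.
Proof.
rewrite /minus -(plus_assoc (plus x y)) (plus_comm z) (plus_assoc (plus x y)).
by rewrite -(plus_assoc x) plus_opp_r plus_zero_r.
Qed.

Lemma minus_minus_minus {G : AbelianGroup} (x y z : G) :
  minus (minus x z) (minus y z) = minus x y.
Proof.
rewrite /minus opp_plus opp_opp -plus_assoc; congr plus.
by rewrite (plus_comm (opp y)) plus_assoc plus_opp_l plus_zero_l.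
Qed.

Section Domination.
Context {V : CompleteNormedModule R_AbsRing}.
Implicit Types (K : R -> V) (l : V).

Lemma continuous_ex_RInt K a b : (forall r, 0 < r -> continuous K r) ->
  0 < a <= b -> ex_RInt K a b.
Proof.
move=> H ab; apply: (@ex_RInt_continuous V) => z.
rewrite Rmin_left ?Rmax_right; [move=> ?; apply: H|..]; lra.
Qed.

Lemma ii_dom K (k : R -> R) L : (forall r, 0 < r -> continuous K r) ->
  (forall r, 0 < r -> norm (K r) <= k r) -> ii k L ->
  exists2 l, ii K l & norm l <= L.
Proof.
move=> cK Kk Hk.
have exK a b : 0 < a <= b -> ex_RInt K a b by exact: continuous_ex_RInt.
have exk a b : 0 < a <= b -> ex_RInt k a b by move=> ab; apply: ii_ex_RInt Hk ab.
have le a b : 0 < a <= b -> norm (RInt K a b) <= RInt k a b.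
  move=> ab; apply: (@norm_RInt_le _ K k a b); first by lra.
  - by move=> x Hx; apply: Kk; lra.
  - exact: RInt_correct (exK _ _ ab).
  - exact: RInt_correct (exk _ _ ab).
have k0 a b : 0 < a <= b -> 0 <= RInt k a b.
  by move=> ab; apply: Rle_trans (le _ _ ab); apply: norm_ge_0.
have key eps : 0 < eps -> exists2 d, 0 < d < 1 & forall a b a' b',
    0 < a < d -> / d < b -> 0 < a' < d -> / d < b' ->
    norm (minus (RInt K a' b') (RInt K a b)) < eps.
  move=> e0; have e2 : 0 < eps / 5 by lra.
  case: (ii_RInt _ _ _ Hk e2) => d d1 Hd; exists (d / 2); first by lra.
  have Hd' a b : 0 < a < d -> / d < b -> Rabs (RInt k a b - L) < eps / 5.
    exact: Hd.
  have ld : 1 < / d by rewrite -{1}Rinv_1; apply: Rinv_lt_contravar; lra.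
  have ld' : / (d / 2) = 2 * / d by field; lra.
  have half a b : 0 < a < d / 2 -> / (d / 2) < b ->
      norm (minus (RInt K a b) (RInt K (d / 2) (2 * / d))) < 2 * (eps / 5).
    move=> Ha Hb; rewrite ld' in Hb.
    have E (W : CompleteNormedModule R_AbsRing) (F : R -> W) :
        (forall a b, 0 < a <= b -> ex_RInt F a b) ->
        RInt F a b = plus (plus (RInt F a (d / 2)) (RInt F (d / 2) (2 * / d)))
          (RInt F (2 * / d) b).
      move=> HF; rewrite !RInt_Chasles //; apply: HF; lra.
    have {}E1 := E _ _ exK; have {E}E2 := E _ _ exk.
    rewrite E1 plus_plus_minus.
    apply: Rle_lt_trans (norm_triangle _ _) _.
    have l1 : norm (RInt K a (d / 2)) <= RInt k a (d / 2) by apply: le; lra.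
    have l2 : norm (RInt K (2 * / d) b) <= RInt k (2 * / d) b by apply: le; lra.
    have h1 : Rabs (RInt k a b - L) < eps / 5 by apply: Hd'; lra.
    have h2 : Rabs (RInt k (d / 2) (2 * / d) - L) < eps / 5 by apply: Hd'; lra.
    move: h1 h2 (Rle_abs (RInt k a b - L)).
    move: (Rle_abs (- (RInt k (d / 2) (2 * / d) - L))); rewrite Rabs_Ropp.
    rewrite E2 /plus /=; lra.
  move=> a b a' b' Ha Hb Ha' Hb'.
  have h1 := half _ _ Ha Hb; have h2 := half _ _ Ha' Hb'.
  rewrite -(minus_minus_minus _ _ (RInt K (d / 2) (2 * / d))).
  apply: Rle_lt_trans (norm_triangle _ _) _; rewrite norm_opp; lra.
have [l Hl] : exists l, filterlim (fun ab => RInt K (fst ab) (snd ab))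
    (filter_prod (at_right 0) (Rbar_locally p_infty)) (locally l).
  apply/filterlim_locally_cauchy => eps.
  have e1 : 0 < eps / (@norm_factor _ V) .
    by apply: Rdiv_lt_0_compat; [apply: cond_pos|apply: norm_factor_gt_0].
  case: (key _ (cond_pos eps)) => d d1 Hd.
  exists (fun ab => 0 < fst ab < d /\ / d < snd ab); split.
    exists (fun a => 0 < a < d) (fun b => / d < b) => //; last by exists (/ d).
    have d0 : 0 < d by lra.
    exists (mkposreal d d0) => y.
    rewrite /ball /= /AbsRing_ball /abs /minus /plus /opp /= => Hy y0.
    move: (Rle_abs (y + - 0)); lra.
  move=> [a b] [a' b'] [/= Ha Hb] [Ha' Hb'].
  by apply: norm_compat1; apply: Hd.
have Hii : ii K l.
  apply: filterlimi_lim_ext_loc Hl.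
  exists (fun a => 0 < a < 1) (fun b => 1 < b).
  - exists (mkposreal 1 Rlt_0_1) => y.
    rewrite /ball /= /AbsRing_ball /abs /minus /plus /opp /= => Hy y0.
    move: (Rle_abs (y + - 0)); lra.
  - by exists 1.
  - by move=> a b Ha Hb /=; apply: RInt_correct; apply: exK; lra.
by exists l => //; apply: ii_norm Hii Hk.
Qed.

End Domination.

Lemma ii_linear {V W : CompleteNormedModule R_AbsRing} (F : V -> W) M K l :
  (forall u v, F (plus u v) = plus (F u) (F v)) ->
  (forall c v, F (scal c v) = scal c (F v)) ->
  (forall v, norm (F v) <= M * norm v) ->
  ii K l -> ii (fun r => F (K r)) (F l).
Proof.
move=> FD FZ FM H.
have Fo v : F (opp v) = opp (F v) by rewrite -(scal_opp_one v) FZ scal_opp_one.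
have lF : is_linear F.
  split=> //.
  exists (Rabs M + 1); split; first by move: (Rabs_pos M); lra.
  move=> v; apply: Rle_trans (FM v) _; apply: Rmult_le_compat_r; first exact: norm_ge_0.
  move: (Rle_abs M); lra.
apply: ii_intro => eps e0.
have M0 : 0 < Rabs M + 1 by move: (Rabs_pos M); lra.
have e1 : 0 < eps / (Rabs M + 1) by apply: Rdiv_lt_0_compat.
case: (ii_elim _ _ _ H e1) => d d1 Hd; exists d; first by lra.
move=> a b Ha Hb; case: (Hd a b Ha Hb) => I HI HIl.
exists (F I).
  rewrite /is_RInt.
  have : filterlim (fun ptd => F (scal (sign (b - a)) (Riemann_sum K ptd)))
     (Riemann_fine a b) (locally (F I)).
    apply: filterlim_comp HI _; exact: (linear_cont F I lF).
  apply: filterlim_ext => ptd; rewrite FZ; congr scal.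
  elim/(@SF_cons_ind R): ptd => [x0 | h s IH] /=.
    rewrite /Riemann_sum /=. by rewrite -(scal_zero_l (zero : V)) FZ scal_zero_l.
  by rewrite !Riemann_sum_cons FD FZ IH.
rewrite /minus -Fo -FD; apply: Rle_lt_trans (FM _) _.
apply: Rle_lt_trans (_ : (Rabs M + 1) * norm (minus I l) < _).
  apply: Rmult_le_compat_r; first exact: norm_ge_0.
  move: (Rle_abs M); lra.
by apply: Rmult_lt_reg_r (Rinv_0_lt_compat _ M0) _; rewrite Rmult_comm -Rmult_assoc Rinv_l ?Rmult_1_l //; lra.
Qed.

Lemma ii_primitive (f k : R -> R) A B :
  (forall r, 0 < r -> is_derive f r (k r)) ->
  (forall r, 0 < r -> continuous k r) ->
  (forall eps, 0 < eps -> exists2 d, 0 < d & forall r, 0 < r < d -> Rabs (f r - A) < eps) ->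
  (forall eps, 0 < eps -> exists2 d, 0 < d & forall r, / d < r -> Rabs (f r - B) < eps) ->
  ii k (B - A).
Proof.
move=> df ck HA HB; apply: ii_intro => eps e0.
have e2 : 0 < eps / 2 by lra.
case: (HA _ e2) => d1 d10 Hd1; case: (HB _ e2) => d2 d20 Hd2.
pose d := Rmin 1 (Rmin d1 d2).
have d0 : 0 < d by repeat apply: Rmin_glb_lt => //; lra.
have l0 : d <= 1 by apply: Rmin_l.
have l1 : d <= d1 by apply: Rle_trans (Rmin_r _ _) (Rmin_l _ _).
have l2 : d <= d2 by apply: Rle_trans (Rmin_r _ _) (Rmin_r _ _).
have i0 : 1 <= / d by rewrite -{1}Rinv_1; apply: Rinv_le_contravar.
have i2 : / d2 <= / d by apply: Rinv_le_contravar.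
exists d => // a b Ha Hb; exists (f b - f a).
  apply: (is_RInt_derive f k) => x; rewrite Rmin_left ?Rmax_right; try lra; move=> Hx.
  - by apply: df; lra.
  - by apply: ck; lra.
have := Hd1 a ltac:(lra); have := Hd2 b ltac:(lra).
rewrite /norm /minus /plus /opp /= /abs /=.
by split_Rabs; lra.
Qed.

Lemma atan_lim eps : 0 < eps ->
  exists2 M, 0 < M & forall x, M < x -> Rabs (atan x - PI / 2) < eps.
Proof.
move=> e0; have p0 := PI_RGT_0.
pose e := Rmin eps (PI / 4).
have e1 : 0 < e by apply: Rmin_glb_lt; lra.
have e2 : e <= eps by apply: Rmin_l.
have e3 : e <= PI / 4 by apply: Rmin_r.
exists (tan (PI / 2 - e)); first by apply: tan_gt_0; lra.
move=> x Hx; have [_ b] := atan_bound x.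
have := atan_increasing _ _ Hx; rewrite atan_tan; last by lra.
split_Rabs; lra.
Qed.

Lemma div_le a b c : 0 < c -> a <= b * c -> a / c <= b.
Proof. by move=> c0 H; apply/(Rle_div_l a b c c0). Qed.

Lemma le_div a b c : 0 < c -> a * c <= b -> a <= b / c.
Proof. by move=> c0 H; apply/(Rle_div_r a b c c0). Qed.

Lemma div_lt a b c : 0 < c -> a < b * c -> a / c < b.
Proof. by move=> c0 H; apply/(Rlt_div_l a b c c0). Qed.

(* kk a is the decay of N^0; kap a is the derivative of atan(r^a) / a *)
Definition kk (a r : R) := Rpower r a / (1 + Rpower r (2 * a)).
Definition kap (a r : R) := kk a r / r.

Lemma Rpower_gt0 x y : 0 < Rpower x y. Proof. exact: exp_pos. Qed.

Lemma Rpower_2a r a : Rpower r (2 * a) = Rpower r a ^ 2.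
Proof. by rewrite (_ : 2 * a = a + a); [rewrite Rpower_plus /=; ring|ring]. Qed.

Lemma kkE a r : kk a r = Rpower r a / (1 + Rpower r a ^ 2).
Proof. by rewrite /kk Rpower_2a. Qed.

Lemma kk_gt0 a r : 0 < kk a r.
Proof.
rewrite kkE; have p := Rpower_gt0 r a.
by apply: Rdiv_lt_0_compat => //; nra.
Qed.

Lemma kap_gt0 a r : 0 < r -> 0 < kap a r.
Proof. by move=> r0; apply: Rdiv_lt_0_compat => //; apply: kk_gt0. Qed.

Lemma kk_le1 a r : kk a r <= 1.
Proof.
rewrite kkE; have p := Rpower_gt0 r a.
apply: div_le; nra.
Qed.

Lemma Rpower_anti_exp r a b : 0 < r <= 1 -> a <= b -> Rpower r b <= Rpower r a.
Proof.
move=> [r0 r1] ab; rewrite -(Rinv_inv r).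
have i0 := Rinv_0_lt_compat _ r0.
have i1 : 1 <= / r by rewrite -Rinv_1; apply: Rinv_le_contravar.
have E c : Rpower (/ / r) c = Rpower (/ r) (- c).
  rewrite /Rpower ln_Rinv //; f_equal; ring.
by rewrite !E; apply: Rle_Rpower; lra.
Qed.

Lemma Rpower1 a : Rpower 1 a = 1.
Proof. by rewrite /Rpower ln_1 Rmult_0_r exp_0. Qed.

Lemma kk_mono a b r : 0 < a <= b -> 0 < r -> kk b r <= kk a r.
Proof.
move=> ab r0; rewrite !kkE.
have p := Rpower_gt0 r a; have q := Rpower_gt0 r b.
have : (Rpower r b - Rpower r a) * (1 - Rpower r a * Rpower r b) <= 0.
  case: (Rle_lt_dec 1 r) => r1.
    have := Rle_Rpower r a b r1 (proj2 ab).
    have := Rle_Rpower r 0 a r1 ltac:(lra).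
    rewrite Rpower_O // => h1 h2.
    have : 1 <= Rpower r a * Rpower r b by nra.
    nra.
  have := Rpower_anti_exp r a b ltac:(lra) (proj2 ab).
  have := Rpower_anti_exp r 0 a ltac:(lra) ltac:(lra).
  rewrite Rpower_O // => h1 h2.
  have : Rpower r a * Rpower r b <= 1 by nra.
  nra.
move: p q; set x := Rpower r a; set y := Rpower r b => p q H.
apply: div_le; first by nra.
rewrite /Rdiv Rmult_assoc (Rmult_comm _ (1 + y ^ 2)) -Rmult_assoc.
apply: le_div; nra.
Qed.

Lemma Rpower_lt a x y : 0 < a -> 0 < x -> x < y -> Rpower x a < Rpower y a.
Proof.
move=> a0 x0 xy; rewrite /Rpower; apply: exp_increasing.
have := ln_increasing x y x0 xy; nra.
Qed.

Lemma Rpower_invK e a : 0 < a -> 0 < e -> Rpower (Rpower e (/ a)) a = e.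
Proof. by move=> a0 e0; rewrite Rpower_mult Rinv_l ?Rpower_1 //; lra. Qed.

Lemma Rpower_lt_small a e r : 0 < a -> 0 < e -> 0 < r ->
  r < Rpower e (/ a) -> Rpower r a < e.
Proof.
by move=> a0 e0 r0 /(Rpower_lt a _ _ a0 r0); rewrite Rpower_invK.
Qed.

Lemma Rpower_gt_large a e r : 0 < a -> 0 < e ->
  Rpower e (/ a) < r -> e < Rpower r a.
Proof.
by move=> a0 e0 /(Rpower_lt a _ _ a0 (Rpower_gt0 _ _)); rewrite Rpower_invK.
Qed.

Lemma kk_small a eps : 0 < a -> 0 < eps ->
  exists2 d, 0 < d < 1 & forall r, 0 < r -> r < d \/ / d < r -> kk a r < eps.
Proof.
move=> a0 e0.
pose e := Rmin eps (/ 2).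
have e1 : 0 < e by apply: Rmin_glb_lt; lra.
have e2 : e <= eps by apply: Rmin_l.
have e3 : e <= / 2 by apply: Rmin_r.
pose d := Rpower e (/ a).
have ia := Rinv_0_lt_compat _ a0.
have d1 : 0 < d by apply: Rpower_gt0.
have dE : Rpower d a = e.
  by rewrite /d Rpower_mult Rinv_l ?Rpower_1 //; lra.
exists d.
  split => //; rewrite -(Rpower1 (/ a)) /d /Rpower ln_1 Rmult_0_r.
  apply: exp_increasing; have := ln_increasing e 1 e1 ltac:(lra).
  rewrite ln_1; nra.
move=> r r0 Hr; have p := Rpower_gt0 r a.
apply: Rlt_le_trans e2; rewrite kkE.
have inc x y : 0 < x -> x < y -> Rpower x a < Rpower y a.
  move=> x0 xy; rewrite /Rpower; apply: exp_increasing.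
  have := ln_increasing x y x0 xy; nra.
case: Hr => Hr.
  have := inc _ _ r0 Hr; rewrite dE => l.
  apply: div_lt; nra.
have := inc _ _ (Rinv_0_lt_compat _ d1) Hr.
have -> : Rpower (/ d) a = / e.
  rewrite -dE /Rpower ln_Rinv // -exp_Ropp; f_equal; ring.
move=> l.
have l' : 1 < e * Rpower r a.
  by apply: (Rmult_lt_reg_l (/ e)); [exact: Rinv_0_lt_compat|rewrite -Rmult_assoc Rinv_l; lra].
apply: div_lt; nra.
Qed.

Lemma continuous_Rpower a r : 0 < r -> continuous (fun x => Rpower x a) r.
Proof.
move=> r0; apply: ex_derive_continuous.
by exists (a * Rpower r (a - 1)); apply/is_derive_Reals; exact: derivable_pt_lim_power.
Qed.

Lemma continuous_inv (f : R -> R) r : continuous f r -> f r <> 0 -> continuous (fun x => / f x) r.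
Proof. by move=> cf f0; apply: (continuous_comp f Rinv) => //; apply: continuous_Rinv. Qed.

Lemma continuous_kap a r : 0 < r -> continuous (kap a) r.
Proof.
move=> r0; have p := Rpower_gt0 r a.
apply: (continuous_ext (fun r => Rpower r a * / (1 + Rpower r a * Rpower r a) * / r)).
  by move=> x; rewrite /kap kkE /Rdiv /= Rmult_1_r.
have c := continuous_Rpower a r r0.
apply: (continuous_mult (K := R_AbsRing)); last first.
  by apply: continuous_inv; [exact: continuous_id|lra].
apply: (continuous_mult (K := R_AbsRing)) => //.
apply: continuous_inv; last by nra.
apply: (continuous_plus (V := R_NormedModule)); first exact: continuous_const.
exact: (continuous_mult (K := R_AbsRing)).
Qed.

Lemma ii_kap a : 0 < a -> ii (kap a) (PI / 2 / a).
Proof.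
move=> a0.
rewrite (_ : PI / 2 / a = PI / 2 / a - 0); last by ring.
apply: (ii_primitive (fun r => atan (Rpower r a) / a)).
- move=> r r0; have p := Rpower_gt0 r a.
  have d1 : is_derive (fun x => Rpower x a) r (a * Rpower r (a - 1)).
    by apply/is_derive_Reals; exact: derivable_pt_lim_power.
  have d2 := is_derive_comp atan (fun x => Rpower x a) r _ _ (is_derive_atan (Rpower r a)) d1.
  have d3 := is_derive_scal _ _ (/ a) _ d2.
  apply: (is_derive_ext (fun x => / a * atan (Rpower x a))).
    by move=> t; rewrite Rmult_comm.
  rewrite (_ : kap a r = / a * scal (a * Rpower r (a - 1)) (/ (1 + (Rpower r a)²))) //.
  rewrite /scal /= /mult /= /kap kkE /Rsqr.
  rewrite (_ : Rpower r (a - 1) = Rpower r a / r); last first.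
    by rewrite /Rminus Rpower_plus Rpower_Ropp Rpower_1.
  by field; repeat split; nra.
- by move=> r; exact: continuous_kap.
- move=> eps e0.
  pose e := Rmin (a * eps) (PI / 4); have p0 := PI_RGT_0.
  have e1 : 0 < e by apply: Rmin_glb_lt; nra.
  have e2 : e <= a * eps by apply: Rmin_l.
  have e3 : e <= PI / 4 by apply: Rmin_r.
  have t0 : 0 < tan e by apply: tan_gt_0; lra.
  exists (Rpower (tan e) (/ a)); first exact: Rpower_gt0.
  move=> r [r0 Hr]; have p := Rpower_gt0 r a.
  have H1 := atan_increasing _ _ (Rpower_lt_small _ _ _ a0 t0 r0 Hr).
  rewrite atan_tan in H1; last by lra.
  have H2 := atan_increasing _ _ p; rewrite atan_0 in H2.
  rewrite Rminus_0_r Rabs_pos_eq; first by apply: div_lt; lra.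
  by apply: Rdiv_le_0_compat; lra.
- move=> eps e0.
  have ae0 : 0 < a * eps by nra.
  case: (atan_lim (a * eps) ae0) => M M0 HM.
  exists (/ Rpower M (/ a)); first by apply: Rinv_0_lt_compat; apply: Rpower_gt0.
  rewrite Rinv_inv => r Hr.
  have H := HM _ (Rpower_gt_large _ _ _ a0 M0 Hr).
  rewrite (_ : _ - _ = (atan (Rpower r a) - PI / 2) / a); last by field; lra.
  rewrite Rabs_div; last lra.
  by rewrite (Rabs_pos_eq a); [apply: div_lt; lra|lra].
Qed.

Lemma ii_cauchy_kernel t : 0 < t -> ii (fun r => t / (t ^ 2 + r ^ 2)) (PI / 2).
Proof.
move=> t0; rewrite -[X in ii _ X]Rminus_0_r.
have it := Rinv_0_lt_compat _ t0.
apply: (ii_primitive (fun r => atan (r / t))).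
- move=> r r0; auto_derive => //; field; split; nra.
- move=> r r0; apply: ex_derive_continuous; auto_derive; nra.
- move=> eps e0.
  pose e := Rmin eps (PI / 4); have p0 := PI_RGT_0.
  have e1 : 0 < e by apply: Rmin_glb_lt; nra.
  have e2 : e <= eps by apply: Rmin_l.
  have e3 : e <= PI / 4 by apply: Rmin_r.
  have t1 : 0 < tan e by apply: tan_gt_0; lra.
  exists (t * tan e); first by nra.
  move=> r [r0 Hr].
  have H1 : r / t < tan e by apply: div_lt; lra.
  have := atan_increasing _ _ H1; rewrite atan_tan; last by lra.
  have H2 : 0 < r / t by apply: Rdiv_lt_0_compat.
  have := atan_increasing _ _ H2; rewrite atan_0.
  rewrite Rminus_0_r => *; rewrite Rabs_pos_eq; lra.
- move=> eps e0; case: (atan_lim _ e0) => M M0 HM.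
  exists (/ (M * t)); first by apply: Rinv_0_lt_compat; nra.
  rewrite Rinv_inv => r Hr; apply: HM.
  by apply: (Rmult_lt_reg_r t) => //; rewrite /Rdiv Rmult_assoc Rinv_l ?Rmult_1_r //; lra.
Qed.

Lemma continuous_2d_slice1 f x y : continuity_2d_pt f x y -> continuous (fun t => f t y) x.
Proof.
move=> H; apply/continuity_pt_filterlim/continuity_pt_locally => eps.
by case: (H eps) => d Hd; exists d => u Hu; apply: Hd => //; rewrite Rminus_diag Rabs_R0; apply: cond_pos.
Qed.

Lemma continuous_2d_slice2 f x y : continuity_2d_pt f x y -> continuous (f x) y.
Proof.
move=> H; apply/continuity_pt_filterlim/continuity_pt_locally => eps.
by case: (H eps) => d Hd; exists d => u Hu; apply: Hd => //; rewrite Rminus_diag Rabs_R0; apply: cond_pos.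
Qed.

Lemma continuous_RInt_param (f : R -> R -> R) x c d : c <= d ->
  (forall t, c <= t <= d -> continuity_2d_pt f x t) ->
  locally x (fun y => ex_RInt (f y) c d) ->
  continuous (fun y => RInt (f y) c d) x.
Proof.
move=> cd cf [e0 He0].
have ex0 : ex_RInt (f x) c d by apply: He0; apply: ball_center.
apply/continuity_pt_filterlim/continuity_pt_locally => eps.
have e1 : 0 < eps / (d - c + 1) by apply: Rdiv_lt_0_compat; [apply: cond_pos|lra].
case: (uniform_continuity_2d_1d' f c d x cf (mkposreal _ e1)) => del Hdel.
have m0 : 0 < Rmin del e0 by apply: Rmin_glb_lt; apply: cond_pos.
exists (mkposreal _ m0) => y Hy.
have Hy1 : Rabs (y - x) < del by apply: Rlt_le_trans Hy (Rmin_l _ _).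
have Hy2 : Rabs (y - x) < e0 by apply: Rlt_le_trans Hy (Rmin_r _ _).
have exy : ex_RInt (f y) c d by apply: He0.
rewrite -[_ - _]/(minus (RInt (f y) c d) (RInt (f x) c d)) -RInt_minus //.
apply: Rle_lt_trans (_ : (d - c) * (eps / (d - c + 1)) < _).
  apply: (@norm_RInt_le_const R_NormedModule (fun t => minus (f y t) (f x t)) c d) => //.
    move=> t Ht; apply: Rlt_le; apply: Hdel => //; try lra.
    - by have := cond_pos del; lra.
    - by move: Hy1; split_Rabs; lra.
    - by rewrite Rminus_diag Rabs_R0; apply: cond_pos.
  by apply: RInt_correct; apply: (@ex_RInt_minus R_NormedModule).
have ep := cond_pos eps.
rewrite (_ : _ * _ = eps * ((d - c) / (d - c + 1))); last by field; lra.
rewrite -{2}(Rmult_1_r eps); apply: Rmult_lt_compat_l => //.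
by apply: div_lt; lra.
Qed.

Lemma continuity_2d_swap f x y : continuity_2d_pt f x y -> continuity_2d_pt (fun v u => f u v) y x.
Proof. by move=> H eps; case: (H eps) => d Hd; exists d => u v Hu Hv; apply: Hd. Qed.

Lemma locally_pos (x : R) (P : R -> Prop) : 0 < x -> (forall y, 0 < y -> P y) -> locally x P.
Proof.
move=> x0 H; exists (mkposreal x x0) => y Hy; apply: H.
move: Hy; rewrite /ball /= /AbsRing_ball /abs /minus /plus /opp /=; split_Rabs; lra.
Qed.

Lemma fubini_rect (f : R -> R -> R) a b c d :
  (forall x y, 0 < x -> 0 < y -> continuity_2d_pt f x y) -> 0 < a <= b -> 0 < c <= d ->
  RInt (fun x => RInt (f x) c d) a b = RInt (fun y => RInt (fun x => f x y) a b) c d.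
Proof.
move=> cf ab cd.
have ex1 x : 0 < x -> ex_RInt (f x) c d.
  move=> x0; apply: continuous_ex_RInt => // r r0.
  by apply: continuous_2d_slice2; apply: cf.
have c1 x : 0 < x -> continuous (fun y => RInt (f y) c d) x.
  move=> x0; apply: continuous_RInt_param => //; first lra.
  - by move=> t Ht; apply: cf; lra.
  - exact: locally_pos.
have c2 x y : 0 < x -> 0 < y -> continuous (fun t => f t y) x.
  by move=> x0 y0; apply: continuous_2d_slice1; apply: cf.
have ex2 u y : 0 < u -> 0 < y -> ex_RInt (fun x => f x y) a u.
  move=> u0 y0; apply: (@ex_RInt_continuous R_CompleteNormedModule) => z Hz.
  have := Rmin_glb_lt a u 0 ltac:(lra) u0 => ?.
  by apply: c2 => //; lra.
have d2 u y : 0 < u -> 0 < y -> is_derive (fun v => RInt (fun x => f x y) a v) u (f u y).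
  move=> u0 y0; apply: (is_derive_RInt (fun x => f x y) _ a); last exact: c2.
  by apply: locally_pos => // v v0; apply: RInt_correct; apply: ex2.
pose P t := RInt (fun x => RInt (f x) c d) a t.
pose Q t := RInt (fun y => RInt (fun x => f x y) a t) c d.
have dP t : 0 < t -> is_derive P t (RInt (f t) c d).
  move=> t0; apply: (is_derive_RInt (fun x => RInt (f x) c d) _ a); last exact: c1.
  apply: locally_pos => // v v0; apply: RInt_correct.
  apply: (@ex_RInt_continuous R_CompleteNormedModule) => z Hz; apply: c1.
  have := Rmin_glb_lt a v 0 ltac:(lra) v0; lra.
have dQ t : 0 < t -> is_derive Q t (RInt (f t) c d).
  move=> t0.
  have E : forall y, 0 < y -> forall u, 0 < u -> Derive (fun z => RInt (fun x => f x y) a z) u = f u y.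
    by move=> y y0 u u0; apply: is_derive_unique; apply: d2.
  rewrite (_ : RInt (f t) c d =
      RInt (fun y => Derive (fun u => RInt (fun x => f x y) a u) t) c d); last first.
    apply: RInt_ext => y; rewrite Rmin_left; [move=> Hy|lra].
    by rewrite E //; lra.
  apply: (is_derive_RInt_param (fun u y => RInt (fun x => f x y) a u)).
  - apply: locally_pos => // u u0 y; rewrite Rmin_left; [move=> Hy|lra].
    by exists (f u y); apply: d2 => //; lra.
  - move=> y; rewrite Rmin_left; [move=> Hy|lra].
    apply: (continuity_2d_pt_ext_loc f); last by apply: cf; lra.
    have m0 : 0 < Rmin t y by apply: Rmin_glb_lt; lra.
    exists (mkposreal _ m0) => u v Hu Hv; rewrite E //.
    + move: (Rmin_r t y) Hv => /=; split_Rabs; lra.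
    + move: (Rmin_l t y) Hu => /=; split_Rabs; lra.
  - apply: locally_pos => // u u0.
    apply: continuous_ex_RInt => // r r0.
    have c3 v w : 0 < v <= w -> continuous (fun y => RInt (fun x => f x y) v w) r.
      move=> vw; apply: (continuous_RInt_param (fun y x => f x y)); first lra.
      - by move=> s Hs; apply: continuity_2d_swap; apply: cf; lra.
      - apply: locally_pos => // y y0; apply: continuous_ex_RInt => // s s0; exact: c2.
    case: (Rle_lt_dec a u) => ua; first by apply: c3; lra.
    apply: (continuous_ext_loc _ (fun y => opp (RInt (fun x => f x y) u a))).
      apply: locally_pos => // y y0.
      apply: opp_RInt_swap; apply: (@continuous_ex_RInt R_CompleteNormedModule); last lra.
      by move=> s s0; apply: c2.
    by apply: (continuous_opp (V := R_NormedModule)); apply: c3; lra.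
have Pa : P a = 0 by rewrite /P RInt_point.
have Qa : Q a = 0.
  rewrite /Q (RInt_ext _ (fun _ => 0)); first by rewrite RInt_const /scal /= /mult /=; ring.
  by move=> y _; rewrite RInt_point.
case: (Rle_lt_or_eq_dec a b (proj2 ab)) => [lab|<-]; last by rewrite -/(P a) -/(Q a) Pa Qa.
have := eq_is_derive (fun t => minus (P t) (Q t)) a b.
rewrite -/(P b) -/(Q b) /minus Pa Qa /plus /opp /= => H.
suff : 0 + - 0 = P b + - Q b by lra.
apply: H => // t Ht; rewrite -(plus_opp_r (RInt (f t) c d)).
apply: (is_derive_minus (V := R_NormedModule)); [apply: dP|apply: dQ]; lra.
Qed.

Lemma ii_tail (K k : R -> R) l L a b : (forall r, 0 < r -> Rabs (K r) <= k r) ->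
  ii K l -> ii k L -> 0 < a <= b -> Rabs (l - RInt K a b) <= L - RInt k a b.
Proof.
move=> Kk HK Hk ab; apply: le_epsilon => eps e0.
have e2 : 0 < eps / 2 by lra.
case: (ii_RInt _ _ _ HK e2) => d1 d11 Hd1; case: (ii_RInt _ _ _ Hk e2) => d2 d21 Hd2.
pose d := Rmin d1 d2.
have d0 : 0 < d by apply: Rmin_glb_lt; lra.
have l1 : d <= d1 by apply: Rmin_l.
have l2 : d <= d2 by apply: Rmin_r.
have i1 : / d1 <= / d by apply: Rinv_le_contravar.
have i2 : / d2 <= / d by apply: Rinv_le_contravar.
pose a' := Rmin a (d / 2); pose b' := Rmax b (/ d + 1).
have a0 : 0 < a' by apply: Rmin_glb_lt; lra.
have a1 : a' <= a by apply: Rmin_l.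
have a2 : a' <= d / 2 by apply: Rmin_r.
have b1 : b <= b' by apply: Rmax_l.
have b2 : / d + 1 <= b' by apply: Rmax_r.
have := Hd1 a' b' ltac:(lra) ltac:(lra); have := Hd2 a' b' ltac:(lra) ltac:(lra).
have exK u v : 0 < u <= v -> ex_RInt K u v by exact: ii_ex_RInt HK.
have exk u v : 0 < u <= v -> ex_RInt k u v by exact: ii_ex_RInt Hk.
have E (F : R -> R) : (forall u v, 0 < u <= v -> ex_RInt F u v) ->
    RInt F a' b' = RInt F a' a + RInt F a b + RInt F b b'.
  move=> HF; rewrite -(RInt_Chasles F a' b b'); try by apply: HF; lra.
  by rewrite -(RInt_Chasles F a' a b) //; apply: HF; lra.
rewrite (E _ exK) (E _ exk) /norm /minus /plus /opp /= /abs /=.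
have le u v : 0 < u <= v -> Rabs (RInt K u v) <= RInt k u v.
  move=> uv; apply: (@norm_RInt_le R_NormedModule K k u v); first by lra.
  - by move=> x Hx; apply: Kk; lra.
  - exact: RInt_correct (exK _ _ uv).
  - exact: RInt_correct (exk _ _ uv).
have := le a' a ltac:(lra); have := le b b' ltac:(lra).
split_Rabs; lra.
Qed.

Lemma ii_fubini (f : R -> R -> R) (A B G H : R -> R) LA LB L1 L2 :
  (forall x y, 0 < x -> 0 < y -> continuity_2d_pt f x y) ->
  (forall x y, 0 < x -> 0 < y -> Rabs (f x y) <= A x * B y) ->
  (forall x, 0 < x -> 0 <= A x) -> (forall y, 0 < y -> 0 <= B y) ->
  ii A LA -> ii B LB ->
  (forall x, 0 < x -> ii (f x) (G x)) -> (forall y, 0 < y -> ii (fun x => f x y) (H y)) ->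
  ii G L1 -> ii H L2 -> L1 = L2.
Proof.
(* Both iterated integrals are close to the one over a large square. *)
have half (f' : R -> R -> R) (A' B' G' : R -> R) LA' LB' L eps : 0 < eps ->
    (forall x y, 0 < x -> 0 < y -> continuity_2d_pt f' x y) ->
    (forall x y, 0 < x -> 0 < y -> Rabs (f' x y) <= A' x * B' y) ->
    (forall x, 0 < x -> 0 <= A' x) -> (forall y, 0 < y -> 0 <= B' y) ->
    ii A' LA' -> ii B' LB' -> (forall x, 0 < x -> ii (f' x) (G' x)) -> ii G' L ->
    exists2 d, 0 < d < 1 & forall a b, 0 < a < d -> / d < b ->
      Rabs (L - RInt (fun x => RInt (f' x) a b) a b) < eps.
  move=> e0 cf fAB A0 B0 HA HB HG HL.
  have LA0 a b : 0 < a <= b -> RInt A' a b <= LA'.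
    move=> ab; have := ii_tail A' A' _ _ a b _ HA HA ab.
    move=> /(_ (fun r r0 => Req_le _ _ (Rabs_pos_eq _ (A0 r r0)))).
    by split_Rabs; lra.
  have LA1 : 0 <= LA'.
    by have := LA0 1 1 ltac:(lra); rewrite RInt_point.
  have e1 : 0 < eps / 2 / (LA' + 1) by apply: Rdiv_lt_0_compat; lra.
  have e2 : 0 < eps / 2 by lra.
  case: (ii_RInt _ _ _ HL e2) => d1 d11 Hd1; case: (ii_RInt _ _ _ HB e1) => d2 d21 Hd2.
  have m0 : 0 < Rmin d1 d2 by apply: Rmin_glb_lt; lra.
  have m1 := Rmin_l d1 d2; have m2 := Rmin_r d1 d2.
  have i0 : 1 < / Rmin d1 d2 by rewrite -{1}Rinv_1; apply: Rinv_lt_contravar; lra.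
  have i1 : / d1 <= / Rmin d1 d2 by apply: Rinv_le_contravar.
  have i2 : / d2 <= / Rmin d1 d2 by apply: Rinv_le_contravar.
  exists (Rmin d1 d2); first lra.
  move=> a b Ha Hb; have ab : 0 < a <= b by lra.
  have h1 := Hd1 a b ltac:(lra) ltac:(lra); have h2 := Hd2 a b ltac:(lra) ltac:(lra).
  have cI x : 0 < x -> continuous (fun x => RInt (f' x) a b) x.
    move=> x0; apply: continuous_RInt_param; first lra.
    - by move=> t Ht; apply: cf; lra.
    - apply: locally_pos => // y y0; apply: continuous_ex_RInt => // s s0.
      by apply: continuous_2d_slice2; apply: cf.
  have exI : ex_RInt (fun x => RInt (f' x) a b) a b by apply: continuous_ex_RInt.
  have exG : ex_RInt G' a b by apply: ii_ex_RInt HL ab.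
  have exA : ex_RInt A' a b by apply: ii_ex_RInt HA ab.
  have : Rabs (RInt G' a b - RInt (fun x => RInt (f' x) a b) a b)
      <= LA' * (LB' - RInt B' a b).
    rewrite -[_ - _]/(minus (RInt G' a b) (RInt (fun x => RInt (f' x) a b) a b)).
    rewrite -RInt_minus //.
    have t0 : 0 <= LB' - RInt B' a b.
      have := ii_tail B' B' _ _ a b _ HB HB ab.
      move=> /(_ (fun r r0 => Req_le _ _ (Rabs_pos_eq _ (B0 r r0)))).
      by split_Rabs; lra.
    apply: Rle_trans (_ : RInt A' a b * (LB' - RInt B' a b) <= _); last first.
      by apply: Rmult_le_compat_r => //; apply: LA0.
    apply: (@norm_RInt_le R_NormedModule (fun x => minus (G' x) (RInt (f' x) a b))
      (fun x => scal (LB' - RInt B' a b) (A' x)) a b); first lra.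
    - move=> x Hx; have x0 : 0 < x by lra.
      have Hk : ii (fun y => A' x * B' y) (A' x * LB') by apply: (ii_scal (A' x) B').
      have := ii_tail _ _ _ _ a b (fun y => fAB x y x0) (HG x x0) Hk ab.
      rewrite (RInt_scal B') ?/scal /= /mult /=; last by apply: ii_ex_RInt HB ab.
      rewrite -[norm _]/(Rabs (G' x - RInt (f' x) a b)); lra.
    - by apply: RInt_correct; apply: (@ex_RInt_minus R_NormedModule).
    - rewrite Rmult_comm; apply: (@is_RInt_scal R_NormedModule); exact: RInt_correct.
  have : LA' * (LB' - RInt B' a b) <= eps / 2.
    apply: Rle_trans (_ : (LA' + 1) * (eps / 2 / (LA' + 1)) <= _); last first.
      by apply: Req_le; field; lra.
    apply: Rmult_le_compat; try lra.
    - have := ii_tail B' B' _ _ a b _ HB HB ab.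
      move=> /(_ (fun r r0 => Req_le _ _ (Rabs_pos_eq _ (B0 r r0)))).
      by split_Rabs; lra.
    - by move: h2; rewrite /norm /minus /plus /opp /= /abs /=; split_Rabs; lra.
  by move: h1; rewrite /norm /minus /plus /opp /= /abs /=; split_Rabs; lra.
move=> cf fAB A0 B0 HA HB HG HH HL1 HL2.
apply: cond_eq => eps e0; have e2 : 0 < eps / 2 by lra.
case: (half f A B G LA LB L1 _ e2) => // d1 d11 Hd1.
case: (half (fun y x => f x y) B A H LB LA L2 _ e2) => //.
- by move=> x y x0 y0; apply: continuity_2d_swap; apply: cf.
- by move=> x y x0 y0; rewrite Rmult_comm; apply: fAB.
move=> d2 d21 Hd2.
have m0 : 0 < Rmin d1 d2 by apply: Rmin_glb_lt; lra.
have m1 := Rmin_l d1 d2; have m2 := Rmin_r d1 d2.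
have i0 : 1 < / Rmin d1 d2 by rewrite -{1}Rinv_1; apply: Rinv_lt_contravar; lra.
have i1 : / d1 <= / Rmin d1 d2 by apply: Rinv_le_contravar.
have i2 : / d2 <= / Rmin d1 d2 by apply: Rinv_le_contravar.
pose a := Rmin d1 d2 / 2; pose b := / Rmin d1 d2 + 1.
have := Hd1 a b ltac:(rewrite /a; lra) ltac:(rewrite /b; lra).
have := Hd2 a b ltac:(rewrite /a; lra) ltac:(rewrite /b; lra).
rewrite -(fubini_rect f) //; try by rewrite /a /b; lra.
split_Rabs; lra.
Qed.

(** * Holomorphic functions and integrals along rays *)

Definition copen (U : C -> Prop) :=
  forall x y, U (x, y) -> locally_2d (fun u v => U (u, v)) x y.

Definition ccont (G : C -> C) (z : C) :=
  continuity_2d_pt (fun u v => fst (G (u, v))) (fst z) (snd z) /\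
  continuity_2d_pt (fun u v => snd (G (u, v))) (fst z) (snd z).

Definition cder (G : C -> C) (z d : C) :=
  [/\ is_derive (fun t => fst (G (t, snd z))) (fst z) (fst d),
      is_derive (fun t => snd (G (t, snd z))) (fst z) (snd d),
      is_derive (fun t => fst (G (fst z, t))) (snd z) (- snd d) &
      is_derive (fun t => snd (G (fst z, t))) (snd z) (fst d)].

Definition hol (U : C -> Prop) (G : C -> C) :=
  exists D, forall z, U z -> [/\ cder G z (D z), ccont G z & ccont D z].

Lemma hol_sub (U U' : C -> Prop) G : (forall z, U' z -> U z) -> hol U G -> hol U' G.
Proof. by move=> s [D H]; exists D => z /s; apply: H. Qed.

Lemma ccont_mul G H z : ccont G z -> ccont H z -> ccont (fun w => G w * H w)%C z.
Proof.
case=> g1 g2 [h1 h2]; split => /=.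
- by apply: continuity_2d_pt_minus; apply: continuity_2d_pt_mult.
- by apply: continuity_2d_pt_plus; apply: continuity_2d_pt_mult.
Qed.

Lemma ccont_add G H z : ccont G z -> ccont H z -> ccont (fun w => G w + H w)%C z.
Proof. by case=> g1 g2 [h1 h2]; split => /=; apply: continuity_2d_pt_plus. Qed.

Lemma ccont_opp G z : ccont G z -> ccont (fun w => - G w)%C z.
Proof. by case=> g1 g2; split => /=; apply: continuity_2d_pt_opp. Qed.

Lemma ccont_const c z : ccont (fun _ => c) z.
Proof. by split; apply: continuity_2d_pt_const. Qed.

Lemma ccont_id z : ccont id z.
Proof. by split; [apply: continuity_2d_pt_id1|apply: continuity_2d_pt_id2]. Qed.

Lemma Cnorm2_gt0 (z : C) : z <> 0%C -> 0 < fst z ^ 2 + snd z ^ 2.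
Proof.
case: z => x y /= H.
have : x <> 0 \/ y <> 0.
  by case: (Req_dec x 0) => [x0|]; [right => y0; apply: H; rewrite x0 y0|left].
by case=> h; [have := Rsqr_pos_lt x h|have := Rsqr_pos_lt y h]; rewrite /Rsqr; nra.
Qed.

Lemma ccont_inv G z : ccont G z -> G z <> 0%C -> ccont (fun w => / G w)%C z.
Proof.
case=> g1 g2 nz; have p := Cnorm2_gt0 _ nz; rewrite (surjective_pairing z) in p nz.
have c : continuity_2d_pt (fun u v => / (fst (G (u, v)) ^ 2 + snd (G (u, v)) ^ 2)) (fst z) (snd z).
  apply: continuity_2d_pt_inv; last by lra.
  apply: (continuity_2d_pt_ext (fun u v => fst (G (u, v)) * fst (G (u, v)) + snd (G (u, v)) * snd (G (u, v)))).
    by move=> u v; rewrite /=; ring.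
  by apply: continuity_2d_pt_plus; apply: continuity_2d_pt_mult.
split => /=; apply: continuity_2d_pt_mult => //; exact: continuity_2d_pt_opp.
Qed.

Lemma is_derive_val (f : R -> R) x l l' : is_derive f x l -> l = l' -> is_derive f x l'.
Proof. by move=> H <-. Qed.

Lemma is_derive_mulR (f g : R -> R) x df dg : is_derive f x df -> is_derive g x dg ->
  is_derive (fun t => f t * g t) x (df * g x + f x * dg).
Proof. by move=> H1 H2; apply: (is_derive_mult f g) => //; exact: Rmult_comm. Qed.

Lemma is_derive_addR (f g : R -> R) x df dg : is_derive f x df -> is_derive g x dg ->
  is_derive (fun t => f t + g t) x (df + dg).
Proof. exact: (is_derive_plus (V := R_NormedModule)). Qed.

Lemma is_derive_subR (f g : R -> R) x df dg : is_derive f x df -> is_derive g x dg ->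
  is_derive (fun t => f t - g t) x (df - dg).
Proof. exact: (is_derive_minus (V := R_NormedModule)). Qed.

Lemma is_derive_oppR (f : R -> R) x df : is_derive f x df ->
  is_derive (fun t => - f t) x (- df).
Proof. exact: (is_derive_opp (V := R_NormedModule)). Qed.

Lemma hol_mul U G H : hol U G -> hol U H -> hol U (fun w => G w * H w)%C.
Proof.
case=> D HD [E HE]; exists (fun z => D z * H z + G z * E z)%C => z Uz.
case: (HD z Uz) => -[g1 g2 g3 g4] cG cD; case: (HE z Uz) => -[h1 h2 h3 h4] cH cE.
split; [split|exact: ccont_mul|].
- apply: is_derive_val; first by apply: is_derive_subR; apply: is_derive_mulR; eassumption.
  by rewrite /= -!surjective_pairing; ring.
- apply: is_derive_val; first by apply: is_derive_addR; apply: is_derive_mulR; eassumption.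
  by rewrite /= -!surjective_pairing; ring.
- apply: is_derive_val; first by apply: is_derive_subR; apply: is_derive_mulR; eassumption.
  by rewrite /= -!surjective_pairing; ring.
- apply: is_derive_val; first by apply: is_derive_addR; apply: is_derive_mulR; eassumption.
  by rewrite /= -!surjective_pairing; ring.
- by apply: ccont_add; apply: ccont_mul.
Qed.

Lemma hol_add U G H : hol U G -> hol U H -> hol U (fun w => G w + H w)%C.
Proof.
case=> D HD [E HE]; exists (fun z => D z + E z)%C => z Uz.
case: (HD z Uz) => -[g1 g2 g3 g4] cG cD; case: (HE z Uz) => -[h1 h2 h3 h4] cH cE.
split; [split|exact: ccont_add|exact: ccont_add].
- exact: is_derive_addR.
- exact: is_derive_addR.
- by apply: is_derive_val; [apply: is_derive_addR; eassumption|rewrite /=; ring].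
- exact: is_derive_addR.
Qed.

Lemma hol_const U c : hol U (fun _ => c).
Proof.
exists (fun _ => 0%C) => z _; split; [|exact: ccont_const|exact: ccont_const].
split; rewrite /= ?Ropp_0; exact: (is_derive_const (V := R_NormedModule)).
Qed.

Lemma hol_id U : hol U id.
Proof.
exists (fun _ => 1%C) => z _; split; [|exact: ccont_id|exact: ccont_const].
split; rewrite /= ?Ropp_0; try exact: (is_derive_const (V := R_NormedModule));
  exact: (is_derive_id (K := R_AbsRing)).
Qed.

Lemma hol_inv U G : hol U G -> (forall z, U z -> G z <> 0%C) -> hol U (fun w => / G w)%C.
Proof.
case=> D HD nz; exists (fun z => - (D z * (/ G z * / G z)))%C => z Uz.
case: (HD z Uz) => -[g1 g2 g3 g4] cG cD; have nGz := nz z Uz.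
have p := Cnorm2_gt0 _ nGz; have cI := ccont_inv _ _ cG nGz.
have p' : fst (G (fst z, snd z)) ^ 2 + snd (G (fst z, snd z)) ^ 2 <> 0.
  by rewrite -surjective_pairing; lra.
have dinv (f g : R -> R) x df dg : is_derive f x df -> is_derive g x dg -> f x ^ 2 + g x ^ 2 <> 0 ->
    is_derive (fun t => f t / (f t ^ 2 + g t ^ 2)) x
      ((df * (f x ^ 2 + g x ^ 2) - f x * (2 * f x * df + 2 * g x * dg)) / (f x ^ 2 + g x ^ 2) ^ 2).
  move=> H1 H2 H3; auto_derive.
    by repeat split; try (by exists df); try (by exists dg); move: H3; rewrite /= ; lra.
  rewrite (is_derive_unique _ _ _ H1) (is_derive_unique _ _ _ H2); field.
  by move: H3 => /=; lra.
have dinv' (f g : R -> R) x df dg : is_derive f x df -> is_derive g x dg -> f x ^ 2 + g x ^ 2 <> 0 ->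
    is_derive (fun t => - f t / (g t ^ 2 + f t ^ 2)) x
      (- ((df * (f x ^ 2 + g x ^ 2) - f x * (2 * f x * df + 2 * g x * dg)) / (f x ^ 2 + g x ^ 2) ^ 2)).
  move=> H1 H2 H3; have := is_derive_oppR _ _ _ (dinv _ _ _ _ _ H1 H2 H3).
  by apply: is_derive_ext => t; rewrite Rplus_comm /Rdiv Ropp_mult_distr_l.
have q' : snd (G (fst z, snd z)) ^ 2 + fst (G (fst z, snd z)) ^ 2 <> 0 by lra.
split=> //; last by apply: ccont_opp; apply: ccont_mul => //; apply: ccont_mul.
split.
- apply: is_derive_val; first by apply: dinv; eassumption.
  rewrite /= -!surjective_pairing; field; move: p => /=; lra.
- apply: is_derive_val; first by apply: dinv'; eassumption.
  rewrite /= -!surjective_pairing; field; move: p => /=; lra.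
- apply: is_derive_val; first by apply: dinv; eassumption.
  rewrite /= -!surjective_pairing; field; move: p => /=; lra.
- apply: is_derive_val; first by apply: dinv'; eassumption.
  rewrite /= -!surjective_pairing; field; move: p => /=; lra.
Qed.

Lemma differentiable_partial (f : R -> R -> R) (fx : R -> R -> R) fy x y :
  locally_2d (fun u v => is_derive (fun t => f t v) u (fx u v)) x y ->
  is_derive (f x) y fy -> continuity_2d_pt fx x y ->
  differentiable_pt_lim f x y (fx x y) fy.
Proof.
move=> H1 H2 H3; apply/filterdiff_differentiable_pt_lim.
apply: is_derive_filterdiff H2 _; last by apply/continuity_2d_pt_filterlim.
by move/locally_2d_locally: H1.
Qed.

Lemma cder_differentiable U G D x y : copen U ->
  (forall z, U z -> cder G z (D z) /\ ccont D z) -> U (x, y) ->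
  differentiable_pt_lim (fun u v => fst (G (u, v))) x y (fst (D (x, y))) (- snd (D (x, y))) /\
  differentiable_pt_lim (fun u v => snd (G (u, v))) x y (snd (D (x, y))) (fst (D (x, y))).
Proof.
move=> oU HD Uz; case: (HD _ Uz) => -[g1 g2 g3 g4] [c1 c2]; split.
- apply: (differentiable_partial (fun u v => fst (G (u, v))) (fun u v => fst (D (u, v)))) => //.
  case: (oU _ _ Uz) => d Hd; exists d => u v Hu Hv.
  by case: (HD _ (Hd _ _ Hu Hv)) => -[].
- apply: (differentiable_partial (fun u v => snd (G (u, v))) (fun u v => snd (D (u, v)))) => //.
  case: (oU _ _ Uz) => d Hd; exists d => u v Hu Hv.
  by case: (HD _ (Hd _ _ Hu Hv)) => -[].
Qed.

Lemma hol_intro U G D : copen U ->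
  (forall z, U z -> cder G z (D z) /\ ccont D z) -> hol U G.
Proof.
move=> oU HD; exists D => -[x y] Uz; case: (HD _ Uz) => h1 h2; split => //.
case: (cder_differentiable _ _ _ _ _ oU HD Uz) => d1 d2.
by split; apply: differentiable_continuity_pt; do 2 eexists; eassumption.
Qed.

Lemma continuity_2d_comp (f u v : R -> R -> R) x y :
  continuity_2d_pt f (u x y) (v x y) -> continuity_2d_pt u x y -> continuity_2d_pt v x y ->
  continuity_2d_pt (fun s t => f (u s t) (v s t)) x y.
Proof.
move=> cf cu cv eps; case: (cf eps) => d Hd; case: (cu d) => d1 H1; case: (cv d) => d2 H2.
have m0 : 0 < Rmin d1 d2 by apply: Rmin_glb_lt; apply: cond_pos.
exists (mkposreal _ m0) => s t Hs Ht; apply: Hd.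
- by apply: H1; [apply: Rlt_le_trans Hs (Rmin_l _ _)|apply: Rlt_le_trans Ht (Rmin_l _ _)].
- by apply: H2; [apply: Rlt_le_trans Hs (Rmin_r _ _)|apply: Rlt_le_trans Ht (Rmin_r _ _)].
Qed.

Lemma continuity_2d_fst (f : R -> R) x y : continuous f x -> continuity_2d_pt (fun u _ => f u) x y.
Proof.
move=> /continuity_pt_filterlim/continuity_pt_locally cf eps; case: (cf eps) => d Hd.
by exists d => u v Hu _; apply: Hd.
Qed.

Lemma continuity_2d_snd (f : R -> R) x y : continuous f y -> continuity_2d_pt (fun _ v => f v) x y.
Proof.
move=> /continuity_pt_filterlim/continuity_pt_locally cf eps; case: (cf eps) => d Hd.
by exists d => u v _ Hv; apply: Hd.
Qed.

Definition expi (phi : R) : C := (cos phi, sin phi).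
Definition pol (r phi : R) : C := (r * cos phi, r * sin phi).

Lemma polE r phi : pol r phi = (RtoC r * expi phi)%C.
Proof. by rewrite /pol /expi /Cmult /=; f_equal; ring. Qed.

Lemma Cmod_expi phi : Cmod (expi phi) = 1.
Proof.
by rewrite /Cmod /= !Rmult_1_r -[cos _ * _]/(Rsqr (cos phi)) Rplus_comm sin2_cos2 sqrt_1.
Qed.

Lemma Cmod_pol r phi : 0 <= r -> Cmod (pol r phi) = r.
Proof. by move=> r0; rewrite polE Cmod_mult Cmod_expi Cmod_R Rmult_1_r Rabs_pos_eq. Qed.

Lemma pol_cont1 r phi : continuity_2d_pt (fun a b => a * cos b) r phi.
Proof.
apply: continuity_2d_pt_mult; first exact: continuity_2d_pt_id1.
apply: continuity_2d_snd; apply: ex_derive_continuous; by auto_derive.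
Qed.

Lemma pol_cont2 r phi : continuity_2d_pt (fun a b => a * sin b) r phi.
Proof.
apply: continuity_2d_pt_mult; first exact: continuity_2d_pt_id1.
apply: continuity_2d_snd; apply: ex_derive_continuous; by auto_derive.
Qed.

Lemma pol_open U r phi : copen U -> U (pol r phi) ->
  locally_2d (fun a b => U (pol a b)) r phi.
Proof.
move=> oU Uz; case: (oU _ _ Uz) => d Hd.
case: (pol_cont1 r phi d) => d1 H1; case: (pol_cont2 r phi d) => d2 H2.
have m0 : 0 < Rmin d1 d2 by apply: Rmin_glb_lt; apply: cond_pos.
exists (mkposreal _ m0) => s t Hs Ht; apply: Hd.
- by apply: H1; [apply: Rlt_le_trans Hs (Rmin_l _ _)|apply: Rlt_le_trans Ht (Rmin_l _ _)].
- by apply: H2; [apply: Rlt_le_trans Hs (Rmin_r _ _)|apply: Rlt_le_trans Ht (Rmin_r _ _)].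
Qed.

(* G(z) dz = ray G phi r dr on the ray z = r e^(i phi) *)
Definition ray (G : C -> C) (phi r : R) : C := (expi phi * G (pol r phi))%C.

Lemma hol_ccont U G z : hol U G -> U z -> ccont G z.
Proof. by case=> D HD /HD[]. Qed.

Lemma ccont_pol G r phi : ccont G (pol r phi) ->
  continuity_2d_pt (fun a b => fst (G (pol a b))) r phi /\
  continuity_2d_pt (fun a b => snd (G (pol a b))) r phi.
Proof.
case=> c1 c2; split.
- exact: (continuity_2d_comp _ (fun a b => a * cos b) (fun a b => a * sin b) _ _ c1
    (pol_cont1 _ _) (pol_cont2 _ _)).
- exact: (continuity_2d_comp _ (fun a b => a * cos b) (fun a b => a * sin b) _ _ c2
    (pol_cont1 _ _) (pol_cont2 _ _)).
Qed.

Lemma ccont_ray G r phi : ccont G (pol r phi) ->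
  continuity_2d_pt (fun a b => fst (ray G b a)) r phi /\
  continuity_2d_pt (fun a b => snd (ray G b a)) r phi.
Proof.
move=> /ccont_pol [c1 c2].
have cc : continuity_2d_pt (fun _ b => cos b) r phi.
  by apply: continuity_2d_snd; apply: ex_derive_continuous; auto_derive.
have cs : continuity_2d_pt (fun _ b => sin b) r phi.
  by apply: continuity_2d_snd; apply: ex_derive_continuous; auto_derive.
split.
- by apply: continuity_2d_pt_minus; apply: continuity_2d_pt_mult.
- by apply: continuity_2d_pt_plus; apply: continuity_2d_pt_mult.
Qed.

Lemma continuous_ray G r phi : ccont G (pol r phi) ->
  continuous (fun s => fst (ray G phi s)) r /\ continuous (fun s => snd (ray G phi s)) r.
Proof.
move=> /ccont_ray [c1 c2]; split.
- exact: (continuous_2d_slice1 (fun a b => fst (ray G b a))).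
- exact: (continuous_2d_slice1 (fun a b => snd (ray G b a))).
Qed.

(* d/dphi (ray G) = i d/dr (r ray G), the Cauchy-Riemann equations in polar
   coordinates; only the real part is needed. *)
Lemma ray_derive U G D r phi : copen U ->
  (forall z, U z -> cder G z (D z) /\ ccont D z) -> U (pol r phi) ->
  let w := (fst (ray G phi r) * 0 +
     (snd (ray G phi r) + r * snd (expi phi * (expi phi * D (pol r phi)))%C)) in
  is_derive (fun t => fst (ray G t r)) phi (- w) /\
  is_derive (fun s => s * snd (ray G phi s)) r w.
Proof.
move=> oU HD Uz w.
case: (cder_differentiable _ _ _ _ _ oU HD Uz) => g1 g2.
have dc : derivable_pt_lim (fun t => r * cos t) phi (- (r * sin phi)).
  by apply/is_derive_Reals; auto_derive => //; ring.
have ds : derivable_pt_lim (fun t => r * sin t) phi (r * cos phi).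
  by apply/is_derive_Reals; auto_derive => //; ring.
have rc : derivable_pt_lim (fun t => t * cos phi) r (cos phi).
  by apply/is_derive_Reals; auto_derive => //; ring.
have rs : derivable_pt_lim (fun t => t * sin phi) r (sin phi).
  by apply/is_derive_Reals; auto_derive => //; ring.
have /is_derive_Reals p1 := derivable_pt_lim_comp_2d _ _ _ _ _ _ _ _ g1 dc ds.
have /is_derive_Reals p2 := derivable_pt_lim_comp_2d _ _ _ _ _ _ _ _ g2 dc ds.
have /is_derive_Reals q1 := derivable_pt_lim_comp_2d _ _ _ _ _ _ _ _ g1 rc rs.
have /is_derive_Reals q2 := derivable_pt_lim_comp_2d _ _ _ _ _ _ _ _ g2 rc rs.
have cc : is_derive cos phi (- sin phi) by auto_derive => //; ring.
have cs : is_derive sin phi (cos phi) by auto_derive => //; ring.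
split.
- apply: is_derive_val; first by apply: is_derive_subR; apply: is_derive_mulR; eassumption.
  by rewrite /w /ray /pol /=; ring.
- have id : is_derive (fun s : R => s) r 1 by auto_derive.
  apply: is_derive_val.
    apply: is_derive_mulR; first exact: id.
    apply: is_derive_addR.
    - by apply: (is_derive_mulR (fun=> cos phi)); [exact: is_derive_const|exact: q2].
    - by apply: (is_derive_mulR (fun=> sin phi)); [exact: is_derive_const|exact: q1].
  by rewrite /w /ray /pol /zero /=; ring.
Qed.

Lemma Cmod_ray G phi r : Cmod (ray G phi r) = Cmod (G (pol r phi)).
Proof. by rewrite Cmod_mult Cmod_expi Rmult_1_l. Qed.

Lemma fst_le_Cmod z : Rabs (fst z) <= Cmod z.
Proof. by apply: Rle_trans (Rmax_Cmod z); apply: Rmax_l. Qed.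

Lemma snd_le_Cmod z : Rabs (snd z) <= Cmod z.
Proof. by apply: Rle_trans (Rmax_Cmod z); apply: Rmax_r. Qed.

Lemma rect_re U G lo hi phi1 phi2 a b B : copen U -> hol U G -> 0 < a <= b ->
  lo < phi1 -> phi1 <= phi2 -> phi2 < hi ->
  (forall r phi, a <= r <= b -> lo < phi < hi -> U (pol r phi)) ->
  (forall phi, phi1 <= phi <= phi2 -> a * Cmod (G (pol a phi)) <= B) ->
  (forall phi, phi1 <= phi <= phi2 -> b * Cmod (G (pol b phi)) <= B) ->
  Rabs (RInt (fun r => fst (ray G phi2 r)) a b - RInt (fun r => fst (ray G phi1 r)) a b)
    <= (phi2 - phi1) * (2 * B).
Proof.
move=> oU [D HD] ab l1 l12 l2 HU Ba Bb.
have HD' z : U z -> cder G z (D z) /\ ccont D z by move=> /HD[].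
pose w r phi := fst (ray G phi r) * 0 +
     (snd (ray G phi r) + r * snd (expi phi * (expi phi * D (pol r phi)))%C).
have dre r phi : U (pol r phi) -> is_derive (fun t => fst (ray G t r)) phi (- w r phi).
  by move=> Uz; case: (ray_derive _ _ _ _ _ oU HD' Uz).
have dim r phi : U (pol r phi) -> is_derive (fun s => s * snd (ray G phi s)) r (w r phi).
  by move=> Uz; case: (ray_derive _ _ _ _ _ oU HD' Uz).
have cw r phi : U (pol r phi) -> continuity_2d_pt w r phi.
  move=> Uz; case: (HD _ Uz) => _ /ccont_ray [c1 c2] cD.
  apply: continuity_2d_pt_plus.
    by apply: continuity_2d_pt_mult => //; apply: continuity_2d_pt_const.
  apply: continuity_2d_pt_plus => //.
  apply: continuity_2d_pt_mult; first exact: continuity_2d_pt_id1.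
  case: (ccont_ray _ _ _ cD) => d1 d2 /=.
  have cc : continuity_2d_pt (fun _ b => cos b) r phi.
    by apply: continuity_2d_snd; apply: ex_derive_continuous; auto_derive.
  have cs : continuity_2d_pt (fun _ b => sin b) r phi.
    by apply: continuity_2d_snd; apply: ex_derive_continuous; auto_derive.
  by apply: continuity_2d_pt_plus; apply: continuity_2d_pt_mult.
pose N phi := RInt (fun r => fst (ray G phi r)) a b.
have dN phi : lo < phi < hi ->
    is_derive N phi (- (b * snd (ray G phi b) - a * snd (ray G phi a))).
  move=> Hphi.
  have lphi (P : R -> Prop) : (forall t, lo < t < hi -> P t) -> locally phi P.
    move=> HP; have m0 : 0 < Rmin (phi - lo) (hi - phi) by apply: Rmin_glb_lt; lra.
    exists (mkposreal _ m0) => t.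
    rewrite /ball /= /AbsRing_ball /abs /minus /plus /opp /= => Ht; apply: HP.
    move: Ht (Rmin_l (phi - lo) (hi - phi)) (Rmin_r (phi - lo) (hi - phi)).
    by split_Rabs; lra.
  have E : RInt (fun t => Derive (fun u => fst (ray G u t)) phi) a b =
      - (b * snd (ray G phi b) - a * snd (ray G phi a)).
    rewrite (RInt_ext _ (fun r => - w r phi)); last first.
      move=> r; rewrite Rmin_left ?Rmax_right; try lra; move=> Hr.
      by apply: is_derive_unique; apply: dre; apply: HU; lra.
    apply: is_RInt_unique; apply: (@is_RInt_opp R_NormedModule).
    apply: (is_RInt_derive (fun s => s * snd (ray G phi s)) (fun r => w r phi)).
      move=> r; rewrite Rmin_left ?Rmax_right; try lra; move=> Hr.
      by apply: dim; apply: HU; lra.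
    move=> r; rewrite Rmin_left ?Rmax_right; try lra; move=> Hr.
    by apply: (continuous_2d_slice1 w); apply: cw; apply: HU; lra.
  rewrite -E; apply: (is_derive_RInt_param (fun t r => fst (ray G t r))).
  - apply: lphi => t Ht r; rewrite Rmin_left ?Rmax_right; try lra; move=> Hr.
    by eexists; apply: dre; apply: HU; lra.
  - move=> r; rewrite Rmin_left ?Rmax_right; try lra; move=> Hr.
    have Ur : U (pol r phi) by apply: HU; lra.
    apply: (continuity_2d_pt_ext_loc (fun t s => - w s t)).
      case: (pol_open _ _ _ oU Ur) => d Hd; exists d => u v Hu Hv.
      by symmetry; apply: is_derive_unique; apply: dre; apply: Hd.
    by apply: continuity_2d_pt_opp; apply: continuity_2d_swap; apply: cw.
  - apply: lphi => t Ht.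
    apply: (@ex_RInt_continuous R_CompleteNormedModule) => r.
    rewrite Rmin_left ?Rmax_right; try lra; move=> Hr.
    have Ur : U (pol r t) by apply: HU; lra.
    by case: (HD _ Ur) => _ /continuous_ray [].
case: (MVT_gen N phi1 phi2 (fun phi => - (b * snd (ray G phi b) - a * snd (ray G phi a)))).
- move=> x; rewrite Rmin_left ?Rmax_right; try lra; move=> Hx; apply: dN; lra.
- move=> x; rewrite Rmin_left ?Rmax_right; try lra; move=> Hx.
  apply/continuity_pt_filterlim; apply: (ex_derive_continuous N).
  by eexists; apply: dN; lra.
move=> c; rewrite Rmin_left ?Rmax_right; try lra; move=> [Hc E].
rewrite -/(N phi2) -/(N phi1) E Rabs_mult (Rabs_pos_eq (phi2 - phi1)); last by lra.
rewrite Rmult_comm; apply: Rmult_le_compat_l; first by lra.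
have h1 := Ba c ltac:(lra); have h2 := Bb c ltac:(lra).
have := snd_le_Cmod (ray G c a); have := snd_le_Cmod (ray G c b).
rewrite !Cmod_ray Rabs_Ropp => k1 k2.
apply: Rle_trans (_ : Rabs (b * snd (ray G c b)) + Rabs (a * snd (ray G c a)) <= _).
  by split_Rabs; lra.
rewrite !Rabs_mult (Rabs_pos_eq a) ?(Rabs_pos_eq b); nra.
Qed.

Lemma rect_im U G lo hi phi1 phi2 a b B : copen U -> hol U G -> 0 < a <= b ->
  lo < phi1 -> phi1 <= phi2 -> phi2 < hi ->
  (forall r phi, a <= r <= b -> lo < phi < hi -> U (pol r phi)) ->
  (forall phi, phi1 <= phi <= phi2 -> a * Cmod (G (pol a phi)) <= B) ->
  (forall phi, phi1 <= phi <= phi2 -> b * Cmod (G (pol b phi)) <= B) ->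
  Rabs (RInt (fun r => snd (ray G phi2 r)) a b - RInt (fun r => snd (ray G phi1 r)) a b)
    <= (phi2 - phi1) * (2 * B).
Proof.
move=> oU hG ab l1 l12 l2 HU Ba Bb.
pose G' z := ((0, -1)%R * G z)%C.
have hG' : hol U G' by apply: hol_mul => //; apply: hol_const.
have E phi r : fst (ray G' phi r) = snd (ray G phi r) by rewrite /ray /G' /=; ring.
have m z : Cmod (G' z) = Cmod (G z).
  rewrite /G' Cmod_mult; rewrite -[RHS]Rmult_1_l; congr (_ * _).
  by rewrite /Cmod /= -[RHS]sqrt_1; congr sqrt; ring.
have R phi : RInt (fun r => snd (ray G phi r)) a b = RInt (fun r => fst (ray G' phi r)) a b.
  by apply: RInt_ext => x _; rewrite E.
rewrite !R; apply: (rect_re U G' lo hi) => // phi Hphi; rewrite m; [exact: Ba|exact: Bb].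
Qed.

Definition cii (K : R -> C) (l : C) :=
  ii (fun r => fst (K r)) (fst l) /\ ii (fun r => snd (K r)) (snd l).

Lemma cii_ext K1 K2 l : (forall r, 0 < r -> K1 r = K2 r) -> cii K1 l -> cii K2 l.
Proof. by move=> E [h1 h2]; split; [apply: ii_ext h1|apply: ii_ext h2] => r r0; rewrite E. Qed.

Lemma cii_add K1 K2 l1 l2 : cii K1 l1 -> cii K2 l2 -> cii (fun r => K1 r + K2 r)%C (l1 + l2)%C.
Proof. by case=> h1 h2 [k1 k2]; split; apply: (@ii_plus R_CompleteNormedModule). Qed.

Lemma ii_lincomb (f g : R -> R) a b l m : ii f l -> ii g m -> ii (fun r => a * f r + b * g r) (a * l + b * m).
Proof.
move=> hf hg; apply: (@ii_plus R_CompleteNormedModule).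
- exact: (@ii_scal R_CompleteNormedModule a).
- exact: (@ii_scal R_CompleteNormedModule b).
Qed.

Lemma cii_mul c K l : cii K l -> cii (fun r => c * K r)%C (c * l)%C.
Proof.
case=> h1 h2; split.
- have := ii_lincomb _ _ (fst c) (- snd c) _ _ h1 h2.
  rewrite [X in ii _ X -> _](_ : _ = fst (c * l)%C); last by rewrite /=; ring.
  by apply: ii_ext => r _ /=; ring.
- have := ii_lincomb _ _ (snd c) (fst c) _ _ h1 h2.
  rewrite [X in ii _ X -> _](_ : _ = snd (c * l)%C); last by rewrite /=; ring.
  by apply: ii_ext => r _ /=; ring.
Qed.

Lemma cii_ray_ex G phi M a : 0 < a -> (forall r, 0 < r -> ccont G (pol r phi)) ->
  (forall r, 0 < r -> Cmod (G (pol r phi)) <= M * kap a r) ->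
  exists l, cii (ray G phi) l.
Proof.
move=> a0 cG HG; have Hk := @ii_scal R_CompleteNormedModule M _ _ (ii_kap a a0).
case: (ii_dom (V := R_CompleteNormedModule) (fun r => fst (ray G phi r)) _ _ _ _ Hk).
- by move=> r r0; case: (continuous_ray _ _ _ (cG r r0)).
- by move=> r r0; apply: Rle_trans (fst_le_Cmod _) _; rewrite Cmod_ray; apply: HG.
move=> l1 h1 _.
case: (ii_dom (V := R_CompleteNormedModule) (fun r => snd (ray G phi r)) _ _ _ _ Hk).
- by move=> r r0; case: (continuous_ray _ _ _ (cG r r0)).
- by move=> r r0; apply: Rle_trans (snd_le_Cmod _) _; rewrite Cmod_ray; apply: HG.
by move=> l2 h2 _; exists (l1, l2).
Qed.

Lemma ii_close (f g : R -> R) l m : ii f l -> ii g m ->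
  (forall eps, 0 < eps -> exists2 d, 0 < d & forall a b, 0 < a < d -> / d < b -> a <= b ->
     Rabs (RInt f a b - RInt g a b) < eps) -> l = m.
Proof.
move=> hf hg H; apply: cond_eq => eps e0; have e3 : 0 < eps / 3 by lra.
case: (ii_RInt _ _ _ hf e3) => d1 d11 Hd1; case: (ii_RInt _ _ _ hg e3) => d2 d21 Hd2.
case: (H _ e3) => d3 d30 Hd3.
pose d := Rmin d1 (Rmin d2 d3).
have d0 : 0 < d by repeat apply: Rmin_glb_lt => //; lra.
have m1 : d <= d1 by apply: Rmin_l.
have m2 : d <= d2 by apply: Rle_trans (Rmin_r _ _) (Rmin_l _ _).
have m3 : d <= d3 by apply: Rle_trans (Rmin_r _ _) (Rmin_r _ _).
have i1 : / d1 <= / d by apply: Rinv_le_contravar.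
have i2 : / d2 <= / d by apply: Rinv_le_contravar.
have i3 : / d3 <= / d by apply: Rinv_le_contravar.
have i4 : 1 < / d by rewrite -{1}Rinv_1; apply: Rinv_lt_contravar; lra.
have := Hd1 (d / 2) (/ d + 1) ltac:(lra) ltac:(lra).
have := Hd2 (d / 2) (/ d + 1) ltac:(lra) ltac:(lra).
have := Hd3 (d / 2) (/ d + 1) ltac:(lra) ltac:(lra) ltac:(lra).
rewrite /norm /minus /plus /opp /= /abs /=; split_Rabs; lra.
Qed.

Lemma ray_shift U G lo hi phi1 phi2 a M l1 l2 : copen U -> hol U G -> 0 < a ->
  lo < phi1 -> phi1 <= phi2 -> phi2 < hi ->
  (forall r phi, 0 < r -> lo < phi < hi -> U (pol r phi)) ->
  (forall r phi, 0 < r -> phi1 <= phi <= phi2 -> Cmod (G (pol r phi)) <= M * kap a r) ->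
  cii (ray G phi1) l1 -> cii (ray G phi2) l2 -> l1 = l2.
Proof.
move=> oU hG a0 h1 h12 h2 HU HM [k11 k12] [k21 k22].
have key eps : 0 < eps -> exists2 d, 0 < d & forall u v, 0 < u < d -> / d < v -> u <= v ->
    (phi2 - phi1) * (2 * (eps / (4 * (phi2 - phi1 + 1)))) < eps /\
    (forall phi, phi1 <= phi <= phi2 -> u * Cmod (G (pol u phi)) <= eps / (4 * (phi2 - phi1 + 1))) /\
    (forall phi, phi1 <= phi <= phi2 -> v * Cmod (G (pol v phi)) <= eps / (4 * (phi2 - phi1 + 1))).
  move=> e0; pose e := eps / (4 * (phi2 - phi1 + 1)).
  have e1 : 0 < e by apply: Rdiv_lt_0_compat; lra.
  have M0 : 0 < Rabs M + 1 by move: (Rabs_pos M); lra.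
  have e2 : 0 < e / (Rabs M + 1) by apply: Rdiv_lt_0_compat.
  case: (kk_small a _ a0 e2) => d d1 Hd; exists d; first lra.
  have i1 : 1 < / d by rewrite -{1}Rinv_1; apply: Rinv_lt_contravar; lra.
  have b r phi : 0 < r -> r < d \/ / d < r -> phi1 <= phi <= phi2 -> r * Cmod (G (pol r phi)) <= e.
    move=> r0 Hr Hp; apply: Rle_trans (_ : r * (M * kap a r) <= _).
      by apply: Rmult_le_compat_l; [lra|exact: HM].
    rewrite (_ : r * _ = M * kk a r); last by rewrite /kap; field; lra.
    have := Hd r r0 Hr; have k0 := kk_gt0 a r => k1.
    apply: Rle_trans (_ : (Rabs M + 1) * (e / (Rabs M + 1)) <= _); last by apply: Req_le; field; lra.
    by have := Rle_abs M; nra.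
  move=> u v Hu Hv uv; split; last by split=> phi Hp; apply: b => //; lra.
  rewrite (_ : _ * _ = eps * ((phi2 - phi1) / (phi2 - phi1 + 1)) / 2); last by field; lra.
  have : (phi2 - phi1) / (phi2 - phi1 + 1) < 1 by apply: div_lt; lra.
  nra.
rewrite (surjective_pairing l1) (surjective_pairing l2); congr pair.
- apply: (ii_close _ _ _ _ k11 k21) => eps e0; case: (key eps e0) => d d0 Hd.
  exists d => // u v Hu Hv uv; case: (Hd u v Hu Hv uv) => lt [b1 b2].
  rewrite Rabs_minus_sym; apply: Rle_lt_trans lt.
  apply: (rect_re U G lo hi) => //; first by lra.
  by move=> r phi Hr Hp; apply: HU; lra.
- apply: (ii_close _ _ _ _ k12 k22) => eps e0; case: (key eps e0) => d d0 Hd.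
  exists d => // u v Hu Hv uv; case: (Hd u v Hu Hv uv) => lt [b1 b2].
  rewrite Rabs_minus_sym; apply: Rle_lt_trans lt.
  apply: (rect_im U G lo hi) => //; first by lra.
  by move=> r phi Hr Hp; apply: HU; lra.
Qed.

Lemma Cmod_sqr z : Cmod z ^ 2 = fst z ^ 2 + snd z ^ 2.
Proof. exact: Cmod2_alt. Qed.

Lemma Cmod_dist_sqr r phi r0 phi0 :
  Cmod (pol r phi - pol r0 phi0)%C ^ 2 = r ^ 2 + r0 ^ 2 - 2 * r * r0 * cos (phi - phi0).
Proof.
rewrite Cmod_sqr cos_minus /=.
have h1 := sin2_cos2 phi; have h2 := sin2_cos2 phi0; move: h1 h2; rewrite /Rsqr.
set c := cos phi; set d := cos phi0; set s := sin phi; set t := sin phi0 => h1 h2.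
rewrite (_ : r * (r * 1) + r0 * (r0 * 1) = r * r * (s * s + c * c) + r0 * r0 * (t * t + d * d)); last by rewrite h1 h2; ring.
ring.
Qed.

Lemma pow2_le_inv x y : 0 <= y -> x ^ 2 <= y ^ 2 -> x <= y.
Proof. by move=> y0 H; apply: Rnot_lt_le => l; nra. Qed.

Lemma dist_pol_sin r phi r0 phi0 : 0 <= r0 ->
  r0 * Rabs (sin (phi - phi0)) <= Cmod (pol r phi - pol r0 phi0)%C.
Proof.
move=> h0; apply: pow2_le_inv; first exact: Cmod_ge_0.
rewrite Cmod_dist_sqr Rpow_mult_distr pow2_abs.
have := sin2_cos2 (phi - phi0); rewrite /Rsqr.
have := pow2_ge_0 (r - r0 * cos (phi - phi0)).
set s := sin _; set c := cos _; nra.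
Qed.

Lemma dist_pol_abs r phi r0 phi0 : 0 <= r -> 0 <= r0 ->
  Rabs (r - r0) <= Cmod (pol r phi - pol r0 phi0)%C.
Proof.
move=> h h0; apply: pow2_le_inv; first exact: Cmod_ge_0.
rewrite Cmod_dist_sqr pow2_abs.
have := COS_bound (phi - phi0).
have : 0 <= r * r0 by nra.
set c := cos _; nra.
Qed.

Lemma dist_pol_cos r phi r0 phi0 k : 0 <= r -> 0 <= r0 -> cos (phi - phi0) <= k -> k <= 1 ->
  sqrt ((1 - k) / 2) * (r + r0) <= Cmod (pol r phi - pol r0 phi0)%C.
Proof.
move=> h h0 hk k1; apply: pow2_le_inv; first exact: Cmod_ge_0.
rewrite Cmod_dist_sqr Rpow_mult_distr pow2_sqrt; last by lra.
have : 0 <= r * r0 by nra.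
have := pow2_ge_0 (r - r0); have := COS_bound (phi - phi0).
set c := cos _ in hk *; nra.
Qed.

Lemma dist_pol_lb r0 phi0 k : 0 < r0 -> k < 1 -> exists2 c, 0 < c &
  forall r phi, 0 < r -> cos (phi - phi0) <= k -> c * (1 + r) <= Cmod (pol r phi - pol r0 phi0)%C.
Proof.
move=> h0 k1; have s0 : 0 < sqrt ((1 - k) / 2) by apply: sqrt_lt_R0; lra.
have m0 : 0 < Rmin 1 r0 by apply: Rmin_glb_lt; lra.
have m1 := Rmin_l 1 r0; have m2 := Rmin_r 1 r0.
exists (sqrt ((1 - k) / 2) * Rmin 1 r0); first by nra.
move=> r phi hr hk; apply: Rle_trans (dist_pol_cos r phi r0 phi0 k _ _ hk _); try lra.
rewrite Rmult_assoc; apply: Rmult_le_compat_l; first by lra.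
nra.
Qed.

Lemma pol_neq r phi r0 phi0 : 0 < r0 -> sin (phi - phi0) <> 0 -> pol r phi <> pol r0 phi0.
Proof.
move=> h0 hs E; have := dist_pol_sin r phi r0 phi0 ltac:(lra).
rewrite E (_ : (_ - _)%C = 0%C); last by ring.
rewrite Cmod_0; have := Rabs_pos_lt _ hs; nra.
Qed.

Lemma Csub_neq0 (z w : C) : z <> w -> (z - w)%C <> 0%C.
Proof. by move=> H E; apply: H; rewrite -(Cplus_0_r w) -E; ring. Qed.

Lemma hol_div_sub U G s : hol U G -> hol (fun z => U z /\ z <> s) (fun z => G z / (z - s))%C.
Proof.
move=> hG; apply: hol_mul; first by apply: hol_sub hG => z [].
apply: (hol_inv _ (fun z => z - s)%C).
- by apply: hol_add; [exact: hol_id|exact: hol_const].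
- by move=> z [_]; exact: Csub_neq0.
Qed.

Lemma copen_neq s : copen (fun z => z <> s).
Proof.
move=> x y H.
have c1 : continuity_2d_pt (fun u v => (u - fst s) * (u - fst s) + (v - snd s) * (v - snd s)) x y.
  by apply: continuity_2d_pt_plus; apply: continuity_2d_pt_mult; apply: continuity_2d_pt_minus;
   (exact: continuity_2d_pt_id1 || exact: continuity_2d_pt_id2 || exact: continuity_2d_pt_const).
have n0 : (x - fst s) * (x - fst s) + (y - snd s) * (y - snd s) <> 0.
  have := Cnorm2_gt0 _ (Csub_neq0 _ _ H) => /=; rewrite /Rminus; lra.
case: (continuity_2d_pt_neq_0 _ _ _ c1 n0) => d Hd; exists d => u v Hu Hv E.
apply: (Hd u v Hu Hv); rewrite -E /=; ring.
Qed.

Lemma copen_and U W : copen U -> copen W -> copen (fun z => U z /\ W z).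
Proof.
move=> oU oW x y [Ux Wx]; case: (oU _ _ Ux) => d1 H1; case: (oW _ _ Wx) => d2 H2.
have m0 : 0 < Rmin d1 d2 by apply: Rmin_glb_lt; apply: cond_pos.
exists (mkposreal _ m0) => u v Hu Hv; split.
- by apply: H1; [apply: Rlt_le_trans Hu (Rmin_l _ _)|apply: Rlt_le_trans Hv (Rmin_l _ _)].
- by apply: H2; [apply: Rlt_le_trans Hu (Rmin_r _ _)|apply: Rlt_le_trans Hv (Rmin_r _ _)].
Qed.

Lemma le_2sin x : 0 <= x <= 1 -> x <= 2 * sin x.
Proof.
move=> hx; case: (MVT_gen (fun t => 2 * sin t - t) 0 x (fun t => 2 * cos t - 1)).
- by move=> t _; auto_derive => //; ring.
- move=> t _; apply/continuity_pt_filterlim; apply: (ex_derive_continuous (fun t => 2 * sin t - t)).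
  by eexists; auto_derive.
move=> c; rewrite Rmin_left ?Rmax_right; try lra; move=> [hc].
have p3 := PI2_3_2.
have : cos (PI / 3) <= cos c by apply: cos_decr_1; lra.
rewrite cos_PI3 sin_0; nra.
Qed.

Lemma ray_shift_pole_re U H lo hi phi1 phi2 r0 phi0 a M l1 l2 :
  let s := pol r0 phi0 in let G z := (H z / (z - s))%C in
  copen U -> hol U H -> 0 < a -> 0 < r0 -> H s = 0%C ->
  lo < phi1 -> phi1 < phi0 -> phi0 < phi2 -> phi2 < hi -> hi - lo <= PI ->
  (forall r phi, 0 < r -> lo < phi < hi -> U (pol r phi)) ->
  (forall r phi, 0 < r -> phi1 <= phi <= phi2 -> Cmod (H (pol r phi)) <= M * ((1 + r) * kap a r)) ->
  cii (ray G phi1) l1 -> cii (ray G phi2) l2 -> fst l1 = fst l2.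
Proof.
move=> s G oU hH a0 h0 Hs h1 h10 h02 h2 hPI HU HM k1 k2.
pose U' z := U z /\ z <> s.
have oU' : copen U' by apply: copen_and => //; apply: copen_neq.
have hG : hol U' G by apply: hol_div_sub.
have sin0 phi : lo < phi < hi -> phi <> phi0 -> sin (phi - phi0) <> 0.
  move=> Hp Hn; case: (Rlt_le_dec phi phi0) => hlt.
  - have := sin_gt_0 (phi0 - phi) ltac:(lra) ltac:(lra).
    rewrite (_ : phi - phi0 = - (phi0 - phi)); last by ring.
    rewrite sin_neg; lra.
  - have := sin_gt_0 (phi - phi0) ltac:(lra) ltac:(lra); lra.
have HU1 r phi : 0 < r -> lo < phi < hi -> phi <> phi0 -> U' (pol r phi).
  by move=> r1 Hp Hn; split; [exact: HU|apply: pol_neq => //; apply: sin0].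
have cH : ccont H s by apply: hol_ccont hH _; apply: HU; lra.
have Mp r phi : 0 < r -> phi1 <= phi <= phi2 -> Cmod (H (pol r phi)) <= Rabs M * ((1 + r) * kap a r).
  move=> r1 Hp; apply: Rle_trans (HM _ _ r1 Hp) _; apply: Rmult_le_compat_r; last exact: Rle_abs.
  by have := kap_gt0 a r r1; nra.
(* the angle of integration may be moved up to phi0 *)
have side eps : 0 < eps -> eps < phi0 - phi1 -> eps < phi2 - phi0 ->
    cii (ray G (phi0 - eps)) l1 /\ cii (ray G (phi0 + eps)) l2.
  move=> e0 e1 e2.
  pose k := cos eps.
  have kl1 : k < 1.
    by rewrite /k -cos_0; apply: cos_decreasing_1; lra.
  case: (dist_pol_lb r0 phi0 k h0 kl1) => c c0 Hc.
  have bG r phi : 0 < r -> phi1 <= phi <= phi2 -> eps <= Rabs (phi - phi0) ->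
      Cmod (G (pol r phi)) <= (Rabs M / c) * kap a r.
    move=> r1 Hp He.
    have ck : cos (phi - phi0) <= k.
      rewrite /k; case: (Rle_lt_dec 0 (phi - phi0)) => hs.
      - rewrite Rabs_pos_eq // in He; apply: cos_decr_1; lra.
      - rewrite Rabs_left // in He; rewrite -cos_neg; apply: cos_decr_1; lra.
    have lb := Hc r phi r1 ck; rewrite -/s in lb.
    have d0 : 0 < Cmod (pol r phi - s)%C by nra.
    have nz : (pol r phi - s)%C <> 0%C by apply/Cmod_gt_0.
    rewrite /G Cmod_div //; apply: div_le => //.
    apply: Rle_trans (Mp _ _ r1 Hp) _.
    have kp := kap_gt0 a r r1; have Ma := Rabs_pos M.
    rewrite (_ : _ * Cmod _ = Rabs M * kap a r * (Cmod (pol r phi - s)%C / c)); last by field; lra.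
    rewrite (_ : Rabs M * ((1 + r) * kap a r) = Rabs M * kap a r * (1 + r)); last by ring.
    apply: Rmult_le_compat_l; first by nra.
    by apply: le_div; lra.
  have cG r phi : 0 < r -> lo < phi < hi -> phi <> phi0 -> ccont G (pol r phi).
    by move=> *; apply: (hol_ccont U') => //; apply: HU1.
  split.
  - have [l Hl] : exists l, cii (ray G (phi0 - eps)) l.
      apply: (cii_ray_ex _ _ (Rabs M / c) a) => // r r1.
      + by apply: cG; lra.
      + by apply: bG; [lra|lra|split_Rabs; lra].
    suff -> : l1 = l by [].
    apply: (ray_shift U' G lo phi0 phi1 (phi0 - eps) a (Rabs M / c)) => //; try lra.
    + by move=> r phi r1 Hp; apply: HU1; lra.
    + by move=> r phi r1 Hp; apply: bG; [lra|lra|split_Rabs; lra].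
  - have [l Hl] : exists l, cii (ray G (phi0 + eps)) l.
      apply: (cii_ray_ex _ _ (Rabs M / c) a) => // r r1.
      + by apply: cG; lra.
      + by apply: bG; [lra|lra|split_Rabs; lra].
    suff -> : l2 = l by [].
    symmetry; apply: (ray_shift U' G phi0 hi (phi0 + eps) phi2 a (Rabs M / c)) => //; try lra.
    + by move=> r phi r1 Hp; apply: HU1; lra.
    + by move=> r phi r1 Hp; apply: bG; [lra|lra|split_Rabs; lra].
(* comparison of the angles phi0 - eps and phi0 + eps: on a small polar box
   around s, H is small while the size of the box is comparable to |z - s| *)
have key eta : 0 < eta -> Rabs (fst l1 - fst l2) <= 40 * eta.
  move=> eta0.
  have [d d0 Hd] : exists2 d, 0 < d & forall r phi, Rabs (r - r0) < d -> Rabs (phi - phi0) < d ->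
      Cmod (H (pol r phi)) <= eta.
    have e2 : 0 < eta / 2 by lra.
    case: (ccont_pol _ _ _ cH) => c1 c2.
    case: (c1 (mkposreal _ e2)) => d1 H1; case: (c2 (mkposreal _ e2)) => d2 H2.
    exists (Rmin d1 d2); first by apply: Rmin_glb_lt; apply: cond_pos.
    move=> r phi Hr Hp; apply: Rle_trans (Cmod_2Rmax _) _.
    have {H1} := H1 r phi (Rlt_le_trans _ _ _ Hr (Rmin_l _ _)) (Rlt_le_trans _ _ _ Hp (Rmin_l _ _)).
    have {H2} := H2 r phi (Rlt_le_trans _ _ _ Hr (Rmin_r _ _)) (Rlt_le_trans _ _ _ Hp (Rmin_r _ _)).
    rewrite Hs /= !Rminus_0_r => H1 H2.
    have q : sqrt 2 <= 2 by have := sqrt_less_alt 2 ltac:(lra); lra.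
    have := sqrt_pos 2; have : Rmax (Rabs (fst (H (pol r phi)))) (Rabs (snd (H (pol r phi)))) <= eta / 2.
      by apply: Rmax_lub; lra.
    have := Rmax_l (Rabs (fst (H (pol r phi)))) (Rabs (snd (H (pol r phi)))).
    have := Rabs_pos (fst (H (pol r phi))); nra.
  pose eps := Rmin (/ 2) (Rmin (d / 2) (Rmin (d / (2 * r0)) (Rmin ((phi0 - phi1) / 2) ((phi2 - phi0) / 2)))).
  have e0 : 0 < eps.
    have : 0 < d / (2 * r0) by apply: Rdiv_lt_0_compat; lra.
    by move=> ?; repeat apply: Rmin_glb_lt; lra.
  have e1 : eps <= / 2 by apply: Rmin_l.
  have e2 : eps <= d / 2 by do 1 (apply: Rle_trans (Rmin_r _ _) _); apply: Rmin_l.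
  have e3 : eps <= d / (2 * r0) by do 2 (apply: Rle_trans (Rmin_r _ _) _); apply: Rmin_l.
  have e4 : eps <= (phi0 - phi1) / 2 by do 3 (apply: Rle_trans (Rmin_r _ _) _); apply: Rmin_l.
  have e5 : eps <= (phi2 - phi0) / 2 by do 3 (apply: Rle_trans (Rmin_r _ _) _); apply: Rmin_r.
  case: (side eps e0 ltac:(lra) ltac:(lra)) => -[k1' _] [k2' _].
  pose w := sin eps.
  have w2 : eps <= 2 * w by apply: le_2sin; lra.
  have w1 : w <= eps by apply: Rlt_le; apply: sin_lt_x.
  have w0 : 0 < w by lra.
  pose rho := r0 * w.
  have rho0 : 0 < rho by rewrite /rho; nra.
  have rho1 : rho <= r0 / 2 by rewrite /rho; nra.
  have rho2 : rho < d.
    have : r0 * eps <= r0 * (d / (2 * r0)) by apply: Rmult_le_compat_l; lra.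
    rewrite (_ : r0 * (d / (2 * r0)) = d / 2); last by field; lra.
    rewrite /rho; nra.
  have GE z : z <> s -> Cmod (G z) = Cmod (H z) / Cmod (z - s)%C.
    by move=> nz; rewrite /G Cmod_div //; exact: Csub_neq0.
  have bside r phi : Rabs (r - r0) = rho -> Rabs (phi - phi0) <= eps -> r * Cmod (G (pol r phi)) <= 2 * eta / w.
    move=> Hr Hp.
    have r1 : 0 < r <= 2 * r0 by move: Hr; split_Rabs; lra.
    have lb := dist_pol_abs r phi r0 phi0 ltac:(lra) ltac:(lra); rewrite Hr -/s in lb.
    have d1 : 0 < Cmod (pol r phi - s)%C by lra.
    have nz : pol r phi <> s.
      by move=> E; move: d1; rewrite E (_ : (s - s)%C = 0%C) ?Cmod_0; [lra|ring].
    rewrite GE // (_ : 2 * eta / w = 2 * r0 * (eta / rho)); last by rewrite /rho; field; lra.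
    apply: Rmult_le_compat; try lra.
    - by apply: Rdiv_le_0_compat => //; exact: Cmod_ge_0.
    - have hb : Cmod (H (pol r phi)) <= eta by apply: Hd; lra.
      apply: div_le => //; apply: Rle_trans hb _.
      rewrite (_ : eta / rho * _ = eta * (Cmod (pol r phi - s)%C / rho)); last by field; lra.
      rewrite -{1}(Rmult_1_r eta); apply: Rmult_le_compat_l; first lra.
      by apply: le_div; lra.
  have hside r phi : Rabs (r - r0) <= rho -> Rabs (phi - phi0) = eps -> Cmod (G (pol r phi)) <= eta / rho.
    move=> Hr Hp.
    have lb := dist_pol_sin r phi r0 phi0 ltac:(lra).
    have E : Rabs (sin (phi - phi0)) = w.
      case: (Rle_lt_dec 0 (phi - phi0)) => hs.
      - rewrite Rabs_pos_eq // in Hp; rewrite Hp Rabs_pos_eq //; rewrite -/w; lra.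
      - rewrite Rabs_left // in Hp; rewrite (_ : phi - phi0 = - eps); last lra.
        rewrite sin_neg Rabs_Ropp Rabs_pos_eq //; rewrite -/w; lra.
    rewrite E -/rho -/s in lb.
    have d1 : 0 < Cmod (pol r phi - s)%C by apply: Rlt_le_trans lb.
    have nz : pol r phi <> s.
      by move=> E'; move: d1; rewrite E' (_ : (s - s)%C = 0%C) ?Cmod_0; [lra|ring].
    rewrite GE //; have hb : Cmod (H (pol r phi)) <= eta by apply: Hd; lra.
    apply: div_le => //; apply: Rle_trans hb _.
    rewrite (_ : eta / rho * _ = eta * (Cmod (pol r phi - s)%C / rho)); last by field; lra.
    rewrite -{1}(Rmult_1_r eta); apply: Rmult_le_compat_l; first lra.
    by apply: le_div; lra.
  have B0 : 0 < 2 * eta / w by apply: Rdiv_lt_0_compat; lra.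
  have [df df0 far] : exists2 df, 0 < df <= r0 / 4 & (4 * r0 <= / df) /\ forall r phi, 0 < r -> r < df \/ / df < r ->
      Rabs (phi - phi0) <= eps -> r * Cmod (G (pol r phi)) <= 2 * eta / w.
    have Ma := Rabs_pos M.
    pose c := Rmin (/ 2) (r0 / 2).
    have c0 : 0 < c by apply: Rmin_glb_lt; lra.
    have c1 : c <= / 2 by apply: Rmin_l.
    have c2 : c <= r0 / 2 by apply: Rmin_r.
    have q0 : 0 < 2 * eta / w * (c / 2 / (Rabs M + 1)).
      by apply: Rmult_lt_0_compat => //; apply: Rdiv_lt_0_compat; lra.
    case: (kk_small a _ a0 q0) => d1 d11 Hd1.
    pose df := Rmin d1 (Rmin (r0 / 4) (Rmin (/ 4) (/ (4 * r0)))).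
    have i4 : 0 < / (4 * r0) by apply: Rinv_0_lt_compat; lra.
    have df0 : 0 < df by repeat apply: Rmin_glb_lt; lra.
    have df1 : df <= d1 by apply: Rmin_l.
    have df2 : df <= r0 / 4 by do 1 (apply: Rle_trans (Rmin_r _ _) _); apply: Rmin_l.
    have df3 : df <= / 4 by do 2 (apply: Rle_trans (Rmin_r _ _) _); apply: Rmin_l.
    have df4 : df <= / (4 * r0) by do 2 (apply: Rle_trans (Rmin_r _ _) _); apply: Rmin_r.
    have i1 : / d1 <= / df by apply: Rinv_le_contravar.
    have i2 : 4 <= / df by rewrite -(Rinv_inv 4); apply: Rinv_le_contravar.
    have i3 : 4 * r0 <= / df by rewrite -(Rinv_inv (4 * r0)); apply: Rinv_le_contravar.
    exists df => //; split=> // r phi r1 Hr Hp.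
    have lb : c / 2 * (1 + r) <= Cmod (pol r phi - s)%C.
      apply: Rle_trans (dist_pol_abs r phi r0 phi0 ltac:(lra) ltac:(lra)).
      by case: Hr => Hr; split_Rabs; nra.
    have d2 : 0 < Cmod (pol r phi - s)%C by nra.
    have nz : pol r phi <> s.
      by move=> E'; move: d2; rewrite E' (_ : (s - s)%C = 0%C) ?Cmod_0; [lra|ring].
    have hk : kk a r < 2 * eta / w * (c / 2 / (Rabs M + 1)) by apply: Hd1 => //; lra.
    have := Mp r phi r1 ltac:(move: Hp; split_Rabs; lra) => hM.
    rewrite GE //; apply: Rle_trans (_ : r * (Rabs M * ((1 + r) * kap a r) / (c / 2 * (1 + r))) <= _).
      apply: Rmult_le_compat_l; first lra.
      apply: Rmult_le_compat => //; first exact: Cmod_ge_0.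
      - by apply: Rlt_le; apply: Rinv_0_lt_compat.
      - by apply: Rinv_le_contravar => //; nra.
    rewrite (_ : r * _ = Rabs M / (c / 2) * kk a r); last by rewrite /kap; field; lra.
    apply: Rle_trans (_ : (Rabs M + 1) / (c / 2) * (2 * eta / w * (c / 2 / (Rabs M + 1))) <= _); last first.
      by apply: Req_le; field; lra.
    have kp := kk_gt0 a r.
    apply: Rmult_le_compat; try lra.
    - by apply: Rdiv_le_0_compat; lra.
    - by apply: Rmult_le_compat_r; [apply: Rlt_le; apply: Rinv_0_lt_compat; lra|lra].
  case: far => [dfr far].
  have e10 : 0 < eta by [].
  case: (ii_RInt _ _ _ k1' e10) => d1 d11 Hd1; case: (ii_RInt _ _ _ k2' e10) => d2 d21 Hd2.
  pose dd := Rmin df (Rmin d1 d2).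
  have dd0 : 0 < dd by repeat apply: Rmin_glb_lt; lra.
  have m1 : dd <= df by apply: Rmin_l.
  have m2 : dd <= d1 by apply: Rle_trans (Rmin_r _ _) (Rmin_l _ _).
  have m3 : dd <= d2 by apply: Rle_trans (Rmin_r _ _) (Rmin_r _ _).
  have i1 : / df <= / dd by apply: Rinv_le_contravar; lra.
  have i2 : / d1 <= / dd by apply: Rinv_le_contravar; lra.
  have i3 : / d2 <= / dd by apply: Rinv_le_contravar; lra.
  pose u := dd / 2; pose v := / dd + 1.
  have {Hd1} := Hd1 u v ltac:(rewrite /u; lra) ltac:(rewrite /v; lra).
  have {Hd2} := Hd2 u v ltac:(rewrite /u; lra) ltac:(rewrite /v; lra).
  have ur : 0 < u < r0 - rho by rewrite /u; lra.
  have vr : r0 + rho < v by rewrite /v; lra.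
  have ch phi : lo < phi < hi -> phi <> phi0 ->
      RInt (fun r => fst (ray G phi r)) u v = RInt (fun r => fst (ray G phi r)) u (r0 - rho)
        + RInt (fun r => fst (ray G phi r)) (r0 - rho) (r0 + rho)
        + RInt (fun r => fst (ray G phi r)) (r0 + rho) v.
    move=> Hp Hn.
    have ex x y : 0 < x <= y -> ex_RInt (fun r => fst (ray G phi r)) x y.
      apply: continuous_ex_RInt => r r1.
      by case: (continuous_ray _ _ _ (hol_ccont _ _ _ hG (HU1 r phi r1 Hp Hn))).
    rewrite -(RInt_Chasles _ u (r0 + rho) v); try by apply: ex; lra.
    by rewrite -(RInt_Chasles _ u (r0 - rho) (r0 + rho)) //; apply: ex; lra.
  have mid phi : Rabs (phi - phi0) = eps -> lo < phi < hi ->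
      Rabs (RInt (fun r => fst (ray G phi r)) (r0 - rho) (r0 + rho)) <= 2 * eta.
    move=> Hp Hl; have Hn : phi <> phi0.
      by move=> E; move: Hp; rewrite E Rminus_diag Rabs_R0; lra.
    rewrite (_ : 2 * eta = (r0 + rho - (r0 - rho)) * (eta / rho)); last by field; lra.
    apply: (@norm_RInt_le_const R_NormedModule (fun r => fst (ray G phi r)) (r0 - rho) (r0 + rho)); first lra.
    - move=> x Hx; apply: Rle_trans (fst_le_Cmod _) _; rewrite Cmod_ray; apply: hside => //.
      by split_Rabs; lra.
    - apply: RInt_correct; apply: continuous_ex_RInt; last by lra.
      move=> r r1.
      by case: (continuous_ray _ _ _ (hol_ccont _ _ _ hG (HU1 r phi r1 Hl Hn))).
  have left := rect_re U' G lo hi (phi0 - eps) (phi0 + eps) u (r0 - rho) (2 * eta / w) oU' hG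
    ltac:(lra) ltac:(lra) ltac:(lra) ltac:(lra).
  have right := rect_re U' G lo hi (phi0 - eps) (phi0 + eps) (r0 + rho) v (2 * eta / w) oU' hG
    ltac:(lra) ltac:(lra) ltac:(lra) ltac:(lra).
  have U'neq r phi : 0 < r -> r <> r0 -> lo < phi < hi -> U' (pol r phi).
    move=> r1 Hr Hp; split; first exact: HU.
    move=> E; apply: Hr; have := dist_pol_abs r phi r0 phi0 ltac:(lra) ltac:(lra).
    by rewrite -/s E (_ : (s - s)%C = 0%C) ?Cmod_0; [split_Rabs; lra|ring].
  have L : (phi0 + eps - (phi0 - eps)) * (2 * (2 * eta / w)) <= 16 * eta.
    rewrite (_ : _ * _ = 8 * eta * (eps / w)); last by field; lra.
    have : eps / w <= 2 by apply: div_le; lra.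
    nra.
  have {left}left : Rabs (RInt (fun r => fst (ray G (phi0 + eps) r)) u (r0 - rho) -
      RInt (fun r => fst (ray G (phi0 - eps) r)) u (r0 - rho)) <= 16 * eta.
    apply: Rle_trans L; apply: left.
    - by move=> r phi Hr Hp; apply: U'neq; lra.
    - by move=> phi Hp; apply: far; [lra|rewrite /u; lra|split_Rabs; lra].
    - by move=> phi Hp; apply: bside; split_Rabs; lra.
  have {right}right : Rabs (RInt (fun r => fst (ray G (phi0 + eps) r)) (r0 + rho) v -
      RInt (fun r => fst (ray G (phi0 - eps) r)) (r0 + rho) v) <= 16 * eta.
    apply: Rle_trans L; apply: right.
    - by move=> r phi Hr Hp; apply: U'neq; lra.
    - by move=> phi Hp; apply: bside; split_Rabs; lra.
    - by move=> phi Hp; apply: far; [lra|rewrite /v; lra|split_Rabs; lra].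
  have := mid (phi0 - eps) ltac:(split_Rabs; lra) ltac:(lra).
  have := mid (phi0 + eps) ltac:(split_Rabs; lra) ltac:(lra).
  rewrite !ch; try lra.
  rewrite /norm /minus /plus /opp /= /abs /=.
  move: left right.
  set A1 := RInt _ u _; set A2 := RInt _ u _; set A3 := RInt _ _ v; set A4 := RInt _ _ v.
  set A5 := RInt _ _ _; set A6 := RInt _ _ _.
  move=> /Rabs_le_between ? /Rabs_le_between ? /Rabs_le_between ? /Rabs_le_between ?.
  move=> /Rabs_def2 ? /Rabs_def2 ?; apply: Rabs_le; lra.
apply: cond_eq => e e0; have := key (e / 41) ltac:(lra); lra.
Qed.

Lemma ray_shift_pole U H lo hi phi1 phi2 r0 phi0 a M l1 l2 :
  let s := pol r0 phi0 in let G z := (H z / (z - s))%C in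
  copen U -> hol U H -> 0 < a -> 0 < r0 -> H s = 0%C ->
  lo < phi1 -> phi1 < phi0 -> phi0 < phi2 -> phi2 < hi -> hi - lo <= PI ->
  (forall r phi, 0 < r -> lo < phi < hi -> U (pol r phi)) ->
  (forall r phi, 0 < r -> phi1 <= phi <= phi2 -> Cmod (H (pol r phi)) <= M * ((1 + r) * kap a r)) ->
  cii (ray G phi1) l1 -> cii (ray G phi2) l2 -> l1 = l2.
Proof.
move=> s G oU hH a0 h0 Hs h1 h10 h02 h2 hPI HU HM k1 k2.
pose H' z := ((0, -1)%R * H z)%C.
have E phi r : ((0, -1)%R * ray G phi r)%C = ray (fun z => H' z / (z - s))%C phi r.
  by rewrite /ray /G /H'; ring_simplify; rewrite /Cdiv; ring.
have mi : Cmod (0, -1)%R = 1 by rewrite /Cmod /= -[RHS]sqrt_1; congr sqrt; ring.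
have hH' : hol U H' by apply: hol_mul => //; apply: hol_const.
have k1' := cii_mul (0, -1)%R _ _ k1; have k2' := cii_mul (0, -1)%R _ _ k2.
rewrite (surjective_pairing l1) (surjective_pairing l2); congr pair.
  exact: (ray_shift_pole_re U H lo hi phi1 phi2 r0 phi0 a M l1 l2).
suff : fst ((0, -1)%R * l1)%C = fst ((0, -1)%R * l2)%C by rewrite /=; lra.
apply: (ray_shift_pole_re U H' lo hi phi1 phi2 r0 phi0 a M) => //.
- by rewrite /H' -/s Hs; ring.
- by move=> r phi r1 Hp; rewrite /H' Cmod_mult mi Rmult_1_l; apply: HM.
- by apply: cii_ext k1' => r _; rewrite E.
- by apply: cii_ext k2' => r _; rewrite E.
Qed.

Lemma kap1 r : 0 < r -> kap 1 r = / (1 + r ^ 2).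
Proof. by move=> r0; rewrite /kap kkE Rpower_1 //; field; nra. Qed.

Lemma kap1_le a r : 0 < a <= 1 -> 0 < r -> kap 1 r <= kap a r.
Proof.
move=> a0 r0; apply: Rmult_le_compat_r; last exact: kk_mono.
by apply: Rlt_le; apply: Rinv_0_lt_compat.
Qed.

(* For the pole s = pol r0 phi0 of the right half-plane, the comparison function
   2 Re(s) / ((z + conj s) (z - s)); -conj s = pol r0 (PI - phi0). On the
   imaginary axis it is real, and its integral is an arctangent. *)
Definition pkap (r0 phi0 : R) (z : C) : C :=
  (RtoC (2 * r0 * cos phi0) / (z - pol r0 (PI - phi0)))%C.

Definition pker (r0 phi0 : R) (z : C) : C := (pkap r0 phi0 z / (z - pol r0 phi0))%C.

Lemma hol_pkap U r0 phi0 : (forall z, U z -> z <> pol r0 (PI - phi0)) -> hol U (pkap r0 phi0).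
Proof.
move=> H; apply: hol_mul; first exact: hol_const.
apply: (hol_inv _ (fun z => z - pol r0 (PI - phi0))%C).
- by apply: hol_add; [exact: hol_id|exact: hol_const].
- by move=> z Uz; apply: Csub_neq0; apply: H.
Qed.

Lemma Csub_diag_mod (z w : C) : 0 < Cmod (z - w)%C -> z <> w.
Proof. by move=> H E; move: H; rewrite E (_ : (w - w)%C = 0%C) ?Cmod_0; [lra|ring]. Qed.

Lemma pker_ray_pi2 r0 phi0 r : 0 < r0 -> 0 < cos phi0 ->
  ray (pker r0 phi0) (PI / 2) r =
  (0, - (2 * (r0 * cos phi0) / ((r - r0 * sin phi0) ^ 2 + (r0 * cos phi0) ^ 2))).
Proof.
move=> h0 c0; rewrite /ray /pker /pkap /pol /expi cos_PI2 sin_PI2.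
rewrite cos_minus sin_minus cos_PI sin_PI Rmult_0_r Rmult_1_r.
rewrite (_ : r0 * (-1 * cos phi0 + 0 * sin phi0) = - (r0 * cos phi0)); last by ring.
rewrite (_ : r0 * (0 * cos phi0 - -1 * sin phi0) = r0 * sin phi0); last by ring.
have p : 0 < r0 * cos phi0 by nra.
rewrite (_ : 2 * r0 * cos phi0 = 2 * (r0 * cos phi0)); last by ring.
move: p; set x := r0 * cos phi0; set y := r0 * sin phi0 => p.
have q : 0 < (r - y) ^ 2 + x ^ 2 by have := pow2_ge_0 (r - y); nra.
have -> : ((0%R, r) - ((- x)%R, y) = (x, (r - y)%R))%C.
  by apply: injective_projections => /=; ring.
have -> : ((0%R, r) - (x, y) = ((- x)%R, (r - y)%R))%C.
  by apply: injective_projections => /=; ring.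
have n1 : (x, (r - y)%R) <> RtoC 0 by case; lra.
have n2 : ((- x)%R, (r - y)%R) <> RtoC 0 by case; lra.
rewrite (_ : (_ * _)%C = (Ci * RtoC (2 * x) / ((x, (r - y)%R) * ((- x)%R, (r - y)%R)))%C); last first.
  by rewrite -[(0, 1)]/Ci; field.
rewrite (_ : ((x, (r - y)%R) * ((- x)%R, (r - y)%R))%C = RtoC (- ((r - y) ^ 2 + x ^ 2))); last first.
  by apply: injective_projections => /=; ring.
move: q; set Q := (r - y) ^ 2 + x ^ 2 => q.
apply: injective_projections => /=; field; nra.
Qed.

Lemma pker_bound r0 phi0 k : 0 < r0 -> k < 1 -> exists C, forall r phi, 0 < r ->
  cos (phi - phi0) <= k -> cos (phi - (PI - phi0)) <= k ->
  [/\ pol r phi <> pol r0 phi0, pol r phi <> pol r0 (PI - phi0) &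
      Cmod (pker r0 phi0 (pol r phi)) <= C * kap 1 r].
Proof.
move=> h0 k1; case: (dist_pol_lb r0 phi0 k h0 k1) => c c0 Hc.
case: (dist_pol_lb r0 (PI - phi0) k h0 k1) => d d0 Hd.
exists (2 * r0 / (c * d)) => r phi r1 h1 h2.
have l1 := Hc r phi r1 h1; have l2 := Hd r phi r1 h2.
have n1 : pol r phi <> pol r0 phi0 by apply: Csub_diag_mod; nra.
have n2 : pol r phi <> pol r0 (PI - phi0) by apply: Csub_diag_mod; nra.
split=> //; rewrite /pker /pkap !Cmod_div; try exact: Csub_neq0.
rewrite kap1 // Cmod_R.
have b : Rabs (2 * r0 * cos phi0) <= 2 * r0.
  by rewrite Rabs_mult (Rabs_pos_eq (2 * r0)); [have := COS_bound phi0; split_Rabs; nra|lra].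
apply: Rle_trans (_ : 2 * r0 / (d * (1 + r)) / (c * (1 + r)) <= _).
  apply: Rmult_le_compat.
  - by apply: Rdiv_le_0_compat; [exact: Rabs_pos|nra].
  - by apply: Rlt_le; apply: Rinv_0_lt_compat; nra.
  - apply: Rmult_le_compat => //; first exact: Rabs_pos.
    + by apply: Rlt_le; apply: Rinv_0_lt_compat; nra.
    + by apply: Rinv_le_contravar => //; nra.
  - by apply: Rinv_le_contravar => //; nra.
rewrite (_ : _ / _ = 2 * r0 / (c * d) * / ((1 + r) ^ 2)); last by field; lra.
apply: Rmult_le_compat_l; first by apply: Rdiv_le_0_compat; nra.
by apply: Rinv_le_contravar; nra.
Qed.

Lemma pker_ii_pi2 r0 phi0 : 0 < r0 -> - (PI / 2) < phi0 < PI / 2 ->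
  cii (ray (pker r0 phi0) (PI / 2)) (0, - (PI + 2 * phi0)).
Proof.
move=> h0 hp; have c0 : 0 < cos phi0 by apply: cos_gt_0; lra.
have p : 0 < r0 * cos phi0 by nra.
apply: (cii_ext (fun r => (0, - (2 * (r0 * cos phi0) / ((r - r0 * sin phi0) ^ 2 + (r0 * cos phi0) ^ 2))))).
  by move=> r r1; rewrite pker_ray_pi2.
have tE : (0 - r0 * sin phi0) / (r0 * cos phi0) = - tan phi0.
  by rewrite /tan; field; lra.
move: p tE; set x := r0 * cos phi0; set y := r0 * sin phi0 => p tE.
split => /=.
  rewrite -[X in ii _ X](Rminus_diag 0).
  apply: (ii_primitive (fun=> 0)) => [r _|r _|e e0|e e0].
  - exact: (is_derive_const (V := R_NormedModule)).
  - exact: continuous_const.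
  - by exists 1; [lra|move=> r _; rewrite Rminus_diag Rabs_R0].
  - by exists 1; [lra|move=> r _; rewrite Rminus_diag Rabs_R0].
rewrite (_ : - (PI + 2 * phi0) = - PI - 2 * phi0); last by ring.
apply: (ii_primitive (fun r => - 2 * atan ((r - y) / x))) => [r r1|r r1|e e0|e e0].
- auto_derive => //; field.
  by have := pow2_ge_0 (r - y) => ?; repeat split; nra.
- apply: ex_derive_continuous; auto_derive; have := pow2_ge_0 (r - y); nra.
- have cf : continuous (fun r => - 2 * atan ((r - y) / x)) 0.
    by apply: ex_derive_continuous; auto_derive; nra.
  move/continuity_pt_filterlim/continuity_pt_locally: cf => /(_ (mkposreal e e0)) [d Hd].
  exists d; first exact: cond_pos.
  move=> r Hr; have := Hd r; rewrite tE atan_opp atan_tan //.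
  rewrite (_ : - 2 * - phi0 = 2 * phi0); last by ring.
  apply; rewrite /ball /= /AbsRing_ball /abs /minus /plus /opp /=; split_Rabs; lra.
- have e2 : 0 < e / 2 by lra.
  case: (atan_lim _ e2) => M M0 HM.
  have q0 : 0 < M * x + Rabs y + 1 by have := Rabs_pos y; nra.
  exists (/ (M * x + Rabs y + 1)); first exact: Rinv_0_lt_compat.
  rewrite Rinv_inv => r Hr.
  have : Rabs (atan ((r - y) / x) - PI / 2) < e / 2.
    by apply: HM; apply: (Rmult_lt_reg_r x) => //; rewrite /Rdiv Rmult_assoc Rinv_l; [have := Rle_abs y; lra|lra].
  by split_Rabs; lra.
Qed.

Lemma cos_le_of_abs x y : 0 <= y <= PI -> y <= Rabs x <= PI -> cos x <= cos y.
Proof.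
move=> hy hx; case: (Rle_lt_dec 0 x) => h.
- by rewrite Rabs_pos_eq // in hx; apply: cos_decr_1; lra.
- by rewrite Rabs_left // in hx; rewrite -(cos_neg x); apply: cos_decr_1; lra.
Qed.

Lemma pker_ii r0 phi0 phi1 : 0 < r0 -> Rabs phi0 < phi1 < PI / 2 ->
  cii (ray (pker r0 phi0) phi1) (0, - (PI + 2 * phi0)).
Proof.
move=> h0 hp; have hp0 : - phi1 < phi0 < phi1 by move: hp; split_Rabs; lra.
have p0 := PI_RGT_0.
pose hi := Rmin (PI - phi1) (PI / 2 + (PI / 2 - phi1)).
pose del := Rmin (phi1 - Rabs phi0) (PI / 2 - phi1).
have d0 : 0 < del by apply: Rmin_glb_lt; lra.
have d1 : del <= phi1 - Rabs phi0 by apply: Rmin_l.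
have d2 : del <= PI / 2 - phi1 by apply: Rmin_r.
have dp : del <= PI by have := Rabs_pos phi0; lra.
have k1 : cos del < 1 by rewrite -cos_0; apply: cos_decreasing_1; lra.
case: (pker_bound r0 phi0 (cos del) h0 k1) => C HC.
have ab := Rle_abs phi0; have ab' := Rle_abs (- phi0); rewrite Rabs_Ropp in ab'.
have HC' r phi : 0 < r -> phi1 <= phi <= PI / 2 ->
  [/\ pol r phi <> pol r0 phi0, pol r phi <> pol r0 (PI - phi0) &
      Cmod (pker r0 phi0 (pol r phi)) <= C * kap 1 r].
  move=> r1 hphi; apply: HC => //; apply: cos_le_of_abs; try lra.
  - by rewrite Rabs_pos_eq; lra.
  - by rewrite Rabs_left; lra.
pose U z := (True /\ z <> pol r0 (PI - phi0)) /\ z <> pol r0 phi0.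
have oU : copen U.
  apply: copen_and; last exact: copen_neq.
  apply: copen_and; last exact: copen_neq.
  by move=> x y _; exists (mkposreal 1 Rlt_0_1).
have hU : hol U (pker r0 phi0).
  by apply: hol_div_sub; apply: hol_pkap => z [].
have UU r phi : 0 < r -> Rabs phi0 < phi < PI - Rabs phi0 -> U (pol r phi).
  move=> r1 hphi; split; first split=> //; apply: pol_neq => //.
  - rewrite (_ : phi - (PI - phi0) = - (PI - phi0 - phi)); last by ring.
    by rewrite sin_neg; have := sin_gt_0 (PI - phi0 - phi) ltac:(lra) ltac:(lra); lra.
  - by have := sin_gt_0 (phi - phi0) ltac:(lra) ltac:(lra); lra.
have [l Hl] : exists l, cii (ray (pker r0 phi0) phi1) l.
  apply: (cii_ray_ex _ _ C 1) => [|r r1|r r1]; first lra.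
  - by apply: (hol_ccont U) => //; apply: UU; lra.
  - by case: (HC' r phi1 r1) => //; lra.
rewrite -(_ : l = (0, - (PI + 2 * phi0))) //.
apply: (ray_shift U (pker r0 phi0) (Rabs phi0) (PI - Rabs phi0) phi1 (PI / 2) 1 C) => //; try lra.
- by move=> r phi r1 hphi; case: (HC' r phi r1 hphi).
- by apply: pker_ii_pi2; lra.
Qed.

Lemma pol_conj r phi : Cconj (pol r phi) = pol r (- phi).
Proof. by rewrite /pol /Cconj /= cos_neg sin_neg; f_equal; ring. Qed.

Lemma expi_conj phi : Cconj (expi phi) = expi (- phi).
Proof. by rewrite /expi /Cconj /= cos_neg sin_neg. Qed.

Lemma pol_2PI r phi : pol r (phi + 2 * PI) = pol r phi.
Proof. by rewrite /pol cos_plus sin_plus cos_2PI sin_2PI; f_equal; ring. Qed.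

Lemma pker_ii_conj r0 phi0 phi1 : 0 < r0 -> Rabs phi0 < phi1 < PI / 2 ->
  cii (ray (pker r0 phi0) (- phi1)) (0, PI - 2 * phi0).
Proof.
move=> h0 hp; have p0 := PI_RGT_0.
have [k1 k2] : cii (ray (pker r0 (- phi0)) phi1) (0, - (PI + 2 * - phi0)).
  by apply: pker_ii => //; rewrite Rabs_Ropp.
have ab := Rle_abs phi0; have ab' := Rle_abs (- phi0); rewrite Rabs_Ropp in ab'.
have E r : 0 < r -> ray (pker r0 phi0) (- phi1) r = Cconj (ray (pker r0 (- phi0)) phi1 r).
  move=> r1; rewrite /ray Cmult_conj expi_conj; congr Cmult.
  have n1 : (pol r phi1 - pol r0 (PI - - phi0))%C <> 0%C.
    apply: Csub_neq0; apply: pol_neq => //.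
    rewrite (_ : phi1 - (PI - - phi0) = - (PI + phi0 - phi1)); last by ring.
    by rewrite sin_neg; have := sin_gt_0 (PI + phi0 - phi1) ltac:(lra) ltac:(lra); lra.
  have n2 : (pol r phi1 - pol r0 (- phi0))%C <> 0%C.
    apply: Csub_neq0; apply: pol_neq => //.
    by have := sin_gt_0 (phi1 - - phi0) ltac:(lra) ltac:(lra); lra.
  have E1 : pol r0 (PI - phi0) = pol r0 (- (PI - - phi0)).
    by rewrite -(pol_2PI r0 (- (PI - - phi0))); f_equal; ring.
  have E2 : pol r0 phi0 = pol r0 (- - phi0) by rewrite Ropp_involutive.
  have E3 : Cconj (RtoC (2 * r0 * cos phi0)) = RtoC (2 * r0 * cos phi0).
    by rewrite /Cconj /= Ropp_0.
  by rewrite /pker /pkap !Cdiv_conj // !Cminus_conj !pol_conj cos_neg E1 {1}E2 E3.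
apply: (cii_ext (fun r => Cconj (ray (pker r0 (- phi0)) phi1 r))).
  by move=> r r1; rewrite E.
split; first exact: k1.
have E' z : -1 * snd z = snd (Cconj z) by rewrite /Cconj [RHS]/=; ring.
have := @ii_scal R_CompleteNormedModule (-1) _ _ k2.
rewrite (_ : scal _ _ = snd (0%R, PI - 2 * phi0)); last by rewrite /scal /= /mult /=; ring.
by apply: ii_ext => r _; exact: E'.
Qed.

Lemma cauchy_formula U G th phi1 r0 phi0 a M l1 l2 : let s := pol r0 phi0 in
  copen U -> hol U G -> 0 < a <= 1 -> 0 < r0 -> Rabs phi0 < phi1 -> phi1 < th <= PI / 2 ->
  (forall r phi, 0 < r -> - th < phi < th -> U (pol r phi)) ->
  (forall r phi, 0 < r -> - phi1 <= phi <= phi1 -> Cmod (G (pol r phi)) <= M * ((1 + r) * kap a r)) ->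
  cii (ray (fun z => G z / (z - s))%C (- phi1)) l1 ->
  cii (ray (fun z => G z / (z - s))%C phi1) l2 ->
  (l1 - l2 = (0, 2 * PI)%R * G s)%C.
Proof.
move=> s oU hG ha h0 hp hth HU HM k1 k2; have p0 := PI_RGT_0.
have ab := Rle_abs phi0; have ab' := Rle_abs (- phi0); rewrite Rabs_Ropp in ab'.
pose H z := (G z + - G s * pkap r0 phi0 z)%C.
have cthl : - cos (th + phi1) < 1.
  have : cos PI < cos (th + phi1) by apply: cos_decreasing_1; have := Rabs_pos phi0; lra.
  rewrite cos_PI; lra.
case: (dist_pol_lb r0 (PI - phi0) _ h0 cthl) => c c0 Hc.
have lb r phi : 0 < r -> - th < phi < th -> c * (1 + r) <= Cmod (pol r phi - pol r0 (PI - phi0))%C.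
  move=> r1 hphi; apply: Hc => //.
  rewrite (_ : phi - (PI - phi0) = phi + phi0 - PI); last by ring.
  rewrite cos_minus cos_PI sin_PI.
  suff : cos (th + phi1) <= cos (phi + phi0) by lra.
  rewrite -(Rabs_pos_eq (th + phi1)); last by have := Rabs_pos phi0; lra.
  rewrite Rabs_pos_eq; last by have := Rabs_pos phi0; lra.
  rewrite -(Ropp_involutive phi) .
  case: (Rle_lt_dec 0 (- - phi + phi0)) => hs.
  - by apply: cos_decr_1; lra.
  - by rewrite -(cos_neg (- - phi + phi0)); apply: cos_decr_1; lra.
pose U' z := U z /\ z <> pol r0 (PI - phi0).
have oU' : copen U' by apply: copen_and => //; apply: copen_neq.
have hH : hol U' H.
  apply: hol_add; first by apply: hol_sub hG => z [].
  by apply: hol_mul; [exact: hol_const|apply: hol_pkap => z []].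
have UU r phi : 0 < r -> - th < phi < th -> U' (pol r phi).
  move=> r1 hphi; split; first exact: HU.
  by apply: Csub_diag_mod; have := lb r phi r1 hphi; nra.
have kE : pkap r0 phi0 s = 1%C.
  have nz : (s - pol r0 (PI - phi0))%C <> 0%C.
    by apply: Csub_neq0; apply: (proj2 (UU r0 phi0 h0 _)); lra.
  rewrite /pkap (_ : RtoC (2 * r0 * cos phi0) = (s - pol r0 (PI - phi0))%C).
    by field.
  rewrite /s /pol cos_minus sin_minus cos_PI sin_PI.
  by apply: injective_projections => /=; ring.
have Hs0 : H s = 0%C by rewrite /H kE; ring.
pose M' := Rabs M + Cmod (G s) * (2 * r0 / c).
have HM' r phi : 0 < r -> - phi1 <= phi <= phi1 -> Cmod (H (pol r phi)) <= M' * ((1 + r) * kap a r).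
  move=> r1 hphi; apply: Rle_trans (Cmod_triangle _ _) _.
  rewrite /M' Rmult_plus_distr_r; have kp := kap_gt0 a r r1.
  apply: Rplus_le_compat.
    apply: Rle_trans (HM _ _ r1 hphi) _; apply: Rmult_le_compat_r; last exact: Rle_abs.
    nra.
  rewrite Cmod_mult Cmod_opp Rmult_assoc; apply: Rmult_le_compat_l; first exact: Cmod_ge_0.
  have l := lb r phi r1 ltac:(lra).
  rewrite /pkap Cmod_div; last by apply: Csub_neq0; apply: (proj2 (UU r phi r1 _)); lra.
  have b : Cmod (RtoC (2 * r0 * cos phi0)) <= 2 * r0.
    rewrite Cmod_R Rabs_mult (Rabs_pos_eq (2 * r0)); last lra.
    by have := COS_bound phi0; split_Rabs; nra.
  apply: Rle_trans (_ : 2 * r0 / (c * (1 + r)) <= _).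
    apply: Rmult_le_compat => //; first exact: Cmod_ge_0.
    - by apply: Rlt_le; apply: Rinv_0_lt_compat; nra.
    - by apply: Rinv_le_contravar => //; nra.
  rewrite (_ : 2 * r0 / (c * (1 + r)) = 2 * r0 / c * / (1 + r)); last by field; lra.
  apply: Rmult_le_compat_l; first by apply: Rdiv_le_0_compat; lra.
  apply: Rle_trans (_ : (1 + r) * kap 1 r <= _); last first.
    by apply: Rmult_le_compat_l; [lra|exact: kap1_le].
  rewrite kap1 //; apply: (Rmult_le_reg_l (1 + r)); first lra.
  rewrite Rinv_r; last lra.
  rewrite -Rmult_assoc; apply: le_div; nra.
have K phi l m : cii (ray (fun z => G z / (z - s))%C phi) l -> cii (ray (pker r0 phi0) phi) m ->
    cii (ray (fun z => H z / (z - s))%C phi) (l + - G s * m)%C.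
  move=> kl km; have := cii_add _ _ _ _ kl (cii_mul (- G s)%C _ _ km).
  by apply: cii_ext => r _; rewrite /ray /H /pker -/s /Cdiv; ring.
have hp' : Rabs phi0 < phi1 < PI / 2 by lra.
have K2 := K _ _ _ k2 (pker_ii r0 phi0 phi1 h0 hp').
have K1 := K _ _ _ k1 (pker_ii_conj r0 phi0 phi1 h0 hp').
have := ray_shift_pole U' H (- th) th (- phi1) phi1 r0 phi0 a M' _ _ oU' hH
  (proj1 ha) h0 Hs0 ltac:(lra) ltac:(lra) ltac:(lra) ltac:(lra) ltac:(lra) UU HM' K1 K2.
move=> E.
rewrite (_ : l1 = (l1 + - G s * (0, PI - 2 * phi0)%R + G s * (0, PI - 2 * phi0)%R)%C); last by ring.
rewrite E; apply: injective_projections => /=; ring.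
Qed.

(** * Clifford algebra and intrinsic functions *)

HB.instance Definition _ := Monoid.isComLaw.Build R 0 Rplus
  (fun x y z => esym (Rplus_assoc x y z)) Rplus_comm Rplus_0_l.

Lemma Rsum_scal (I : finType) (P : pred I) (F : I -> R) a :
  \big[Rplus/0]_(i | P i) (a * F i) = a * \big[Rplus/0]_(i | P i) F i.
Proof.
symmetry; apply: (big_morph (fun x => a * x)); last by rewrite Rmult_0_r.
by move=> x y; rewrite Rmult_plus_distr_l.
Qed.

Lemma Rsum_ge0 (I : finType) (P : pred I) (F : I -> R) :
  (forall i, P i -> 0 <= F i) -> 0 <= \big[Rplus/0]_(i | P i) F i.
Proof. by move=> H; apply: (big_ind (fun x => 0 <= x)); [lra|move=> x y; lra|]. Qed.

Lemma Rsum_opp (I : finType) (P : pred I) (F : I -> R) :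
  \big[Rplus/0]_(i | P i) (- F i) = - \big[Rplus/0]_(i | P i) F i.
Proof.
symmetry; apply: (big_morph (fun x => - x)); last by rewrite Ropp_0.
by move=> x y; rewrite Ropp_plus_distr.
Qed.

Section Clifford.
Context {n : nat}.
Implicit Types (x y z s t J : Cl n) (A B C : {set 'I_n}).

Lemma symdiff_eq0 A B : (symdiff A B == set0) = (B == A).
Proof.
rewrite /symdiff setU_eq0 !setD_eq0 eqEsubset andbC //.
Qed.

Lemma symdiff0s A : symdiff set0 A = A.
Proof. by rewrite /symdiff set0D setD0 set0U. Qed.

Lemma symdiffs0 A : symdiff A set0 = A.
Proof. by rewrite /symdiff set0D setD0 setU0. Qed.

Lemma symdiffC A B : symdiff A B = symdiff B A.
Proof. by rewrite /symdiff setUC. Qed.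

Lemma cl_sign0s A : cl_sign set0 A = 1.
Proof.
rewrite /cl_sign (_ : [set p | _] = set0) ?cards0 //.
by apply/setP => p; rewrite !inE.
Qed.

Lemma cl_signs0 A : cl_sign A set0 = 1.
Proof.
rewrite /cl_sign (_ : [set p | _] = set0) ?cards0 //.
by apply/setP => p; rewrite !inE andbF.
Qed.

Lemma cl_addE x y A : cl_add x y A = x A + y A. Proof. by rewrite ffunE. Qed.
Lemma cl_oppE x A : cl_opp x A = - x A. Proof. by rewrite ffunE. Qed.
Lemma cl_scalE a x A : cl_scal a x A = a * x A. Proof. by rewrite ffunE. Qed.
Lemma cl_realE a A : cl_real n a A = if A == set0 then a else 0. Proof. by rewrite ffunE. Qed.

Lemma cl_mulE x y C : cl_mul x y C = \big[Rplus/0]_A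
  \big[Rplus/0]_(B | symdiff A B == C) (cl_sign A B * (x A * y B)).
Proof. by rewrite ffunE. Qed.

Lemma cl_mul_addl x y z : cl_mul (cl_add x y) z = cl_add (cl_mul x z) (cl_mul y z).
Proof.
apply/ffunP => C; rewrite cl_addE !cl_mulE -big_split; apply: eq_bigr => A _.
by rewrite -big_split; apply: eq_bigr => B _; rewrite cl_addE /=; ring.
Qed.

Lemma cl_mul_addr x y z : cl_mul x (cl_add y z) = cl_add (cl_mul x y) (cl_mul x z).
Proof.
apply/ffunP => C; rewrite cl_addE !cl_mulE -big_split; apply: eq_bigr => A _.
by rewrite -big_split; apply: eq_bigr => B _; rewrite cl_addE /=; ring.
Qed.

Lemma cl_mul_scall a x y : cl_mul (cl_scal a x) y = cl_scal a (cl_mul x y).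
Proof.
apply/ffunP => C; rewrite cl_scalE !cl_mulE -Rsum_scal; apply: eq_bigr => A _.
by rewrite -Rsum_scal; apply: eq_bigr => B _; rewrite cl_scalE; ring.
Qed.

Lemma cl_mul_scalr a x y : cl_mul x (cl_scal a y) = cl_scal a (cl_mul x y).
Proof.
apply/ffunP => C; rewrite cl_scalE !cl_mulE -Rsum_scal; apply: eq_bigr => A _.
by rewrite -Rsum_scal; apply: eq_bigr => B _; rewrite cl_scalE; ring.
Qed.

Lemma cl_mul_reall a x : cl_mul (cl_real n a) x = cl_scal a x.
Proof.
apply/ffunP => C; rewrite cl_scalE cl_mulE (bigD1 set0) //= [X in _ + X]big1 => [|A An0]; last first.
  by apply: big1 => B _; rewrite cl_realE (negbTE An0); ring.
rewrite (eq_bigl (fun B => B == C)) => [|B]; last by rewrite symdiff0s.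
by rewrite big_pred1_eq cl_realE eqxx cl_sign0s; ring.
Qed.

Lemma cl_mul_realr a x : cl_mul x (cl_real n a) = cl_scal a x.
Proof.
apply/ffunP => C; rewrite cl_scalE cl_mulE (bigD1 C) //= [X in _ + X]big1 => [|A AC].
  rewrite (bigD1 set0) /= ?symdiffs0 // [X in _ + X + _]big1 => [|B /andP[_ Bn0]].
    by rewrite cl_realE eqxx cl_signs0; ring.
  by rewrite cl_realE (negbTE Bn0); ring.
apply: big1 => B /eqP E; rewrite cl_realE; case: eqP => [B0|_]; last by ring.
by move: AC; rewrite -E B0 symdiffs0 eqxx.
Qed.

Lemma Sc_mul x y : Sc (cl_mul x y) = \big[Rplus/0]_A (cl_sign A A * (x A * y A)).
Proof.
rewrite /Sc cl_mulE; apply: eq_bigr => A _.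
by rewrite (eq_bigl (fun B => B == A)) ?big_pred1_eq // => B; rewrite symdiff_eq0.
Qed.

Lemma Sc_mulC x y : Sc (cl_mul x y) = Sc (cl_mul y x).
Proof. by rewrite !Sc_mul; apply: eq_bigr => A _; ring. Qed.

Lemma cl_conjK x : cl_conj (cl_conj x) = x.
Proof.
apply/ffunP => A; rewrite !ffunE -Rmult_assoc -Rpow_mult_distr.
have -> : -1 * -1 = 1 by ring.
by rewrite pow1 Rmult_1_l.
Qed.

Lemma cl_sign1 (i j : 'I_n) : cl_sign [set i] [set j] = if (j <= i)%N then -1 else 1.
Proof.
rewrite /cl_sign; case: leqP => ij.
  rewrite (_ : [set p | _] = [set (i, j)]) ?cards1 /=; first by ring.
  apply/setP => -[a b]; rewrite !inE /= xpair_eqE.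
  by case: eqP => // ->; case: eqP => // ->; rewrite ij.
rewrite (_ : [set p | _] = set0) ?cards0 //.
apply/setP => -[a b]; rewrite !inE /=.
by case: eqP => // ->; case: eqP => // ->; rewrite leqNgt ij.
Qed.

Section ImUnit.
Context {J : Cl n}.
Hypothesis HJ : im_unit J.

Lemma im_unit_sum : \big[Rplus/0]_A (J A) ^ 2 = 1.
Proof.
case: HJ => _ /(f_equal (fun r : R => r * r)); rewrite /cl_norm sqrt_sqrt; first by rewrite Rmult_1_l.
by apply: Rsum_ge0 => A _; apply: pow2_ge_0.
Qed.

Lemma im_unit0 : J set0 = 0.
Proof. by case: HJ => H _; apply: H; rewrite cards0. Qed.

Lemma im_unit_sqr : cl_mul J J = cl_real n (-1).
Proof.
case: (HJ) => H1 _; apply/ffunP => C; rewrite cl_realE; case: eqP => [->|/eqP Cn0].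
  transitivity (Ropp 1); last by ring.
  rewrite -/(Sc _) Sc_mul -im_unit_sum -Rsum_opp; apply: eq_bigr => A _.
  case: (altP (@cards1P _ A)) => [[i ->]|/eqP/H1 ->]; last by rewrite /=; ring.
  by rewrite cl_sign1 leqnn /=; ring.
rewrite cl_mulE; set S := (LHS).
suff : S = - S by lra.
rewrite /S -Rsum_opp (exchange_big_dep predT) //=; apply: eq_bigr => B _.
rewrite -Rsum_opp; apply: eq_big => [A|A /eqP E]; first by rewrite symdiffC.
case: (altP (@cards1P _ A)) => [[i Ai]|/eqP/H1 ->]; last by ring.
case: (altP (@cards1P _ B)) => [[j Bj]|/eqP/H1 ->]; last by ring.
have ij : i != j.
  apply/eqP => ij; move: Cn0; rewrite -E Ai Bj ij.
  by rewrite (_ : symdiff _ _ = set0) ?eqxx //; apply/eqP; rewrite symdiff_eq0.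
rewrite Ai Bj !cl_sign1; move: ij; rewrite -val_eqE /= neq_ltn.
by case: ltngtP => //= _ _; ring.
Qed.

Lemma im_unit_conj : cl_conj J = cl_opp J.
Proof.
case: HJ => H1 _; apply/ffunP => A; rewrite !ffunE.
case: (altP (@cards1P _ A)) => [[i ->]|/eqP/H1 ->]; last by ring.
by rewrite cards1 /=; ring.
Qed.

Lemma slice_ptE (x y : R) A : slice_pt J x y A = if A == set0 then x else y * J A.
Proof.
rewrite cl_addE cl_realE cl_scalE; case: eqP => [->|_]; last by ring.
by rewrite im_unit0; ring.
Qed.

Lemma Sc_slice (x y : R) : Sc (slice_pt J x y) = x.
Proof. by rewrite /Sc slice_ptE eqxx. Qed.

Lemma cl_norm_slice (x y : R) : cl_norm (slice_pt J x y) = Cmod (x, y).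
Proof.
rewrite /cl_norm /Cmod; congr sqrt; rewrite [fst _]/= [snd _]/=.
have := im_unit_sum; rewrite (bigD1 set0) //= im_unit0 => E.
rewrite (bigD1 set0) //= slice_ptE eqxx; congr (_ + _).
rewrite (_ : y * (y * 1) = y ^ 2 * 1); last by ring.
rewrite -[X in _ = _ * X]E (_ : 0 * (0 * 1) = 0) ?Rplus_0_l -?Rsum_scal; last by ring.
by apply: eq_bigr => A /negbTE An0; rewrite slice_ptE An0; ring.
Qed.

Lemma slice_inj (x y x' y' : R) : slice_pt J x y = slice_pt J x' y' -> x = x' /\ y = y'.
Proof.
move=> E; have ex : x = x' by rewrite -(Sc_slice x y) E Sc_slice.
split=> //; suff : y - y' = 0 by lra.
have : cl_norm (slice_pt J 0 (y - y')) = 0.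
  rewrite (_ : slice_pt _ _ _ = cl_add (slice_pt J x y) (cl_opp (slice_pt J x' y'))); last first.
    by apply/ffunP => A; rewrite slice_ptE [RHS]cl_addE cl_oppE !slice_ptE ex; case: eqP => _; ring.
  rewrite E /cl_norm big1 ?sqrt_0 // => A _; rewrite cl_addE cl_oppE /=; ring.
by rewrite cl_norm_slice => /Cmod_eq_0 [].
Qed.

Lemma slice_mul (x y x' y' : R) : cl_mul (slice_pt J x y) (slice_pt J x' y') =
  slice_pt J (x * x' - y * y') (x * y' + y * x').
Proof.
rewrite {1 2}/slice_pt cl_mul_addl !cl_mul_addr !cl_mul_reall !cl_mul_realr.
rewrite cl_mul_scall cl_mul_scalr im_unit_sqr.
by apply/ffunP => A; rewrite !(cl_addE, cl_scalE, cl_realE); case: eqP => _; ring.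
Qed.

Lemma slice_scal (r x y : R) : cl_scal r (slice_pt J x y) = slice_pt J (r * x) (r * y).
Proof. by apply/ffunP => A; rewrite !(cl_addE, cl_scalE, cl_realE); case: eqP => _; ring. Qed.

Lemma slice_opp (x y : R) : cl_opp (slice_pt J x y) = slice_pt J (- x) (- y).
Proof. by apply/ffunP => A; rewrite !(cl_addE, cl_oppE, cl_scalE, cl_realE); case: eqP => _; ring. Qed.

Lemma opp_im_unit : cl_opp J = slice_pt J 0 (-1).
Proof. by apply/ffunP => A; rewrite !(cl_addE, cl_oppE, cl_scalE, cl_realE); case: eqP => _; ring. Qed.

Lemma slice_real (x : R) : slice_pt J x 0 = cl_real n x.
Proof. by apply/ffunP => A; rewrite !(cl_addE, cl_oppE, cl_scalE, cl_realE); case: eqP => _; ring. Qed.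

Lemma paravector_slice (x y : R) : paravector (slice_pt J x y).
Proof.
case: HJ => H1 _ A cA; rewrite slice_ptE.
case: eqP cA => [->|_ cA]; first by rewrite cards0.
by rewrite H1 ?Rmult_0_r // => E; rewrite E in cA.
Qed.

End ImUnit.

Lemma im_unit_opp J : im_unit J -> im_unit (cl_opp J).
Proof.
move=> HJ; split=> [A cA|]; first by rewrite cl_oppE (proj1 HJ) // Ropp_0.
rewrite -(proj2 HJ) /cl_norm; congr sqrt; apply: eq_bigr => A _; rewrite cl_oppE; ring.
Qed.

Lemma im_unit_ex : (0 < n)%N -> exists J, im_unit J.
Proof.
move=> n0; pose i := Ordinal n0.
exists [ffun A : {set 'I_n} => if A == [set i] then 1 else 0]; split.
  by move=> A cA; rewrite ffunE; case: eqP => // E; case: cA; rewrite E cards1.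
rewrite /cl_norm (bigD1 [set i]) //= [X in _ + X]big1 => [|A /negbTE nA].
  by rewrite ffunE eqxx -[RHS]sqrt_1; congr sqrt; ring.
by rewrite ffunE nA; ring.
Qed.

Lemma paravector_ex s : (0 < n)%N -> paravector s ->
  exists J (x y : R), im_unit J /\ s = slice_pt J x y.
Proof.
move=> n0 ps.
pose v : Cl n := [ffun A => if A == set0 then 0 else s A].
have E0 : forall A, v A = if A == set0 then 0 else s A by move=> A; rewrite ffunE.
have q0 : 0 <= \big[Rplus/0]_A (v A) ^ 2 by apply: Rsum_ge0 => A _; apply: pow2_ge_0.
case: (Req_dec (cl_norm v) 0) => [v0|vn0].
  case: (im_unit_ex n0) => J HJ; exists J, (Sc s), 0; split => //.
  apply/ffunP => A; rewrite slice_ptE // Rmult_0_l; case: eqP => [->//|/eqP An0].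
  have S0 : \big[Rplus/0]_A (v A) ^ 2 = 0 by apply: sqrt_eq_0.
  move: S0; rewrite (bigD1 A) //= E0 (negbTE An0) => S0.
  move: S0; set S := (X in _ + X = _) => S0.
  have h : 0 <= S by apply: Rsum_ge0 => B _; apply: (pow2_ge_0 (v B)).
  have h2 := pow2_ge_0 (s A); have : s A * s A = 0 by rewrite /= in h2; nra.
  by case/Rmult_integral.
have v1 : 0 <= cl_norm v by exact: sqrt_pos.
have vp : 0 < cl_norm v by lra.
exists (cl_scal (/ cl_norm v) v), (Sc s), (cl_norm v); split; last first.
  apply/ffunP => A; rewrite !(cl_addE, cl_scalE, cl_realE) E0.
  by case: eqP => [->|_]; rewrite /Sc -Rmult_assoc Rinv_r // ?Rmult_0_r ?Rplus_0_r // Rmult_1_l Rplus_0_l.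
split=> [A cA|].
  rewrite cl_scalE E0; case: eqP => [_|/eqP An0]; first by ring.
  rewrite ps ?Rmult_0_r // ltn_neqAle card_gt0 An0 andbT eq_sym; exact/eqP.
rewrite {1}/cl_norm (eq_bigr (fun A => (/ cl_norm v) ^ 2 * (v A) ^ 2)) => [|A _]; last first.
  by rewrite cl_scalE; ring.
rewrite Rsum_scal sqrt_mult //; last exact: pow2_ge_0.
rewrite sqrt_pow2; last by apply: Rlt_le; apply: Rinv_0_lt_compat.
by rewrite -/(cl_norm v) Rinv_l.
Qed.

End Clifford.

(* D_th and the complement of its closure, in the coordinates of a slice C_J:
   |Arg| < th means cos th |z| < x *)
Definition dsec (th : R) (z : C) : Prop := cos th * Cmod z < Rabs (fst z).
Definition outer (om : R) (z : C) : Prop := Rabs (fst z) < cos om * Cmod z.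

Lemma continuity_2d_Cmod x y : continuity_2d_pt (fun u v => Cmod (u, v)) x y.
Proof.
move=> eps; have s0 : 0 < sqrt 2 by apply: sqrt_lt_R0; lra.
have e1 : 0 < eps / 2 by have := cond_pos eps; lra.
exists (mkposreal _ e1) => u v Hu Hv.
have t (a b : C) : Cmod a - Cmod b <= Cmod (a - b)%C.
  by have := Cmod_triangle (a - b)%C b; rewrite (_ : (a - b + b)%C = a); [lra|ring].
have b (a b' c d : R) : Rabs (a - c) < eps / 2 -> Rabs (b' - d) < eps / 2 -> Cmod ((a, b') - (c, d))%C < eps.
  move=> h1 h2; apply: Rle_lt_trans (Cmod_2Rmax _) _.
  have q : sqrt 2 < 2 by have := sqrt_less_alt 2 ltac:(lra); lra.
  have m : Rmax (Rabs (fst ((a, b') - (c, d))%C)) (Rabs (snd ((a, b') - (c, d))%C)) < eps / 2.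
    by apply: Rmax_lub_lt.
  have m0 : 0 <= Rmax (Rabs (fst ((a, b') - (c, d))%C)) (Rabs (snd ((a, b') - (c, d))%C)).
    by apply: Rle_trans (Rmax_l _ _); apply: Rabs_pos.
  nra.
have := b u v x y Hu Hv; have := b x y u v; rewrite !(Rabs_minus_sym x) !(Rabs_minus_sym y) => /(_ Hu Hv).
have := t (u, v) (x, y); have := t (x, y) (u, v).
by move=> *; apply: Rabs_def1; lra.
Qed.

Lemma copen_lt (f g : R -> R -> R) : (forall x y, continuity_2d_pt f x y) ->
  (forall x y, continuity_2d_pt g x y) -> copen (fun z => f (fst z) (snd z) < g (fst z) (snd z)).
Proof.
move=> cf cg x y /= H; have e0 : 0 < (g x y - f x y) / 2 by lra.
case: (cf x y (mkposreal _ e0)) => d1 H1; case: (cg x y (mkposreal _ e0)) => d2 H2.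
have m0 : 0 < Rmin d1 d2 by apply: Rmin_glb_lt; apply: cond_pos.
exists (mkposreal _ m0) => u v Hu Hv.
have := H1 u v (Rlt_le_trans _ _ _ Hu (Rmin_l _ _)) (Rlt_le_trans _ _ _ Hv (Rmin_l _ _)).
have := H2 u v (Rlt_le_trans _ _ _ Hu (Rmin_r _ _)) (Rlt_le_trans _ _ _ Hv (Rmin_r _ _)).
by move=> /= /Rabs_def2 ? /Rabs_def2 ?; lra.
Qed.

Lemma continuity_2d_abs1 x y : continuity_2d_pt (fun u _ => Rabs u) x y.
Proof. by apply: continuity_2d_fst; apply: continuous_Rabs. Qed.

Lemma copen_dsec th : copen (dsec th).
Proof.
move=> x y; rewrite /dsec; apply: (copen_lt (fun u v => cos th * Cmod (u, v)) (fun u _ => Rabs u)).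
- move=> u v; apply: continuity_2d_pt_mult; [exact: continuity_2d_pt_const|exact: continuity_2d_Cmod].
- exact: continuity_2d_abs1.
Qed.

Lemma copen_outer om : copen (outer om).
Proof.
move=> x y; rewrite /outer; apply: (copen_lt (fun u _ => Rabs u) (fun u v => cos om * Cmod (u, v))).
- exact: continuity_2d_abs1.
- move=> u v; apply: continuity_2d_pt_mult; [exact: continuity_2d_pt_const|exact: continuity_2d_Cmod].
Qed.

Lemma dsec_conj th z : dsec th z -> dsec th (Cconj z).
Proof. by rewrite /dsec Cmod_conj. Qed.

Lemma dsec_opp th z : dsec th z -> dsec th (- z)%C.
Proof. by rewrite /dsec Cmod_opp /= Rabs_Ropp. Qed.

Lemma dsec_neq0 th z : dsec th z -> z <> 0%C.
Proof. by move=> H E; move: H; rewrite E /dsec Cmod_0 /= Rabs_R0; lra. Qed.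

Lemma outer_neq0 th z : outer th z -> z <> 0%C.
Proof. by move=> H E; move: H; rewrite E /outer Cmod_0 /= Rabs_R0; lra. Qed.

Lemma dsec_pol th r phi : 0 < r -> 0 <= th <= PI / 2 -> Rabs phi < th -> dsec th (pol r phi).
Proof.
move=> r0 hth hp; rewrite /dsec Cmod_pol; last lra.
have p0 := PI_RGT_0.
have : cos th < cos phi.
  case: (Rle_lt_dec 0 phi) => h.
  - by rewrite Rabs_pos_eq // in hp; apply: cos_decreasing_1; lra.
  - by rewrite Rabs_left // in hp; rewrite -(cos_neg phi); apply: cos_decreasing_1; lra.
have : 0 <= cos th by apply: cos_ge_0; lra.
by move=> ? ?; rewrite /= Rabs_pos_eq; nra.
Qed.

Lemma outer_pol om r phi : 0 < r -> 0 <= om <= PI / 2 -> om < phi < PI - om -> outer om (pol r phi).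
Proof.
move=> r0 hom hp; rewrite /outer Cmod_pol; last lra.
have p0 := PI_RGT_0.
have h1 : cos phi < cos om by apply: cos_decreasing_1; lra.
have h2 : cos (PI - om) < cos phi by apply: cos_decreasing_1; lra.
move: h2; rewrite cos_minus cos_PI sin_PI => h2.
by rewrite /= Rabs_mult (Rabs_pos_eq r) ?(Rmult_comm (cos om)); [apply: Rmult_lt_compat_l => //; apply: Rabs_def1; lra|lra].
Qed.

Lemma outer_conj om z : outer om z -> outer om (Cconj z).
Proof. by rewrite /outer Cmod_conj. Qed.

Lemma Rabs_acos_lt q th : -1 <= q <= 1 -> 0 < th < PI / 2 -> Rabs (acos q) < th <-> cos th < q.
Proof.
move=> hq hth; have [a0 a1] := acos_bound q; have p0 := PI_RGT_0.
rewrite Rabs_pos_eq //; split=> H.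
- by rewrite -(cos_acos q) //; apply: cos_decreasing_1; lra.
- apply: Rnot_le_lt => h; have : cos (acos q) <= cos th by apply: cos_decr_1; lra.
  rewrite cos_acos //; lra.
Qed.

Definition sl {n} (J : Cl n) (z : C) : Cl n := slice_pt J (fst z) (snd z).

Section Slices.
Context {n : nat} (n_gt0 : (0 < n)%N).
Implicit Types (J s t : Cl n) (z : C).

Lemma cl_norm_sl J z : im_unit J -> cl_norm (sl J z) = Cmod z.
Proof. by move=> HJ; rewrite cl_norm_slice // -surjective_pairing. Qed.

Lemma sl_eq0 J z : im_unit J -> sl J z = cl_real n 0 -> z = 0%C.
Proof.
move=> HJ; rewrite -(slice_real (J := J)) => /(slice_inj HJ _ _ _ _) [h1 h2].
by rewrite (surjective_pairing z) h1 h2.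
Qed.

Lemma sector_sl J th z : 0 < th < PI / 2 -> im_unit J ->
  sector th (sl J z) <-> cos th * Cmod z < fst z.
Proof.
move=> hth HJ; have c0 : 0 < cos th by apply: cos_gt_0; lra.
have E : 0 < Cmod z -> (cos th < fst z / Cmod z <-> cos th * Cmod z < fst z).
  by move=> z0; symmetry; apply: Rlt_div_r.
have B : 0 < Cmod z -> -1 <= fst z / Cmod z <= 1.
  move=> z0; have /Rabs_le_between := fst_le_Cmod z => ?.
  by split; [apply: le_div|apply: div_le]; lra.
rewrite /sector /Arg cl_norm_sl // Sc_slice //; split.
- case=> _ nz; have z0 : 0 < Cmod z.
    by apply/Cmod_gt_0 => z0; apply: nz; rewrite z0 /sl slice_real.
  by rewrite Rabs_acos_lt ?E //; exact: B.
- move=> H; have zn : z <> 0%C by move=> z0; move: H; rewrite z0 Cmod_0 /=; lra.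
  have z0 : 0 < Cmod z by apply/Cmod_gt_0.
  split; [exact: paravector_slice|by move/(sl_eq0 _ _ HJ)|].
  by rewrite Rabs_acos_lt ?E //; exact: B.
Qed.

Lemma dsector_sl J th z : 0 < th < PI / 2 -> im_unit J -> dsector th (sl J z) <-> dsec th z.
Proof.
move=> hth HJ; rewrite /dsector /dsec.
have -> : cl_opp (sl J z) = sl J (- z)%C by rewrite /sl slice_opp.
have c0 : 0 < cos th by apply: cos_gt_0; lra.
rewrite !sector_sl // Cmod_opp /=; have := Cmod_ge_0 z => m0; have : 0 <= cos th * Cmod z by nra.
by split_Rabs; [split; [case; lra|right; lra]|split; [case; lra|left; lra]].
Qed.

Lemma dsector_all th x y : 0 < th < PI / 2 ->
  (forall J, im_unit J -> dsector th (slice_pt J x y)) <-> dsec th (x, y).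
Proof.
move=> hth; split=> [H|H J HJ].
- by case: (im_unit_ex n_gt0) => J HJ; apply/(dsector_sl J th (x, y)) => //; apply: H.
- by apply/(dsector_sl J th (x, y)).
Qed.

Lemma Sc_le_norm s : Rabs (Sc s) <= cl_norm s.
Proof.
rewrite -sqrt_Rsqr_abs /cl_norm; apply: sqrt_le_1_alt.
rewrite (bigD1 set0) //= /Rsqr Rmult_1_r -/(Sc s); set S := (X in _ + X).
have : 0 <= S by apply: Rsum_ge0 => A _; apply: (pow2_ge_0 (s A)).
lra.
Qed.

Lemma cl_norm_sqr s : cl_norm s * cl_norm s = \big[Rplus/0]_A (s A) ^ 2.
Proof. by rewrite /cl_norm sqrt_sqrt //; apply: Rsum_ge0 => A _; apply: pow2_ge_0. Qed.

Lemma cl_norm_triangle s t : cl_norm (cl_add s t) <= cl_norm s + cl_norm t.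
Proof.
pose P := \big[Rplus/0]_A (s A * t A).
have s0 : 0 <= cl_norm s by exact: sqrt_pos.
have t0 : 0 <= cl_norm t by exact: sqrt_pos.
have E (a b : R) : \big[Rplus/0]_A (a * s A + b * t A) ^ 2 =
    a ^ 2 * (cl_norm s * cl_norm s) + 2 * a * b * P + b ^ 2 * (cl_norm t * cl_norm t).
  rewrite !cl_norm_sqr /P -!Rsum_scal -!big_split /=; apply: eq_bigr => A _; ring.
have CS : P <= cl_norm s * cl_norm t.
  apply: Rnot_lt_le => lt; set S := cl_norm s in s0 E lt; set Tn := cl_norm t in t0 E lt.
  have q a b : 0 <= a ^ 2 * (S * S) + 2 * a * b * P + b ^ 2 * (Tn * Tn).
    by rewrite -E; apply: Rsum_ge0 => A _; apply: pow2_ge_0.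
  case: (Req_dec Tn 0) => [T0|Tn0].
    have := q 1 (- ((S * S + 1) / (2 * P))); rewrite T0.
    have P0 : 0 < P by nra.
    rewrite (_ : _ + _ = -1); first lra.
    by field; lra.
  have := q (Tn ^ 2) (- P).
  have T1 : 0 < Tn by lra.
  have : P * P * (Tn * Tn) > (S * Tn) * (S * Tn) * (Tn * Tn).
    apply: Rmult_gt_compat_r; first by nra.
    have : 0 <= S * Tn by nra.
    nra.
  nra.
apply: pow2_le_inv; first lra.
have := E 1 1; rewrite /= !Rmult_1_l !Rmult_1_r.
rewrite (eq_bigr (fun A => (cl_add s t A) ^ 2)) => [|A _]; last by rewrite cl_addE /=; ring.
rewrite -cl_norm_sqr; nra.
Qed.

Lemma outer_not_closure J om z : 0 < om < PI / 2 -> im_unit J -> outer om z ->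
  ~ pv_closure (@dsector n om) (sl J z).
Proof.
move=> hom HJ Oz [_ H].
have c0 : 0 < cos om by apply: cos_gt_0; lra.
have c1 := COS_bound om.
pose g := cos om * Cmod z - Rabs (fst z); have g0 : 0 < g by move: Oz; rewrite /outer /g; lra.
case: (H (g / 4)); first lra.
move=> t [Ht Hd].
have pt : paravector t.
  case: Ht => -[] // p _ _ A cA; have := p A cA; rewrite cl_oppE; lra.
case: (paravector_ex t n_gt0 pt) => J' [x [y [HJ' E]]].
move: Ht Hd; rewrite E => Ht Hd.
have {}Ht : dsec om (x, y) by apply/(dsector_sl J').
have h1 := Rle_lt_trans _ _ _ (Sc_le_norm _) Hd.
have h2 : Cmod z <= Cmod (x, y) + g / 4.
  rewrite -(cl_norm_sl J z) // -(cl_norm_sl J' (x, y)) //.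
  set t' := sl J' (x, y).
  have -> : sl J z = cl_add t' (cl_opp (cl_add t' (cl_opp (sl J z)))).
    by apply/ffunP => A; rewrite [RHS]cl_addE !cl_oppE cl_addE cl_oppE; rewrite Ropp_plus_distr Ropp_involutive -Rplus_assoc Rplus_opp_r Rplus_0_l.
  apply: Rle_trans (cl_norm_triangle _ _) _.
  have -> : cl_norm (cl_opp (cl_add t' (cl_opp (sl J z)))) = cl_norm (cl_add t' (cl_opp (sl J z))).
    by rewrite /cl_norm; congr sqrt; apply: eq_bigr => A _; rewrite cl_oppE /=; ring.
  by apply: Rplus_le_compat_l; apply: Rlt_le.
move: h1; rewrite /Sc cl_addE cl_oppE -!/(Sc _) !Sc_slice // => h1.
move: Ht; rewrite /dsec /= => Ht.
have : Rabs x <= Rabs (fst z) + g / 4 by move: h1; split_Rabs; lra.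
have := Rmult_le_compat_l _ _ _ (Rlt_le _ _ c0) h2.
have -> : cos om * Cmod z = g + Rabs (fst z) by rewrite /g; ring.
nra.
Qed.

Lemma intrinsic_hol th (f : Cl n -> Cl n) : 0 < th < PI / 2 -> intrinsic (@dsector n th) f ->
  exists g : C -> C, [/\ hol (dsec th) g,
    forall z, dsec th z -> g (Cconj z) = Cconj (g z) &
    forall J z, im_unit J -> dsec th z -> f (sl J z) = sl J (g z)].
Proof.
move=> hth [al [be [p [q H]]]].
exists (fun z => (al (fst z) (snd z), be (fst z) (snd z))); split.
- apply: (hol_intro _ _ (fun z => (p (fst z) (snd z), - q (fst z) (snd z)))); first exact: copen_dsec.
  move=> [x y] Hz; case: (H x y) => [J HJ|_ _ [d1 d2] [d3 d4] [c1 c2]]; first by apply/(dsector_sl J th (x, y)).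
  split; last by split => //=; apply: continuity_2d_pt_opp.
  by split => //=; rewrite Ropp_involutive.
- move=> [x y] Hz; case: (H x y) => [J HJ|_ [e1 e2] _ _ _]; first by apply/(dsector_sl J th (x, y)).
  by rewrite /Cconj /= e1 e2.
- move=> J [x y] HJ Hz; case: (H x y) => [J' HJ'|e _ _ _ _]; first by apply/(dsector_sl J' th (x, y)).
  exact: e.
Qed.

Lemma hol_intrinsic th (f : Cl n -> Cl n) g : 0 < th < PI / 2 -> hol (dsec th) g ->
  (forall z, dsec th z -> g (Cconj z) = Cconj (g z)) ->
  (forall J z, im_unit J -> dsec th z -> f (sl J z) = sl J (g z)) -> intrinsic (@dsector n th) f.
Proof.
move=> hth [D HD] Hc Hf.
exists (fun x y => fst (g (x, y))), (fun x y => snd (g (x, y))).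
exists (fun x y => fst (D (x, y))), (fun x y => - snd (D (x, y))) => x y /dsector_all Hz.
have {}Hz := Hz hth; case: (HD _ Hz) => -[d1 d2 d3 d4] _ [c1 c2]; split => //.
- by move=> J HJ; have := Hf J _ HJ Hz.
- by have := Hc _ Hz; rewrite /Cconj /= => ->.
- by split => //=; rewrite Ropp_involutive.
- by split => //; apply: continuity_2d_pt_opp.
Qed.

Lemma sup_norm_ub th (f : Cl n -> Cl n) M s : (forall t, dsector th t -> cl_norm (f t) <= M) ->
  dsector th s -> cl_norm (f s) <= sup_norm (@dsector n th) f.
Proof.
move=> HM Hs; rewrite /sup_norm; set E := (fun r => _).
case: (Lub_Rbar_correct E) => ub lub.
have h1 : Rbar_le (cl_norm (f s)) (Lub_Rbar E) by apply: ub; exists s.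
have h2 : Rbar_le (Lub_Rbar E) M by apply: lub => r [t Ht ->]; apply: HM.
by move: h1 h2; case: (Lub_Rbar E).
Qed.

End Slices.

(** * Hilbert modules and resolvents *)

Section Hilbert.
Context {n : nat} {V : right_hilbert_module n}.
Implicit Types (u v w : V) (a : R) (s : Cl n).

Definition ipr v w : R := Sc (ip v w).

Lemma ipr_addl u v w : ipr (plus u v) w = ipr u w + ipr v w.
Proof. by rewrite /ipr ip_addl /Sc cl_addE. Qed.

Lemma ipr_addr u v w : ipr w (plus u v) = ipr w u + ipr w v.
Proof. by rewrite /ipr ip_addr /Sc cl_addE. Qed.

Lemma ipr_scall a v w : ipr (scal a v) w = a * ipr v w.
Proof. by rewrite /ipr ip_scall /Sc cl_scalE. Qed.

Lemma ipr_scalr a v w : ipr v (scal a w) = a * ipr v w.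
Proof. by rewrite /ipr ip_scalr /Sc cl_scalE. Qed.

Lemma ipr_sym v w : ipr v w = ipr w v.
Proof. by rewrite /ipr -(ip_conj w v) /Sc ffunE cards0 mul0n /= Rmult_1_l. Qed.

Lemma ipr_oppl v w : ipr (opp v) w = - ipr v w.
Proof. by rewrite -scal_opp_one ipr_scall /opp /one /=; ring. Qed.

Lemma ipr_oppr v w : ipr w (opp v) = - ipr w v.
Proof. by rewrite ipr_sym ipr_oppl ipr_sym. Qed.

Lemma ipr_subl u v w : ipr (minus u v) w = ipr u w - ipr v w.
Proof. by rewrite /minus ipr_addl ipr_oppl. Qed.

Lemma ipr_subr u v w : ipr w (minus u v) = ipr w u - ipr w v.
Proof. by rewrite /minus ipr_addr ipr_oppr. Qed.

Lemma ipr_0l w : ipr zero w = 0.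
Proof. by rewrite -(scal_zero_l (zero : V)) ipr_scall /zero /=; ring. Qed.

Lemma ipr_0r w : ipr w zero = 0.
Proof. by rewrite ipr_sym ipr_0l. Qed.

Definition iprE := (ipr_addl, ipr_addr, ipr_scall, ipr_scalr, ipr_oppl, ipr_oppr,
  ipr_subl, ipr_subr, ipr_0l, ipr_0r).

Lemma ipr_norm v : ipr v v = norm v ^ 2.
Proof. exact: ip_norm. Qed.

Lemma ipr_ge0 v : 0 <= ipr v v.
Proof. by rewrite ipr_norm; apply: pow2_ge_0. Qed.

Lemma ipr_eq0 v : ipr v v = 0 -> v = zero.
Proof.
rewrite ipr_norm => H; apply: norm_eq_zero.
by have := norm_ge_0 v; rewrite /= in H; nra.
Qed.

Lemma ipr_ext v v' : (forall w, ipr v w = ipr v' w) -> v = v'.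
Proof.
move=> H; have : minus v v' = zero by apply: ipr_eq0; rewrite ipr_subl H; ring.
by move=> E; rewrite -(plus_zero_r v) -(plus_opp_l v') plus_assoc -/(minus v v') E plus_zero_l.
Qed.

Lemma ipr_CS v w : Rabs (ipr v w) <= norm v * norm w.
Proof.
have nv := norm_ge_0 v; have nw := norm_ge_0 w.
apply: pow2_le_inv; first by nra.
rewrite pow2_abs Rpow_mult_distr -!ipr_norm.
have q a b : 0 <= a ^ 2 * ipr v v - 2 * a * b * ipr v w + b ^ 2 * ipr w w.
  by have := ipr_ge0 (minus (scal a v) (scal b w)); rewrite !iprE (ipr_sym w v); lra.
have := ipr_ge0 v; have := ipr_ge0 w.
case=> [w0|w0] v0; last first.
  have := q 1 ((ipr v v + 1) / (2 * ipr v w)); rewrite -w0.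
  case: (Req_dec (ipr v w) 0) => [->|p0]; first by lra.
  rewrite (_ : _ + _ = -1); first lra.
  by field.
have := q (ipr w w) (ipr v w).
rewrite (_ : _ + _ = ipr w w * (ipr v v * ipr w w - ipr v w ^ 2)); last by ring.
by move=> h; have := Rmult_le_reg_l _ 0 _ w0; rewrite Rmult_0_r => /(_ _ h); lra.
Qed.

Lemma norm_le_ipr v M : 0 <= M -> (forall w, ipr v w <= M * norm w) -> norm v <= M.
Proof.
move=> M0 /(_ v); rewrite ipr_norm; have := norm_ge_0 v => n0 H.
by apply: Rnot_lt_le => lt; rewrite /= in H; nra.
Qed.

Lemma norm_sub v w : norm (minus v w) ^ 2 = norm v ^ 2 - 2 * ipr v w + norm w ^ 2.
Proof. by rewrite -!ipr_norm !iprE (ipr_sym w v); ring. Qed.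

Lemma norm_scalV a v : norm (scal a v) = Rabs a * norm v.
Proof.
apply: Rsqr_inj; [exact: norm_ge_0|by apply: Rmult_le_pos; [exact: Rabs_pos|exact: norm_ge_0]|].
have := ipr_norm (scal a v); rewrite !iprE ipr_norm /Rsqr /= => E.
have := pow2_abs a; rewrite /= => Ea; nra.
Qed.

Lemma norm_add_le v w : norm (plus v w) <= norm v + norm w.
Proof. exact: norm_triangle. Qed.

Lemma norm_sub_le v w : norm (minus v w) <= norm v + norm w.
Proof. by apply: Rle_trans (norm_triangle _ _) _; rewrite norm_opp; apply: Rle_refl. Qed.

Lemma cauchy_lim (u : nat -> V) :
  (forall eps, 0 < eps -> exists N, forall p q, (N <= p)%coq_nat -> (N <= q)%coq_nat ->
     norm (minus (u p) (u q)) < eps) ->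
  exists l, forall eps, 0 < eps -> exists N, forall p, (N <= p)%coq_nat -> norm (minus (u p) l) < eps.
Proof.
move=> H.
have [l Hl] : exists l, filterlim u eventually (locally l).
  apply/filterlim_locally_cauchy => eps.
  case: (H _ (cond_pos eps)) => N HN; exists (fun p => (N <= p)%coq_nat); split; first by exists N.
  by move=> p q Hp Hq; apply: norm_compat1; apply: HN.
exists l => eps e0.
have HP : locally l (fun y => norm (minus y l) < eps).
  by apply: locally_le_locally_norm; exists (mkposreal eps e0).
by case: (Hl _ HP) => N HN; exists N.
Qed.

Lemma riesz (F : V -> R) M : (forall u v, F (plus u v) = F u + F v) ->
  (forall a v, F (scal a v) = a * F v) -> (forall v, Rabs (F v) <= M * norm v) ->
  exists u, forall v, F v = ipr v u.
Proof.
move=> FD FZ FM.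
(* maximize the concave functional 2 F x - |x|^2 *)
pose P x := 2 * F x - norm x ^ 2.
have bP : bound (fun r => exists x, r = P x).
  exists (M ^ 2) => r [x ->]; have /Rabs_le_between := FM x; rewrite /P.
  by have := pow2_ge_0 (M - norm x); nra.
case: (completeness _ bP) => [|m [ub lub]]; first by exists (P zero), zero.
have Pm x : P x <= m by apply: ub; exists x.
have app k : exists x, m - / INR k.+1 < P x.
  apply: NNPP => H; have i0 : 0 < / INR k.+1 by apply: Rinv_0_lt_compat; apply: lt_0_INR; apply/ltP.
  suff : m <= m - / INR k.+1 by lra.
  apply: lub => r [x ->]; apply: Rnot_lt_le => lt; apply: H; by exists x.
have [x Hx] : exists x : nat -> V, forall k, m - / INR k.+1 < P (x k).
  exact: (functional_choice (fun k y => m - / INR k.+1 < P y)) app.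
have par (y z : V) : norm (minus y z) ^ 2 <= 2 * (m - P y) + 2 * (m - P z).
  have := Pm (scal (/ 2) (plus y z)); rewrite /P FZ FD -!ipr_norm !iprE (ipr_sym z y); nra.
have inv_small eps : 0 < eps -> exists N, forall p, (N <= p)%coq_nat -> / INR p.+1 < eps.
  move=> e0; case: (archimed_cor1 eps e0) => N [HN N0]; exists N => p Hp.
  apply: Rlt_trans HN; apply: Rinv_lt_contravar; last by apply: lt_INR; apply/ltP; rewrite ltnS; apply/leP.
  by apply: Rmult_lt_0_compat; apply: lt_0_INR => //; apply/ltP.
case: (cauchy_lim x) => [eps e0|u Hu].
  have e1 : 0 < eps ^ 2 / 4 by nra.
  case: (inv_small _ e1) => N HN; exists N => p q Hp Hq.
  have := par (x p) (x q); have := Hx p; have := Hx q; have := HN p Hp; have := HN q Hq => *.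
  apply: Rnot_le_lt => le; have : eps ^ 2 <= norm (minus (x p) (x q)) ^ 2 by apply: pow_incr; lra.
  lra.
have Fo (v : V) : F (opp v) = - F v by rewrite -scal_opp_one FZ /opp /one /=; ring.
have Pu : P u = m.
  apply: cond_eq => eps e0.
  have M0 : 0 <= M \/ forall v : V, norm v = 0.
    case: (Rle_lt_dec 0 M) => hM; [by left|right => v].
    by have := FM v; have := Rabs_pos (F v); have := norm_ge_0 v; nra.
  have cP (y : V) : norm (minus y u) < 1 -> Rabs (P y - P u) <= (2 * Rabs M + 2 * norm u + 1) * norm (minus y u).
    move=> h; have /Rabs_le_between := FM (minus y u); rewrite /minus FD Fo -/(minus y u) => f.
    have E : norm y ^ 2 - norm u ^ 2 = norm (minus y u) ^ 2 + 2 * ipr (minus y u) u.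
      by rewrite -!ipr_norm !iprE (ipr_sym u y); ring.
    have /Rabs_le_between := ipr_CS (minus y u) u.
    have := norm_ge_0 (minus y u); have := norm_ge_0 u; have := Rle_abs M => *.
    rewrite /P; apply: Rabs_le; split; nra.
  have K0 : 0 < 2 * Rabs M + 2 * norm u + 1 by have := Rabs_pos M; have := norm_ge_0 u; lra.
  have e2 : 0 < Rmin 1 (eps / 2 / (2 * Rabs M + 2 * norm u + 1)).
    by apply: Rmin_glb_lt; [lra|apply: Rdiv_lt_0_compat; lra].
  case: (Hu _ e2) => N1 H1; case: (inv_small (eps / 2)) => [|N2 H2]; first lra.
  pose p := (N1 + N2)%N.
  have p1 : (N1 <= p)%coq_nat by apply/leP; exact: leq_addr.
  have p2 : (N2 <= p)%coq_nat by apply/leP; exact: leq_addl.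
  have h1 := H1 p p1; have h2 := H2 p p2.
  have := cP (x p) (Rlt_le_trans _ _ _ h1 (Rmin_l _ _)).
  have : (2 * Rabs M + 2 * norm u + 1) * norm (minus (x p) u) < eps / 2.
    rewrite Rmult_comm; apply/Rlt_div_r => //; exact: Rlt_le_trans h1 (Rmin_r _ _).
  have := Hx p; have := Pm (x p); have := Pm u; move=> *; split_Rabs; lra.
exists u => v.
have q t : 0 <= norm v ^ 2 * t ^ 2 - 2 * t * (F v - ipr v u).
  have := Pm (plus u (scal t v)); rewrite -Pu /P FD FZ -!ipr_norm !iprE (ipr_sym u v); nra.
have n0 := pow2_ge_0 (norm v).
set d := F v - ipr v u in q; suff : d = 0 by rewrite /d; lra.
have := q (d / (norm v ^ 2 + 1)).
set N2 := norm v ^ 2 in n0 q *; move=> h.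
have E : N2 * (d / (N2 + 1)) ^ 2 - 2 * (d / (N2 + 1)) * d = - (d ^ 2) * ((N2 + 2) / (N2 + 1) ^ 2).
  by field; lra.
rewrite E in h; have c0 : 0 < (N2 + 2) / (N2 + 1) ^ 2 by apply: Rdiv_lt_0_compat; nra.
have : d ^ 2 <= 0 by nra.
by move=> *; nra.
Qed.

Definition adj (F : V -> V) (w : V) : V := iota (fun u => forall v, ipr (F v) w = ipr v u).

Lemma adjP (F : V -> V) M : (forall u v, F (plus u v) = plus (F u) (F v)) ->
  (forall a v, F (scal a v) = scal a (F v)) -> norm_le F M ->
  forall v w, ipr (F v) w = ipr v (adj F w).
Proof.
move=> FD FZ FM v w; rewrite /adj.
have H : exists! u, forall v, ipr (F v) w = ipr v u.
  case: (riesz (fun v => ipr (F v) w) (Rabs M * norm w)) => [*|*|x|u Hu].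
  - by rewrite FD ipr_addl.
  - by rewrite FZ ipr_scall.
  - apply: Rle_trans (ipr_CS _ _) _; have := FM x; have := norm_ge_0 w; have := norm_ge_0 x.
    have := Rle_abs M => *; have : norm (F x) <= Rabs M * norm x by nra.
    nra.
  exists u; split => // u' Hu'; apply: ipr_ext => x; by rewrite ipr_sym -Hu Hu' ipr_sym.
by have := iota_correct _ H v.
Qed.

Lemma rmul_adj v w s : ipr w (rmul v s) = ipr (rmul w (cl_conj s)) v.
Proof. by rewrite /ipr ip_rmulr ip_rmull cl_conjK Sc_mulC. Qed.

Lemma rmul_scal a v s : rmul (scal a v) s = scal a (rmul v s).
Proof. by rewrite -rmul_real -rmul_mul cl_mul_reall -rmul_real -rmul_mul cl_mul_realr. Qed.

Lemma rmul_cl_scal a v s : rmul v (cl_scal a s) = scal a (rmul v s).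
Proof. by rewrite -cl_mul_reall rmul_mul rmul_real rmul_scal. Qed.

Lemma rmul_opp v s : rmul (opp v) s = opp (rmul v s).
Proof. by rewrite -scal_opp_one rmul_scal scal_opp_one. Qed.

Lemma rmul_sub v w s : rmul (minus v w) s = minus (rmul v s) (rmul w s).
Proof. by rewrite /minus rmul_addl rmul_opp. Qed.

Lemma rmul_cl_opp v s : rmul v (cl_opp s) = opp (rmul v s).
Proof.
rewrite (_ : cl_opp s = cl_scal (-1) s); last by apply/ffunP => A; rewrite cl_oppE cl_scalE; ring.
by rewrite rmul_cl_scal -scal_opp_one.
Qed.

Lemma rmul_sl J z v : rmul v (sl J z) = plus (scal (fst z) v) (scal (snd z) (rmul v J)).
Proof. by rewrite /sl /slice_pt rmul_addr rmul_real rmul_cl_scal. Qed.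

Lemma rmulJJ J v : im_unit J -> rmul (rmul v J) J = opp v.
Proof. by move=> HJ; rewrite -rmul_mul im_unit_sqr // rmul_real -scal_opp_one. Qed.

Lemma ipr_rmulJ J v w : im_unit J -> ipr (rmul v J) w = - ipr v (rmul w J).
Proof. by move=> HJ; rewrite rmul_adj im_unit_conj // rmul_cl_opp ipr_oppl Ropp_involutive. Qed.

Lemma norm_rmulJ J v : im_unit J -> norm (rmul v J) = norm v.
Proof.
move=> HJ; apply: Rsqr_inj; try exact: norm_ge_0.
have := ipr_norm (rmul v J); rewrite ipr_rmulJ // rmulJJ // ipr_oppr ipr_norm /Rsqr /=; lra.
Qed.

End Hilbert.

Ltac vring := apply: ipr_ext => ?; rewrite !iprE; ring.

Class bisect {n : nat} {V : right_hilbert_module n} (T : operator V) (om : R) : Prop := Bisect {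
  bisect_n : (0 < n)%N;
  bisect_om : 0 < om < PI / 2;
  bisect_lin : right_linear T;
  bisect_spec : forall s, S_spectrum T s -> pv_closure (@dsector n om) s;
  bisect_bd : forall phi, om < phi < PI / 2 -> exists2 C : R, 0 <= C &
    forall s, paravector s -> s <> cl_real n 0 -> ~ dsector phi s ->
      norm_le (op_inv (op_IR T s)) (C / cl_norm s)
}.

Section Resolvent.
Context {n : nat} {V : right_hilbert_module n} {T : operator V} {om : R} {HT : bisect T om}.
Let n_gt0 := bisect_n (T := T).
Let om_bounds := bisect_om (T := T).
Let T_lin := bisect_lin (T := T).
Let T_spec := bisect_spec (T := T).

Lemma dom_add (u v : V) : dom T u -> dom T v -> dom T (plus u v).
Proof. by case: T_lin => _ H _ du dv; case: (H u v du dv). Qed.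

Lemma T_add (u v : V) : dom T u -> dom T v -> T (plus u v) = plus (T u) (T v).
Proof. by case: T_lin => _ H _ du dv; case: (H u v du dv). Qed.

Lemma dom_rmul (u : V) s : dom T u -> dom T (rmul u s).
Proof. by case: T_lin => _ _ H du; case: (H u s du). Qed.

Lemma T_rmul (u : V) s : dom T u -> T (rmul u s) = rmul (T u) s.
Proof. by case: T_lin => _ _ H du; case: (H u s du). Qed.

Lemma dom_scal a (u : V) : dom T u -> dom T (scal a u).
Proof. by rewrite -rmul_real; apply: dom_rmul. Qed.

Lemma T_scal a (u : V) : dom T u -> T (scal a u) = scal a (T u).
Proof. by rewrite -rmul_real => du; rewrite T_rmul // rmul_real. Qed.

Lemma dom_opp (u : V) : dom T u -> dom T (opp u).
Proof. by rewrite -scal_opp_one; apply: dom_scal. Qed.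

Lemma T_opp (u : V) : dom T u -> T (opp u) = opp (T u).
Proof. by rewrite -(scal_opp_one u) -(scal_opp_one (T u)); apply: T_scal. Qed.

Lemma dom_sub (u v : V) : dom T u -> dom T v -> dom T (minus u v).
Proof. by move=> du dv; apply: dom_add => //; apply: dom_opp. Qed.

Lemma T_sub (u v : V) : dom T u -> dom T v -> T (minus u v) = minus (T u) (T v).
Proof. by move=> du dv; rewrite T_add ?T_opp //; apply: dom_opp. Qed.

Definition Qz (z : C) (u : V) : V :=
  plus (minus (T (T u)) (scal (2 * fst z) (T u))) (scal (Cmod z ^ 2) u).

Definition isQ (z : C) (u v : V) := [/\ dom T u, dom T (T u) & Qz z u = v].

Definition Nz (z : C) (v : V) : V := iota (fun u => isQ z u v).

Lemma Nz_unique z v : outer om z -> exists! u, isQ z u v.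
Proof.
move=> Oz; case: (im_unit_ex n_gt0) => J HJ.
have [F _ [HF1 HF2]] : inv_in_B (op_Q T (sl J z)).
  apply: NNPP => H; apply: (outer_not_closure n_gt0 J om z) => //.
  apply: T_spec; split; first exact: paravector_slice.
  by case.
move: HF1 HF2; rewrite /op_Q /= Sc_slice // cl_norm_sl // -/(Qz z _) => HF1 HF2.
exists (F v); split; first by case: (HF1 v) => -[d1 d2] E; split.
by move=> u [d1 d2 <-]; apply: HF2.
Qed.

Lemma NzP z v : outer om z -> isQ z (Nz z v) v.
Proof. by move=> Oz; exact: (iota_correct _ (Nz_unique z v Oz)). Qed.

Lemma Nz_uniq z u v : outer om z -> isQ z u v -> Nz z v = u.
Proof.
move=> Oz Hu; case: (Nz_unique z v Oz) => u0 [_ H].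
by rewrite -(H _ Hu); symmetry; apply: H; apply: NzP.
Qed.

Lemma dom_Nz z v : outer om z -> dom T (Nz z v). Proof. by move=> /(NzP z v)[]. Qed.
Lemma dom_TNz z v : outer om z -> dom T (T (Nz z v)). Proof. by move=> /(NzP z v)[]. Qed.

Lemma TTNz z v : outer om z ->
  T (T (Nz z v)) = minus (plus v (scal (2 * fst z) (T (Nz z v)))) (scal (Cmod z ^ 2) (Nz z v)).
Proof.
move=> /(NzP z v)[_ _]; rewrite /Qz => E; apply: ipr_ext => w.
by have := f_equal (ipr^~ w) E; rewrite /= !iprE; lra.
Qed.

Lemma Nz_add z u v : outer om z -> Nz z (plus u v) = plus (Nz z u) (Nz z v).
Proof.
move=> Oz; case: (NzP z u Oz) => a1 a2 a3; case: (NzP z v Oz) => b1 b2 b3.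
set p := Nz z u in a1 a2 a3 *; set q := Nz z v in b1 b2 b3 *.
apply: Nz_uniq => //; split; rewrite ?T_add //; try exact: dom_add.
by rewrite -a3 -b3 /Qz !T_add //; vring.
Qed.

Lemma Nz_scal z a v : outer om z -> Nz z (scal a v) = scal a (Nz z v).
Proof.
move=> Oz; case: (NzP z v Oz) => b1 b2 b3; set q := Nz z v in b1 b2 b3 *.
apply: Nz_uniq => //; split; rewrite ?T_scal //; try exact: dom_scal.
by rewrite -b3 /Qz !T_scal //; vring.
Qed.

Lemma Nz_rmul z v s : outer om z -> Nz z (rmul v s) = rmul (Nz z v) s.
Proof.
move=> Oz; case: (NzP z v Oz) => b1 b2 b3; set q := Nz z v in b1 b2 b3 *.
apply: Nz_uniq => //; split; rewrite ?T_rmul //; try exact: dom_rmul.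
by rewrite -b3 /Qz !T_rmul // rmul_addl rmul_sub !rmul_scal.
Qed.

Lemma Nz_opp z v : outer om z -> Nz z (opp v) = opp (Nz z v).
Proof. by move=> Oz; rewrite -(scal_opp_one v) -(scal_opp_one (Nz z v)) Nz_scal. Qed.

Lemma Nz_sub z u v : outer om z -> Nz z (minus u v) = minus (Nz z u) (Nz z v).
Proof. by move=> Oz; rewrite /minus Nz_add ?Nz_opp. Qed.

Lemma T_Nz z u : outer om z -> dom T u -> T (Nz z u) = Nz z (T u).
Proof.
move=> Oz du; symmetry; have d1 := dom_Nz z u Oz; have d2 := dom_TNz z u Oz.
apply: Nz_uniq => //; split=> //.
- by rewrite TTNz //; apply: dom_sub; [apply: dom_add => //|]; apply: dom_scal.
- rewrite /Qz TTNz // T_sub ?T_add ?T_scal //; try exact: dom_scal.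
    by rewrite TTNz //; vring.
  by apply: dom_add => //; apply: dom_scal.
Qed.

Lemma dom_TTNz z u : outer om z -> dom T u -> dom T (T (T (Nz z u))).
Proof.
move=> Oz du; have d1 := dom_Nz z u Oz; have d2 := dom_TNz z u Oz.
by rewrite TTNz //; apply: dom_sub; [apply: dom_add => //|]; apply: dom_scal.
Qed.

Lemma NzC z s v : outer om z -> outer om s -> Nz z (Nz s v) = Nz s (Nz z v).
Proof.
move=> Oz Os; have d1 := dom_Nz z v Oz; have d2 := dom_TNz z v Oz.
have E1 : T (Nz s (Nz z v)) = Nz s (T (Nz z v)) by apply: T_Nz.
have E2 : T (Nz s (T (Nz z v))) = Nz s (T (T (Nz z v))) by apply: T_Nz.
apply: Nz_uniq => //; split; rewrite ?E1; try exact: dom_Nz.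
by rewrite /Qz E1 E2 -(Nz_scal s _ (T _)) // -(Nz_scal s _ (Nz z v)) // -Nz_sub // -Nz_add //; congr Nz; case: (NzP z v Oz) => _ _ E; exact: E.
Qed.

(* (I^R s - T)^-1 v = R1 z v + (R2 z v) J for s = x + J y, z = (x, y) *)
Definition R1 (z : C) (v : V) : V := minus (scal (fst z) (Nz z v)) (T (Nz z v)).
Definition R2 (z : C) (v : V) : V := scal (- snd z) (Nz z v).

Lemma R1_add z u v : outer om z -> R1 z (plus u v) = plus (R1 z u) (R1 z v).
Proof. by move=> Oz; rewrite /R1 Nz_add // T_add; [vring|exact: dom_Nz|exact: dom_Nz]. Qed.

Lemma R2_add z u v : outer om z -> R2 z (plus u v) = plus (R2 z u) (R2 z v).
Proof. by move=> Oz; rewrite /R2 Nz_add //; vring. Qed.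

Lemma R1_scal z a v : outer om z -> R1 z (scal a v) = scal a (R1 z v).
Proof. by move=> Oz; rewrite /R1 Nz_scal // T_scal; [vring|exact: dom_Nz]. Qed.

Lemma R2_scal z a v : outer om z -> R2 z (scal a v) = scal a (R2 z v).
Proof. by move=> Oz; rewrite /R2 Nz_scal //; vring. Qed.

Lemma R1_rmul z v s : outer om z -> R1 z (rmul v s) = rmul (R1 z v) s.
Proof. by move=> Oz; rewrite /R1 Nz_rmul // T_rmul ?rmul_sub ?rmul_scal //; exact: dom_Nz. Qed.

Lemma R2_rmul z v s : outer om z -> R2 z (rmul v s) = rmul (R2 z v) s.
Proof. by move=> Oz; rewrite /R2 Nz_rmul // rmul_scal. Qed.

Lemma dom_R1 z v : outer om z -> dom T (R1 z v).
Proof. by move=> Oz; apply: dom_sub; [apply: dom_scal; exact: dom_Nz|exact: dom_TNz]. Qed.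

Lemma dom_R2 z v : outer om z -> dom T (R2 z v).
Proof. by move=> Oz; apply: dom_scal; exact: dom_Nz. Qed.

(* conj z and z have the same Q_z *)
Lemma Nz_conj z v : Nz (Cconj z) v = Nz z v.
Proof. by rewrite /Nz /isQ /Qz Cmod_conj. Qed.

Lemma R1_conj z v : R1 (Cconj z) v = R1 z v.
Proof. by rewrite /R1 Nz_conj. Qed.

Lemma R2_conj z v : R2 (Cconj z) v = opp (R2 z v).
Proof. by rewrite /R2 Nz_conj /=; vring. Qed.

Lemma TR z v : outer om z ->
  T (R1 z v) = minus (minus (scal (fst z) (R1 z v)) (scal (snd z) (R2 z v))) v /\
  T (R2 z v) = plus (scal (fst z) (R2 z v)) (scal (snd z) (R1 z v)).
Proof.
move=> Oz; have d1 := dom_Nz z v Oz; have d2 := dom_TNz z v Oz; split.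
- rewrite /R1 T_sub ?T_scal ?TTNz //; try exact: dom_scal.
  rewrite /R2 Cmod_sqr; vring.
- rewrite /R2 T_scal //; rewrite /R1; vring.
Qed.

Lemma op_inv_IR J z v : im_unit J -> outer om z ->
  op_inv (op_IR T (sl J z)) v = plus (R1 z v) (rmul (R2 z v) J).
Proof.
move=> HJ Oz; rewrite /op_inv /op_IR /=.
set P := fun u : V => _; set u0 := plus _ _.
have P0 : P u0.
  case: (TR z v Oz) => e1 e2; have d1 := dom_R1 z v Oz; have d2 := dom_R2 z v Oz.
  split; first by apply: dom_add => //; apply: dom_rmul.
  rewrite rmul_sl /u0 T_add ?T_rmul //; last exact: dom_rmul.
  rewrite e1 e2 /R1 /R2 !(rmul_addl, rmul_scal, rmul_opp, rmul_sub) rmulJJ //.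
  vring.
suff U u : P u -> u = u0.
  have E : exists! u, P u by exists u0; split => // u /U.
  by apply: U; exact: (iota_correct _ E).
case=> du Eu.
(* T maps the difference of two solutions d to d s, hence Q_s(T) d = 0 *)
pose d := minus u u0; case: P0 => du0 Eu0.
have dd : dom T d by apply: dom_sub.
have Td : T d = rmul d (sl J z).
  rewrite /d T_sub // rmul_sub; apply: ipr_ext => w.
  have := f_equal (ipr^~ w) Eu; have := f_equal (ipr^~ w) Eu0; rewrite /= !iprE; lra.
have Q0 (x : V) : dom T x -> T x = rmul x (sl J z) -> Nz z zero = x.
  move=> {dd Td} dd Td.
  apply: Nz_uniq => //; split => //; first by rewrite Td; apply: dom_rmul.
  rewrite /Qz Td T_rmul // Td !rmul_sl !(rmul_addl, rmul_scal) rmulJJ // Cmod_sqr.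
  vring.
move: Q0; have -> : Nz z zero = zero by rewrite -(scal_zero_l (zero : V)) Nz_scal // !scal_zero_l.
move=> /(_ d dd Td) d0; apply: ipr_ext => w; have := f_equal (ipr^~ w) d0.
by rewrite /d /= !iprE; lra.
Qed.

Section Products.
Variables (z s : C) (v : V).
Hypotheses (Oz : outer om z) (Os : outer om s).
Let e0 := Nz z (Nz s v).
Let e1 := T e0.
Let e2 := T e1.
Let e3 := T e2.

Let NsE : Nz s v = plus (minus e2 (scal (2 * fst z) e1)) (scal (Cmod z ^ 2) e0).
Proof. by case: (NzP z (Nz s v) Oz) => _ _ E; exact: esym E. Qed.

Let de0 : dom T e0. Proof. exact: dom_Nz. Qed.
Let de1 : dom T e1. Proof. exact: dom_TNz. Qed.
Let de2 : dom T e2. Proof. by apply: dom_TTNz => //; exact: dom_Nz. Qed.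

Let TNsE : T (Nz s v) = plus (minus e3 (scal (2 * fst z) e2)) (scal (Cmod z ^ 2) e1).
Proof. by rewrite NsE T_add ?T_sub ?T_scal //; try exact: dom_scal; apply: dom_sub => //; exact: dom_scal. Qed.

Let NzE : Nz z v = plus (minus e2 (scal (2 * fst s) e1)) (scal (Cmod s ^ 2) e0).
Proof. by rewrite /e2 /e1 /e0 NzC //; case: (NzP s (Nz z v) Os) => _ _ E; exact: esym E. Qed.

Let TNzE : T (Nz z v) = plus (minus e3 (scal (2 * fst s) e2)) (scal (Cmod s ^ 2) e1).
Proof. by rewrite NzE T_add ?T_sub ?T_scal //; try exact: dom_scal; apply: dom_sub => //; exact: dom_scal. Qed.

Let NR1 : Nz z (R1 s v) = minus (scal (fst s) e0) e1.
Proof. by rewrite /R1 Nz_sub // Nz_scal // -T_Nz //; exact: dom_Nz. Qed.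

Let NR2 : Nz z (R2 s v) = scal (- snd s) e0.
Proof. by rewrite /R2 Nz_scal. Qed.

Let TNR1 : T (Nz z (R1 s v)) = minus (scal (fst s) e1) e2.
Proof. by rewrite NR1 T_sub ?T_scal //; exact: dom_scal. Qed.

Let TNR2 : T (Nz z (R2 s v)) = scal (- snd s) e1.
Proof. by rewrite NR2 T_scal. Qed.

(* R(s) - R(z) = (z - s) R(z) R(s) *)
Lemma resolvent_identity :
  minus (R1 s v) (R1 z v) = minus
    (scal (fst z - fst s) (minus (R1 z (R1 s v)) (R2 z (R2 s v))))
    (scal (snd z - snd s) (plus (R1 z (R2 s v)) (R2 z (R1 s v)))) /\
  minus (R2 s v) (R2 z v) = plus
    (scal (fst z - fst s) (plus (R1 z (R2 s v)) (R2 z (R1 s v))))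
    (scal (snd z - snd s) (minus (R1 z (R1 s v)) (R2 z (R2 s v)))).
Proof.
have A1 u : R1 z u = minus (scal (fst z) (Nz z u)) (T (Nz z u)) by [].
have A2 u : R2 z u = scal (- snd z) (Nz z u) by [].
rewrite !A1 !A2 TNR1 TNR2 NR1 NR2 /R1 /R2 TNsE NsE TNzE NzE !Cmod_sqr.
by split; vring.
Qed.

(* N(z) R(s) = (R(s) + T N(z) + (s - 2 Re z) N(z)) / ((s - z) (s - conj z)) *)
Lemma Nz_R : let q := ((s - z) * (s - Cconj z))%C in
  minus (scal (fst q) (Nz z (R1 s v))) (scal (snd q) (Nz z (R2 s v))) =
    plus (R1 s v) (plus (T (Nz z v)) (scal (fst s - 2 * fst z) (Nz z v))) /\
  plus (scal (fst q) (Nz z (R2 s v))) (scal (snd q) (Nz z (R1 s v))) =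
    plus (R2 s v) (scal (snd s) (Nz z v)).
Proof.
rewrite /= NR1 NR2 /R1 /R2 TNsE NsE TNzE NzE !Cmod_sqr.
by split; vring.
Qed.

(* T N(z) R(s) = (s R(s) + s T N(z) - |z|^2 N(z)) / ((s - z) (s - conj z)) *)
Lemma TNz_R : let q := ((s - z) * (s - Cconj z))%C in
  minus (scal (fst q) (T (Nz z (R1 s v)))) (scal (snd q) (T (Nz z (R2 s v)))) =
    plus (minus (scal (fst s) (R1 s v)) (scal (snd s) (R2 s v)))
      (minus (scal (fst s) (T (Nz z v))) (scal (Cmod z ^ 2) (Nz z v))) /\
  plus (scal (fst q) (T (Nz z (R2 s v)))) (scal (snd q) (T (Nz z (R1 s v)))) =
    plus (plus (scal (fst s) (R2 s v)) (scal (snd s) (R1 s v))) (scal (snd s) (T (Nz z v))).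
Proof.
rewrite Cmod_sqr /= TNR1 TNR2 /R1 /R2 TNsE NsE TNzE NzE !Cmod_sqr.
by split; vring.
Qed.

End Products.

End Resolvent.

Arguments Nz {n V} T z v.
Arguments R1 {n V} T z v.
Arguments R2 {n V} T z v.

Lemma is_derive_caratheodory (f g : R -> R) x :
  locally x (fun y => f y - f x = (y - x) * g y) -> continuous g x -> is_derive f x (g x).
Proof.
move=> [d Hd] /continuity_pt_filterlim/continuity_pt_locally cg.
apply/is_derive_Reals => eps e0; case: (cg (mkposreal eps e0)) => d' Hd'.
have m0 : 0 < Rmin d d' by apply: Rmin_glb_lt; apply: cond_pos.
exists (mkposreal _ m0) => h hn0 /= hh.
have e1 : Rabs (x + h - x) < d by rewrite (_ : x + h - x = h); [exact: Rlt_le_trans hh (Rmin_l _ _)|ring].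
have e2 : Rabs (x + h - x) < d' by rewrite (_ : x + h - x = h); [exact: Rlt_le_trans hh (Rmin_r _ _)|ring].
have := Hd (x + h) e1; have := Hd' (x + h) e2 => /= h1 ->.
by rewrite (_ : (x + h - x) * g (x + h) / h = g (x + h)) //; field.
Qed.

Section VContinuity.
Context {n : nat} {V : right_hilbert_module n}.
Implicit Types (f : C -> V) (w : V).

Definition vcont f (z : C) := forall eps, 0 < eps -> exists2 d, 0 < d &
  forall z', Cmod (z' - z)%C < d -> norm (minus (f z') (f z)) < eps.

Lemma Cmod_lt_box (a b : C) d : Rabs (fst a - fst b) < d / 2 -> Rabs (snd a - snd b) < d / 2 ->
  Cmod (a - b)%C < d.
Proof.
move=> h1 h2; apply: Rle_lt_trans (Cmod_2Rmax _) _.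
have q : sqrt 2 < 2 by have := sqrt_less_alt 2 ltac:(lra); lra.
have m : Rmax (Rabs (fst (a - b)%C)) (Rabs (snd (a - b)%C)) < d / 2 by apply: Rmax_lub_lt.
have m0 : 0 <= Rmax (Rabs (fst (a - b)%C)) (Rabs (snd (a - b)%C)).
  by apply: Rle_trans (Rmax_l _ _); apply: Rabs_pos.
have := sqrt_pos 2; nra.
Qed.

Lemma vcont_ipr f w x y : vcont f (x, y) -> continuity_2d_pt (fun u v => ipr (f (u, v)) w) x y.
Proof.
move=> cf eps; have K0 : 0 < norm w + 1 by have := norm_ge_0 w; lra.
have e1 : 0 < eps / (norm w + 1) by apply: Rdiv_lt_0_compat; [exact: cond_pos|].
case: (cf _ e1) => d d0 Hd; have d2 : 0 < d / 2 by lra.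
exists (mkposreal _ d2) => u v /= Hu Hv; rewrite -ipr_subl.
apply: Rle_lt_trans (ipr_CS _ _) _.
have h := Hd (u, v) (Cmod_lt_box (u, v) (x, y) d Hu Hv).
have n0 := norm_ge_0 w; have n1 := norm_ge_0 (minus (f (u, v)) (f (x, y))).
apply: Rle_lt_trans (_ : norm (minus (f (u, v)) (f (x, y))) * (norm w + 1) < _); first by nra.
apply/(Rlt_div_r _ _ _ K0) => //.
Qed.

Lemma vcont_add f g z : vcont f z -> vcont g z -> vcont (fun s => plus (f s) (g s)) z.
Proof.
move=> cf cg eps e0; have e2 : 0 < eps / 2 by lra.
case: (cf _ e2) => d1 d10 H1; case: (cg _ e2) => d2 d20 H2.
exists (Rmin d1 d2); first exact: Rmin_glb_lt.
move=> s Hs; have h1 := H1 s (Rlt_le_trans _ _ _ Hs (Rmin_l _ _)).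
have h2 := H2 s (Rlt_le_trans _ _ _ Hs (Rmin_r _ _)).
rewrite (_ : minus _ _ = plus (minus (f s) (f z)) (minus (g s) (g z))); last by vring.
by apply: Rle_lt_trans (norm_triangle _ _) _; lra.
Qed.

Lemma vcont_const w z : vcont (fun _ => w) z.
Proof.
move=> eps e0; exists 1; first lra.
move=> s _; rewrite (_ : minus w w = zero) ?norm_zero //; vring.
Qed.

End VContinuity.

Section ResolventAnalysis.
Context {n : nat} {V : right_hilbert_module n} {T : operator V} {om : R} {HT : bisect T om}.
Local Notation Nz := (Nz T).
Local Notation R1 := (R1 T).
Local Notation R2 := (R2 T).
Let om_bounds := bisect_om (T := T).

Definition cone (phi : R) (z : C) := z <> 0%C /\ Rabs (fst z) <= cos phi * Cmod z.

Lemma cone_outer phi z : om < phi < PI / 2 -> cone phi z -> outer om z.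
Proof.
move=> hp [z0 hz]; rewrite /outer; have m0 : 0 < Cmod z by apply/Cmod_gt_0.
have : cos phi < cos om by apply: cos_decreasing_1; have := om_bounds; lra.
by nra.
Qed.

Lemma R_bound phi : om < phi < PI / 2 -> exists2 K, 0 <= K & forall z (v : V), cone phi z ->
  norm (R1 z v) <= K / Cmod z * norm v /\ norm (R2 z v) <= K / Cmod z * norm v.
Proof.
move=> hp; case: (bisect_bd (T := T) phi hp) => K K0 HK; exists K => // z v cz.
have Oz := cone_outer phi z hp cz; case: (cz) => z0 hz.
case: (im_unit_ex (bisect_n (T := T))) => J HJ.
have b J' : im_unit J' -> norm (plus (R1 z v) (rmul (R2 z v) J')) <= K / Cmod z * norm v.
  move=> HJ'; rewrite -(op_inv_IR (om := om)) // -(cl_norm_sl J') //; apply: HK.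
  - exact: paravector_slice.
  - by move=> /(sl_eq0 _ _ HJ').
  - rewrite dsector_sl //; last by have := om_bounds; lra.
    by rewrite /dsec; lra.
have h1 := b J HJ; have h2 := b _ (im_unit_opp _ HJ); rewrite rmul_cl_opp in h2.
split.
- rewrite (_ : R1 z v = scal (/ 2) (plus (plus (R1 z v) (rmul (R2 z v) J)) (plus (R1 z v) (opp (rmul (R2 z v) J))))).
    rewrite norm_scalV Rabs_pos_eq; last lra.
    by have := norm_add_le (plus (R1 z v) (rmul (R2 z v) J)) (plus (R1 z v) (opp (rmul (R2 z v) J))); lra.
  by apply: ipr_ext => w; rewrite !iprE; field.
- rewrite -(norm_rmulJ J) // (_ : rmul (R2 z v) J = scal (/ 2) (minus (plus (R1 z v) (rmul (R2 z v) J)) (plus (R1 z v) (opp (rmul (R2 z v) J))))).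
    rewrite norm_scalV Rabs_pos_eq; last lra.
    by have := norm_sub_le (plus (R1 z v) (rmul (R2 z v) J)) (plus (R1 z v) (opp (rmul (R2 z v) J))); lra.
  by apply: ipr_ext => w; rewrite !iprE; field.
Qed.

Lemma R_lip phi : om < phi < PI / 2 -> exists2 K, 0 <= K & forall z s (v : V), cone phi z -> cone phi s ->
  norm (minus (R1 s v) (R1 z v)) <= Cmod (s - z)%C * (K / (Cmod z * Cmod s)) * norm v /\
  norm (minus (R2 s v) (R2 z v)) <= Cmod (s - z)%C * (K / (Cmod z * Cmod s)) * norm v.
Proof.
move=> hp; case: (R_bound phi hp) => K K0 HK; exists (4 * K ^ 2); first by nra.
move=> z s v cz cs; have Oz := cone_outer phi z hp cz; have Os := cone_outer phi s hp cs.
have z0 : 0 < Cmod z by apply/Cmod_gt_0; case: cz.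
have s0 : 0 < Cmod s by apply/Cmod_gt_0; case: cs.
case: (HK s v cs) => s1 s2.
pose B := K / Cmod z * (K / Cmod s * norm v).
have k1 : 0 <= K / Cmod z by apply: Rdiv_le_0_compat.
have mono u : norm u <= K / Cmod s * norm v -> norm (R1 z u) <= B /\ norm (R2 z u) <= B.
  move=> hu; case: (HK z u cz) => a b; rewrite /B; split.
  - by apply: Rle_trans a _; apply: Rmult_le_compat_l.
  - by apply: Rle_trans b _; apply: Rmult_le_compat_l.
case: (mono _ s1) => a11 a21; case: (mono _ s2) => a12 a22.
have B0 : 0 <= B by apply: Rle_trans a11; apply: norm_ge_0.
have E : Cmod (s - z)%C * (4 * K ^ 2 / (Cmod z * Cmod s)) * norm v = 4 * (Cmod (s - z)%C * B).
  by rewrite /B; field; lra.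
rewrite E; case: (resolvent_identity z s v Oz Os) => -> ->.
have f1 : Rabs (fst z - fst s) <= Cmod (s - z)%C.
  by rewrite Rabs_minus_sym; apply: (fst_le_Cmod (s - z)%C).
have f2 : Rabs (snd z - snd s) <= Cmod (s - z)%C.
  by rewrite Rabs_minus_sym; apply: (snd_le_Cmod (s - z)%C).
have plus_le (u u' : V) c d : norm u <= c -> norm u' <= d -> norm (plus u u') <= c + d.
  by move=> *; apply: Rle_trans (norm_triangle _ _) _; lra.
have minus_le (u u' : V) c d : norm u <= c -> norm u' <= d -> norm (minus u u') <= c + d.
  by move=> *; apply: plus_le => //; rewrite norm_opp.
have ts a (u : V) c : Rabs a <= Cmod (s - z)%C -> norm u <= c -> norm (scal a u) <= Cmod (s - z)%C * c.
  move=> ha hu; rewrite norm_scalV; apply: Rmult_le_compat => //; [exact: Rabs_pos|exact: norm_ge_0].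
rewrite (_ : 4 * (Cmod (s - z)%C * B) = Cmod (s - z)%C * (B + B) + Cmod (s - z)%C * (B + B)); last by ring.
split.
- by apply: (minus_le); apply: ts => //; [exact: (minus_le)|exact: (plus_le)].
- by apply: (plus_le); apply: ts => //; [exact: (plus_le)|exact: (minus_le)].
Qed.

Lemma outer_cone z : outer om z -> exists2 phi, om < phi < PI / 2 & outer phi z.
Proof.
move=> Oz; have hom := om_bounds; have z0 : 0 < Cmod z by apply/Cmod_gt_0; apply: outer_neq0 Oz.
have p0 := PI_RGT_0; have c0 : 0 < cos om by apply: cos_gt_0; lra.
have c1 := COS_bound om.
pose t := Rabs (fst z) / Cmod z.
have t0 : 0 <= t by apply: Rdiv_le_0_compat => //; exact: Rabs_pos.
have t1 : t < cos om by apply: div_lt.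
pose q := (t + cos om) / 2.
have hq : 0 < q < cos om by rewrite /q; lra.
have cq : cos (acos q) = q by apply: cos_acos; lra.
have [a0 a1] := acos_bound q.
exists (acos q).
  split; apply: Rnot_le_lt => h.
  - have : cos om <= cos (acos q) by apply: cos_decr_1; lra.
    by rewrite cq; lra.
  - have : cos (acos q) <= cos (PI / 2) by apply: cos_decr_1; lra.
    by rewrite cq cos_PI2; lra.
rewrite /outer cq (_ : Rabs (fst z) = t * Cmod z); last by rewrite /t; field; lra.
by apply: Rmult_lt_compat_r => //; rewrite /q; lra.
Qed.

Lemma outer_near z : outer om z -> exists2 phi, om < phi < PI / 2 & exists2 d, 0 < d &
  cone phi z /\ forall z', Cmod (z' - z)%C < d -> cone phi z' /\ Cmod z / 2 <= Cmod z'.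
Proof.
move=> Oz; case: (outer_cone z Oz) => phi hp Ophi; exists phi => //.
have oc s : outer phi s -> cone phi s.
  by move=> Os; split; [exact: outer_neq0 Os|apply: Rlt_le].
have z0 : 0 < Cmod z by apply/Cmod_gt_0; apply: outer_neq0 Oz.
case: z Oz Ophi z0 => x y Oz Ophi z0; case: (copen_outer phi x y Ophi) => d Hd.
exists (Rmin d (Cmod (x, y) / 2)); first by apply: Rmin_glb_lt; [exact: cond_pos|lra].
split; first exact: oc.
move=> [u v] Hs.
have h1 := Rlt_le_trans _ _ _ Hs (Rmin_l _ _); have h2 := Rlt_le_trans _ _ _ Hs (Rmin_r _ _).
split.
- apply: oc; apply: Hd.
  + exact: Rle_lt_trans (fst_le_Cmod ((u, v) - (x, y))%C) h1.
  + exact: Rle_lt_trans (snd_le_Cmod ((u, v) - (x, y))%C) h1.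
- have := Cmod_triangle ((x, y) - (u, v))%C (u, v); rewrite (_ : ((x, y) - (u, v) + (u, v))%C = (x, y)); last by ring.
  by rewrite -(Cmod_opp ((x, y) - (u, v))%C) (_ : (- ((x, y) - (u, v)))%C = ((u, v) - (x, y))%C); [lra|ring].
Qed.

Lemma vcont_R (f : C -> V) z : outer om z -> vcont f z ->
  vcont (fun s => R1 s (f s)) z /\ vcont (fun s => R2 s (f s)) z.
Proof.
move=> Oz cf; case: (outer_near z Oz) => phi hp [d d0 [cz Hd]].
have z0 : 0 < Cmod z by apply/Cmod_gt_0; apply: outer_neq0 Oz.
case: (R_bound phi hp) => K K0 HK; case: (R_lip phi hp) => L L0 HL.
have KEY (R : C -> V -> V) : (forall s u v, outer om s -> R s (minus u v) = minus (R s u) (R s v)) ->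
    (forall s v, cone phi s -> norm (R s v) <= K / Cmod s * norm v) ->
    (forall s v, cone phi s -> norm (minus (R s v) (R z v)) <= Cmod (s - z)%C * (L / (Cmod z * Cmod s)) * norm v) ->
    vcont (fun s => R s (f s)) z.
  move=> Rs RK RL eps e0.
  pose A := K / (Cmod z / 2) + 1; pose B := L / (Cmod z * (Cmod z / 2)) * norm (f z) + 1.
  have A1 : 0 <= K / (Cmod z / 2) by apply: Rdiv_le_0_compat; lra.
  have A0 : 0 < A by rewrite /A; lra.
  have B1 : 0 <= L / (Cmod z * (Cmod z / 2)) by apply: Rdiv_le_0_compat; nra.
  have B0 : 0 < B by have := norm_ge_0 (f z); rewrite /B; nra.
  have e1 : 0 < eps / 2 / A by apply: Rdiv_lt_0_compat; lra.
  have e2 : 0 < eps / 2 / B by apply: Rdiv_lt_0_compat; lra.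
  case: (cf _ e1) => d1 d10 H1.
  exists (Rmin d (Rmin d1 (eps / 2 / B))); first by repeat apply: Rmin_glb_lt.
  move=> s Hs; have h0 := Rlt_le_trans _ _ _ Hs (Rmin_l _ _).
  have h1 := Rlt_le_trans _ _ _ Hs (Rle_trans _ _ _ (Rmin_r _ _) (Rmin_l _ _)).
  have h2 := Rlt_le_trans _ _ _ Hs (Rle_trans _ _ _ (Rmin_r _ _) (Rmin_r _ _)).
  case: (Hd s h0) => cs ms; have Os := cone_outer phi s hp cs.
  rewrite (_ : minus _ _ = plus (R s (minus (f s) (f z))) (minus (R s (f z)) (R z (f z)))); last first.
    by rewrite Rs //; vring.
  apply: Rle_lt_trans (norm_triangle _ _) _.
  have {}H1 := H1 s h1; have n1 := norm_ge_0 (minus (f s) (f z)); have n2 := norm_ge_0 (f z).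
  have i1 : / Cmod s <= / (Cmod z / 2) by apply: Rinv_le_contravar; lra.
  have b1 : norm (R s (minus (f s) (f z))) < eps / 2.
    apply: Rle_lt_trans (RK _ _ cs) _.
    apply: Rle_lt_trans (_ : norm (minus (f s) (f z)) * A < _); last by apply/(Rlt_div_r _ _ _ A0).
    rewrite Rmult_comm; apply: Rmult_le_compat_l => //.
    have : K / Cmod s <= K / (Cmod z / 2) by apply: Rmult_le_compat_l.
    by rewrite /A; lra.
  have b2 : norm (minus (R s (f z)) (R z (f z))) < eps / 2.
    apply: Rle_lt_trans (RL _ _ cs) _.
    apply: Rle_lt_trans (_ : Cmod (s - z)%C * B < _); last by apply/(Rlt_div_r _ _ _ B0).
    rewrite Rmult_assoc; apply: Rmult_le_compat_l; first exact: Cmod_ge_0.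
    have i2 : / (Cmod z * Cmod s) <= / (Cmod z * (Cmod z / 2)).
      by apply: Rinv_le_contravar; nra.
    have : L / (Cmod z * Cmod s) <= L / (Cmod z * (Cmod z / 2)) by apply: Rmult_le_compat_l.
    by rewrite /B; nra.
  lra.
have sub1 s u v : outer om s -> R1 s (minus u v) = minus (R1 s u) (R1 s v).
  by move=> Os; rewrite /minus R1_add // -(scal_opp_one v) R1_scal // scal_opp_one.
have sub2 s u v : outer om s -> R2 s (minus u v) = minus (R2 s u) (R2 s v).
  by move=> Os; rewrite /minus R2_add // -(scal_opp_one v) R2_scal // scal_opp_one.
split; apply: KEY => // s v cs; try (by case: (HK s v cs)); by case: (HL z s v cz cs).
Qed.

Definition rho (v w : V) (z : C) : C := (ipr (R1 z v) w, ipr (R2 z v) w).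

Lemma rho_hol v w : hol (outer om) (rho v w).
Proof.
pose D z : C := (- ipr (minus (R1 z (R1 z v)) (R2 z (R2 z v))) w,
                 - ipr (plus (R1 z (R2 z v)) (R2 z (R1 z v))) w).
exists D => -[x y] Oz.
have cR : vcont (fun s => R1 s v) (x, y) /\ vcont (fun s => R2 s v) (x, y).
  by apply: (vcont_R (fun _ => v)) => //; exact: vcont_const.
have cu u : vcont (fun s => R1 s u) (x, y) /\ vcont (fun s => R2 s u) (x, y).
  by apply: (vcont_R (fun _ => u)) => //; exact: vcont_const.
case: (cR) => c1 c2; case: (vcont_R _ _ Oz c1) => c11 c21; case: (vcont_R _ _ Oz c2) => c12 c22.
split; last 1 first.
- split.
  + apply: continuity_2d_pt_opp; apply: (vcont_ipr (fun s => minus (R1 s (R1 s v)) (R2 s (R2 s v)))).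
    apply: vcont_add => //.
    move=> eps e0; case: (c22 eps e0) => d d0 Hd; exists d => // s /Hd h.
    by rewrite (_ : minus _ _ = opp (minus (R2 s (R2 s v)) (R2 (x, y) (R2 (x, y) v)))) ?norm_opp //; vring.
  + apply: continuity_2d_pt_opp; apply: (vcont_ipr (fun s => plus (R1 s (R2 s v)) (R2 s (R1 s v)))).
    exact: vcont_add.
- have lx (P : C -> Prop) : (forall z, outer om z -> P z) -> locally x (fun t => P (t, y)).
    move=> HP; case: (copen_outer om x y Oz) => d Hd; exists d => t Ht; apply: HP; apply: Hd => //.
    by rewrite Rminus_diag Rabs_R0; apply: cond_pos.
  have ly (P : C -> Prop) : (forall z, outer om z -> P z) -> locally y (fun t => P (x, t)).
    move=> HP; case: (copen_outer om x y Oz) => d Hd; exists d => t Ht; apply: HP; apply: Hd => //.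
    by rewrite Rminus_diag Rabs_R0; apply: cond_pos.
  have ci u f : continuous (fun t => ipr (R1 (t, y) u) f) x /\ continuous (fun t => ipr (R2 (t, y) u) f) x /\
      continuous (fun t => ipr (R1 (x, t) u) f) y /\ continuous (fun t => ipr (R2 (x, t) u) f) y.
    case: (cu u) => k1 k2; have := vcont_ipr _ f _ _ k1; have := vcont_ipr _ f _ _ k2 => m2 m1.
    by split; [|split; [|split]]; first [exact: (continuous_2d_slice1 _ _ _ m1)|exact: (continuous_2d_slice1 _ _ _ m2)
      |exact: (continuous_2d_slice2 _ _ _ m1)|exact: (continuous_2d_slice2 _ _ _ m2)].
  have cadd (f g : R -> R) t : continuous f t -> continuous g t -> continuous (fun s => f s + g s) t.
    exact: (continuous_plus (V := R_NormedModule)).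
  have csub (f g : R -> R) t : continuous f t -> continuous g t -> continuous (fun s => f s - g s) t.
    exact: (continuous_minus (V := R_NormedModule)).
  have copp (f : R -> R) t : continuous f t -> continuous (fun s => - f s) t.
    exact: (continuous_opp (V := R_NormedModule)).
  case: (ci (R1 (x, y) v) w) => a1 [a2 [a3 a4]]; case: (ci (R2 (x, y) v) w) => b1 [b2 [b3 b4]].
  have RI z : outer om z -> forall u,
      u = ipr (R1 z v) w - ipr (R1 (x, y) v) w ->
      forall u', u' = ipr (R2 z v) w - ipr (R2 (x, y) v) w ->
      u = - ((fst z - x) * (ipr (R1 z (R1 (x, y) v)) w - ipr (R2 z (R2 (x, y) v)) w)
            - (snd z - y) * (ipr (R1 z (R2 (x, y) v)) w + ipr (R2 z (R1 (x, y) v)) w)) /\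
      u' = - ((fst z - x) * (ipr (R1 z (R2 (x, y) v)) w + ipr (R2 z (R1 (x, y) v)) w)
            + (snd z - y) * (ipr (R1 z (R1 (x, y) v)) w - ipr (R2 z (R2 (x, y) v)) w)).
    move=> Oz' u -> u' ->; case: (resolvent_identity z (x, y) v Oz' Oz) => E1 E2.
    have := f_equal (ipr^~ w) E1; have := f_equal (ipr^~ w) E2; rewrite /= !iprE => {}E1 {}E2.
    by split; lra.
  have near1 (P : R -> Prop) : (forall t, outer om (t, y) -> P t) -> locally x P.
    move=> HP; case: (copen_outer om x y Oz) => d Hd; exists d => t Ht; apply: HP; apply: Hd => //.
    by rewrite Rminus_diag Rabs_R0; apply: cond_pos.
  have near2 (P : R -> Prop) : (forall t, outer om (x, t) -> P t) -> locally y P.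
    move=> HP; case: (copen_outer om x y Oz) => d Hd; exists d => t Ht; apply: HP; apply: Hd => //.
    by rewrite Rminus_diag Rabs_R0; apply: cond_pos.
  rewrite /cder /rho /D /= ipr_subl ipr_addl; split.
  + apply: (is_derive_caratheodory (fun t => ipr (R1 (t, y) v) w)
      (fun t => - (ipr (R1 (t, y) (R1 (x, y) v)) w - ipr (R2 (t, y) (R2 (x, y) v)) w))).
      by apply: near1 => t Ot; case: (RI _ Ot _ erefl _ erefl) => -> _ /=; ring.
    by apply: copp; apply: csub.
  + apply: (is_derive_caratheodory (fun t => ipr (R2 (t, y) v) w)
      (fun t => - (ipr (R1 (t, y) (R2 (x, y) v)) w + ipr (R2 (t, y) (R1 (x, y) v)) w))).
      by apply: near1 => t Ot; case: (RI _ Ot _ erefl _ erefl) => _ -> /=; ring.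
    by apply: copp; apply: cadd.
  + rewrite Ropp_involutive.
    apply: (is_derive_caratheodory (fun t => ipr (R1 (x, t) v) w)
      (fun t => ipr (R1 (x, t) (R2 (x, y) v)) w + ipr (R2 (x, t) (R1 (x, y) v)) w)).
      by apply: near2 => t Ot; case: (RI _ Ot _ erefl _ erefl) => -> _ /=; ring.
    by apply: cadd.
  + apply: (is_derive_caratheodory (fun t => ipr (R2 (x, t) v) w)
      (fun t => - (ipr (R1 (x, t) (R1 (x, y) v)) w - ipr (R2 (x, t) (R2 (x, y) v)) w))).
      by apply: near2 => t Ot; case: (RI _ Ot _ erefl _ erefl) => _ -> /=; ring.
    by apply: copp; apply: csub.
- by split; [exact: (vcont_ipr _ w _ _ c1)|exact: (vcont_ipr _ w _ _ c2)].
Qed.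

Lemma rho_bound phi : om < phi < PI / 2 -> exists2 K, 0 <= K & forall z v w, cone phi z ->
  Cmod (rho v w z) <= K / Cmod z * norm v * norm w.
Proof.
move=> hp; case: (R_bound phi hp) => K K0 HK; exists (2 * K); first lra.
move=> z v w cz; have z0 : 0 < Cmod z by apply/Cmod_gt_0; case: cz.
case: (HK z v cz) => h1 h2; have w0 := norm_ge_0 w.
have b u : norm u <= K / Cmod z * norm v -> Rabs (ipr u w) <= K / Cmod z * norm v * norm w.
  by move=> hu; apply: Rle_trans (ipr_CS _ _) _; apply: Rmult_le_compat_r.
apply: Rle_trans (Cmod_2Rmax _) _.
have q : sqrt 2 <= 2 by have := sqrt_less_alt 2 ltac:(lra); lra.
have m : Rmax (Rabs (fst (rho v w z))) (Rabs (snd (rho v w z))) <= K / Cmod z * norm v * norm w.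
  by apply: Rmax_lub; apply: b.
have m0 : 0 <= Rmax (Rabs (fst (rho v w z))) (Rabs (snd (rho v w z))).
  by apply: Rle_trans (Rmax_l _ _); apply: Rabs_pos.
rewrite (_ : 2 * K / Cmod z * norm v * norm w = 2 * (K / Cmod z * norm v * norm w)); last by field; lra.
have := sqrt_pos 2; nra.
Qed.

Lemma Nz_bound phi : om < phi < PI / 2 -> exists2 K, 0 <= K & forall z (v : V), cone phi z ->
  norm (Nz z v) <= K / Cmod z ^ 2 * norm v.
Proof.
move=> hp; case: (R_bound phi hp) => K K0 HK.
have hom := om_bounds; have p0 := PI_RGT_0.
have s0 : 0 < sin phi by apply: sin_gt_0; lra.
exists (K / sin phi); first by apply: Rdiv_le_0_compat.
move=> z v cz; have z0 : 0 < Cmod z by apply/Cmod_gt_0; case: cz.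
case: (HK z v cz) => _.
have y0 : sin phi * Cmod z <= Rabs (snd z).
  apply: pow2_le_inv; first exact: Rabs_pos.
  rewrite pow2_abs; case: cz => _ h; have := Cmod_sqr z; have := sin2_cos2 phi; rewrite /Rsqr.
  have := pow2_abs (fst z); have := Rabs_pos (fst z); set X := Rabs (fst z) in h *.
  have c0 : 0 < cos phi by apply: cos_gt_0; lra.
  have : X ^ 2 <= (cos phi * Cmod z) ^ 2 by apply: pow_incr; split; [exact: Rabs_pos|].
  nra.
rewrite norm_scalV Rabs_Ropp => h.
have n0 := norm_ge_0 (Nz z v).
rewrite (_ : K / sin phi / Cmod z ^ 2 * norm v = K / Cmod z * norm v / (sin phi * Cmod z)); last by field; lra.
apply: le_div; first by nra.
by apply: Rle_trans h; rewrite Rmult_comm; apply: Rmult_le_compat_r.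
Qed.

End ResolventAnalysis.

(** * The functional calculus *)

Definition ang (th psi : R) := Rabs psi < th \/ Rabs (psi - PI) < th.

Definition good (th : R) (g : C -> C) :=
  hol (dsec th) g /\ forall z, dsec th z -> g (Cconj z) = Cconj (g z).

Definition decay (th a M : R) (g : C -> C) := forall r psi, 0 < r -> ang th psi ->
  Cmod (g (pol r psi)) <= M * kk a r.

Definition n0 (th : R) (g : C -> C) := good th g /\
  exists a M, [/\ 0 < a <= 1, 0 <= M & decay th a M g].

Lemma dsec_ang th r psi : 0 < r -> 0 <= th <= PI / 2 -> ang th psi -> dsec th (pol r psi).
Proof.
move=> r0 hth [h|h]; first exact: dsec_pol.
have E : pol r psi = (- pol r (psi - PI))%C.
  by rewrite /pol cos_minus sin_minus cos_PI sin_PI /Copp /=; f_equal; ring.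
by rewrite E; apply: dsec_opp; apply: dsec_pol.
Qed.

Lemma ang_le th th' psi : th <= th' -> ang th psi -> ang th' psi.
Proof. by move=> h [k|k]; [left|right]; lra. Qed.

Lemma dsec_le th th' z : 0 <= th <= th' -> th' <= PI / 2 -> dsec th z -> dsec th' z.
Proof.
move=> h h'; rewrite /dsec => H; apply: Rle_lt_trans H.
apply: Rmult_le_compat_r; first exact: Cmod_ge_0.
by have p0 := PI_RGT_0; apply: cos_decr_1; lra.
Qed.

Lemma good_le th th' g : 0 <= th <= th' -> th' <= PI / 2 -> good th' g -> good th g.
Proof.
move=> h h' [H1 H2]; split.
- by apply: hol_sub H1 => z; apply: dsec_le.
- by move=> z Hz; apply: H2; apply: dsec_le Hz.
Qed.

Lemma n0_le th th' g : 0 <= th <= th' -> th' <= PI / 2 -> n0 th' g -> n0 th g.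
Proof.
move=> h h' [H1 [a [M [ha hM H2]]]]; split; first exact: good_le H1.
by exists a, M; split => // r psi r0 hp; apply: H2 => //; apply: ang_le hp; lra.
Qed.

Lemma good_mul th g h : good th g -> good th h -> good th (fun z => g z * h z)%C.
Proof.
case=> g1 g2 [h1 h2]; split; first exact: hol_mul.
by move=> z Hz; rewrite g2 // h2 // Cmult_conj.
Qed.

Lemma good_add th g h : good th g -> good th h -> good th (fun z => g z + h z)%C.
Proof.
case=> g1 g2 [h1 h2]; split; first exact: hol_add.
by move=> z Hz; rewrite g2 // h2 // Cplus_conj.
Qed.

Lemma good_real th (x : R) : good th (fun _ => RtoC x).
Proof. by split; [exact: hol_const|move=> z _; rewrite /Cconj /= Ropp_0]. Qed.

Lemma good_id th : good th id.
Proof. by split; [exact: hol_id|]. Qed.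

Lemma n0_mul_bd th g h M : n0 th g -> good th h ->
  (forall r psi, 0 < r -> ang th psi -> Cmod (h (pol r psi)) <= M) -> n0 th (fun z => g z * h z)%C.
Proof.
case=> g1 [a [K [ha hK H]]] gh hM; split; first exact: good_mul.
exists a, (K * Rabs M); split => //; first by have := Rabs_pos M; nra.
move=> r psi r0 hp; rewrite Cmod_mult.
rewrite (_ : K * Rabs M * kk a r = K * kk a r * Rabs M); last by ring.
apply: Rmult_le_compat; try exact: Cmod_ge_0; first exact: H.
by apply: Rle_trans (hM _ _ r0 hp) (Rle_abs _).
Qed.

Lemma snd_ray0 th G r : 0 < th <= PI / 2 -> good th G -> 0 < r -> snd (ray G 0 r) = 0.
Proof.
move=> hth [_ H] r0; have : snd (G (pol r 0)) = 0.
  have := H (pol r 0) ltac:(apply: dsec_pol; rewrite ?Rabs_R0; lra).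
  rewrite pol_conj Ropp_0; case: (G (pol r 0)) => x y; rewrite /Cconj /= => -[]; lra.
by rewrite /ray /= cos_0 sin_0 => ->; ring.
Qed.

Lemma snd_rayPI th G r : 0 < th <= PI / 2 -> good th G -> 0 < r -> snd (ray G PI r) = 0.
Proof.
move=> hth [_ H] r0; have : snd (G (pol r PI)) = 0.
  have := H (pol r PI) ltac:(apply: dsec_ang => //; [lra|right; rewrite Rminus_diag Rabs_R0; lra]).
  rewrite pol_conj -(pol_2PI r (- PI)) (_ : - PI + 2 * PI = PI); last by ring.
  by case: (G (pol r PI)) => x y; rewrite /Cconj /= => -[]; lra.
by rewrite /ray /= cos_PI sin_PI => ->; ring.
Qed.

Lemma ii_zero (f : R -> R) : (forall r, 0 < r -> f r = 0) -> ii f 0.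
Proof.
move=> H; apply: (ii_ext (V := R_CompleteNormedModule) (fun r => 0 * kap 1 r)).
  by move=> r r0; rewrite H // Rmult_0_l.
have := @ii_scal R_CompleteNormedModule 0 (kap 1) _ (ii_kap 1 Rlt_0_1).
by rewrite (_ : scal 0 _ = 0) //; apply: Rmult_0_l.
Qed.

Lemma ray_im_zero th phi G a M : 0 < phi < th -> th <= PI / 2 -> good th G -> 0 < a ->
  (forall r psi, 0 < r -> ang th psi -> Cmod (G (pol r psi)) <= M * kap a r) ->
  ii (fun r => snd (ray G phi r)) 0 /\ ii (fun r => snd (ray G (PI - phi) r)) 0.
Proof.
move=> hphi hth gG a0 HM; case: (gG) => hG cG.
have UU r psi : 0 < r -> - th < psi < th -> dsec th (pol r psi).
  by move=> r0 hp; apply: dsec_pol => //; [lra|apply: Rabs_def1; lra].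
have UU' r psi : 0 < r -> PI - th < psi < PI + th -> dsec th (pol r psi).
  by move=> r0 hp; apply: dsec_ang => //; [lra|right; apply: Rabs_def1; lra].
have aR psi : - th < psi < th -> ang th psi by move=> h; left; apply: Rabs_def1; lra.
have aL psi : PI - th < psi < PI + th -> ang th psi by move=> h; right; apply: Rabs_def1; lra.
have ex psi : ang th psi -> exists l, cii (ray G psi) l.
  move=> hp; apply: (cii_ray_ex _ _ M a) => // r r0; last exact: HM.
  by apply: hol_ccont hG _; apply: dsec_ang => //; lra.
split.
- case: (ex phi) => [|l Hl]; first by apply: aR; lra.
  case: (ex 0) => [|l0 Hl0]; first by apply: aR; lra.
  have E : l0 = l.
    apply: (ray_shift (dsec th) G (- th) th 0 phi a M) => //; try lra.
    + exact: copen_dsec.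
    + by move=> r psi r0 hp; apply: HM => //; apply: aR; lra.
  case: Hl => _; rewrite -E; case: Hl0 => _ h0.
  rewrite (ii_uniq _ _ _ h0 (ii_zero _ _)) // => r r0; apply: (snd_ray0 th) => //; lra.
- case: (ex (PI - phi)) => [|l Hl]; first by apply: aL; lra.
  case: (ex PI) => [|l0 Hl0]; first by apply: aL; lra.
  have E : l = l0.
    apply: (ray_shift (dsec th) G (PI - th) (PI + th) (PI - phi) PI a M) => //; try lra.
    + exact: copen_dsec.
    + by move=> r psi r0 hp; apply: HM => //; apply: aL; lra.
  case: Hl => _; rewrite E; case: Hl0 => _ h0.
  rewrite (ii_uniq _ _ _ h0 (ii_zero _ _)) // => r r0; apply: (snd_rayPI th) => //; lra.
Qed.

Section Calculus.
Context {n : nat} {V : right_hilbert_module n} {T : operator V} {om : R} {HT : bisect T om}.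
Local Notation Nz := (Nz T).
Local Notation R1 := (R1 T).
Local Notation R2 := (R2 T).
Local Notation rho := (rho (T := T)).
Let om_bounds := bisect_om (T := T).

(* the imaginary part of c (R1 + i R2) v *)
Definition imR (z c : C) (v : V) : V := plus (scal (snd c) (R1 z v)) (scal (fst c) (R2 z v)).

Definition cint (phi : R) (g : C -> C) (v : V) (r : R) : V :=
  minus (imR (pol r phi) (ray g phi r) v) (imR (pol r (PI - phi)) (ray g (PI - phi) r) v).

(* The integral over the boundary of D_phi in C_J, without J: the J-parts of
   conjugate rays cancel, their real parts agree, and the two rays in the left
   half-plane are represented by the one of angle PI - phi. *)
Definition calc (phi : R) (g : C -> C) (v : V) : V :=
  scal (- / PI) (RInt_gen (cint phi g v) (at_right 0) (Rbar_locally p_infty)).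

Lemma ipr_imR z c v w : ipr (imR z c v) w = snd (c * rho v w z)%C.
Proof. by rewrite /imR ipr_addl (ipr_scall _ (R1 z v)) (ipr_scall _ (R2 z v)) /rho /=; ring. Qed.

Lemma ipr_imR_ray z g psi r v w : z = pol r psi ->
  ipr (imR z (ray g psi r) v) w = snd (ray (fun z => g z * rho v w z)%C psi r).
Proof. by move=> ->; rewrite ipr_imR /ray Cmult_assoc. Qed.

Lemma continuous_norm_intro (f : R -> V) x : (forall eps, 0 < eps -> exists2 d, 0 < d &
  forall y, Rabs (y - x) < d -> norm (minus (f y) (f x)) < eps) -> continuous f x.
Proof.
move=> H P [eps HP]; case: (H eps (cond_pos eps)) => d d0 Hd.
exists (mkposreal d d0) => y Hy; apply: HP; apply: norm_compat1; apply: Hd; exact: Hy.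
Qed.

Lemma continuous_vcont_pol (f : C -> V) psi r : vcont f (pol r psi) ->
  continuous (fun s => f (pol s psi)) r.
Proof.
move=> cf; apply: continuous_norm_intro => eps e0; case: (cf eps e0) => d d0 Hd.
exists d => // s Hs; apply: Hd.
rewrite (_ : (pol s psi - pol r psi)%C = pol (s - r) psi); last first.
  by rewrite /pol /Cminus /Cplus /Copp /=; f_equal; ring.
by rewrite polE Cmod_mult Cmod_expi Cmod_R Rmult_1_r.
Qed.

Lemma continuous_imR g psi v r : outer om (pol r psi) -> ccont g (pol r psi) ->
  continuous (fun s => imR (pol s psi) (ray g psi s) v) r.
Proof.
move=> Oz cg; case: (continuous_ray _ _ _ cg) => c1 c2.
case: (vcont_R (fun _ => v) _ Oz (vcont_const _ _)) => k1 k2.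
apply: (continuous_plus (V := rhm_sort V)); apply: (continuous_scal (V := rhm_sort V)) => //.
- exact: (continuous_vcont_pol (fun s => R1 s v)).
- exact: (continuous_vcont_pol (fun s => R2 s v)).
Qed.

Lemma outer_two th phi r : om < phi < th -> th <= PI / 2 -> 0 < r ->
  outer om (pol r phi) /\ outer om (pol r (PI - phi)).
Proof.
by have hom := om_bounds => hp hth r0; split; apply: outer_pol; lra.
Qed.

Lemma cone_pol phi psi r : 0 < r -> 0 < phi < PI / 2 -> phi <= psi <= PI - phi -> cone phi (pol r psi).
Proof.
move=> r0 hp hpsi; have p0 := PI_RGT_0; split.
  by apply/Cmod_gt_0; rewrite Cmod_pol; lra.
rewrite Cmod_pol; last lra.
have h1 : cos psi <= cos phi by apply: cos_decr_1; lra.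
have h2 : cos (PI - phi) <= cos psi by apply: cos_decr_1; lra.
move: h2; rewrite cos_minus cos_PI sin_PI => h2.
rewrite /= Rabs_mult (Rabs_pos_eq r) 1?Rmult_comm; last lra.
by apply: Rmult_le_compat_r; [lra|apply: Rabs_le; lra].
Qed.

Lemma imR_bound phi : om < phi < PI / 2 -> exists2 K, 0 <= K & forall z c v, cone phi z ->
  norm (imR z c v) <= K * (Cmod c / Cmod z) * norm v.
Proof.
move=> hp; case: (R_bound (T := T) phi hp) => K K0 HK; exists (2 * K); first lra.
move=> z c v cz; case: (HK z v cz) => h1 h2.
apply: Rle_trans (norm_add_le _ _) _; rewrite (norm_scalV _ (R1 z v)) (norm_scalV _ (R2 z v)).
have f1 := fst_le_Cmod c; have f2 := snd_le_Cmod c.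
have z0 : 0 < Cmod z by apply/Cmod_gt_0; case: cz.
have n1 := norm_ge_0 (R1 z v); have n2 := norm_ge_0 (R2 z v).
have b1 : Rabs (snd c) * norm (R1 z v) <= Cmod c * (K / Cmod z * norm v).
  by apply: Rmult_le_compat => //; exact: Rabs_pos.
have b2 : Rabs (fst c) * norm (R2 z v) <= Cmod c * (K / Cmod z * norm v).
  by apply: Rmult_le_compat => //; exact: Rabs_pos.
rewrite (_ : 2 * K * (Cmod c / Cmod z) * norm v = 2 * (Cmod c * (K / Cmod z * norm v))); last by field; lra.
lra.
Qed.

Lemma calc_bound phi : om < phi < PI / 2 -> exists2 K, 0 < K & forall th g (k : R -> R) L,
  phi < th -> th <= PI / 2 -> good th g ->
  (forall r, 0 < r -> Cmod (g (pol r phi)) <= k r * r /\ Cmod (g (pol r (PI - phi))) <= k r * r) ->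
  ii k L -> forall v, (exists l, ii (cint phi g v) l) /\ norm (calc phi g v) <= K * L * norm v.
Proof.
move=> hp; have hom := om_bounds; case: (imR_bound phi hp) => K K0 HK.
have p0 := PI_RGT_0; have ip := Rinv_0_lt_compat _ p0.
exists ((2 * K + 1) / PI); first by apply: Rdiv_lt_0_compat; lra.
move=> th g k L hphi hth [hg _] Hk HL v.
have c1 r : 0 < r -> cone phi (pol r phi) by move=> r0; apply: cone_pol; lra.
have c2 r : 0 < r -> cone phi (pol r (PI - phi)) by move=> r0; apply: cone_pol; lra.
have D1 r : 0 < r -> dsec th (pol r phi).
  by move=> r0; apply: dsec_ang => //; [lra|left; rewrite Rabs_pos_eq; lra].
have D2 r : 0 < r -> dsec th (pol r (PI - phi)).
  by move=> r0; apply: dsec_ang => //; [lra|right; rewrite (_ : _ - PI = - phi) ?Rabs_Ropp ?Rabs_pos_eq; lra].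
have kb r : 0 < r -> 0 <= k r.
  move=> r0; case: (Hk r r0) => h _; have := Cmod_ge_0 (g (pol r phi)) => h'.
  by apply: (Rmult_le_reg_r r) => //; lra.
have bd r : 0 < r -> norm (cint phi g v r) <= 2 * K * norm v * k r.
  move=> r0; apply: Rle_trans (norm_sub_le _ _) _.
  have b psi : cone phi (pol r psi) -> Cmod (g (pol r psi)) <= k r * r ->
      norm (imR (pol r psi) (ray g psi r) v) <= K * norm v * k r.
    move=> cp hk; apply: Rle_trans (HK _ _ _ cp) _.
    rewrite Cmod_ray Cmod_pol; last lra.
    have : Cmod (g (pol r psi)) / r <= k r by apply: div_le.
    have := norm_ge_0 v; move=> nv h; rewrite (_ : K * norm v * k r = K * k r * norm v); last by ring.
    by apply: Rmult_le_compat_r => //; apply: Rmult_le_compat_l.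
  case: (Hk r r0) => k1 k2; have := b _ (c1 r r0) k1; have := b _ (c2 r r0) k2; lra.
have [l Hl nl] : exists2 l, ii (cint phi g v) l & norm l <= 2 * K * norm v * L.
  apply: (ii_dom (V := rhm_sort V) _ (fun r => 2 * K * norm v * k r)).
  - move=> r r0; case: (outer_two th phi r _ hth r0) => [|O1 O2]; first lra.
    apply: (continuous_minus (V := rhm_sort V)).
    + by apply: continuous_imR => //; apply: (hol_ccont _ _ _ hg); exact: D1.
    + by apply: continuous_imR => //; apply: (hol_ccont _ _ _ hg); exact: D2.
  - exact: bd.
  - exact: (@ii_scal R_CompleteNormedModule (2 * K * norm v) k L).
split; first by exists l.
have L0 : 0 <= L.
  have z0 : ii (fun _ : R => 0) 0 by apply: ii_zero.
  have := ii_norm (V := R_CompleteNormedModule) (fun _ => 0) 0 k L _ z0 HL.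
  rewrite /norm /= /abs /= Rabs_R0; by apply=> r r0; exact: kb.
rewrite /calc (is_RInt_gen_unique _ _ Hl) norm_scalV Rabs_Ropp Rabs_pos_eq; last lra.
rewrite (_ : (2 * K + 1) / PI * L * norm v = / PI * ((2 * K + 1) * L * norm v)); last by field; lra.
apply: Rmult_le_compat_l; first lra.
have := norm_ge_0 v => nv; have : 0 <= L * norm v by nra.
nra.
Qed.

Lemma n0_ex th phi g v : om < phi < th -> th <= PI / 2 -> n0 th g -> exists l, ii (cint phi g v) l.
Proof.
move=> hp hth [gg [a [M [ha hM H]]]]; case: (calc_bound phi) => [|K K0 HK]; first lra.
have hom := om_bounds.
case: (HK th g (fun r => M * kap a r) (M * (PI / 2 / a)) _ hth gg _ _ v) => //; first lra.
- move=> r r0; rewrite (_ : M * kap a r * r = M * kk a r); last by rewrite /kap; field; lra.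
  split; apply: H => //; [left; rewrite Rabs_pos_eq; lra|right].
  by rewrite (_ : _ - PI = - phi) ?Rabs_Ropp ?Rabs_pos_eq; lra.
- by apply: (@ii_scal R_CompleteNormedModule M (kap a)); apply: ii_kap; lra.
Qed.

Lemma ii_ipr (K : R -> V) l w : ii K l -> ii (fun r => ipr (K r) w) (ipr l w).
Proof.
apply: (ii_linear (W := R_CompleteNormedModule) (fun v => ipr v w) (norm w)).
- by move=> u v; rewrite ipr_addl.
- by move=> c v; rewrite ipr_scall.
- by move=> v; rewrite Rmult_comm; exact: ipr_CS.
Qed.

Definition pint (phi : R) (H : C -> C) (r : R) : R := snd (ray H phi r) - snd (ray H (PI - phi) r).

Lemma ipr_cint phi g v w r : ipr (cint phi g v r) w = pint phi (fun z => g z * rho v w z)%C r.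
Proof. by rewrite /cint ipr_subl !(ipr_imR_ray _ _ _ r). Qed.

Lemma calc_ipr th phi g v w : om < phi < th -> th <= PI / 2 -> n0 th g ->
  ii (pint phi (fun z => g z * rho v w z)%C) (- PI * ipr (calc phi g v) w).
Proof.
move=> hp hth ng; case: (n0_ex th phi g v hp hth ng) => l Hl.
have p0 := PI_RGT_0.
have E : - PI * ipr (calc phi g v) w = ipr l w.
  by rewrite /calc (is_RInt_gen_unique _ _ Hl) ipr_scall; field; lra.
rewrite E; apply: (ii_ext (V := R_CompleteNormedModule) (fun r => ipr (cint phi g v r) w)).
  by move=> r _; rewrite ipr_cint.
exact: ii_ipr.
Qed.

Lemma calc_char th phi g v u : om < phi < th -> th <= PI / 2 -> n0 th g ->
  (forall w, ii (pint phi (fun z => g z * rho v w z)%C) (- PI * ipr u w)) -> calc phi g v = u.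
Proof.
move=> hp hth ng H; apply: ipr_ext => w; have p0 := PI_RGT_0.
have := ii_uniq _ _ _ (calc_ipr th phi g v w hp hth ng) (H w); nra.
Qed.

Lemma grho_bound th phi g a M v w : om < phi -> phi < PI / 2 -> decay th a M g -> 0 <= M ->
  exists2 K, 0 <= K & forall r psi, 0 < r -> ang th psi -> phi <= psi <= PI - phi ->
    Cmod (g (pol r psi) * rho v w (pol r psi))%C <= K * kap a r.
Proof.
move=> hp hp2 H hM; have hom := om_bounds.
case: (rho_bound (T := T) phi) => [|K K0 HK]; first lra.
have nv := norm_ge_0 v; have nw := norm_ge_0 w.
exists (M * (K * norm v * norm w)); first by repeat apply: Rmult_le_pos.
move=> r psi r0 ha hpsi; rewrite Cmod_mult.
have := HK (pol r psi) v w (cone_pol phi psi r r0 ltac:(lra) hpsi); rewrite Cmod_pol; last lra.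
move=> b; rewrite (_ : _ * kap a r = M * kk a r * (K / r * norm v * norm w)); last by rewrite /kap; field; lra.
by apply: Rmult_le_compat => //; [exact: Cmod_ge_0|exact: Cmod_ge_0|exact: H].
Qed.

Lemma calc_indep th phi phi' g v : om < phi <= phi' -> phi' < th -> th <= PI / 2 -> n0 th g ->
  calc phi g v = calc phi' g v.
Proof.
move=> hp hp' hth ng; have hom := om_bounds; symmetry.
apply: (calc_char th) => // [|w]; first lra.
have := calc_ipr th phi g v w ltac:(lra) hth ng.
case: (ng) => -[hg cg] [a [M [ha hM H]]].
case: (grho_bound th phi g a M v w) => // [||K K0 HK]; try lra.
pose U z := dsec th z /\ outer om z.
have oU : copen U by apply: copen_and; [exact: copen_dsec|exact: copen_outer].
pose G z := (g z * rho v w z)%C.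
have hG : hol U G by apply: hol_mul; [apply: hol_sub hg => z []|apply: hol_sub (rho_hol v w) => z []].
have UU r psi : 0 < r -> om < psi < th -> U (pol r psi).
  move=> r0 h; split; first by apply: dsec_pol => //; [lra|rewrite Rabs_pos_eq; lra].
  by apply: outer_pol; lra.
have UU' r psi : 0 < r -> PI - th < psi < PI - om -> U (pol r psi).
  move=> r0 h; split; first by apply: dsec_ang => //; [lra|right; apply: Rabs_def1; lra].
  by apply: outer_pol; lra.
have ex psi : ang th psi -> phi <= psi <= PI - phi -> (forall r, 0 < r -> U (pol r psi)) -> exists l, cii (ray G psi) l.
  move=> h1 h2 hU; apply: (cii_ray_ex _ _ K a) => [|r r0|r r0]; first lra.
  - exact: hol_ccont hG (hU r r0).
  - exact: HK.
have aR psi : om < psi < th -> ang th psi by move=> h; left; apply: Rabs_def1; lra.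
have aL psi : PI - th < psi < PI - om -> ang th psi by move=> h; right; apply: Rabs_def1; lra.
case: (ex phi) => [|||l1 k1]; [by apply: aR; lra|lra|by move=> r r0; apply: UU; lra|].
case: (ex phi') => [|||l2 k2]; [by apply: aR; lra|lra|by move=> r r0; apply: UU; lra|].
case: (ex (PI - phi)) => [|||l3 k3]; [by apply: aL; lra|lra|by move=> r r0; apply: UU'; lra|].
case: (ex (PI - phi')) => [|||l4 k4]; [by apply: aL; lra|lra|by move=> r r0; apply: UU'; lra|].
have E1 : l1 = l2.
  apply: (ray_shift U G om th phi phi' a K) => //; try lra.
  by move=> r psi r0 h; apply: HK => //; [apply: aR; lra|lra].
have E2 : l4 = l3.
  apply: (ray_shift U G (PI - th) (PI - om) (PI - phi') (PI - phi) a K) => //; try lra.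
  by move=> r psi r0 h; apply: HK => //; [apply: aL; lra|lra].
have m1 : ii (pint phi G) (snd l1 - snd l3).
  by apply: (@ii_minus R_CompleteNormedModule); [case: k1|case: k3].
have m2 : ii (pint phi' G) (snd l2 - snd l4).
  by apply: (@ii_minus R_CompleteNormedModule); [case: k2|case: k4].
by move=> h; rewrite (ii_uniq _ _ _ h m1) E1 -E2.
Qed.

End Calculus.

Arguments calc {n V} T phi g v.

Lemma cos_far x d : 0 <= d <= PI -> d <= Rabs x <= 2 * PI - d -> cos x <= cos d.
Proof.
move=> hd hx; have E : cos x = cos (Rabs x).
  by case: (Rle_lt_dec 0 x) => h; [rewrite Rabs_pos_eq|rewrite Rabs_left // cos_neg].
rewrite E; case: (Rle_lt_dec (Rabs x) PI) => h; first by apply: cos_decr_1; lra.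
have -> : cos (Rabs x) = cos (2 * PI - Rabs x).
  by rewrite cos_minus cos_2PI sin_2PI; ring.
by apply: cos_decr_1; lra.
Qed.

Lemma dist_sector th chi d rho0 r psi : 0 < d -> 0 < th -> th + d <= chi <= PI - th - d ->
  0 < rho0 -> 0 < r -> ang th psi ->
  sqrt ((1 - cos d) / 2) * (r + rho0) <= Cmod (pol r psi - pol rho0 chi)%C /\
  sqrt ((1 - cos d) / 2) * (r + rho0) <= Cmod (pol r psi - pol rho0 (- chi))%C.
Proof.
move=> d0 th0 hchi rh0 r0 ha; have c1 := COS_bound d; have p0 := PI_RGT_0.
split; apply: dist_pol_cos; try lra; apply: cos_far; try lra;
  case: ha => /Rabs_def2 ha; split; split_Rabs; lra.
Qed.

Lemma sqrt_cos_gt0 d : 0 < d <= PI -> 0 < sqrt ((1 - cos d) / 2).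
Proof.
move=> hd; apply: sqrt_lt_R0; have : cos d < cos 0 by apply: cos_decreasing_1; lra.
rewrite cos_0; lra.
Qed.

Definition nz (z s : C) : C := (/ ((s - z) * (s - Cconj z)))%C.

Lemma dsec_outer_neq th z s : outer th z -> dsec th s -> s <> z /\ s <> Cconj z.
Proof.
move=> Oz Ds; split=> E; move: Ds; rewrite E.
- by move: Oz; rewrite /outer /dsec; lra.
- by move/outer_conj: Oz; rewrite /outer /dsec; lra.
Qed.

Lemma Cmul_neq0 (a b : C) : a <> 0%C -> b <> 0%C -> (a * b)%C <> 0%C.
Proof. by move=> a0 b0; apply/Cmod_gt_0; rewrite Cmod_mult; apply: Rmult_lt_0_compat; apply/Cmod_gt_0. Qed.

Lemma nz_den_neq0 th z s : outer th z -> dsec th s -> ((s - z) * (s - Cconj z))%C <> 0%C.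
Proof.
by move=> Oz Ds; case: (dsec_outer_neq th z s Oz Ds) => h1 h2; apply: Cmul_neq0; apply: Csub_neq0.
Qed.

Lemma good_nz th z : outer th z -> good th (nz z).
Proof.
move=> Oz; split.
  apply: (hol_inv _ (fun s => (s - z) * (s - Cconj z))%C) => [|s]; last exact: nz_den_neq0.
  by apply: hol_mul; apply: hol_add; try exact: hol_id; exact: hol_const.
move=> s Ds; rewrite /nz Cinv_conj; last exact: nz_den_neq0 Ds.
by rewrite Cmult_conj !Cminus_conj Cconj_conj Cmult_comm.
Qed.

Lemma nz_bound th chi d rho0 r psi : 0 < d -> 0 < th -> th + d <= chi <= PI - th - d ->
  0 < rho0 -> 0 < r -> ang th psi ->
  Cmod (nz (pol rho0 chi) (pol r psi)) <= / ((1 - cos d) / 2 * (r + rho0) ^ 2).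
Proof.
move=> d0 th0 hchi rh0 r0 ha; have p0 := PI_RGT_0.
case: (dist_sector th chi d rho0 r psi d0 th0 hchi rh0 r0 ha) => h1 h2.
have s0 := sqrt_cos_gt0 d ltac:(lra); have c1 := COS_bound d.
set k := sqrt _ in h1 h2 s0.
have kE : (1 - cos d) / 2 = k * k by rewrite /k sqrt_sqrt //; lra.
have q0 : 0 < k * (r + rho0) by nra.
rewrite /nz Cmod_inv; last first.
  by apply: Cmul_neq0; apply/Cmod_gt_0; rewrite ?pol_conj; lra.
rewrite Cmod_mult pol_conj kE; apply: Rinv_le_contravar; first by nra.
rewrite (_ : k * k * (r + rho0) ^ 2 = (k * (r + rho0)) * (k * (r + rho0))); last by ring.
by apply: Rmult_le_compat; lra.
Qed.

Lemma outer_pol_two th rho0 chi : 0 < rho0 -> 0 < th < PI / 2 -> th < chi < PI - th -> outer th (pol rho0 chi).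
Proof. by move=> *; apply: outer_pol; lra. Qed.

Lemma sin_cos_gt d : 0 < d <= PI -> 0 < (1 - cos d) / 2.
Proof.
move=> hd; have : cos d < cos 0 by apply: cos_decreasing_1; lra.
rewrite cos_0; lra.
Qed.

Lemma pint_add phi G H r : pint phi (fun z => G z + H z)%C r = pint phi G r + pint phi H r.
Proof. by rewrite /pint /ray /=; ring. Qed.

Lemma pint_ext phi G H r : G (pol r phi) = H (pol r phi) -> G (pol r (PI - phi)) = H (pol r (PI - phi)) ->
  pint phi G r = pint phi H r.
Proof. by rewrite /pint /ray => -> ->. Qed.

Section ResolventCalculus.
Context {n : nat} {V : right_hilbert_module n} {T : operator V} {om : R} {HT : bisect T om}.
Local Notation Nz := (Nz T).
Local Notation R1 := (R1 T).
Local Notation R2 := (R2 T).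
Local Notation rho := (rho (T := T)).
Local Notation calc := (calc T).
Let om_bounds := bisect_om (T := T).

(* Multiplying R(s) by a bounded operator F which acts, up to a term
   holomorphic in the double sector, as the multiplication by k(s) *)
Lemma calc_op th phi g k (F : V -> V) B z0 chi Mk : om < phi < th -> th < chi < PI - th -> 0 < z0 ->
  n0 th g -> good th k -> (forall r psi, 0 < r -> ang th psi -> Cmod (k (pol r psi)) <= Mk) ->
  (forall u v, F (plus u v) = plus (F u) (F v)) -> (forall a v, F (scal a v) = scal a (F v)) ->
  norm_le F B ->
  (forall v w, exists a b, forall s, dsec th s -> outer om s ->
     (ipr (F (R1 s v)) w, ipr (F (R2 s v)) w) =
     (k s * rho v w s + nz (pol z0 chi) s * (RtoC a + RtoC b * s))%C) ->
  n0 th (fun s => g s * k s)%C /\ forall v, calc phi (fun s => g s * k s)%C v = F (calc phi g v).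
Proof.
move=> hp hchi z00 ng gk kb FD FZ FB HF; have hom := om_bounds; have p0 := PI_RGT_0.
have ngk : n0 th (fun s => g s * k s)%C by apply: n0_mul_bd kb.
split=> // v; apply: (calc_char th) => // [|w]; first lra.
case: (HF v w) => a [b E].
have := calc_ipr th phi g v (adj F w) hp ltac:(lra) ng.
rewrite -(adjP F B) // => h.
case: (ng) => gg [e [M [he hM H]]].
pose z := pol z0 chi; have Oz : outer th z by apply: outer_pol_two; lra.
pose G s := (g s * (nz z s * (RtoC a + RtoC b * s)))%C.
have gG : good th G.
  apply: good_mul => //; apply: good_mul; first exact: good_nz.
  by apply: good_add; [exact: good_real|apply: good_mul; [exact: good_real|exact: good_id]].
pose d := Rmin (chi - th) (PI - th - chi).
have d0 : 0 < d by apply: Rmin_glb_lt; lra.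
have d1 : d <= chi - th by apply: Rmin_l.
have d2 : d <= PI - th - chi by apply: Rmin_r.
have k0 := sin_cos_gt d ltac:(lra); set c := (1 - cos d) / 2 in k0.
have GB r psi : 0 < r -> ang th psi -> Cmod (G (pol r psi)) <= M * ((Rabs a / z0 + Rabs b) / c) * kap e r.
  move=> r0 ha; rewrite Cmod_mult.
  rewrite (_ : M * _ * kap e r = M * kk e r * ((Rabs a / z0 + Rabs b) / c / r)); last by rewrite /kap; field; lra.
  apply: Rmult_le_compat; try exact: Cmod_ge_0; first exact: H.
  rewrite Cmod_mult; have nb := nz_bound th chi d z0 r psi d0 ltac:(lra) ltac:(lra) z00 r0 ha.
  rewrite -/z -/c in nb.
  have lb : Cmod (RtoC a + RtoC b * pol r psi)%C <= Rabs a + Rabs b * r.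
    apply: Rle_trans (Cmod_triangle _ _) _; rewrite Cmod_R Cmod_mult Cmod_R Cmod_pol; lra.
  have a0 := Rabs_pos a; have b0 := Rabs_pos b.
  apply: Rle_trans (_ : / (c * (r + z0) ^ 2) * (Rabs a + Rabs b * r) <= _).
    by apply: Rmult_le_compat => //; exact: Cmod_ge_0.
  rewrite Rmult_comm; apply: div_le; first by apply: Rmult_lt_0_compat => //; apply: pow_lt; lra.
  rewrite (_ : _ * (c * _) = (Rabs a / z0 + Rabs b) * ((r + z0) ^ 2 / r)); last by field; lra.
  have q1 : r + 2 * z0 <= (r + z0) ^ 2 / r by apply: le_div; nra.
  have q2 : 0 <= Rabs a / z0 by apply: Rdiv_le_0_compat.
  apply: Rle_trans (_ : (Rabs a / z0 + Rabs b) * (r + 2 * z0) <= _); last by apply: Rmult_le_compat_l; lra.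
  rewrite (_ : (_ + _) * (r + 2 * z0) = 2 * Rabs a + Rabs b * r + Rabs a / z0 * r + 2 * Rabs b * z0); last by field; lra.
  have : 0 <= Rabs a / z0 * r by nra.
  have : 0 <= 2 * Rabs b * z0 by nra.
  lra.
have he0 : 0 < e by lra.
have hp' : 0 < phi < th by lra.
have hth : th <= PI / 2 by lra.
case: (ray_im_zero th phi G e _ hp' hth gG he0 GB) => v1 v2.
have v0 : ii (pint phi G) 0.
  by have := @ii_minus R_CompleteNormedModule _ _ _ _ v1 v2; rewrite (_ : minus 0 0 = 0) //; apply: Rminus_diag.
have := @ii_minus R_CompleteNormedModule _ _ _ _ h v0.
rewrite (_ : minus _ 0 = - PI * ipr (F (calc phi g v)) w); last by rewrite /minus /plus /opp /=; ring.
apply: ii_ext => r r0.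
have step s : dsec th s -> outer om s -> (g s * rho v (adj F w) s)%C = (g s * k s * rho v w s + G s)%C.
  move=> Ds Os; rewrite (_ : rho v (adj F w) s = (k s * rho v w s + nz z s * (RtoC a + RtoC b * s))%C).
    by rewrite /G; ring.
  by rewrite -E // !(adjP F B).
have D1 : dsec th (pol r phi) by apply: dsec_ang => //; [lra|left; rewrite Rabs_pos_eq; lra].
have D2 : dsec th (pol r (PI - phi)).
  by apply: dsec_ang => //; [lra|right; rewrite (_ : _ - PI = - phi) ?Rabs_Ropp ?Rabs_pos_eq; lra].
case: (outer_two (T := T) th phi r) => // O1 O2.
rewrite (pint_ext phi _ (fun s => g s * k s * rho v w s + G s)%C); [|exact: step|exact: step].
by rewrite pint_add /minus /plus /opp /=; ring.
Qed.

Lemma TNz_add z u v : outer om z -> T (Nz z (plus u v)) = plus (T (Nz z u)) (T (Nz z v)).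
Proof. by move=> Oz; rewrite Nz_add // T_add //; exact: dom_Nz. Qed.

Lemma TNz_scal z a v : outer om z -> T (Nz z (scal a v)) = scal a (T (Nz z v)).
Proof. by move=> Oz; rewrite Nz_scal // T_scal //; exact: dom_Nz. Qed.

Lemma TNz_bounded th z : om < th < PI / 2 -> cone th z ->
  (exists B, norm_le (Nz z) B) /\ exists B, norm_le (fun v => T (Nz z v)) B.
Proof.
move=> hth cz; case: (Nz_bound (T := T) th hth) => K K0 HK; case: (R_bound (T := T) th hth) => L L0 HL.
split; first by exists (K / Cmod z ^ 2) => v; exact: HK.
exists (Rabs (fst z) * (K / Cmod z ^ 2) + L / Cmod z) => v.
rewrite (_ : T (Nz z v) = minus (scal (fst z) (Nz z v)) (R1 z v)); last first.
  by rewrite /R1; vring.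
apply: Rle_trans (norm_sub_le _ _) _; rewrite norm_scalV Rmult_plus_distr_r.
apply: Rplus_le_compat; last by case: (HL z v cz).
by rewrite Rmult_assoc; apply: Rmult_le_compat_l; [exact: Rabs_pos|exact: HK].
Qed.

Lemma calc_Nz th phi g z0 chi : om < phi < th -> th < chi < PI - th -> 0 < z0 -> n0 th g ->
  let z := pol z0 chi in
  [/\ n0 th (fun s => g s * nz z s)%C, forall v, calc phi (fun s => g s * nz z s)%C v = Nz z (calc phi g v),
      n0 th (fun s => g s * (s * nz z s))%C &
      forall v, calc phi (fun s => g s * (s * nz z s))%C v = T (Nz z (calc phi g v))].
Proof.
move=> hp hchi z00 ng z; have hom := om_bounds; have p0 := PI_RGT_0.
have hth : om < th < PI / 2 by lra.
have Oth : outer th z by apply: outer_pol_two; lra.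
have cz : cone th z by split; [exact: outer_neq0 Oth|apply: Rlt_le].
have Oz : outer om z by apply: cone_outer cz; lra.
case: (TNz_bounded th z hth cz) => -[B1 HB1] [B2 HB2].
pose d := Rmin (chi - th) (PI - th - chi).
have d0 : 0 < d by apply: Rmin_glb_lt; lra.
have d1 : d <= chi - th by apply: Rmin_l.
have d2 : d <= PI - th - chi by apply: Rmin_r.
have k0 := sin_cos_gt d ltac:(lra); set c := (1 - cos d) / 2 in k0.
have nb r psi : 0 < r -> ang th psi -> Cmod (nz z (pol r psi)) <= / (c * (r + z0) ^ 2).
  by move=> r0 ha; apply: (nz_bound th chi d) => //; lra.
have X (q A Bq : C) : q <> 0%C -> (q * A)%C = Bq -> A = (/ q * Bq)%C by move=> q0 <-; field.
case: (calc_op th phi g (nz z) (Nz z) B1 z0 chi (/ (c * z0 ^ 2))) => //.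
- exact: good_nz.
- move=> r psi r0 ha; apply: Rle_trans (nb r psi r0 ha) _; apply: Rinv_le_contravar; first by apply: Rmult_lt_0_compat => //; apply: pow_lt; lra.
  by apply: Rmult_le_compat_l; [lra|apply: pow_incr; lra].
- by move=> u v; rewrite Nz_add.
- by move=> a v; rewrite Nz_scal.
- move=> v w; exists (ipr (T (Nz z v)) w - 2 * fst z * ipr (Nz z v) w), (ipr (Nz z v) w) => s Ds Os.
  case: (Nz_R z s v Oz Os) => E1 E2.
  rewrite -/z (X _ (ipr (Nz z (R1 s v)) w, ipr (Nz z (R2 s v)) w) (rho v w s + (RtoC (ipr (T (Nz z v)) w - 2 * fst z * ipr (Nz z v) w) +
    RtoC (ipr (Nz z v) w) * s))%C (nz_den_neq0 th z s Oth Ds)).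
    by rewrite /nz Cmult_plus_distr_l.
  have := f_equal (ipr^~ w) E1; have := f_equal (ipr^~ w) E2; move=> {E1 E2}.
  rewrite /= !iprE => E2 E1.
  by apply: injective_projections; rewrite /= !iprE; lra.
move=> n1 c1; case: (calc_op th phi g (fun s => s * nz z s)%C (fun v => T (Nz z v)) B2 z0 chi (/ (c * z0))) => //.
- by apply: good_mul; [exact: good_id|exact: good_nz].
- move=> r psi r0 ha; rewrite Cmod_mult Cmod_pol; last lra.
  apply: Rle_trans (_ : r * / (c * (r + z0) ^ 2) <= _).
    by apply: Rmult_le_compat_l; [lra|exact: nb].
  apply: div_le; first by apply: Rmult_lt_0_compat => //; apply: pow_lt; lra.
  rewrite (_ : / (c * z0) * _ = (r + z0) ^ 2 / z0); last by field; lra.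
  apply: le_div; nra.
- by move=> u v; rewrite TNz_add.
- by move=> a v; rewrite TNz_scal.
- move=> v w; exists (- Cmod z ^ 2 * ipr (Nz z v) w), (ipr (T (Nz z v)) w) => s Ds Os.
  case: (TNz_R z s v Oz Os) => E1 E2.
  rewrite -/z (X _ (ipr (T (Nz z (R1 s v))) w, ipr (T (Nz z (R2 s v))) w) (s * rho v w s + (RtoC (- Cmod z ^ 2 * ipr (Nz z v) w) +
    RtoC (ipr (T (Nz z v)) w) * s))%C (nz_den_neq0 th z s Oth Ds)).
    by rewrite /nz Cmult_plus_distr_l Cmult_assoc (Cmult_comm (/ _)%C s).
  have := f_equal (ipr^~ w) E1; have := f_equal (ipr^~ w) E2; move=> {E1 E2}.
  rewrite /= !iprE => E2 E1.
  by apply: injective_projections; rewrite /= !iprE; lra.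
Qed.

End ResolventCalculus.

Lemma is_derive_comp_opp (f : R -> R) x l : is_derive f (- x) l -> is_derive (fun t => f (- t)) x (- l).
Proof.
move=> H; have d : is_derive Ropp x (-1) by auto_derive => //; ring.
have := is_derive_comp f Ropp x _ _ H d.
by rewrite (_ : scal (-1) l = - l) // /scal /= /mult /=; ring.
Qed.

Lemma ccont_opp_arg G z : ccont G (- z)%C -> ccont (fun s => G (- s)%C) z.
Proof.
case=> c1 c2; split.
- apply: (continuity_2d_comp (fun u v => fst (G (u, v))) (fun u _ => - u) (fun _ v => - v)) => //.
  + by apply: continuity_2d_pt_opp; apply: continuity_2d_pt_id1.
  + by apply: continuity_2d_pt_opp; apply: continuity_2d_pt_id2.
- apply: (continuity_2d_comp (fun u v => snd (G (u, v))) (fun u _ => - u) (fun _ v => - v)) => //.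
  + by apply: continuity_2d_pt_opp; apply: continuity_2d_pt_id1.
  + by apply: continuity_2d_pt_opp; apply: continuity_2d_pt_id2.
Qed.

Lemma hol_opp_arg (U : C -> Prop) G : (forall z, U z -> U (- z)%C) -> hol U G -> hol U (fun z => G (- z)%C).
Proof.
move=> HU [D HD]; exists (fun z => - D (- z))%C => z /HU /HD [[d1 d2 d3 d4] cG cD].
split; [split|exact: ccont_opp_arg|exact: ccont_opp (ccont_opp_arg _ _ cD)].
- exact: (is_derive_comp_opp (fun t => fst (G (t, - snd z)))).
- exact: (is_derive_comp_opp (fun t => snd (G (t, - snd z)))).
- exact: (is_derive_comp_opp (fun t => fst (G (- fst z, t)))).
- exact: (is_derive_comp_opp (fun t => snd (G (- fst z, t)))).
Qed.

Lemma good_opp_arg th g : good th g -> good th (fun z => g (- z)%C).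
Proof.
case=> h1 h2; split; first by apply: hol_opp_arg h1 => z; exact: dsec_opp.
by move=> z Hz; rewrite -Copp_conj h2 //; exact: dsec_opp.
Qed.

Lemma pol_opp r psi : (- pol r psi)%C = pol r (psi + PI).
Proof. by rewrite /pol /Copp /= cos_plus sin_plus cos_PI sin_PI; f_equal; ring. Qed.

Lemma ang_plusPI th psi : Rabs psi < th -> ang th (psi + PI).
Proof. by move=> h; right; rewrite (_ : psi + PI - PI = psi) //; ring. Qed.

Lemma cauchy_outside th phi1 G r0 phi0 k a M : 0 < phi1 < th -> th <= PI / 2 -> hol (dsec th) G ->
  0 < a -> 0 < r0 -> k < 1 -> (forall psi, - th < psi < th -> cos (psi - phi0) <= k) ->
  (forall r psi, 0 < r -> - th < psi < th -> Cmod (G (pol r psi)) <= M * kk a r) ->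
  exists l, cii (ray (fun z => G z / (z - pol r0 phi0))%C (- phi1)) l /\
            cii (ray (fun z => G z / (z - pol r0 phi0))%C phi1) l.
Proof.
move=> hp hth hG a0 h0 k1 Hk HM; case: (dist_pol_lb r0 phi0 k h0 k1) => c c0 Hc.
set s := pol r0 phi0; pose F z := (G z / (z - s))%C.
pose U z := dsec th z /\ z <> s.
have oU : copen U by apply: copen_and; [exact: copen_dsec|exact: copen_neq].
have hF : hol U F by apply: hol_div_sub.
have lb r psi : 0 < r -> - th < psi < th -> c * (1 + r) <= Cmod (pol r psi - s)%C.
  by move=> *; apply: Hc => //; apply: Hk.
have UU r psi : 0 < r -> - th < psi < th -> U (pol r psi).
  move=> r1 h; split; first by apply: dsec_pol => //; [lra|apply: Rabs_def1; lra].
  by apply: Csub_diag_mod; have := lb r psi r1 h; nra.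
have FB r psi : 0 < r -> - th < psi < th -> Cmod (F (pol r psi)) <= Rabs M / c * kap a r.
  move=> r1 h; have l := lb r psi r1 h.
  have d0 : 0 < Cmod (pol r psi - s)%C by nra.
  rewrite /F Cmod_div; last by apply/Cmod_gt_0.
  apply: div_le => //; apply: Rle_trans (HM _ _ r1 h) _.
  have kp := kap_gt0 a r r1; have Ma := Rabs_pos M; have Mb := Rle_abs M.
  rewrite (_ : kk a r = r * kap a r); last by rewrite /kap; field; lra.
  rewrite (_ : _ * Cmod _ = Rabs M * kap a r * (Cmod (pol r psi - s)%C / c)); last by field; lra.
  apply: Rle_trans (_ : Rabs M * kap a r * r <= _).
    by rewrite (_ : M * (r * kap a r) = M * kap a r * r); [apply: Rmult_le_compat_r; nra|ring].
  apply: Rmult_le_compat_l; first by nra.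
  by apply: le_div => //; nra.
have ex psi : - th < psi < th -> exists l, cii (ray F psi) l.
  move=> h; apply: (cii_ray_ex _ _ (Rabs M / c) a) => // r r1; last exact: FB.
  by apply: (hol_ccont U) => //; apply: UU.
case: (ex (- phi1)) => [|l1 H1]; first lra.
case: (ex phi1) => [|l2 H2]; first lra.
exists l1; split => //; rewrite (_ : l1 = l2) //.
apply: (ray_shift U F (- th) th (- phi1) phi1 a (Rabs M / c)) => //; try lra.
by move=> r psi r1 h; apply: FB => //; lra.
Qed.

Lemma cauchy_inside th phi1 G r0 phi0 a M : 0 < phi1 < th -> th <= PI / 2 -> hol (dsec th) G ->
  0 < a <= 1 -> 0 < r0 -> Rabs phi0 < phi1 ->
  (forall r psi, 0 < r -> - th < psi < th -> Cmod (G (pol r psi)) <= M * kk a r) ->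
  exists l1 l2, [/\ cii (ray (fun z => G z / (z - pol r0 phi0))%C (- phi1)) l1,
    cii (ray (fun z => G z / (z - pol r0 phi0))%C phi1) l2 &
    (l1 - l2 = (0, 2 * PI)%R * G (pol r0 phi0))%C].
Proof.
move=> hp hth hG a0 h0 hp0 HM; set s := pol r0 phi0; pose F z := (G z / (z - s))%C.
pose U z := dsec th z /\ z <> s.
have hF : hol U F by apply: hol_div_sub.
have p0 := PI_RGT_0; have ab := Rabs_pos phi0.
have kl : cos (phi1 - Rabs phi0) < 1 by rewrite -cos_0; apply: cos_decreasing_1; lra.
case: (dist_pol_lb r0 phi0 _ h0 kl) => c c0 Hc.
have ex psi : Rabs psi = phi1 -> exists l, cii (ray F psi) l.
  move=> h; have hpsi : - th < psi < th by move: h; split_Rabs; lra.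
  have lb r : 0 < r -> c * (1 + r) <= Cmod (pol r psi - s)%C.
    move=> r1; apply: Hc => //; apply: cos_far; first lra.
    by move: h hp0; split_Rabs; lra.
  apply: (cii_ray_ex _ _ (Rabs M / c) a) => [|r r1|r r1]; first lra.
  - apply: (hol_ccont U) => //; split; first by apply: dsec_pol => //; lra.
    by apply: Csub_diag_mod; have := lb r r1; nra.
  - have l := lb r r1; have d0 : 0 < Cmod (pol r psi - s)%C by nra.
    rewrite /F Cmod_div; last by apply/Cmod_gt_0.
    apply: div_le => //; apply: Rle_trans (HM _ _ r1 hpsi) _.
    have kp := kap_gt0 a r r1; have Ma := Rabs_pos M; have Mb := Rle_abs M.
    rewrite (_ : kk a r = r * kap a r); last by rewrite /kap; field; lra.
    rewrite (_ : _ * Cmod _ = Rabs M * kap a r * (Cmod (pol r psi - s)%C / c)); last by field; lra.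
    apply: Rle_trans (_ : Rabs M * kap a r * r <= _).
      by rewrite (_ : M * (r * kap a r) = M * kap a r * r); [apply: Rmult_le_compat_r; nra|ring].
    apply: Rmult_le_compat_l; first by nra.
    by apply: le_div => //; nra.
case: (ex (- phi1)) => [|l1 H1]; first by rewrite Rabs_Ropp Rabs_pos_eq; lra.
case: (ex phi1) => [|l2 H2]; first by rewrite Rabs_pos_eq; lra.
exists l1, l2; split => //.
apply: (cauchy_formula (dsec th) G th phi1 r0 phi0 a (Rabs M)) => //; try lra.
- exact: copen_dsec.
- by move=> r psi r1 h; apply: dsec_pol => //; [lra|apply: Rabs_def1; lra].
- move=> r psi r1 h; apply: Rle_trans (HM _ _ r1 _) _; first lra.
  rewrite (_ : kk a r = r * kap a r); last by rewrite /kap; field; lra.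
  have kp := kap_gt0 a r r1; have Ma := Rabs_pos M; have Mb := Rle_abs M.
  apply: Rle_trans (_ : Rabs M * (r * kap a r) <= _); first by apply: Rmult_le_compat_r; nra.
  by apply: Rmult_le_compat_l; nra.
Qed.

(* k1 z, k2 z are the components of 1 / (z - s), as functions of s *)
Definition k1 (z s : C) : C := ((RtoC (fst z) - s) * nz z s)%C.
Definition k2 (z s : C) : C := (RtoC (- snd z) * nz z s)%C.

Definition qker (e : C -> C) (chi : R) (s : C) (t : R) : C :=
  (RtoC (snd (ray e chi t)) * k1 (pol t chi) s + RtoC (fst (ray e chi t)) * k2 (pol t chi) s)%C.

Definition eker e phi s t : C := (qker e phi s t - qker e (PI - phi) s t)%C.

Lemma qkerE e chi s t : e (Cconj (pol t chi)) = Cconj (e (pol t chi)) ->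
  s <> pol t chi -> s <> pol t (- chi) ->
  qker e chi s t = (/ (2 * Ci) * (ray (fun z => e z / (z - s)) chi t - ray (fun z => e z / (z - s)) (- chi) t))%C.
Proof.
move=> E n1 n2; rewrite -pol_conj in n2.
have ci : Ci <> 0%C by move=> /(f_equal snd) /=; lra.
have two : RtoC 2 <> 0%C by move=> /(f_equal fst) /=; lra.
have E2 : (expi (- chi) * e (pol t (- chi)))%C = Cconj (ray e chi t).
  by rewrite /ray Cmult_conj expi_conj -E pol_conj.
rewrite /ray (_ : (expi (- chi) * (e (pol t (- chi)) / (pol t (- chi) - s)))%C =
  (expi (- chi) * e (pol t (- chi)) / (pol t (- chi) - s))%C); last by rewrite /Cdiv; ring.
rewrite E2 (_ : (expi chi * (e (pol t chi) / (pol t chi - s)))%C = (ray e chi t / (pol t chi - s))%C); last by rewrite /ray /Cdiv; ring.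
rewrite /qker /k1 /k2 /nz -pol_conj; set a := ray e chi t; set z := pol t chi in n1 n2 *.
have d1 := Csub_neq0 _ _ n1; have d2 := Csub_neq0 _ _ n2.
have d3 : (z - s)%C <> 0%C by apply: Csub_neq0 => h; apply: n1.
have d4 : (Cconj z - s)%C <> 0%C by apply: Csub_neq0 => h; apply: n2.
have A2 : RtoC (snd a) = ((a - Cconj a) / (2 * Ci))%C by exact (im_alt a).
have A1 : RtoC (fst a) = ((a + Cconj a) / 2)%C by exact (re_alt a).
have Z2 : RtoC (- snd z) = (- ((z - Cconj z) / (2 * Ci)))%C by rewrite RtoC_opp -(im_alt z).
have Z1 : RtoC (fst z) = ((z + Cconj z) / 2)%C by exact (re_alt z).
have ii : (Ci * Ci)%C = (- (1))%C by apply: injective_projections => /=; ring.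
rewrite A1 A2 Z1 Z2; field; repeat split => //.
Qed.

Lemma ray_plusPI G eta t : ray G (eta + PI) t = ray (fun y => - G (- y))%C eta t.
Proof.
rewrite /ray -pol_opp (_ : expi (eta + PI) = (- expi eta)%C); first by ring.
by rewrite /expi cos_plus sin_plus cos_PI sin_PI /Copp /=; f_equal; ring.
Qed.

Lemma ray_minusPI G eta t : ray G (eta - PI) t = ray (fun y => - G (- y))%C eta t.
Proof.
rewrite -ray_plusPI /ray -(pol_2PI t (eta - PI)) (_ : eta - PI + 2 * PI = eta + PI); last by ring.
congr Cmult; rewrite /expi cos_minus sin_minus cos_plus sin_plus cos_PI sin_PI; f_equal; ring.
Qed.

Lemma kk_decay_ang th a M e : decay th a M e ->
  (forall r psi, 0 < r -> - th < psi < th -> Cmod (e (pol r psi)) <= M * kk a r) /\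
  (forall r psi, 0 < r -> - th < psi < th -> Cmod (e (- pol r psi)%C) <= M * kk a r).
Proof.
move=> H; split=> r psi r0 hp; first by apply: H => //; left; apply: Rabs_def1; lra.
by rewrite pol_opp; apply: H => //; apply: ang_plusPI; apply: Rabs_def1; lra.
Qed.

Lemma Cinv_opp (z : C) : (/ (- z))%C = (- / z)%C.
Proof.
apply: injective_projections; rewrite /= /Rdiv (_ : - fst z * (- fst z * 1) = fst z * (fst z * 1)) 1?(_ : - snd z * (- snd z * 1) = snd z * (snd z * 1)); ring.
Qed.

(* Partial fractions and Cauchy's formula: only the sector containing s
   contributes *)
Lemma eker_int th phi phi' e r psi : 0 < phi < phi' -> phi' < th -> th <= PI / 2 -> n0 th e ->
  0 < r -> psi = phi \/ psi = PI - phi ->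
  cii (eker e phi' (pol r psi)) (RtoC (- PI) * e (pol r psi))%C.
Proof.
move=> hp hp' hth ne r0 hpsi; case: (ne) => ge [a [M [ha hM H]]].
have p0 := PI_RGT_0; case: (kk_decay_ang _ _ _ _ H) => HA HB.
pose F z := (e z / (z - pol r psi))%C.
pose et y := e (- y)%C; pose B y := (et y / (y - pol r (psi + PI)))%C.
have gt : good th et by apply: good_opp_arg.
pose m := (phi + phi') / 2.
have am : ang m psi.
  case: hpsi => ->; [left; rewrite Rabs_pos_eq /m; lra|right].
  by rewrite (_ : _ - PI = - phi) ?Rabs_Ropp ?Rabs_pos_eq /m; lra.
have ne1 chi t : 0 < t -> m < chi < PI - m -> pol r psi <> pol t chi /\ pol r psi <> pol t (- chi).
  move=> t0 hchi; pose d := Rmin (chi - m) (PI - m - chi).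
  have d0 : 0 < d by apply: Rmin_glb_lt; lra.
  have d1 : d <= chi - m by apply: Rmin_l.
  have d2 : d <= PI - m - chi by apply: Rmin_r.
  have m0 : 0 < m by rewrite /m; lra.
  case: (dist_sector m chi d t r psi d0 m0 ltac:(lra) t0 r0 am) => h1 h2.
  have k0 := sqrt_cos_gt0 d ltac:(rewrite /m in m0 d1 d2; lra).
  by split; apply: Csub_diag_mod; nra.
have ce psi' t : 0 < t -> ang th psi' -> e (Cconj (pol t psi')) = Cconj (e (pol t psi')).
  by move=> t0 h; case: ge => _; apply; apply: dsec_ang => //; lra.
have EB eta t : (- F (- pol t eta))%C = B (pol t eta).
  rewrite /F /B /et -(pol_opp r psi) /Cdiv.
  have -> : (- pol t eta - pol r psi)%C = (- (pol t eta - - pol r psi))%C by ring.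
  by rewrite Cinv_opp; ring.
have [a1 [a2 [b1 [b2 [A1 A2 B1 B2 E]]]]] : exists a1 a2 b1 b2, [/\ cii (ray F (- phi')) a1, cii (ray F phi') a2,
    cii (ray B (- phi')) b1, cii (ray B phi') b2 & ((a2 - a1) - (b1 - b2) = - ((0, 2 * PI)%R * e (pol r psi)))%C].
  have he : hol (dsec th) e by case: ge.
  have het : hol (dsec th) et by case: gt.
  have hp1 : 0 < phi' < th by lra.
  pose k := cos (PI - phi - th).
  have k1 : k < 1 by rewrite /k -cos_0; apply: cos_decreasing_1; lra.
  case: hpsi => Epsi; subst psi.
  - case: (cauchy_inside th phi' e r phi a M hp1 hth he ha r0 ltac:(rewrite Rabs_pos_eq; lra) HA) => a1 [a2 [A1 A2 A3]].
    case: (cauchy_outside th phi' et r (phi + PI) k a M hp1 hth het ltac:(lra) r0 k1 _ HB) => [x hx|b [B1 B2]].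
      by apply: cos_far; [lra|split_Rabs; lra].
    exists a1, a2, b, b; split => //; rewrite -A3; ring.
  - case: (cauchy_outside th phi' e r (PI - phi) k a M hp1 hth he ltac:(lra) r0 k1 _ HA) => [x hx|b [B1 B2]].
      by apply: cos_far; [lra|split_Rabs; lra].
    have EP : PI - phi + PI = - phi + 2 * PI by ring.
    case: (cauchy_inside th phi' et r (- phi) a M hp1 hth het ha r0 ltac:(rewrite Rabs_Ropp Rabs_pos_eq; lra) HB) => a1 [a2 [A1 A2 A3]].
    exists b, b, a1, a2; rewrite /B EP pol_2PI; split => //; rewrite A3 /et pol_opp.
    by rewrite (_ : - phi + PI = PI - phi); ring.
have ci : Ci <> 0%C by move=> /(f_equal snd) /=; lra.
have two : RtoC 2 <> 0%C by move=> /(f_equal fst) /=; lra.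
rewrite (_ : (RtoC (- PI) * e (pol r psi))%C = (/ (2 * Ci) * ((a2 - a1) - (b1 - b2)))%C); last first.
  rewrite E (_ : (0, 2 * PI)%R = (2 * Ci * RtoC PI)%C); last by apply: injective_projections => /=; ring.
  by rewrite RtoC_opp; field.
apply: (cii_ext (fun t => / (2 * Ci) * ((ray F phi' t + (- (1)) * ray F (- phi') t) + (- (1)) * (ray B (- phi') t + (- (1)) * ray B phi' t)))%C).
  move=> t t0; rewrite /eker.
  case: (ne1 phi' t t0 ltac:(rewrite /m; lra)) => n1 n2.
  case: (ne1 (PI - phi') t t0 ltac:(rewrite /m; lra)) => n3 n4.
  have a1' : ang th phi' by left; rewrite Rabs_pos_eq; lra.
  have a2' : ang th (PI - phi').
    by right; rewrite (_ : PI - phi' - PI = - phi') ?Rabs_Ropp ?Rabs_pos_eq; lra.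
  rewrite (qkerE _ _ _ _ (ce _ _ t0 a1') n1 n2) (qkerE _ _ _ _ (ce _ _ t0 a2') n3 n4).
  have -> : ray (fun z => e z / (z - pol r psi))%C (PI - phi') t = ray B (- phi') t.
    by rewrite (_ : PI - phi' = - phi' + PI) ?ray_plusPI; [rewrite /ray -EB|ring].
  have -> : ray (fun z => e z / (z - pol r psi))%C (- (PI - phi')) t = ray B phi' t.
    by rewrite (_ : - (PI - phi') = phi' - PI) ?ray_minusPI; [rewrite /ray -EB|ring].
  rewrite -/F; ring.
rewrite (_ : (a2 - a1 - (b1 - b2))%C = (a2 + (- (1)) * a1 + (- (1)) * (b1 + (- (1)) * b2))%C); last by ring.
by apply: cii_mul; apply: cii_add; [apply: cii_add => //; apply: cii_mul|apply: cii_mul; apply: cii_add => //; apply: cii_mul].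
Qed.

Lemma n0_mul th e h : n0 th e -> n0 th h -> n0 th (fun z => e z * h z)%C.
Proof.
move=> ne [gh [a [M [ha hM H]]]]; apply: (n0_mul_bd _ _ _ M) => // r psi r0 hp.
apply: Rle_trans (H _ _ r0 hp) _; have k1 := kk_le1 a r; nra.
Qed.

Lemma ccont_comp_snd A psi q : ccont A (pol (snd q) psi) -> ccont (fun q => A (pol (snd q) psi)) q.
Proof.
have c1 : continuity_2d_pt (fun _ r => r * cos psi) (fst q) (snd q).
  by apply: continuity_2d_pt_mult; [exact: continuity_2d_pt_id2|exact: continuity_2d_pt_const].
have c2 : continuity_2d_pt (fun _ r => r * sin psi) (fst q) (snd q).
  by apply: continuity_2d_pt_mult; [exact: continuity_2d_pt_id2|exact: continuity_2d_pt_const].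
case=> cA1 cA2; split.
- exact: (continuity_2d_comp (fun x y => fst (A (x, y))) _ _ _ _ cA1 c1 c2).
- exact: (continuity_2d_comp (fun x y => snd (A (x, y))) _ _ _ _ cA2 c1 c2).
Qed.

Lemma ccont_comp_fst A psi q : ccont A (pol (fst q) psi) -> ccont (fun q => A (pol (fst q) psi)) q.
Proof.
have c1 : continuity_2d_pt (fun r _ => r * cos psi) (fst q) (snd q).
  by apply: continuity_2d_pt_mult; [exact: continuity_2d_pt_id1|exact: continuity_2d_pt_const].
have c2 : continuity_2d_pt (fun r _ => r * sin psi) (fst q) (snd q).
  by apply: continuity_2d_pt_mult; [exact: continuity_2d_pt_id1|exact: continuity_2d_pt_const].
case=> cA1 cA2; split.
- exact: (continuity_2d_comp (fun x y => fst (A (x, y))) _ _ _ _ cA1 c1 c2).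
- exact: (continuity_2d_comp (fun x y => snd (A (x, y))) _ _ _ _ cA2 c1 c2).
Qed.

Lemma ccont_fst G q : ccont G q -> ccont (fun q => RtoC (fst (G q))) q.
Proof. by case=> c1 _; split; [|exact: continuity_2d_pt_const]. Qed.

Lemma ccont_snd G q : ccont G q -> ccont (fun q => RtoC (snd (G q))) q.
Proof. by case=> _ c2; split; [|exact: continuity_2d_pt_const]. Qed.

Lemma ccont_sub G H z : ccont G z -> ccont H z -> ccont (fun w => G w - H w)%C z.
Proof. by move=> h1 h2; apply: ccont_add => //; exact: ccont_opp. Qed.

Lemma ccont_conj G z : ccont G z -> ccont (fun w => Cconj (G w)) z.
Proof. by case=> c1 c2; split => //; exact: continuity_2d_pt_opp. Qed.

Lemma ccont_qker e chi psi q : ccont e (pol (fst q) chi) ->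
  pol (snd q) psi <> pol (fst q) chi -> pol (snd q) psi <> pol (fst q) (- chi) ->
  ccont (fun q => qker e chi (pol (snd q) psi) (fst q)) q.
Proof.
move=> ce n1 n2.
have cz : ccont (fun q => pol (fst q) chi) q by apply: (ccont_comp_fst id); exact: ccont_id.
have cs : ccont (fun q => pol (snd q) psi) q by apply: (ccont_comp_snd id); exact: ccont_id.
have ca : ccont (fun q => ray e chi (fst q)) q.
  by apply: ccont_mul; [exact: ccont_const|exact: ccont_comp_fst].
have cn : ccont (fun q => nz (pol (fst q) chi) (pol (snd q) psi)) q.
  apply: (ccont_inv (fun q => (pol (snd q) psi - pol (fst q) chi) * (pol (snd q) psi - Cconj (pol (fst q) chi)))%C).
    by apply: ccont_mul; apply: ccont_sub => //; exact: ccont_conj.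
  by rewrite pol_conj; apply: Cmul_neq0; exact: Csub_neq0.
apply: ccont_add; apply: ccont_mul.
- exact: (ccont_snd (fun q => ray e chi (fst q))).
- apply: ccont_mul => //; apply: ccont_sub => //.
  exact: (ccont_fst (fun q => pol (fst q) chi)).
- exact: (ccont_fst (fun q => ray e chi (fst q))).
- apply: ccont_mul => //; have := ccont_opp _ _ (ccont_snd (fun q => pol (fst q) chi) q cz).
  case=> c1 c2; split => //; exact: continuity_2d_pt_const.
Qed.

Lemma qker_bound th chi d e a M : 0 < d -> 0 < th -> th + d <= chi <= PI - th - d ->
  (forall t, 0 < t -> Cmod (e (pol t chi)) <= M * kk a t) ->
  forall r psi t, 0 < r -> 0 < t -> ang th psi ->
  Cmod (qker e chi (pol r psi) t) <= 2 * M / ((1 - cos d) / 2) * kap a t.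
Proof.
move=> d0 th0 hchi H r psi t r0 t0 ha; have p0 := PI_RGT_0.
have nb := nz_bound th chi d t r psi d0 th0 hchi t0 r0 ha.
have k0 := sin_cos_gt d ltac:(lra); move: nb k0; set c := (1 - cos d) / 2; set N := nz _ _ => nb k0.
set A := ray e chi t; have HA : Cmod A <= M * kk a t by rewrite Cmod_ray; exact: H.
have N0 := Cmod_ge_0 N; have A0 := Cmod_ge_0 A.
have b1 : Cmod (k1 (pol t chi) (pol r psi)) <= / (c * t).
  rewrite /k1 Cmod_mult -/N; have l : Cmod (RtoC (fst (pol t chi)) - pol r psi)%C <= t + r.
    apply: Rle_trans (Cmod_triangle _ _) _; rewrite Cmod_opp Cmod_pol; last lra.
    by rewrite Cmod_R; have := fst_le_Cmod (pol t chi); rewrite Cmod_pol; lra.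
  apply: Rle_trans (_ : (t + r) * / (c * (r + t) ^ 2) <= _).
    by apply: Rmult_le_compat => //; exact: Cmod_ge_0.
  rewrite (_ : (t + r) * _ = / (c * (t + r))); last by field; lra.
  by apply: Rinv_le_contravar; nra.
have b2 : Cmod (k2 (pol t chi) (pol r psi)) <= / (c * t).
  rewrite /k2 Cmod_mult -/N Cmod_R Rabs_Ropp.
  have l : Rabs (snd (pol t chi)) <= t by have := snd_le_Cmod (pol t chi); rewrite Cmod_pol; lra.
  apply: Rle_trans (_ : t * / (c * (r + t) ^ 2) <= _).
    by apply: Rmult_le_compat => //; exact: Rabs_pos.
  apply: div_le; first by apply: Rmult_lt_0_compat => //; apply: pow_lt; lra.
  rewrite (_ : / (c * t) * _ = (r + t) ^ 2 / t); last by field; lra.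
  by apply: le_div; nra.
have f1 := fst_le_Cmod A; have f2 := snd_le_Cmod A.
rewrite /qker -/A; move: (k1 _ _) (k2 _ _) b1 b2 => K1 K2 b1 b2.
apply: Rle_trans (Cmod_triangle _ _) _; rewrite !Cmod_mult !Cmod_R.
have i0 : 0 < / (c * t) by apply: Rinv_0_lt_compat; nra.
apply: Rle_trans (_ : Cmod A * / (c * t) + Cmod A * / (c * t) <= _).
  by apply: Rplus_le_compat; apply: Rmult_le_compat => //; first [exact: Rabs_pos|exact: Cmod_ge_0].
rewrite (_ : 2 * M / c * kap a t = M * kk a t * / (c * t) + M * kk a t * / (c * t)); last by rewrite /kap; field; lra.
nra.
Qed.

Section Product.
Context {n : nat} {V : right_hilbert_module n} {T : operator V} {om : R} {HT : bisect T om}.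
Local Notation Nz := (Nz T).
Local Notation R1 := (R1 T).
Local Notation R2 := (R2 T).
Local Notation rho := (rho (T := T)).
Local Notation calc := (calc T).
Local Notation cint := (cint (T := T)).
Let om_bounds := bisect_om (T := T).

Lemma qker_ii th phi h chi t c v w : om < phi < th -> th < chi < PI - th -> 0 < t -> n0 th h ->
  ii (pint phi (fun s => h s * rho v w s * (RtoC (snd c) * k1 (pol t chi) s + RtoC (fst c) * k2 (pol t chi) s))%C)
     (- PI * ipr (imR (T := T) (pol t chi) c (calc phi h v)) w).
Proof.
move=> hp hchi t0 nh; have hom := om_bounds; have p0 := PI_RGT_0; have hth : th <= PI / 2 by lra.
case: (calc_Nz (T := T) th phi h t chi hp hchi t0 nh) => n1 E1 n2 E2.
set z := pol t chi in n1 E1 n2 E2 *.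
have i1 := @calc_ipr _ _ T om HT th phi _ v w hp hth n1; rewrite E1 in i1.
have i2 := @calc_ipr _ _ T om HT th phi _ v w hp hth n2; rewrite E2 in i2.
have := ii_lincomb _ _ (snd c * fst z - fst c * snd z) (- snd c) _ _ i1 i2.
set x := calc phi h v; set a := - PI * _; set b := - PI * _; set l := _ + _.
rewrite (_ : - PI * ipr _ w = l).
  by apply: ii_ext => r r0; rewrite /pint /ray /k1 /k2 /=; ring.
rewrite /l /a /b /imR /R1 /R2 !iprE; ring.
Qed.

Lemma calc_mul th phi e h v : om < phi < th -> th < PI / 2 -> n0 th e -> n0 th h ->
  calc phi e (calc phi h v) = calc phi (fun z => e z * h z)%C v.
Proof.
move=> hp hth ne nh; have hom := om_bounds; have p0 := PI_RGT_0; have hth' : th <= PI / 2 by lra.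
pose phi' := (phi + th) / 2; pose m := (phi + phi') / 2.
have hphi' : phi < phi' < th by rewrite /phi'; lra.
have hm : phi < m < phi' by rewrite /m; lra.
rewrite (calc_indep (T := T) th phi phi' e) //; try lra.
set x := calc phi h v; apply: ipr_ext => w.
have nh' : n0 m h by apply: (n0_le _ th) => //; lra.
have nm := n0_mul _ _ _ ne nh.
case: (ne) => -[he ce] [a [M [ha hM HM]]]; case: (nh) => -[hh ch] [b [N [hb hN HN]]].
case: (grho_bound (T := T) th phi h b N v w _ _ HN hN) => // [||K K0 HK]; try lra.
pose f t r := pint phi (fun s => h s * rho v w s * eker e phi' s t)%C r.
pose G t := - PI * ipr (cint phi' e x t) w.
pose H r := - PI * pint phi (fun s => e s * h s * rho v w s)%C r.
pose d := Rmin (phi' - m) (PI - m - (PI - phi')).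
have d0 : 0 < d by apply: Rmin_glb_lt; lra.
have d1 : d <= phi' - m by apply: Rmin_l.
have cp := sin_cos_gt d ltac:(lra); set c := (1 - cos d) / 2 in cp.
have a1 : ang th phi' by left; rewrite Rabs_pos_eq; lra.
have a2 : ang th (PI - phi').
  by right; rewrite (_ : PI - phi' - PI = - phi') ?Rabs_Ropp ?Rabs_pos_eq; lra.
have am psi : psi = phi \/ psi = PI - phi -> ang m psi.
  case=> ->; [by left; rewrite Rabs_pos_eq; lra|right].
  by rewrite (_ : PI - phi - PI = - phi) ?Rabs_Ropp ?Rabs_pos_eq; lra.
have ath psi : psi = phi \/ psi = PI - phi -> ang th psi by move/am; apply: ang_le; lra.
have pb psi : psi = phi \/ psi = PI - phi -> phi <= psi <= PI - phi by case=> ->; lra.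
have qb r psi t : 0 < r -> 0 < t -> ang m psi -> Cmod (eker e phi' (pol r psi) t) <= 2 * (2 * M / c * kap a t).
  move=> r0 t0 am1; apply: Rle_trans (Cmod_triangle _ _) _; rewrite Cmod_opp.
  have := qker_bound m phi' d e a M d0 ltac:(lra) ltac:(lra) (fun t t0 => HM t phi' t0 a1) r psi t r0 t0 am1.
  have := qker_bound m (PI - phi') d e a M d0 ltac:(lra) ltac:(lra) (fun t t0 => HM t _ t0 a2) r psi t r0 t0 am1.
  rewrite -/c; lra.
have Mc : 0 <= 2 * M / c by apply: Rdiv_le_0_compat; lra.
have E : - PI * (- PI * ipr (calc phi' e x) w) = - PI * (- PI * ipr (calc phi (fun z => e z * h z)%C v) w).
  apply: (ii_fubini f (fun t => 4 * (2 * M / c) * kap a t) (fun r => K * kap b r) G H).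
  - move=> t r t0 r0.
    have cc psi : psi = phi \/ psi = PI - phi ->
        continuity_2d_pt (fun t r => snd (expi psi * (h (pol r psi) * rho v w (pol r psi) * eker e phi' (pol r psi) t))%C) t r.
      move=> hpsi.
      have D : dsec th (pol r psi) by apply: dsec_ang => //; [lra|exact: ath].
      have O : outer om (pol r psi) by case: (outer_two (T := T) th phi r) => // O1 O2; case: hpsi => ->.
      suff : ccont (fun q => expi psi * (h (pol (snd q) psi) * rho v w (pol (snd q) psi) * eker e phi' (pol (snd q) psi) (fst q)))%C (t, r) by case.
      apply: ccont_mul; first exact: ccont_const.
      have ne1 chi : m + d <= chi <= PI - m - d -> pol r psi <> pol t chi /\ pol r psi <> pol t (- chi).
        move=> hchi; have m0 : 0 < m by lra.
        case: (dist_sector m chi d t r psi d0 m0 hchi t0 r0 (am _ hpsi)) => h1 h2.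
        have k0 := sqrt_cos_gt0 d ltac:(lra).
        by split; apply: Csub_diag_mod; nra.
      apply: ccont_mul; last first.
        case: (ne1 phi') => [|n1 n2]; first lra.
        case: (ne1 (PI - phi')) => [|n3 n4]; first lra.
        apply: ccont_sub; apply: ccont_qker => //; apply: (hol_ccont (dsec th)) => //.
        + by apply: dsec_ang => //; lra.
        + by apply: dsec_ang => //; lra.
      apply: (ccont_comp_snd (fun s => h s * rho v w s)%C psi (t, r)).
      apply: ccont_mul; first by apply: (hol_ccont (dsec th)).
      by apply: hol_ccont (rho_hol v w) _.
    by apply: continuity_2d_pt_minus; apply: cc; [left|right].
  - move=> t r t0 r0.
    have bb psi : psi = phi \/ psi = PI - phi ->
        Rabs (snd (ray (fun s => h s * rho v w s * eker e phi' s t)%C psi r)) <= K * kap b r * (2 * (2 * M / c * kap a t)).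
      move=> hpsi; apply: Rle_trans (snd_le_Cmod _) _; rewrite Cmod_ray Cmod_mult.
      apply: Rmult_le_compat; try exact: Cmod_ge_0.
      + by apply: HK => //; [exact: ath|exact: pb].
      + by apply: qb => //; exact: am.
    have := bb phi ltac:(left; reflexivity); have := bb (PI - phi) ltac:(right; reflexivity).
    rewrite /f /pint; split_Rabs; lra.
  - by move=> t t0; have := kap_gt0 a t t0; move=> k0; apply: Rmult_le_pos; lra.
  - by move=> r r0; have := kap_gt0 b r r0; move=> k0; apply: Rmult_le_pos; lra.
  - by apply: (@ii_scal R_CompleteNormedModule); apply: ii_kap; lra.
  - by apply: (@ii_scal R_CompleteNormedModule); apply: ii_kap; lra.
  - move=> t t0.
    have i1 := @qker_ii m phi h phi' t (ray e phi' t) v w ltac:(lra) ltac:(lra) t0 nh'.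
    have i2 := @qker_ii m phi h (PI - phi') t (ray e (PI - phi') t) v w ltac:(lra) ltac:(lra) t0 nh'.
    have := @ii_minus R_CompleteNormedModule _ _ _ _ i1 i2.
    rewrite (_ : minus _ _ = G t); last by rewrite /G /cint iprE -/x /minus /plus /opp /=; ring.
    apply: ii_ext => r r0; rewrite /f /pint /minus /plus /opp /ray /eker /qker /=; ring.
  - move=> r r0.
    have ek psi : psi = phi \/ psi = PI - phi ->
        ii (fun t => snd (ray (fun s => h s * rho v w s * eker e phi' s t)%C psi r))
           (- PI * snd (ray (fun s => e s * h s * rho v w s)%C psi r)).
      move=> hpsi; have := eker_int th phi phi' e r psi ltac:(lra) ltac:(lra) hth' ne r0 hpsi.
      move/(cii_mul (expi psi * (h (pol r psi) * rho v w (pol r psi)))%C) => -[_].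
      rewrite (_ : snd (_ * (RtoC (- PI) * _))%C = - PI * snd (ray (fun s => e s * h s * rho v w s)%C psi r)).
        by apply: ii_ext => t t0; rewrite /ray -Cmult_assoc.
      rewrite /ray -[RHS]/(- PI * _); set s := pol r psi.
      rewrite (_ : (_ * (RtoC (- PI) * e s))%C = (RtoC (- PI) * (expi psi * (e s * h s * rho v w s)))%C); last by ring.
      by rewrite /=; ring.
    have := @ii_minus R_CompleteNormedModule _ _ _ _ (ek phi ltac:(left; reflexivity)) (ek (PI - phi) ltac:(right; reflexivity)).
    by rewrite (_ : minus _ _ = H r) // /H /pint /minus /plus /opp /=; ring.
  - apply: (@ii_scal R_CompleteNormedModule).
    apply: (ii_ext (V := R_CompleteNormedModule) (pint phi' (fun z => e z * rho x w z)%C)).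
      by move=> r r0; rewrite ipr_cint.
    by apply: (@calc_ipr _ _ T om HT th) => //; lra.
  - by apply: (@ii_scal R_CompleteNormedModule); apply: (@calc_ipr _ _ T om HT th).
have P2 : 0 < PI * PI by nra.
nra.
Qed.

End Product.

Definition rot (z : C) : C := (- snd z, fst z).

Lemma ccont_rot G z : ccont G (rot z) -> ccont (fun s => G (rot s)) z.
Proof.
have c1 : continuity_2d_pt (fun _ v => - v) (fst z) (snd z).
  by apply: continuity_2d_pt_opp; apply: continuity_2d_pt_id2.
have c2 : continuity_2d_pt (fun u _ => u) (fst z) (snd z) by apply: continuity_2d_pt_id1.
case=> g1 g2; split.
- exact: (continuity_2d_comp (fun u v => fst (G (u, v))) _ _ _ _ g1 c1 c2).
- exact: (continuity_2d_comp (fun u v => snd (G (u, v))) _ _ _ _ g2 c1 c2).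
Qed.

Lemma hol_rot (U U' : C -> Prop) G : (forall z, U' z -> U (rot z)) -> hol U G -> hol U' (fun z => G (rot z)).
Proof.
move=> HU [D HD]; exists (fun z => rot (D (rot z))) => z /HU /HD [[d1 d2 d3 d4] cG cD].
split; [split|exact: ccont_rot|].
- exact: d3.
- exact: d4.
- exact: (is_derive_comp_opp (fun t => fst (G (t, fst z)))).
- exact: (is_derive_comp_opp (fun t => snd (G (t, fst z)))).
- by case: (ccont_rot _ _ cD) => c1 c2; split => //; exact: continuity_2d_pt_opp.
Qed.

Lemma rot_pol r eta : rot (pol r eta) = pol r (PI / 2 + eta).
Proof. by rewrite /rot /pol /= cos_plus sin_plus cos_PI2 sin_PI2; f_equal; ring. Qed.

Lemma ray_rot F eta t : ray F (PI / 2 + eta) t = ((0, 1)%R * ray (fun z => F (rot z)) eta t)%C.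
Proof.
rewrite /ray rot_pol Cmult_assoc; congr Cmult.
by rewrite /expi cos_plus sin_plus cos_PI2 sin_PI2; apply: injective_projections => /=; ring.
Qed.

Lemma dsec_rot om z : 0 <= om <= PI / 2 -> dsec (PI / 2 - om) z -> outer om (rot z).
Proof.
move=> hom; rewrite /dsec /outer cos_shift /= Rabs_Ropp => h.
have sx := Cmod_sqr z; have sr : Cmod (rot z) ^ 2 = Cmod z ^ 2 by rewrite !Cmod_sqr /=; ring.
have E : Cmod (rot z) = Cmod z.
  by apply: Rle_antisym; apply: pow2_le_inv; try exact: Cmod_ge_0; rewrite sr; exact: Rle_refl.
rewrite E; apply: Rnot_le_lt => h'.
have s2 := sin2_cos2 om; rewrite /Rsqr in s2.
have z0 := Cmod_ge_0 z.
have c0 : 0 <= cos om by apply: cos_ge_0; lra.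
have s0 : 0 <= sin om by apply: sin_ge_0; have := PI_RGT_0; lra.
have q1 : (cos om * Cmod z) ^ 2 <= snd z ^ 2 by rewrite -(pow2_abs (snd z)); apply: pow_incr; split => //; nra.
have q2 : (sin om * Cmod z) ^ 2 < fst z ^ 2.
  rewrite -(pow2_abs (fst z)); have : 0 <= sin om * Cmod z by nra.
  by move=> p; nra.
have : (sin om * Cmod z) ^ 2 + (cos om * Cmod z) ^ 2 = Cmod z ^ 2.
  by rewrite (_ : _ + _ = (sin om * sin om + cos om * cos om) * Cmod z ^ 2); [rewrite s2; ring|ring].
lra.
Qed.

Definition e0 (z : C) : C := (z * nz (0, 1)%R z)%C.

Lemma pol_1_PI2 : pol 1 (PI / 2) = (0, 1)%R.
Proof. by rewrite /pol cos_PI2 sin_PI2; f_equal; ring. Qed.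

Lemma n0_e0 th : 0 < th < PI / 2 -> n0 th e0.
Proof.
move=> hth; split.
  apply: good_mul; first exact: good_id.
  by apply: good_nz; rewrite -pol_1_PI2; apply: outer_pol; lra.
have p0 := PI_RGT_0; pose d := PI / 2 - th; have cp := sin_cos_gt d ltac:(rewrite /d; lra).
exists 1, (/ ((1 - cos d) / 2)); split; [lra|by apply: Rlt_le; apply: Rinv_0_lt_compat|].
move=> r psi r0 ha; rewrite Cmod_mult Cmod_pol; last lra.
have := nz_bound th (PI / 2) d 1 r psi ltac:(rewrite /d; lra) ltac:(lra) ltac:(rewrite /d; lra) Rlt_0_1 r0 ha.
rewrite pol_1_PI2 => nb; move: cp nb; set c := (1 - cos d) / 2 => cp nb.
have kE : kk 1 r = r / (1 + r ^ 2) by rewrite kkE Rpower_1.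
rewrite kE; apply: Rle_trans (Rmult_le_compat_l _ _ _ (Rlt_le _ _ r0) nb) _.
rewrite (_ : / c * (r / _) = r * / (c * (1 + r ^ 2))); last by field; split; nra.
apply: Rmult_le_compat_l; first lra.
by apply: Rinv_le_contravar; nra.
Qed.

Section Regularizer.
Context {n : nat} {V : right_hilbert_module n} {T : operator V} {om : R} {HT : bisect T om}.
Local Notation Nz := (Nz T).
Local Notation R1 := (R1 T).
Local Notation rho := (rho (T := T)).
Local Notation calc := (calc T).
Let om_bounds := bisect_om (T := T).

(* Cauchy's formula at i, in the sectors around the imaginary axis *)
Lemma calc_e0 th phi v : om < phi < th -> th < PI / 2 -> calc phi e0 v = T (Nz (0, 1)%R v).
Proof.
move=> hp hth; have hom := om_bounds; have p0 := PI_RGT_0.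
have n0e : n0 th e0 by apply: n0_e0; lra.
apply: (calc_char (T := T) th) => // [|w]; first lra.
set s := (0, 1)%R.
have n1 w' := calc_ipr (T := T) th phi e0 v w' hp ltac:(lra) n0e.
have := n1 w.
pose F z := (e0 z * rho v w z)%C; pose G z := (z * / (z + 1) * rho v w (rot z))%C.
pose eta := PI / 2 - phi; pose th2 := PI / 2 - om.
case: (rho_bound (T := T) phi) => [|K K0 HK]; first lra.
have nv := norm_ge_0 v; have nw := norm_ge_0 w.
set Kv := K * norm v * norm w.
have Kv0 : 0 <= Kv by repeat apply: Rmult_le_pos.
pose U z := dsec th2 z /\ z <> (- (1))%C.
have oU : copen U by apply: copen_and; [exact: copen_dsec|exact: copen_neq].
have E1 : (- (1))%C = pol 1 PI by rewrite /pol cos_PI sin_PI; apply: injective_projections => /=; ring.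
have D1 psi r : 0 < r -> - PI / 2 <= psi <= PI / 2 -> sqrt ((1 - 0) / 2) * (r + 1) <= Cmod (pol r psi + 1)%C.
  move=> r0 hpsi; rewrite (_ : (pol r psi + 1)%C = (pol r psi - pol 1 PI)%C); last by rewrite -E1; ring.
  apply: dist_pol_cos; try lra.
  rewrite cos_minus cos_PI sin_PI; have := cos_ge_0 psi ltac:(lra) ltac:(lra); lra.
have c0 : 0 < sqrt ((1 - 0) / 2) by apply: sqrt_lt_R0; lra.
set c := sqrt _ in D1 c0.
have UU r psi : 0 < r -> - th2 < psi < th2 -> U (pol r psi).
  move=> r0 h; split; first by apply: dsec_pol => //; rewrite /th2; [lra|apply: Rabs_def1; rewrite -/th2; lra].
  move=> E; have := D1 psi r r0 ltac:(rewrite /th2 in h; lra).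
  by rewrite E (_ : (- (1) + 1)%C = 0%C) ?Cmod_0; [nra|ring].
have hG : hol U G.
  apply: hol_mul.
    apply: hol_mul; first exact: hol_id.
    apply: hol_inv; first by apply: hol_add; [exact: hol_id|exact: hol_const].
    by move=> z [_ nz1] E; apply: nz1; rewrite (_ : z = (z + 1 + - (1))%C); [rewrite E|]; ring.
  apply: (hol_rot (outer om) U (rho v w)); last exact: rho_hol.
  by move=> z [h _]; apply: dsec_rot => //; lra.
have GB r psi : 0 < r -> - eta <= psi <= eta -> Cmod (G (pol r psi)) <= Kv / c * ((1 + r) * kap 1 r).
  move=> r0 hpsi; have l := D1 psi r r0 ltac:(rewrite /eta in hpsi; lra).
  rewrite /G !Cmod_mult Cmod_pol; last lra.
  rewrite Cmod_inv; last by apply/Cmod_gt_0; nra.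
  rewrite rot_pol kap1 //.
  have cz : cone phi (pol r (PI / 2 + psi)) by apply: cone_pol; rewrite /eta in hpsi; lra.
  have b := HK _ v w cz; rewrite Cmod_pol in b; last lra.
  apply: Rle_trans (_ : r * / (c * (r + 1)) * (K / r * norm v * norm w) <= _).
    apply: Rmult_le_compat => //; try exact: Cmod_ge_0.
      by apply: Rmult_le_pos; [lra|apply: Rlt_le; apply: Rinv_0_lt_compat; nra].
    by apply: Rmult_le_compat_l; [lra|apply: Rinv_le_contravar; nra].
  rewrite (_ : r * _ * _ = Kv / c * / (r + 1)); last by rewrite /Kv; field; lra.
  apply: Rmult_le_compat_l; first exact: Rdiv_le_0_compat.
  apply: (Rmult_le_reg_r (r + 1)); first lra.
  rewrite Rinv_l; last lra.
  rewrite (_ : _ * / _ * _ = (1 + r) * (r + 1) / (1 + r ^ 2)); last by field; nra.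
  by apply: le_div; nra.
case: (n0e) => ge [a [M [ha hM H]]].
case: (grho_bound (T := T) th phi e0 a M v w) => // [||L L0 HL]; try lra.
have D2 psi r : 0 < r -> Rabs psi = eta -> ray F (PI / 2 + psi) r = ray (fun z => G z / (z - pol 1 0))%C psi r.
  move=> r0 hpsi; rewrite ray_rot /ray; set z := pol r psi.
  have E0 : pol 1 0 = RtoC 1 by rewrite /pol cos_0 sin_0; apply: injective_projections => /=; ring.
  have z1 : (z + 1)%C <> 0%C.
    by apply/Cmod_gt_0; have := D1 psi r r0 ltac:(move: hpsi; rewrite /eta; split_Rabs; lra); rewrite -/z; nra.
  have z2 : (z - 1)%C <> 0%C.
    rewrite -E0; apply: Csub_neq0; apply: pol_neq; first lra.
    rewrite Rminus_0_r => Es; have : sin (Rabs psi) = 0.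
      by case: (Rle_lt_dec 0 psi) => h; [rewrite Rabs_pos_eq|rewrite Rabs_left // sin_neg Es; ring].
    by rewrite hpsi => h; have := sin_gt_0 eta ltac:(rewrite /eta; lra) ltac:(rewrite /eta; lra); lra.
  rewrite E0 /F /e0 /G.
  have -> : nz (0, 1)%R (rot z) = (- / ((z - 1) * (z + 1)))%C.
    rewrite -Cinv_opp /nz; congr Cinv; rewrite /rot; case: z {z1 z2} => x y.
    by apply: injective_projections => /=; ring.
  have -> : rot z = ((0, 1)%R * z)%C by rewrite /rot; apply: injective_projections => /=; ring.
  rewrite (_ : ((0, 1)%R * _)%C = - ((0, 1)%R * (0, 1)%R) * (expi psi * (z * / ((z - 1) * (z + 1)) * rho v w ((0, 1)%R * z))))%C; last by ring.
  rewrite (_ : (- ((0, 1)%R * (0, 1)%R))%C = RtoC 1); last by apply: injective_projections => /=; ring.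
  by field.
have ex psi : ang th (PI / 2 + psi) -> Rabs psi = eta -> exists l, cii (ray F (PI / 2 + psi)) l.
  move=> ha' h; have p1 : phi <= PI / 2 + psi <= PI - phi by move: h; rewrite /eta; split_Rabs; lra.
  apply: (cii_ray_ex _ _ L a) => [|r r0|r r0]; first lra; last exact: HL.
  apply: ccont_mul; first by case: ge => h1 _; apply: hol_ccont h1 _; apply: dsec_ang => //; lra.
  by apply: hol_ccont (rho_hol v w) _; apply: outer_pol; lra.
have Er : PI / 2 + - eta = phi by rewrite /eta; lra.
have El : PI / 2 + eta = PI - phi by rewrite /eta; lra.
case: (ex (- eta)) => [||l1 H1].
- by rewrite Er; left; rewrite Rabs_pos_eq; lra.
- by rewrite Rabs_Ropp Rabs_pos_eq /eta; lra.
case: (ex eta) => [||l2 H2].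
- by rewrite El; right; rewrite (_ : _ - PI = - phi) ?Rabs_Ropp ?Rabs_pos_eq; lra.
- by rewrite Rabs_pos_eq /eta; lra.
have : (l1 - l2 = (0, 2 * PI)%R * G (pol 1 0))%C.
  apply: (cauchy_formula U G th2 eta 1 0 1 (Kv / c)) => //; try lra.
  - by rewrite Rabs_R0 /eta; lra.
  - by rewrite /eta /th2; lra.
  - by apply: cii_ext H1 => r r0; apply: D2 => //; rewrite Rabs_Ropp Rabs_pos_eq /eta; lra.
  - by apply: cii_ext H2 => r r0; apply: D2 => //; rewrite Rabs_pos_eq /eta; lra.
have -> : G (pol 1 0) = (RtoC (/ 2) * rho v w s)%C.
  rewrite /G rot_pol Rplus_0_r pol_1_PI2 (_ : pol 1 0 = RtoC 1); last by rewrite /pol cos_0 sin_0; apply: injective_projections => /=; ring.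
  by congr Cmult; apply: injective_projections => /=; field.
move/(f_equal snd); rewrite /= => EE.
rewrite Er in H1; rewrite El in H2; case: H1 => _ H1; case: H2 => _ H2.
have I := @ii_minus R_CompleteNormedModule _ _ _ _ H1 H2.
rewrite -/(pint phi F) => J; move: I; rewrite (_ : minus _ _ = - PI * ipr (T (Nz s v)) w) //.
rewrite /minus /plus /opp /= (_ : snd l1 + - snd l2 = PI * ipr (R1 s v) w); last by rewrite EE; field.
by rewrite /R1 !iprE /s /=; ring.
Qed.

End Regularizer.

Lemma polar_dsec th z : 0 < th < PI / 2 -> dsec th z -> exists2 psi, ang th psi & z = pol (Cmod z) psi.
Proof.
have pos x y : 0 < th < PI / 2 -> 0 < x -> dsec th (x, y) ->
    Rabs (atan (y / x)) < th /\ (x, y) = pol (Cmod (x, y)) (atan (y / x)).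
  move=> hth x0; set psi := atan _ => D.
  have m0 : 0 < Cmod (x, y) by apply/Cmod_gt_0 => -[E _]; lra.
  have q : sqrt (1 + (y / x)²) = Cmod (x, y) / x.
    rewrite /Cmod /= (_ : 1 + (y / x)² = (x * (x * 1) + y * (y * 1)) / (x * x)); last by rewrite /Rsqr; field; lra.
    by rewrite sqrt_div_alt ?sqrt_square //; nra.
  have c : cos psi = x / Cmod (x, y) by rewrite /psi cos_atan q; field; lra.
  have s : sin psi = y / Cmod (x, y) by rewrite /psi sin_atan q; field; lra.
  split; last by rewrite /pol c s; f_equal; field; lra.
  apply: Rnot_le_lt => h; have hb : Rabs psi <= PI / 2 by have := atan_bound (y / x); rewrite -/psi => hb; split_Rabs; lra.
  have l : cos (Rabs psi) <= cos th by apply: cos_decr_1; lra.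
  have E : cos (Rabs psi) = cos psi by rewrite /Rabs; case: Rcase_abs => // _; rewrite cos_neg.
  move: D; rewrite /dsec /= Rabs_pos_eq; last lra.
  rewrite E c in l => D; have : x <= cos th * Cmod (x, y).
    by have := Rmult_le_compat_r _ _ _ (Rlt_le _ _ m0) l; rewrite /Rdiv Rmult_assoc Rinv_l; lra.
  lra.
move=> hth; case: z => x y D; case: (Rlt_le_dec 0 x) => x0.
  by case: (pos x y hth x0 D) => h1 h2; exists (atan (y / x)) => //; left.
have x1 : x <> 0.
  move=> E; move: D; rewrite E /dsec /= Rabs_R0 => D.
  have c0 : 0 < cos th by apply: cos_gt_0; lra.
  by have := Cmod_ge_0 (0, y); nra.
case: (pos (- x) (- y) hth ltac:(lra) (dsec_opp th (x, y) D)) => h1 h2.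
set psi := atan _ in h1 h2; exists (psi + PI); first exact: ang_plusPI.
have E : (x, y) = (- (- x, - y)%R)%C by rewrite /Copp /= !Ropp_involutive.
by rewrite {1}E h2 pol_opp -[(- x, - y)%R]/(- (x, y))%C Cmod_opp.
Qed.

Section Lift.
Context {n : nat}.

Definition slice_rep (th : R) (f : Cl n -> Cl n) (g : C -> C) :=
  forall J z, im_unit J -> dsec th z -> f (sl J z) = sl J (g z).

(* For real s the quotient by cl_norm v = 0 is multiplied by v = 0. *)
Definition lift (g : C -> C) (s : Cl n) : Cl n :=
  let v := cl_add s (cl_real n (- Sc s)) in let z := (Sc s, cl_norm v) in
  cl_add (cl_real n (fst (g z))) (cl_scal (snd (g z) / cl_norm v) v).

Lemma slice_rep_lift th g : (forall z, dsec th z -> g (Cconj z) = Cconj (g z)) -> slice_rep th (lift g) g.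
Proof.
move=> Hc J [x y] HJ D; rewrite /lift /sl /= Sc_slice //.
have -> : cl_add (slice_pt J x y) (cl_real n (- x)) = slice_pt J 0 y.
  by apply/ffunP => A; rewrite !(cl_addE, cl_scalE, cl_realE); case: eqP => _; ring.
rewrite cl_norm_slice // (_ : Cmod (0, y) = Rabs y); last first.
  by rewrite /Cmod /= (_ : 0 * _ + _ = Rsqr y) ?sqrt_Rsqr_abs // /Rsqr; ring.
have H0 := Hc _ D; rewrite /Cconj /= in H0.
have -> : cl_scal (snd (g (x, Rabs y)) / Rabs y) (slice_pt J 0 y) = slice_pt J 0 (snd (g (x, y))).
  rewrite slice_scal // Rmult_0_r; congr slice_pt.
  case: (Rtotal_order y 0) => [h|[h|h]].
  - by rewrite Rabs_left // H0 /=; field; lra.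
  - by move: H0; rewrite h Rabs_R0 Ropp_0 => /(f_equal snd) /=; lra.
  - by rewrite Rabs_pos_eq; [field|]; lra.
have -> : fst (g (x, Rabs y)) = fst (g (x, y)).
  by rewrite /Rabs; case: Rcase_abs => // _; rewrite H0.
by apply/ffunP => A; rewrite !(cl_addE, cl_scalE, cl_realE); case: eqP => _; ring.
Qed.

Lemma slice_rep_mul th e f ge gf : slice_rep th e ge -> slice_rep th f gf ->
  slice_rep th (fun_mul e f) (fun z => ge z * gf z)%C.
Proof.
move=> He Hf J z HJ D; rewrite /fun_mul He // Hf // /sl slice_mul //=.
Qed.

Hypothesis n_gt0 : (0 < n)%N.

Lemma dsector_ex th s : 0 < th < PI / 2 -> dsector th (s : Cl n) -> exists J z, [/\ im_unit J, dsec th z & s = sl J z].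
Proof.
move=> hth D; have ps : paravector s.
  case: D => -[ps _ _] // A cA; have := ps A cA; rewrite cl_oppE; lra.
case: (paravector_ex s n_gt0 ps) => J [x [y [HJ E]]].
exists J, (x, y); split => //.
by apply/(dsector_sl J th (x, y)) => //; rewrite /sl /= -E.
Qed.

Lemma n0_N0 th f g : 0 < th < PI / 2 -> slice_rep th f g -> n0 th g -> Defs.N0 (@dsector n th) f.
Proof.
move=> hth Hf [[hg cg] [a [M [ha hM H]]]]; split; first exact: (hol_intrinsic n_gt0 th f g).
exists a, M; split => //; first lra.
move=> s /(dsector_ex th s hth) [J [z [HJ D ->]]].
rewrite Hf // !cl_norm_sl //; case: (polar_dsec th z hth D) => psi ap ->.
have m0 : 0 < Cmod z by apply/Cmod_gt_0; exact: dsec_neq0 D.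
rewrite Cmod_pol; last lra.
by apply: Rle_trans (H _ _ m0 ap) _; rewrite /kk; apply: Req_le; rewrite /Rdiv; ring.
Qed.

Lemma N0_n0 th f : 0 < th < PI / 2 -> Defs.N0 (@dsector n th) f -> exists2 g, n0 th g & slice_rep th f g.
Proof.
move=> hth [Hi [a [C [a0 C0 H]]]]; case: (intrinsic_hol th f hth Hi) => g [hg cg Hf].
exists g => //; split=> //; exists (Rmin a 1), C; have m1 := Rmin_r a 1.
have m0 : 0 < Rmin a 1 by apply: Rmin_glb_lt; lra.
split => // r psi r0 ap; have D : dsec th (pol r psi) by apply: dsec_ang => //; lra.
case: (im_unit_ex n_gt0) => J HJ; rewrite -(cl_norm_sl J) // -Hf //.
apply: Rle_trans (H _ _) _; first by apply/(dsector_sl J th).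
rewrite cl_norm_sl // Cmod_pol; last lra.
rewrite /Rdiv Rmult_assoc; apply: Rmult_le_compat_l => //.
by apply: (kk_mono (Rmin a 1) a r) => //; split => //; exact: Rmin_l.
Qed.

End Lift.

Section SectorIntegral.
Context {n : nat} {V : right_hilbert_module n} {T : operator V} {om : R} {HT : bisect T om}.
Local Notation R1 := (R1 T).
Local Notation R2 := (R2 T).
Local Notation calc := (calc T).
Local Notation imR := (imR (T := T)).
Let om_bounds := bisect_om (T := T).

Lemma imR_ii th phi psi g v : om < phi < th -> th < PI / 2 -> n0 th g -> psi = phi \/ psi = PI - phi ->
  exists l, ii (fun r => imR (pol r psi) (ray g psi r) v) l /\
  exists l', ii (fun r => imR (pol r psi) ((0, 1)%R * ray g psi r)%C v) l'.
Proof.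
move=> hp hth [[hg cg] [a [M [ha hM H]]]] hpsi; have hom := om_bounds; have p0 := PI_RGT_0.
case: (imR_bound (T := T) phi) => [|K K0 HK]; first lra.
have ap : ang th psi.
  by case: hpsi => ->; [left; rewrite Rabs_pos_eq; lra|right; rewrite (_ : _ - PI = - phi) ?Rabs_Ropp ?Rabs_pos_eq; lra].
have gen g' : (forall r, 0 < r -> ccont g' (pol r psi)) -> (forall r, 0 < r -> Cmod (g' (pol r psi)) <= M * kk a r) ->
    exists l, ii (fun r => imR (pol r psi) (ray g' psi r) v) l.
  move=> cg' bg'; case: (ii_dom (V := rhm_sort V) (fun r => imR (pol r psi) (ray g' psi r) v)
    (fun r => K * M * norm v * kap a r) (K * M * norm v * (PI / 2 / a))) => [r r0|r r0||l Hl _]; last by exists l.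
  - apply: continuous_imR; last exact: cg'.
    by apply: outer_pol => //; [lra|case: hpsi => ->; lra].
  - apply: Rle_trans (HK _ _ _ _) _; first by apply: cone_pol => //; [lra|case: hpsi => ->; lra].
    rewrite Cmod_ray Cmod_pol; last lra.
    have nv := norm_ge_0 v.
    rewrite (_ : K * M * norm v * kap a r = K * (M * kk a r / r) * norm v); last by rewrite /kap; field; lra.
    apply: Rmult_le_compat_r => //; apply: Rmult_le_compat_l => //.
    by apply: Rmult_le_compat_r; [apply: Rlt_le; exact: Rinv_0_lt_compat|exact: bg'].
  - by apply: (@ii_scal R_CompleteNormedModule); apply: ii_kap; lra.
have cg1 r : 0 < r -> ccont g (pol r psi) by move=> r0; apply: hol_ccont hg _; apply: dsec_ang => //; lra.
case: (gen g) => [//|r r0|l Hl]; first exact: H.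
exists l; split => //.
case: (gen (fun z => (0, 1)%R * g z)%C) => [r r0|r r0|l' Hl'].
- by apply: ccont_mul; [exact: ccont_const|exact: cg1].
- rewrite Cmod_mult (_ : Cmod (0, 1) = 1) ?Rmult_1_l; first exact: H.
  by rewrite /Cmod /= (_ : _ + _ = 1) ?sqrt_1 //; ring.
exists l'; apply: ii_ext Hl' => r r0; congr imR; rewrite /ray; ring.
Qed.

(* The real part of the integrand on a ray is odd under conjugation, the J-part
   even *)
Lemma ray_integral_pair th J f g psi v l l' : 0 < th < PI / 2 -> im_unit J -> slice_rep th f g -> good th g ->
  ang th psi -> om < psi < PI - om ->
  ii (fun r => imR (pol r psi) (ray g psi r) v) l ->
  ii (fun r => imR (pol r psi) ((0, 1)%R * ray g psi r)%C v) l' ->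
  ray_integral T J (slice_pt J (cos psi) (sin psi)) f v = minus l (rmul l' J) /\
  ray_integral T J (slice_pt J (cos psi) (- sin psi)) f v = minus (opp l) (rmul l' J).
Proof.
move=> hth HJ Hf [_ cg] ap hpsi H1 H2; have hom := om_bounds.
have H3 : ii (fun r => rmul (imR (pol r psi) ((0, 1)%R * ray g psi r)%C v) J) (rmul l' J).
  apply: (ii_linear (W := rhm_sort V) (fun v : V => rmul v J) 1) H2.
  - by move=> u w; rewrite rmul_addl.
  - by move=> c w; rewrite rmul_scal.
  - by move=> w; rewrite norm_rmulJ //; lra.
pose K eta r := rmul (op_inv (op_IR T (cl_scal r (slice_pt J (cos eta) (sin eta)))) v)
      (cl_mul (f (cl_scal r (slice_pt J (cos eta) (sin eta)))) (cl_mul (slice_pt J (cos eta) (sin eta)) (cl_opp J))).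
have uniq eta L : ii (K eta) L -> ray_integral T J (slice_pt J (cos eta) (sin eta)) f v = L.
  by move=> HL; exact (is_RInt_gen_unique _ _ HL).
have key eta r : 0 < r -> dsec th (pol r eta) -> outer om (pol r eta) ->
    K eta r =
    minus (imR (pol r eta) (ray g eta r) v) (rmul (imR (pol r eta) ((0, 1)%R * ray g eta r)%C v) J).
  move=> r0 D O; rewrite /K slice_scal // -[slice_pt J (r * _) _]/(sl J (pol r eta)) Hf // op_inv_IR //.
  rewrite opp_im_unit // slice_mul // /sl slice_mul //.
  set z := pol r eta.
  rewrite (_ : slice_pt J _ _ = sl J (snd (ray g eta r), - fst (ray g eta r))); last first.
    by rewrite /sl /ray -/z /=; congr slice_pt; ring.
  rewrite /imR; move: (ray g eta r) (R1 z v) (R2 z v) => c u1 u2.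
  rewrite rmul_sl !rmul_addl rmulJJ // !rmul_scal /=.
  by apply: ipr_ext => w; rewrite !iprE; ring.
split.
- have I := @ii_minus (rhm_sort V) _ _ _ _ H1 H3.
  apply: uniq; move: I; apply: ii_ext => r r0.
  by rewrite key //; [apply: dsec_ang => //; lra|apply: outer_pol; lra].
- have H1' := @ii_scal (rhm_sort V) (-1) _ _ H1.
  rewrite (_ : opp l = scal (-1) l); last by vring.
  have I := @ii_minus (rhm_sort V) _ _ _ _ H1' H3.
  rewrite -(cos_neg psi) -sin_neg; apply: uniq; move: I; apply: ii_ext => r r0.
  have D : dsec th (pol r psi) by apply: dsec_ang => //; lra.
  have O : outer om (pol r psi) by apply: outer_pol; lra.
  have Ep : pol r (- psi) = Cconj (pol r psi) by rewrite pol_conj.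
  rewrite key //; last 2 first.
  - by rewrite Ep; exact: dsec_conj.
  - by rewrite Ep; exact: outer_conj.
  have -> : ray g (- psi) r = Cconj (ray g psi r) by rewrite /ray Cmult_conj expi_conj Ep cg.
  rewrite Ep /imR R1_conj R2_conj; move: (ray g psi r) (R1 _ v) (R2 _ v) => c u1 u2.
  rewrite !rmul_addl !rmul_scal rmul_opp /=.
  by apply: ipr_ext => w; rewrite !iprE; ring.
Qed.

Lemma dsector_integral_calc th phi J f g v : om < phi < th -> th < PI / 2 -> im_unit J ->
  slice_rep th f g -> n0 th g -> dsector_integral T phi J f v = calc phi g v.
Proof.
move=> hp hth HJ Hf ng; have hom := om_bounds; have p0 := PI_RGT_0.
case: (imR_ii th phi phi g v hp hth ng ltac:(left; reflexivity)) => l1 [H1 [m1 K1]].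
case: (imR_ii th phi (PI - phi) g v hp hth ng ltac:(right; reflexivity)) => l2 [H2 [m2 K2]].
case: (ng) => gg _.
case: (ray_integral_pair th J f g phi v l1 m1 ltac:(lra) HJ Hf gg ltac:(left; rewrite Rabs_pos_eq; lra) ltac:(lra) H1 K1) => E1 E2.
have a2 : ang th (PI - phi) by right; rewrite (_ : _ - PI = - phi) ?Rabs_Ropp ?Rabs_pos_eq; lra.
case: (ray_integral_pair th J f g (PI - phi) v l2 m2 ltac:(lra) HJ Hf gg a2 ltac:(lra) H2 K2) => E3 E4.
rewrite /dsector_integral /= !slice_opp E1 E2.
have c1 : cos (PI - phi) = - cos phi by rewrite cos_minus cos_PI sin_PI; ring.
have c2 : sin (PI - phi) = - - sin phi by rewrite sin_minus cos_PI sin_PI; ring.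
rewrite c1 c2 in E3 E4; rewrite E3 -[X in slice_pt J _ X]Ropp_involutive E4.
rewrite /calc (is_RInt_gen_unique _ _ (@ii_minus (rhm_sort V) _ _ _ _ H1 H2)).
apply: ipr_ext => w; rewrite !iprE; field; lra.
Qed.

End SectorIntegral.

(** * Quadratic estimates *)

Section VDerivative.
Context {n : nat} {V : right_hilbert_module n}.
Implicit Types (u v w x y z : V) (g h : R -> V).

Definition rcont g (t : R) := forall eps, 0 < eps -> locally t (fun s => norm (minus (g s) (g t)) < eps).

Lemma rcont_const v t : rcont (fun _ => v) t.
Proof.
move=> eps e0; exists (mkposreal 1 Rlt_0_1) => s _.
by rewrite (_ : minus v v = zero) ?norm_zero //; vring.
Qed.

Lemma rcont_plus g h t : rcont g t -> rcont h t -> rcont (fun s => plus (g s) (h s)) t.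
Proof.
move=> cg ch eps e0; have e2 : 0 < eps / 2 by lra.
apply: filter_imp (filter_and _ _ (cg _ e2) (ch _ e2)) => s [h1 h2].
rewrite (_ : minus _ _ = plus (minus (g s) (g t)) (minus (h s) (h t))); last by vring.
apply: Rle_lt_trans (norm_add_le _ _) _; lra.
Qed.

Lemma rcont_scal (c : R -> R) g t : continuous c t -> rcont g t -> rcont (fun s => scal (c s) (g s)) t.
Proof.
move=> cc cg eps e0; have g0 := norm_ge_0 (g t).
pose d := Rmin 1 (eps / (2 * (norm (g t) + 1))).
have d0 : 0 < d by apply: Rmin_glb_lt; [lra|apply: Rdiv_lt_0_compat; lra].
have b0 := Rabs_pos (c t).
have e1 : 0 < eps / (2 * (Rabs (c t) + 1)) by apply: Rdiv_lt_0_compat; lra.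
have cc' : locally t (fun s => Rabs (c s - c t) < d).
  by refine (cc (fun y : R => Rabs (y - c t) < d) _); exists (mkposreal d d0).
apply: filter_imp (filter_and _ _ cc' (cg _ e1)) => s [h1 h2].
have m1 := Rmin_l 1 (eps / (2 * (norm (g t) + 1))); have m2 := Rmin_r 1 (eps / (2 * (norm (g t) + 1))).
rewrite -/d in m1 m2.
rewrite (_ : minus _ _ = plus (scal (c s) (minus (g s) (g t))) (scal (c s - c t) (g t))); last by vring.
apply: Rle_lt_trans (norm_add_le _ _) _; rewrite !norm_scalV.
have q1 : Rabs (c s) <= Rabs (c t) + 1 by split_Rabs; lra.
have q2 : Rabs (c s) * norm (minus (g s) (g t)) < eps / 2.
  apply: Rle_lt_trans (_ : (Rabs (c t) + 1) * norm (minus (g s) (g t)) < _).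
    by apply: Rmult_le_compat_r => //; exact: norm_ge_0.
  rewrite (_ : eps / 2 = (Rabs (c t) + 1) * (eps / (2 * (Rabs (c t) + 1)))); last by field; lra.
  by apply: Rmult_lt_compat_l; lra.
have q3 : Rabs (c s - c t) * norm (g t) <= eps / 2.
  apply: Rle_trans (_ : eps / (2 * (norm (g t) + 1)) * (norm (g t) + 1) <= _).
    by apply: Rmult_le_compat => //; try exact: Rabs_pos; lra.
  by apply: Req_le; field; lra.
lra.
Qed.

Lemma rcont_ipr g h t : rcont g t -> rcont h t -> continuous (fun s => ipr (g s) (h s)) t.
Proof.
move=> cg ch P [eps HP].
have g0 := norm_ge_0 (g t); have h0 := norm_ge_0 (h t).
pose d := Rmin 1 (eps / (2 * (norm (g t) + norm (h t) + 1))).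
have p0 := cond_pos eps.
have q0 : 0 < eps / (2 * (norm (g t) + norm (h t) + 1)) by apply: Rdiv_lt_0_compat; lra.
have d0 : 0 < d by apply: Rmin_glb_lt; [lra|].
apply: filter_imp (filter_and _ _ (cg _ d0) (ch _ d0)) => s [h1 h2].
have m1 := Rmin_l 1 (eps / (2 * (norm (g t) + norm (h t) + 1))).
have m2 := Rmin_r 1 (eps / (2 * (norm (g t) + norm (h t) + 1))); rewrite -/d in m1 m2.
apply: HP; rewrite /ball /= /AbsRing_ball /abs /= /minus /plus /opp /=.
set a := minus (g s) (g t) in h1; set b := minus (h s) (h t) in h2.
rewrite (_ : ipr (g s) (h s) + - _ = ipr a (h t) + (ipr (g t) b + ipr a b)); last by rewrite /a /b !iprE; ring.
have c1 := ipr_CS a (h t); have c2 := ipr_CS (g t) b; have c3 := ipr_CS a b.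
have a0 := norm_ge_0 a; have b0 := norm_ge_0 b.
have T : Rabs (ipr a (h t) + (ipr (g t) b + ipr a b)) <= norm a * norm (h t) + norm (g t) * norm b + norm a * norm b.
  by move: c1 c2 c3; split_Rabs; lra.
apply: Rle_lt_trans T _.
have l1 : norm a * norm (h t) <= d * norm (h t) by apply: Rmult_le_compat_r; lra.
have l2 : norm (g t) * norm b <= d * norm (g t) by rewrite Rmult_comm; apply: Rmult_le_compat_r; lra.
have l3 : norm a * norm b <= d * 1 by apply: Rmult_le_compat; lra.
have l4 : d * (norm (g t) + norm (h t) + 1) <= eps / 2.
  apply: Rle_trans (Rmult_le_compat_r _ _ _ _ m2) _; first lra.
  by apply: Req_le; field; lra.
lra.
Qed.

Definition vdiff g (t : R) l := exists h, [/\ rcont h t, h t = l &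
  locally t (fun s => minus (g s) (g t) = scal (s - t) (h s))].

Lemma vdiff_const v t : vdiff (fun _ => v) t zero.
Proof.
exists (fun _ => zero); split => //; first exact: rcont_const.
by exists (mkposreal 1 Rlt_0_1) => s _; vring.
Qed.

Lemma vdiff_rcont g t l : vdiff g t l -> rcont g t.
Proof.
case=> h [ch _ Hh] eps e0.
have ci : continuous (fun s : R => s - t) t by apply: ex_derive_continuous; auto_derive.
have := rcont_scal _ _ _ ci ch eps e0.
move=> c; apply: filter_imp (filter_and _ _ c Hh) => s [h1 ->].
by rewrite (_ : scal (s - t) (h s) = minus (scal (s - t) (h s)) (scal (t - t) (h t))); last by vring.
Qed.

Lemma vdiff_ipr g t l w : vdiff g t l -> is_derive (fun s => ipr (g s) w) t (ipr l w).
Proof.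
case=> h [ch <- Hh]; apply: (is_derive_caratheodory _ (fun s => ipr (h s) w)).
  by apply: filter_imp Hh => s E; rewrite -ipr_subl E ipr_scall.
by apply: rcont_ipr => //; exact: rcont_const.
Qed.

Lemma vdiff_sqr g t l : vdiff g t l -> is_derive (fun s => norm (g s) ^ 2) t (2 * ipr l (g t)).
Proof.
move=> dg; have cg := vdiff_rcont _ _ _ dg; case: dg => h [ch <- Hh].
have -> : 2 * ipr (h t) (g t) = ipr (h t) (g t) + ipr (g t) (h t) by rewrite (ipr_sym (g t)); ring.
apply: (is_derive_caratheodory _ (fun s => ipr (h s) (g s) + ipr (g t) (h s))).
  apply: filter_imp Hh => s E; rewrite -!ipr_norm.
  rewrite (_ : _ - _ = ipr (minus (g s) (g t)) (g s) + ipr (g t) (minus (g s) (g t))); last by rewrite !iprE; ring.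
  by rewrite E !iprE; ring.
apply: (continuous_plus (V := R_NormedModule)); apply: rcont_ipr => //; exact: rcont_const.
Qed.
End VDerivative.

Section Family.
Context {n : nat} {V : right_hilbert_module n}.
Implicit Types (u v w x y z : V).

(* The properties of P t = t^2 (t^2 + A)^-1, for m-accretive A, and of its
   adjoint *)
Record resolvent_family (P : R -> V -> V) : Prop := {
  rf_add : forall t x y, 0 < t -> P t (plus x y) = plus (P t x) (P t y);
  rf_scal : forall t a x, 0 < t -> P t (scal a x) = scal a (P t x);
  rf_firm : forall t x, 0 < t -> norm (P t x) ^ 2 <= ipr x (P t x);
  rf_comm : forall s t x, 0 < s -> 0 < t -> P s (P t x) = P t (P s x);
  rf_res : forall s t x, 0 < s -> 0 < t ->
    minus (P s x) (P t x) = scal ((s ^ 2 - t ^ 2) / s ^ 2) (P s (minus x (P t x)))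
}.

Variable P : R -> V -> V.
Hypothesis HP : resolvent_family P.

Definition pw k t x := iter k (P t) x.
Definition psi t x := P t (minus x (P t x)).
(* q(P t) for q = 10 x^3 - 15 x^4 + 6 x^5, which satisfies q(0) = 0, q(1) = 1 and
   x (1 - x) q'(x) = 30 (x (1 - x))^3 *)
Definition qq t x := plus (scal 10 (pw 3 t x)) (plus (scal (-15) (pw 4 t x)) (scal 6 (pw 5 t x))).

Lemma rf_contr t x : 0 < t -> norm (P t x) <= norm x.
Proof.
move=> t0; have h := rf_firm _ HP t x t0; have c := ipr_CS x (P t x).
have a0 := norm_ge_0 (P t x); have b0 := norm_ge_0 x; have := Rle_abs (ipr x (P t x)) => l.
by apply: Rnot_lt_le => lt; nra.
Qed.

Lemma rf_sub t x y : 0 < t -> P t (minus x y) = minus (P t x) (P t y).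
Proof.
move=> t0; have -> : minus x y = plus x (scal (-1) y) by vring.
by rewrite (rf_add _ HP) // (rf_scal _ HP) //; vring.
Qed.

Lemma psi_bound t x : 0 < t -> norm (psi t x) ^ 2 <= ipr (minus (P t x) (P t (P t x))) (P t x).
Proof.
move=> t0; rewrite /psi rf_sub //; set y := P t x; have h := rf_firm _ HP t y t0.
by rewrite norm_sub ipr_subl ipr_norm (ipr_sym (P t y) y); lra.
Qed.

Lemma rcont_rf g t : 0 < t -> rcont g t -> rcont (fun s => P s (g s)) t.
Proof.
move=> t0 cg eps e0; have e2 : 0 < eps / 2 by lra.
set z := minus (g t) (P t (g t)).
have cc : continuous (fun s => (s ^ 2 - t ^ 2) / s ^ 2 * norm z) t.
  by apply: ex_derive_continuous; auto_derive; have := pow_lt t 2 t0; lra.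
have H1 : locally t (fun s => Rabs ((s ^ 2 - t ^ 2) / s ^ 2 * norm z) < eps / 2).
  refine (cc (fun y : R => Rabs y < eps / 2) _); rewrite Rminus_diag /Rdiv !Rmult_0_l.
  by exists (mkposreal _ e2) => y; rewrite /ball /= /AbsRing_ball /abs /= /minus /plus /opp /= Ropp_0 Rplus_0_r.
have H2 : locally t (fun s => 0 < s).
  by exists (mkposreal t t0) => s; rewrite /ball /= /AbsRing_ball /abs /= /minus /plus /opp /=; split_Rabs; lra.
apply: filter_imp (filter_and _ _ (filter_and _ _ H1 H2) (cg _ e2)) => s [[h1 s0] h2].
have -> : minus (P s (g s)) (P t (g t)) = plus (P s (minus (g s) (g t))) (minus (P s (g t)) (P t (g t))).
  by rewrite rf_sub //; vring.
apply: Rle_lt_trans (norm_add_le _ _) _.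
have k1 := rf_contr s (minus (g s) (g t)) s0.
rewrite (rf_res _ HP) // -/z norm_scalV; have k2 := rf_contr s z s0.
have : Rabs ((s ^ 2 - t ^ 2) / s ^ 2) * norm (P s z) <= Rabs ((s ^ 2 - t ^ 2) / s ^ 2 * norm z).
  rewrite Rabs_mult (Rabs_pos_eq (norm z)); last exact: norm_ge_0.
  by apply: Rmult_le_compat_l => //; exact: Rabs_pos.
lra.
Qed.

Lemma vdiff_rf g t l : 0 < t -> vdiff g t l ->
  vdiff (fun s => P s (g s)) t (plus (P t l) (scal (2 / t) (P t (minus (g t) (P t (g t)))))).
Proof.
move=> t0 [h [ch <- Hh]]; set z := minus (g t) (P t (g t)).
exists (fun s => plus (P s (h s)) (scal ((s + t) / s ^ 2) (P s z))); split.
- apply: rcont_plus; first exact: rcont_rf.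
  apply: rcont_scal; first by apply: ex_derive_continuous; auto_derive; have := pow_lt t 2 t0; lra.
  by apply: (rcont_rf (fun _ => z)) => //; exact: rcont_const.
- by apply: ipr_ext => w; rewrite !iprE; field; lra.
- have H2 : locally t (fun s => 0 < s).
    by exists (mkposreal t t0) => s; rewrite /ball /= /AbsRing_ball /abs /= /minus /plus /opp /=; split_Rabs; lra.
  apply: filter_imp (filter_and _ _ Hh H2) => s [E s0].
  have -> : minus (P s (g s)) (P t (g t)) = plus (P s (minus (g s) (g t))) (minus (P s (g t)) (P t (g t))).
    by rewrite rf_sub //; vring.
  rewrite E (rf_scal _ HP) // (rf_res _ HP) // -/z.
  by apply: ipr_ext => w; rewrite !iprE; field; lra.
Qed.

Lemma pw_sub k t x y : 0 < t -> pw k t (minus x y) = minus (pw k t x) (pw k t y).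
Proof. by move=> t0; elim: k => //= k ->; rewrite rf_sub. Qed.

Lemma pw_S k t x : pw k t (P t x) = P t (pw k t x).
Proof. by elim: k => //= k ->. Qed.

Lemma pw_contr k t x : 0 < t -> norm (pw k t x) <= norm x.
Proof. by move=> t0; elim: k => [|k IH] /=; [lra|apply: Rle_trans (rf_contr _ _ t0) IH]. Qed.

Lemma vdiff_pw k t y : 0 < t -> vdiff (fun s => pw k s y) t (scal (2 * INR k / t) (pw k t (minus y (P t y)))).
Proof.
move=> t0; elim: k => [|k IH].
  rewrite (_ : scal _ _ = zero); first exact: vdiff_const.
  by rewrite Rmult_0_r /Rdiv Rmult_0_l; vring.
have := vdiff_rf _ _ _ t0 IH; rewrite -/(pw k.+1 _ _).
congr vdiff; rewrite (rf_scal _ HP) // pw_sub // pw_S.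
rewrite -[pw k.+1 t _]/(P t (pw k t (minus y (P t y)))) pw_sub // pw_S.
by apply: ipr_ext => w; rewrite !iprE S_INR; field; lra.
Qed.

Lemma vdiff_qq t y w : 0 < t -> is_derive (fun s => ipr (qq s y) w) t (60 / t * ipr (psi t (psi t (psi t y))) w).
Proof.
move=> t0; rewrite /qq.
apply: (is_derive_ext (fun s => 10 * ipr (pw 3 s y) w + (-15 * ipr (pw 4 s y) w + 6 * ipr (pw 5 s y) w))).
  by move=> s; rewrite !iprE.
have E k := vdiff_ipr _ _ _ w (vdiff_pw k t y t0).
apply: is_derive_val.
  apply: is_derive_addR; first by apply: is_derive_scal; exact: E.
  by apply: is_derive_addR; apply: is_derive_scal; exact: E.
rewrite /psi /pw /= !rf_sub // !iprE; simpl; field; lra.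
Qed.

Lemma energy_derive t v : 0 < t ->
  is_derive (fun s => norm (P s v) ^ 2) t (4 / t * ipr (minus (P t v) (P t (P t v))) (P t v)).
Proof.
move=> t0; apply: is_derive_val; first by apply: vdiff_sqr; apply: (vdiff_pw 1).
by rewrite /pw /= rf_sub // !iprE; field; lra.
Qed.

End Family.

Section Energy.
Context {n : nat} {V : right_hilbert_module n}.
Implicit Types (u v w x y z : V).
Variables (P P' : R -> V -> V).
Hypotheses (HP : resolvent_family P) (HP' : resolvent_family P').
Hypothesis PP' : forall t x w, 0 < t -> ipr (P t x) w = ipr x (P' t w).

Lemma psi_adj t x w : 0 < t -> ipr (psi P t x) w = ipr x (psi P' t w).
Proof.
by move=> t0; rewrite /psi (PP' t) // (rf_sub P' HP') // ipr_subl ipr_subr PP'.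
Qed.

(* The integrals of |psi_t v|^2 dt/t and |psi_t^* w|^2 dt/t are controlled by the
   growth of |P_t v|^2 and |P_t^* w|^2; by AM-GM so is the derivative of
   <q(P_t) y, w> *)
Lemma energy_weak v y w B a b lam : 0 < a -> a < b -> 0 <= B -> 0 < lam ->
  (forall t w, 0 < t -> Rabs (ipr (psi P t (psi P t (psi P t y))) w) <= B * norm (psi P t v) * norm (psi P' t w)) ->
  ipr (minus (qq P b y) (qq P a y)) w <=
    15 * B / 2 * (lam * (norm (P b v) ^ 2 - norm (P a v) ^ 2) + norm w ^ 2 / lam).
Proof.
move=> a0 ab B0 l0 H.
pose e t := ipr (minus (P t v) (P t (P t v))) (P t v).
pose e' t := ipr (minus (P' t w) (P' t (P' t w))) (P' t w).
pose Phi s := 15 * B / 2 * lam * norm (P s v) ^ 2 + (15 * B / 2 / lam * norm (P' s w) ^ 2 + (-1) * ipr (qq P s y) w).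
pose dPhi t := 15 * B / 2 * lam * (4 / t * e t) + (15 * B / 2 / lam * (4 / t * e' t) +
  (-1) * (60 / t * ipr (psi P t (psi P t (psi P t y))) w)).
have dd t : 0 < t -> is_derive Phi t (dPhi t).
  move=> t0; apply: is_derive_addR; first by apply: is_derive_scal; exact: energy_derive.
  by apply: is_derive_addR; apply: is_derive_scal; [exact: energy_derive|exact: vdiff_qq].
have hm : Rmin a b = a by apply: Rmin_left; lra.
have hM : Rmax a b = b by apply: Rmax_right; lra.
case: (MVT_gen Phi a b dPhi) => [x|x|c [hc E]]; rewrite ?hm ?hM.
- by move=> hx; apply: dd; lra.
- move=> hx; apply/continuity_pt_filterlim; apply: ex_derive_continuous.
  by exists (dPhi x); apply: dd; lra.
rewrite hm hM in hc; have c0 : 0 < c by lra.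
have p1 := psi_bound P HP c v c0; have p2 := psi_bound P' HP' c w c0; rewrite -/(e c) in p1; rewrite -/(e' c) in p2.
have h := H c w c0; have n1 := norm_ge_0 (psi P c v); have n2 := norm_ge_0 (psi P' c w).
have pos : 0 <= dPhi c.
  have -> : dPhi c = 60 / c * (B / 2 * (lam * e c + e' c / lam) - ipr (psi P c (psi P c (psi P c y))) w).
    by rewrite /dPhi; field; lra.
  apply: Rmult_le_pos; first by apply: Rlt_le; apply: Rdiv_lt_0_compat; lra.
  move: h p1 p2 n1 n2; set al := norm (psi P c v); set be := norm _; set q := ipr _ w => h p1 p2 n1 n2.
  have am : al * be <= (lam * e c + e' c / lam) / 2.
    have : 0 <= lam * (al - be / lam) ^ 2 by apply: Rmult_le_pos; [lra|exact: pow2_ge_0].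
    rewrite (_ : lam * _ = lam * al ^ 2 - 2 * (al * be) + be ^ 2 / lam); last by field; lra.
    have : lam * al ^ 2 <= lam * e c by apply: Rmult_le_compat_l; lra.
    have : be ^ 2 / lam <= e' c / lam by apply: Rmult_le_compat_r => //; apply: Rlt_le; exact: Rinv_0_lt_compat.
    lra.
  have : B * al * be <= B / 2 * (lam * e c + e' c / lam).
    by rewrite (_ : B / 2 * _ = B * ((lam * e c + e' c / lam) / 2)); [rewrite Rmult_assoc; apply: Rmult_le_compat_l|field; lra].
  by have := Rle_abs q; lra.
have inc : Phi a <= Phi b by have : 0 <= dPhi c * (b - a); [apply: Rmult_le_pos; lra|lra].
have w1 := rf_contr P' HP' b w ltac:(lra).
have w2 : norm (P' b w) ^ 2 <= norm w ^ 2 by apply: pow_incr; split => //; exact: norm_ge_0.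
have w3 := pow2_ge_0 (norm (P' a w)).
have w4 : 15 * B / 2 / lam * (norm (P' b w) ^ 2 - norm (P' a w) ^ 2) <= 15 * B / 2 / lam * norm w ^ 2.
  by apply: Rmult_le_compat_l; [apply: Rdiv_le_0_compat; lra|lra].
rewrite ipr_subl (_ : 15 * B / 2 * _ = 15 * B / 2 * lam * (norm (P b v) ^ 2 - norm (P a v) ^ 2) +
  15 * B / 2 / lam * norm w ^ 2); last by field; lra.
by rewrite /Phi in inc; lra.
Qed.

Lemma energy v y B a b : 0 < a -> a < b -> 0 <= B ->
  (forall t w, 0 < t -> Rabs (ipr (psi P t (psi P t (psi P t y))) w) <= B * norm (psi P t v) * norm (psi P' t w)) ->
  norm (minus (qq P b y) (qq P a y)) ^ 2 <= (15 * B) ^ 2 * (norm (P b v) ^ 2 - norm (P a v) ^ 2).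
Proof.
move=> a0 ab B0 H; set d := minus _ _; set dE := _ - _.
have h lam l0 := energy_weak v y d B a b lam a0 ab B0 l0 H; rewrite -/d -/dE ipr_norm in h.
case: (Rle_lt_or_eq_dec _ _ B0) => [B1|E].
- have := h (15 * B) ltac:(lra).
  rewrite (_ : 15 * B / 2 * _ = (15 * B) ^ 2 / 2 * dE + norm d ^ 2 / 2); last by field; lra.
  lra.
- by have := h 1 Rlt_0_1; rewrite -E; lra.
Qed.

End Energy.

Lemma adj_family {n : nat} {V : right_hilbert_module n} (P : R -> V -> V) : resolvent_family P ->
  resolvent_family (fun t => adj (P t)) /\ forall t x w, 0 < t -> ipr (P t x) w = ipr x (adj (P t) w).
Proof.
move=> HP; have A t (x w : V) : 0 < t -> ipr (P t x) w = ipr x (adj (P t) w).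
  move=> t0; apply: (adjP (P t) 1) => [u v|a v|v]; first exact: (rf_add P HP).
  - exact: (rf_scal P HP).
  - by rewrite Rmult_1_l; exact: (rf_contr P HP).
split => //; split.
- by move=> t x y t0; apply: ipr_ext => w; rewrite ipr_addl 3!(ipr_sym _ w) -!A // ipr_addr.
- by move=> t a x t0; apply: ipr_ext => w; rewrite ipr_scall 2!(ipr_sym _ w) -!A // ipr_scalr.
- move=> t x t0; set y := adj (P t) x.
  have c u : norm (minus (scal 2 (P t u)) u) <= norm u.
    apply: pow2_le_inv; first exact: norm_ge_0.
    rewrite norm_sub norm_scalV ipr_scall (Rabs_pos_eq 2) ?Rpow_mult_distr; last lra.
    by have := rf_firm P HP t u t0; rewrite (ipr_sym _ u); lra.
  have c' : norm (minus (scal 2 y) x) <= norm x.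
    apply: norm_le_ipr; first exact: norm_ge_0.
    move=> w; have -> : ipr (minus (scal 2 y) x) w = ipr (minus (scal 2 (P t w)) w) x.
      by rewrite !ipr_subl !ipr_scall (ipr_sym y) -A // (ipr_sym x).
    apply: Rle_trans (Rle_abs _) _; apply: Rle_trans (ipr_CS _ _) _.
    by rewrite Rmult_comm; apply: Rmult_le_compat_l; [exact: norm_ge_0|exact: c].
  have : norm (minus (scal 2 y) x) ^ 2 <= norm x ^ 2 by apply: pow_incr; split => //; exact: norm_ge_0.
  rewrite norm_sub norm_scalV ipr_scall (Rabs_pos_eq 2) ?Rpow_mult_distr; last lra.
  by rewrite (ipr_sym x); lra.
- by move=> s t x s0 t0; apply: ipr_ext => w; rewrite 2!(ipr_sym _ w) -!A // (rf_comm P HP).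
- move=> s t x s0 t0; apply: ipr_ext => w; rewrite ipr_scall ipr_subl 3!(ipr_sym _ w) -!A // ipr_subr -A //.
  have := f_equal (ipr^~ x) (rf_res P HP s t w s0 t0); rewrite /= ipr_scall !ipr_subl.
  rewrite (rf_sub P HP) // ipr_subl (rf_comm P HP) //.
Qed.

Section ResolventFamily.
Context {n : nat} {V : right_hilbert_module n} {T : operator V} {om : R} {HT : bisect T om}.
Hypothesis T2_accretive : m_accretive (op_sq T).
Local Notation Nz := (Nz T).
Let om_bounds := bisect_om (T := T).

Definition PT (t : R) (v : V) : V := scal (t ^ 2) (Nz (0, t) v).

Lemma outer_imag t : 0 < t -> outer om (0, t).
Proof.
have hom := om_bounds; move=> t0; rewrite (_ : (0, t) = pol t (PI / 2)); last by rewrite /pol cos_PI2 sin_PI2; f_equal; ring.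
by apply: outer_pol; lra.
Qed.

Lemma Cmod_imag t : 0 < t -> Cmod (0, t) = t.
Proof. by move=> t0; rewrite /Cmod /= (_ : _ + _ = t * t); [rewrite sqrt_square; lra|ring]. Qed.

Lemma TT_imag t x : 0 < t -> T (T (Nz (0, t) x)) = minus x (PT t x).
Proof.
move=> t0; rewrite TTNz ?Cmod_imag //; last exact: outer_imag.
by rewrite /PT /=; vring.
Qed.

Lemma PT_family : resolvent_family PT.
Proof.
split.
- by move=> t x y t0; rewrite /PT Nz_add; [vring|exact: outer_imag].
- by move=> t a x t0; rewrite /PT Nz_scal; [vring|exact: outer_imag].
- move=> t x t0; have O := outer_imag t t0.
  case: T2_accretive => _ /(_ (Nz (0, t) x)) acc _.
  have d1 : dom T (Nz (0, t) x) by exact: dom_Nz.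
  have d2 : dom T (T (Nz (0, t) x)) by exact: dom_TNz.
  have := acc (conj d1 d2); rewrite -/(ipr _ _) [app _ _]/= TT_imag //.
  rewrite -ipr_norm /PT ipr_subl !ipr_scall !ipr_scalr => h.
  by apply: Rmult_le_compat_l; [exact: pow2_ge_0|lra].
- move=> s t x s0 t0; have Os := outer_imag s s0; have Ot := outer_imag t t0.
  by rewrite /PT !Nz_scal // NzC //; vring.
- move=> s t x s0 t0; have Os := outer_imag s s0; have Ot := outer_imag t t0.
  rewrite -TT_imag //; set u := Nz (0, t) x; set c := T (T u).
  have Eu : u = plus (Nz (0, s) c) (scal (s ^ 2) (Nz (0, s) u)).
    rewrite -Nz_scal // -Nz_add //; symmetry; apply: Nz_uniq => //.
    split; [exact: dom_Nz|exact: dom_TNz|].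
    by rewrite /Qz Cmod_imag //= -/u -/c; vring.
  have Ex : x = plus c (scal (t ^ 2) u).
    by rewrite /c TT_imag // /PT -/u; vring.
  rewrite {1}/PT {1}Ex Nz_add // Nz_scal // /PT -/u {2}Eu.
  by apply: ipr_ext => w; rewrite !iprE; field; lra.
Qed.

End ResolventFamily.

Lemma n0_add th g h : n0 th g -> n0 th h -> n0 th (fun z => g z + h z)%C.
Proof.
case=> gg [a [M [ha hM H]]] [gh [b [N [hb hN HN]]]]; split; first exact: good_add.
have m1 := Rmin_l a b; have m2 := Rmin_r a b.
have m0 : 0 < Rmin a b by apply: Rmin_glb_lt; lra.
exists (Rmin a b), (M + N); split; [lra|lra|] => r psi r0 hp.
apply: Rle_trans (Cmod_triangle _ _) _; rewrite Rmult_plus_distr_r; apply: Rplus_le_compat.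
- by apply: Rle_trans (H _ _ r0 hp) _; apply: Rmult_le_compat_l => //; apply: kk_mono => //; lra.
- by apply: Rle_trans (HN _ _ r0 hp) _; apply: Rmult_le_compat_l => //; apply: kk_mono => //; lra.
Qed.

Definition bdg th (k : C -> C) := good th k /\ exists M, forall r psi, 0 < r -> ang th psi -> Cmod (k (pol r psi)) <= M.

Lemma bdg_real th (x : R) : bdg th (fun _ => RtoC x).
Proof. by split; [exact: good_real|exists (Rabs x) => r psi _ _; rewrite Cmod_R; lra]. Qed.

Lemma bdg_add th g h : bdg th g -> bdg th h -> bdg th (fun z => g z + h z)%C.
Proof.
case=> gg [M HM] [gh [N HN]]; split; first exact: good_add.
exists (M + N) => r psi r0 hp; apply: Rle_trans (Cmod_triangle _ _) _.
by have := HM r psi r0 hp; have := HN r psi r0 hp; lra.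
Qed.

Lemma bdg_mul th g h : bdg th g -> bdg th h -> bdg th (fun z => g z * h z)%C.
Proof.
case=> gg [M HM] [gh [N HN]]; split; first exact: good_mul.
exists (M * N) => r psi r0 hp; rewrite Cmod_mult.
by apply: Rmult_le_compat; [exact: Cmod_ge_0|exact: Cmod_ge_0|exact: HM|exact: HN].
Qed.

Lemma n0_bdg th g k : n0 th g -> bdg th k -> n0 th (fun z => g z * k z)%C.
Proof. by move=> ng [gk [M HM]]; apply: n0_mul_bd HM. Qed.

Definition pz (t : R) (z : C) : C := (RtoC (t ^ 2) * nz (0, t)%R z)%C.

Definition qpol (x : C) : C := (x * x * x * (10 + x * (RtoC (-15) + 6 * x)))%C.
Definition qdiff (x y : C) : C := (10 * (x * x + x * y + y * y) + (RtoC (-15) * (x * x * x + x * x * y + x * y * y + y * y * y) +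
  6 * (x * x * x * x + x * x * x * y + x * x * y * y + x * y * y * y + y * y * y * y)))%C.

Lemma qdiffE x y : (qpol x - qpol y)%C = ((x - y) * qdiff x y)%C.
Proof. rewrite /qpol /qdiff; ring. Qed.

Definition XX (a b : R) (z : C) : C := (qpol (pz b z) - qpol (pz a z))%C.

Section Approximation.
Variable th : R.
Hypothesis hth : 0 < th < PI / 2.

Definition cth := (1 - cos (PI / 2 - th)) / 2.

Lemma cth_gt0 : 0 < cth.
Proof. by apply: sin_cos_gt; lra. Qed.

Lemma imag_pol t : (0, t)%R = pol t (PI / 2).
Proof. by rewrite /pol cos_PI2 sin_PI2; f_equal; ring. Qed.

Lemma nz_imag_bound t r psi : 0 < t -> 0 < r -> ang th psi ->
  Cmod (nz (0, t)%R (pol r psi)) <= / (cth * (r + t) ^ 2).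
Proof. by move=> t0 r0 hp; rewrite imag_pol; apply: (nz_bound th (PI / 2) (PI / 2 - th)) => //; lra. Qed.

Lemma pz_bound t r psi : 0 < t -> 0 < r -> ang th psi -> Cmod (pz t (pol r psi)) <= / cth * (t / (r + t)) ^ 2.
Proof.
move=> t0 r0 hp; have c0 := cth_gt0; rewrite /pz Cmod_mult Cmod_R Rabs_pos_eq; last exact: pow2_ge_0.
apply: Rle_trans (Rmult_le_compat_l _ _ _ (pow2_ge_0 t) (nz_imag_bound t r psi t0 r0 hp)) _.
by apply: Req_le; field; lra.
Qed.

Lemma pz_bound1 t r psi : 0 < t -> 0 < r -> ang th psi -> Cmod (pz t (pol r psi)) <= / cth.
Proof.
move=> t0 r0 hp; apply: Rle_trans (pz_bound t r psi t0 r0 hp) _; have c0 := Rinv_0_lt_compat _ cth_gt0.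
have q0 : 0 <= t / (r + t) by apply: Rdiv_le_0_compat; lra.
have q1 : t / (r + t) <= 1 by apply: div_le; lra.
rewrite -[X in _ <= X]Rmult_1_r; apply: Rmult_le_compat_l; nra.
Qed.

Lemma pz_compl t z : 0 < t -> dsec th z -> (1 - pz t z)%C = (z * z * nz (0, t)%R z)%C.
Proof.
move=> t0 D; have nq := nz_den_neq0 th (0, t)%R z ltac:(rewrite imag_pol; apply: outer_pol; lra) D.
rewrite /pz /nz; set q := ((z - _) * _)%C in nq *.
have E : q = (z * z + RtoC (t ^ 2))%C by rewrite /q; case: (z) => x y; apply: injective_projections => /=; ring.
by rewrite -[X in (X - _)%C](Cinv_r q nq) {1}E; ring.
Qed.

Lemma pz_compl_bound t r psi : 0 < t -> 0 < r -> ang th psi ->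
  Cmod (1 - pz t (pol r psi))%C <= / cth * (r / (r + t)) ^ 2.
Proof.
move=> t0 r0 hp; have c0 := cth_gt0.
have D : dsec th (pol r psi) by apply: dsec_ang => //; lra.
rewrite pz_compl // !Cmod_mult Cmod_pol; last lra.
have r2 : 0 <= r * r by nra.
apply: Rle_trans (Rmult_le_compat_l _ _ _ r2 (nz_imag_bound t r psi t0 r0 hp)) _.
by apply: Req_le; field; lra.
Qed.

Lemma bdg_pz t : 0 < t -> bdg th (pz t).
Proof.
move=> t0; split; last by exists (/ cth) => r psi; exact: pz_bound1.
apply: good_mul; first exact: good_real.
by apply: good_nz; rewrite imag_pol; apply: outer_pol; lra.
Qed.

Lemma bdg_qpol t : 0 < t -> bdg th (fun z => qpol (pz t z)).
Proof. by move=> /bdg_pz b; repeat (first [exact: b|apply: bdg_mul|apply: bdg_add|exact: bdg_real]). Qed.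

Lemma qpol_bound : exists2 M, 0 <= M & forall t r psi, 0 < t -> 0 < r -> ang th psi -> Cmod (qpol (pz t (pol r psi))) <= M.
Proof.
have c0 := Rinv_0_lt_compat _ cth_gt0; set m := / cth in c0.
have m3 : 0 <= m * m * m by apply: Rmult_le_pos; nra.
exists (m * m * m * (10 + m * (15 + 6 * m))); first by apply: Rmult_le_pos => //; nra.
move=> t r psi t0 r0 hp; have := pz_bound1 t r psi t0 r0 hp; move: (pz t _) => x; rewrite -/m => hx.
have x0 := Cmod_ge_0 x.
have b1 : Cmod (RtoC (-15) + 6 * x)%C <= 15 + 6 * m.
  apply: Rle_trans (Cmod_triangle _ _) _; rewrite Cmod_mult !Cmod_R.
  by rewrite (Rabs_left1 (-15)) ?(Rabs_pos_eq 6); lra.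
have b2 : Cmod (10 + x * (RtoC (-15) + 6 * x))%C <= 10 + m * (15 + 6 * m).
  apply: Rle_trans (Cmod_triangle _ _) _; rewrite Cmod_mult Cmod_R Rabs_pos_eq; last lra.
  by apply: Rplus_le_compat_l; apply: Rmult_le_compat => //; exact: Cmod_ge_0.
have x2 : Cmod x * Cmod x <= m * m by apply: Rmult_le_compat.
have x3 : Cmod x * Cmod x * Cmod x <= m * m * m by apply: Rmult_le_compat => //; nra.
rewrite /qpol; move: (10 + _)%C b2 => y b2; rewrite !Cmod_mult.
by apply: Rmult_le_compat => //; try exact: Cmod_ge_0; repeat apply: Rmult_le_pos.
Qed.

Lemma n0_XX a b : 0 < a -> 0 < b -> n0 th (XX a b).
Proof.
move=> a0 b0; have c0 := cth_gt0.
have ba := bdg_pz a a0; have bb := bdg_pz b b0.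
have bX : bdg th (XX a b).
  have -> : XX a b = (fun z => qpol (pz b z) + RtoC (-1) * qpol (pz a z))%C.
    by apply: functional_extensionality => z; rewrite /XX; move: (qpol _) (qpol _) => x y; apply: injective_projections => /=; ring.
  by apply: bdg_add; [|apply: bdg_mul; [exact: bdg_real|]]; exact: bdg_qpol.
have [_ [S HS]] : bdg th (fun z => qdiff (pz b z) (pz a z)).
  by repeat (first [exact: ba|exact: bb|apply: bdg_mul|apply: bdg_add|exact: bdg_real]).
split; first by case: bX.
pose m := Rabs (b ^ 2 - a ^ 2) / (cth * cth) * / (4 * a) * (1 + / b ^ 2).
exists 1, (m * Rabs S).
have b2 : 0 < / b ^ 2 by apply: Rinv_0_lt_compat; nra.
have m0 : 0 <= m.
  apply: Rmult_le_pos; last lra.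
  apply: Rmult_le_pos; last by apply: Rlt_le; apply: Rinv_0_lt_compat; lra.
  by apply: Rdiv_le_0_compat; [exact: Rabs_pos|nra].
split; [lra|by apply: Rmult_le_pos => //; exact: Rabs_pos|] => r psi r0 hp.
have D : dsec th (pol r psi) by apply: dsec_ang => //; lra.
rewrite /XX qdiffE Cmod_mult; have hS := Rle_trans _ _ _ (HS r psi r0 hp) (Rle_abs S).
rewrite (_ : m * Rabs S * kk 1 r = m * kk 1 r * Rabs S); last by ring.
apply: Rmult_le_compat => //; try exact: Cmod_ge_0.
have -> : (pz b (pol r psi) - pz a (pol r psi))%C =
    (RtoC (b ^ 2 - a ^ 2) * (pol r psi * pol r psi) * (nz (0, a)%R (pol r psi) * nz (0, b)%R (pol r psi)))%C.
  have e1 := pz_compl a _ a0 D; have e2 := pz_compl b _ b0 D.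
  set z := pol r psi in e1 e2 *.
  have -> : (pz b z - pz a z)%C = (pz b z * (1 - pz a z) - pz a z * (1 - pz b z))%C by ring.
  by rewrite e1 e2 /pz RtoC_minus; ring.
rewrite !Cmod_mult Cmod_R Cmod_pol; last lra.
have na := nz_imag_bound a r psi a0 r0 hp; have nb := nz_imag_bound b r psi b0 r0 hp.
have r2 : 0 <= r * r by nra.
apply: Rle_trans (_ : Rabs (b ^ 2 - a ^ 2) * (r * r) * (/ (cth * (r + a) ^ 2) * / (cth * (r + b) ^ 2)) <= _).
  apply: Rmult_le_compat_l; first by apply: Rmult_le_pos => //; exact: Rabs_pos.
  by apply: Rmult_le_compat => //; exact: Cmod_ge_0.
have kE : kk 1 r = r / (1 + r ^ 2) by rewrite kkE Rpower_1.
have q1 : r / (r + a) ^ 2 <= / (4 * a).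
  apply: div_le; first nra.
  rewrite Rmult_comm; apply: le_div; first lra.
  have := pow2_ge_0 (r - a); nra.
have q2 : r / (r + b) ^ 2 <= (1 + / b ^ 2) * kk 1 r.
  rewrite kE (_ : _ * (r / _) = r * ((1 + / b ^ 2) / (1 + r ^ 2))); last by field; split; nra.
  apply: Rmult_le_compat_l; first lra.
  rewrite (_ : (1 + / b ^ 2) / (1 + r ^ 2) = / ((1 + r ^ 2) / (1 + / b ^ 2))); last by field; split; [|split]; nra.
  apply: Rinv_le_contravar; first by apply: Rdiv_lt_0_compat; nra.
  apply: div_le; first lra.
  have : b ^ 2 * / b ^ 2 = 1 by field; lra.
  have : 0 <= r ^ 2 * / b ^ 2 by apply: Rmult_le_pos; nra.
  have : 0 <= 2 * r * b * (1 + / b ^ 2) by apply: Rmult_le_pos; nra.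
  nra.
rewrite (_ : Rabs _ * _ * _ = Rabs (b ^ 2 - a ^ 2) / (cth * cth) * ((r / (r + a) ^ 2) * (r / (r + b) ^ 2))); last by field; lra.
rewrite (_ : m * kk 1 r = Rabs (b ^ 2 - a ^ 2) / (cth * cth) * (/ (4 * a) * ((1 + / b ^ 2) * kk 1 r))); last by rewrite /m; ring.
apply: Rmult_le_compat_l; first by apply: Rdiv_le_0_compat; [exact: Rabs_pos|nra].
by apply: Rmult_le_compat => //; apply: Rdiv_le_0_compat; nra.
Qed.

End Approximation.

(* Half of the decay is traded for a power of t. *)
Lemma kk_gain a t r : 0 < a <= 1 -> 0 < t -> 0 < r ->
  (t / (r + t)) ^ 2 * kk a r <= 2 * Rpower t (a / 2) * kk (a / 2) r /\
  (r / (r + t)) ^ 2 * kk a r <= 2 * / Rpower t (a / 2) * kk (a / 2) r.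
Proof.
move=> ha t0 r0; set h := a / 2.
have gen x y : 0 < x -> 0 < y -> (x / (y + x)) ^ 2 <= Rpower x h / Rpower y h.
  move=> x0 y0; have u0 := Rpower_gt0 y h; have s0 := Rpower_gt0 x h.
  have q0 : 0 <= x / (y + x) by apply: Rdiv_le_0_compat; lra.
  case: (Rle_lt_dec y x) => l.
    have q1 : x / (y + x) <= 1 by apply: div_le; lra.
    apply: Rle_trans (_ : 1 <= _); first by nra.
    apply: le_div => //; rewrite Rmult_1_l.
    by case: (Rle_lt_or_eq_dec _ _ l) => [l'|->]; [apply: Rlt_le; apply: Rpower_lt => //; rewrite /h; lra|lra].
  have e0 : 0 < x / y by apply: Rdiv_lt_0_compat.
  have e1 : x / y <= 1 by apply: div_le; lra.
  have E : Rpower x h = Rpower (x / y) h * Rpower y h by rewrite Rpower_mult_distr //; congr Rpower; field; lra.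
  rewrite E (_ : _ * _ / _ = Rpower (x / y) h); last by field; lra.
  apply: Rle_trans (_ : Rpower (x / y) 2 <= _); last by apply: Rpower_anti_exp => //; rewrite /h; lra.
  rewrite (_ : Rpower (x / y) 2 = (x / y) ^ 2); last by rewrite -(Rpower_pow 2) //=.
  apply: pow_incr; split => //.
  by apply: Rmult_le_compat_l; [lra|apply: Rinv_le_contravar; lra].
have g1 := gen t r t0 r0; have g2 := gen r t r0 t0; rewrite (Rplus_comm t r) in g2.
set s := Rpower t h in g1 g2 *; set u := Rpower r h in g1 g2 *.
have s0 : 0 < s by exact: Rpower_gt0. have u0 : 0 < u by exact: Rpower_gt0.
have Eu : Rpower r a = u ^ 2 by rewrite /u -Rpower_2a; congr Rpower; rewrite /h; field.
have k1 : kk a r = u ^ 2 / (1 + u ^ 4) by rewrite kkE Eu; congr (_ / (1 + _)); ring.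
have k2 : kk h r = u / (1 + u ^ 2) by rewrite kkE.
have k0 := kk_gt0 a r; rewrite k2; split.
- apply: Rle_trans (Rmult_le_compat_r _ _ _ (Rlt_le _ _ k0) g1) _; rewrite k1.
  rewrite (_ : s / u * _ = s * u * / (1 + u ^ 4)); last by field; split; nra.
  rewrite (_ : 2 * s * _ = s * u * (2 / (1 + u ^ 2))); last by field; nra.
  apply: Rmult_le_compat_l; first nra.
  apply: le_div; first nra.
  by rewrite Rmult_comm; apply: div_le; nra.
- apply: Rle_trans (Rmult_le_compat_r _ _ _ (Rlt_le _ _ k0) g2) _; rewrite k1.
  have s1 := Rinv_0_lt_compat _ s0.
  rewrite (_ : u / s * _ = / s * u * (u ^ 2 / (1 + u ^ 4))); last by field; split; nra.
  rewrite (_ : 2 * / s * _ = / s * u * (2 / (1 + u ^ 2))); last by field; split; nra.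
  apply: Rmult_le_compat_l; first nra.
  apply: le_div; first nra.
  rewrite (_ : u ^ 2 / _ * _ = u ^ 2 * (1 + u ^ 2) / (1 + u ^ 4)); last by field; nra.
  apply: div_le; first nra.
  have := pow2_ge_0 (u ^ 2 - 1); nra.
Qed.

Section SeqLimit.
Context {n : nat} {V : right_hilbert_module n}.

Definition seqlim (u : nat -> V) (l : V) := forall eps, 0 < eps -> exists N, forall p, (N <= p)%coq_nat -> norm (minus (u p) l) < eps.

Lemma seqlim_ipr u l w : seqlim u l -> Un_cv (fun k => ipr (u k) w) (ipr l w).
Proof.
move=> H eps e0; have nw := norm_ge_0 w.
case: (H (eps / (norm w + 1))) => [|N HN]; first by apply: Rdiv_lt_0_compat; lra.
exists N => p /HN h; rewrite /Rdist -ipr_subl; apply: Rle_lt_trans (ipr_CS _ _) _.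
have e1 : 0 < eps / (norm w + 1) by apply: Rdiv_lt_0_compat; lra.
apply: Rle_lt_trans (_ : eps / (norm w + 1) * norm w < _); first by apply: Rmult_le_compat_r; lra.
rewrite (_ : eps / _ * _ = eps - eps / (norm w + 1)); last by field; lra.
lra.
Qed.

Lemma Un_cv_ext (a b : nat -> R) l : (forall k, a k = b k) -> Un_cv a l -> Un_cv b l.
Proof. by move=> E H eps /H [N HN]; exists N => p /HN; rewrite E. Qed.

Lemma seqlim_add u v w lu lv lw : (forall k, w k = plus (u k) (v k)) ->
  seqlim u lu -> seqlim v lv -> seqlim w lw -> lw = plus lu lv.
Proof.
move=> E hu hv hw; apply: ipr_ext => x.
apply: (UL_sequence (fun k => ipr (w k) x)); first exact: seqlim_ipr.
rewrite ipr_addl; apply: (Un_cv_ext (fun k => ipr (u k) x + ipr (v k) x)).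
  by move=> k; rewrite E ipr_addl.
by apply: CV_plus; exact: seqlim_ipr.
Qed.

Lemma seqlim_rmul u w lu lw s : (forall k, w k = rmul (u k) s) -> seqlim u lu -> seqlim w lw -> lw = rmul lu s.
Proof.
move=> E hu hw; apply: ipr_ext => x.
apply: (UL_sequence (fun k => ipr (w k) x)); first exact: seqlim_ipr.
have A (y : V) : ipr (rmul y s) x = ipr y (rmul x (cl_conj s)) by rewrite rmul_adj cl_conjK.
rewrite A; apply: (Un_cv_ext (fun k => ipr (u k) (rmul x (cl_conj s)))).
  by move=> k; rewrite E A.
exact: seqlim_ipr.
Qed.

Lemma seqlim_uniq u l l' : seqlim u l -> seqlim u l' -> l = l'.
Proof. by move=> h h'; apply: ipr_ext => x; apply: (UL_sequence (fun k => ipr (u k) x)); exact: seqlim_ipr. Qed.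

Lemma seqlim_bound u l M : (forall k, norm (u k) <= M) -> seqlim u l -> norm l <= M.
Proof.
move=> H hl; apply: le_epsilon => eps e0; case: (hl _ e0) => N HN.
rewrite (_ : l = minus (u N) (minus (u N) l)); last by vring.
by apply: Rle_trans (norm_sub_le _ _) _; apply: Rplus_le_compat; [exact: H|apply: Rlt_le; apply: HN; lia].
Qed.

Lemma seqlim_op (F : V -> V) L u l : (forall x y, F (minus x y) = minus (F x) (F y)) -> norm_le F L ->
  seqlim u l -> seqlim (fun k => F (u k)) (F l).
Proof.
move=> FS FL hl eps e0; have L0 := Rabs_pos L.
case: (hl (eps / (Rabs L + 1))) => [|N HN]; first by apply: Rdiv_lt_0_compat; lra.
exists N => p /HN h; rewrite -FS; apply: Rle_lt_trans (FL _) _.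
apply: Rle_lt_trans (_ : (Rabs L + 1) * norm (minus (u p) l) < _).
  by apply: Rmult_le_compat_r; [exact: norm_ge_0|have := Rle_abs L; lra].
rewrite (_ : eps = (Rabs L + 1) * (eps / (Rabs L + 1))); last by field; lra.
by apply: Rmult_lt_compat_l; lra.
Qed.

Lemma seqlim_growing (u : nat -> V) (e : nat -> R) C M : 0 <= C ->
  (forall k m, (k < m)%coq_nat -> norm (minus (u m) (u k)) ^ 2 <= C * (e m - e k)) ->
  (forall k m, (k < m)%coq_nat -> e k <= e m) -> (forall k, e k <= M) -> exists l, seqlim u l.
Proof.
move=> C0 H mono bd; apply: cauchy_lim => eps e0.
have [l Hl] : {l | Un_cv e l}.
  apply: growing_cv; first by move=> k; apply: mono; lia.
  by exists M => _ [k ->].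
have C1 : 0 < eps ^ 2 / (C + 1) by apply: Rdiv_lt_0_compat; nra.
case: (CV_Cauchy e (exist _ l Hl) _ C1) => N HN; exists N.
have gen p q : (N <= p)%coq_nat -> (N <= q)%coq_nat -> (p < q)%coq_nat -> norm (minus (u q) (u p)) < eps.
  move=> hp hq pq; have h := H p q pq; have d := HN q p hq hp; rewrite /Rdist Rabs_pos_eq in d; last by have := mono p q pq; lra.
  apply: Rnot_le_lt => l1; have : eps ^ 2 <= norm (minus (u q) (u p)) ^ 2 by apply: pow_incr; lra.
  have : C * (e q - e p) <= C * (eps ^ 2 / (C + 1)) by apply: Rmult_le_compat_l; lra.
  rewrite (_ : C * (eps ^ 2 / _) = eps ^ 2 - eps ^ 2 / (C + 1)); last by field; lra.
  lra.
move=> p q hp hq; case: (Nat.lt_trichotomy p q) => [pq|[->|qp]].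
- rewrite (_ : minus (u p) (u q) = opp (minus (u q) (u p))) ?norm_opp; [exact: gen|vring].
- by rewrite (_ : minus _ _ = zero) ?norm_zero //; vring.
- exact: gen.
Qed.
End SeqLimit.

Section Estimates.
Context {n : nat} {V : right_hilbert_module n} {T : operator V} {om : R} {HT : bisect T om}.
Hypothesis T2_accretive : m_accretive (op_sq T).
Variables th phi : R.
Hypotheses (hth : th < PI / 2) (hphi : om < phi < th).
Local Notation Nz := (Nz T).
Local Notation R1 := (R1 T).
Local Notation R2 := (R2 T).
Local Notation rho := (rho (T := T)).
Local Notation calc := (calc T phi).
Local Notation PT := (PT (T := T)).
Let om_bounds := bisect_om (T := T).

Let hth' : th <= PI / 2. Proof. by apply: Rlt_le. Qed.
Let th0 : 0 < th < PI / 2. Proof. by have := om_bounds; lra. Qed.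
Let ang1 : ang th phi. Proof. by left; have := om_bounds; rewrite Rabs_pos_eq; lra. Qed.
Let ang2 : ang th (PI - phi).
Proof. by right; have := om_bounds; rewrite (_ : _ - PI = - phi) ?Rabs_Ropp ?Rabs_pos_eq; lra. Qed.
Let PTF : resolvent_family PT := PT_family T2_accretive.

Lemma calc_add g h v : n0 th g -> n0 th h -> calc (fun z => g z + h z)%C v = plus (calc g v) (calc h v).
Proof.
move=> ng nh; apply: (calc_char (T := T) th) => // [|w]; first exact: n0_add.
have i1 := @calc_ipr _ _ T om HT th phi g v w hphi hth' ng.
have i2 := @calc_ipr _ _ T om HT th phi h v w hphi hth' nh.
have := @ii_plus R_CompleteNormedModule _ _ _ _ i1 i2.
rewrite (_ : plus _ _ = - PI * ipr (plus (calc g v) (calc h v)) w); last by rewrite iprE /plus /=; ring.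
by apply: ii_ext => r r0; rewrite /plus /pint /ray /=; ring.
Qed.

Lemma n0_scal g c : n0 th g -> n0 th (fun z => g z * RtoC c)%C.
Proof. by move=> ng; apply: n0_bdg => //; exact: bdg_real. Qed.

Lemma calc_scal g c v : n0 th g -> calc (fun z => g z * RtoC c)%C v = scal c (calc g v).
Proof.
move=> ng; apply: (calc_char (T := T) th) => // [|w]; first exact: n0_scal.
have i1 := @calc_ipr _ _ T om HT th phi g v w hphi hth' ng.
have := @ii_scal R_CompleteNormedModule c _ _ i1.
rewrite (_ : scal c (- PI * ipr (calc g v) w) = - PI * ipr (scal c (calc g v)) w); last by rewrite (ipr_scall c (calc g v)) /scal /= /mult /=; ring.
by apply: ii_ext => r r0; rewrite /scal /= /mult /= /pint /ray /=; ring.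
Qed.

Lemma calc_vadd g u v : n0 th g -> calc g (plus u v) = plus (calc g u) (calc g v).
Proof.
move=> ng; apply: (calc_char (T := T) th) => // w.
have i1 := @calc_ipr _ _ T om HT th phi g u w hphi hth' ng.
have i2 := @calc_ipr _ _ T om HT th phi g v w hphi hth' ng.
have := @ii_plus R_CompleteNormedModule _ _ _ _ i1 i2.
rewrite (_ : plus _ _ = - PI * ipr (plus (calc g u) (calc g v)) w); last by rewrite iprE /plus /=; ring.
apply: ii_ext => r r0; case: (outer_two (T := T) th phi r hphi hth' r0) => O1 O2.
have Ra s : outer om s -> rho (plus u v) w s = (rho u w s + rho v w s)%C.
  by move=> O; rewrite /rho R1_add // R2_add // (ipr_addl (R1 s u)) (ipr_addl (R2 s u)).
rewrite (pint_ext phi (fun z => g z * rho (plus u v) w z)%C (fun z => g z * rho u w z + g z * rho v w z)%C) ?pint_add //.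
- by rewrite Ra //; ring.
- by rewrite Ra //; ring.
Qed.

Lemma calc_vscal g c v : n0 th g -> calc g (scal c v) = scal c (calc g v).
Proof.
move=> ng; apply: (calc_char (T := T) th) => // w.
have i1 := @calc_ipr _ _ T om HT th phi g v w hphi hth' ng.
have := @ii_scal R_CompleteNormedModule c _ _ i1.
rewrite (_ : scal c (- PI * ipr (calc g v) w) = - PI * ipr (scal c (calc g v)) w); last by rewrite (ipr_scall c (calc g v)) /scal /= /mult /=; ring.
apply: ii_ext => r r0; case: (outer_two (T := T) th phi r hphi hth' r0) => O1 O2.
have Ra s : outer om s -> rho (scal c v) w s = (RtoC c * rho v w s)%C.
  move=> O; rewrite /rho R1_scal // R2_scal // (ipr_scall c (R1 s v)) (ipr_scall c (R2 s v)).
  by apply: injective_projections => /=; ring.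
rewrite (pint_ext phi (fun z => g z * rho (scal c v) w z)%C (fun z => RtoC c * (g z * rho v w z))%C).
- by rewrite /scal /= /mult /= /pint /ray /=; ring.
- by rewrite Ra //; ring.
- by rewrite Ra //; ring.
Qed.

Lemma calc_rmul g v s : n0 th g -> calc g (rmul v s) = rmul (calc g v) s.
Proof.
move=> ng; apply: (calc_char (T := T) th) => // w.
have i1 := @calc_ipr _ _ T om HT th phi g v (rmul w (cl_conj s)) hphi hth' ng.
have A (x : V) : ipr x (rmul w (cl_conj s)) = ipr (rmul x s) w by rewrite rmul_adj cl_conjK.
rewrite A in i1; move: i1; apply: ii_ext => r r0.
case: (outer_two (T := T) th phi r hphi hth' r0) => O1 O2.
have Ra z : outer om z -> rho v (rmul w (cl_conj s)) z = rho (rmul v s) w z.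
  by move=> O; rewrite /rho R1_rmul // R2_rmul // (A (R1 z v)) (A (R2 z v)).
by apply: pint_ext; rewrite Ra.
Qed.

Lemma R_PT s t v : 0 < t -> outer om s -> R1 s (PT t v) = PT t (R1 s v) /\ R2 s (PT t v) = PT t (R2 s v).
Proof.
move=> t0 Os; have Ot : outer om (0, t)%R by exact: outer_imag.
have E : Nz s (PT t v) = PT t (Nz s v) by rewrite /PT Nz_scal // NzC.
have d1 : dom T (Nz (0, t)%R (Nz s v)) by exact: dom_Nz.
have d2 : dom T (Nz s v) by exact: dom_Nz.
split; last by rewrite /R2 E /PT Nz_scal //; vring.
rewrite /R1 E (rf_sub _ PTF) // (rf_scal _ PTF) //; congr minus.
by rewrite /PT T_scal // T_Nz.
Qed.

Lemma calc_PT_comm g t v : 0 < t -> n0 th g -> calc g (PT t v) = PT t (calc g v).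
Proof.
move=> t0 ng; apply: (calc_char (T := T) th) => // w.
case: (adj_family PT PTF) => _ A; rewrite A //.
have i1 := @calc_ipr _ _ T om HT th phi g v (adj (PT t) w) hphi hth' ng.
move: i1; apply: ii_ext => r r0.
case: (outer_two (T := T) th phi r hphi hth' r0) => O1 O2.
have Ra z : outer om z -> rho v (adj (PT t) w) z = rho (PT t v) w z.
  by move=> O; case: (R_PT z t v t0 O) => E1 E2; rewrite /rho E1 E2 (A t (R1 z v)) // (A t (R2 z v)).
by apply: pint_ext; rewrite Ra.
Qed.

Lemma calc_pz g t v : 0 < t -> n0 th g -> calc (fun z => g z * pz t z)%C v = PT t (calc g v).
Proof.
move=> t0 ng; case: (calc_Nz (T := T) th phi g t (PI / 2) hphi ltac:(have := th0; lra) t0 ng) => n1 E1 _ _.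
rewrite -imag_pol in n1 E1.
have -> : (fun z => g z * pz t z)%C = (fun z => g z * nz (0, t)%R z * RtoC (t ^ 2))%C.
  by apply: functional_extensionality => z; rewrite /pz; ring.
by rewrite calc_scal // E1.
Qed.

Lemma n0_pz g t : 0 < t -> n0 th g -> n0 th (fun z => g z * pz t z)%C.
Proof. by move=> t0 ng; apply: n0_bdg => //; apply: bdg_pz. Qed.

Lemma n0_qpol g t : 0 < t -> n0 th g -> n0 th (fun z => g z * qpol (pz t z))%C.
Proof. by move=> t0 ng; apply: n0_bdg => //; apply: bdg_qpol. Qed.

Lemma calc_qpol g t v : 0 < t -> n0 th g -> calc (fun z => g z * qpol (pz t z))%C v = qq PT t (calc g v).
Proof.
move=> t0 ng; have n1 := n0_pz _ _ t0 ng; have n2 := n0_pz _ _ t0 n1; have n3 := n0_pz _ _ t0 n2.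
have n4 := n0_pz _ _ t0 n3; have n5 := n0_pz _ _ t0 n4.
set p := pz t in n1 n2 n3 n4 n5 *.
have -> : (fun z => g z * qpol (p z))%C = (fun z => g z * p z * p z * p z * RtoC 10 +
    (g z * p z * p z * p z * p z * RtoC (-15) + g z * p z * p z * p z * p z * p z * RtoC 6))%C.
  by apply: functional_extensionality => z; rewrite /qpol; ring.
have m3 := n0_scal _ 10 n3; have m4 := n0_scal _ (-15) n4; have m5 := n0_scal _ 6 n5.
rewrite calc_add //; last exact: n0_add.
by rewrite calc_add // !calc_scal // /p !calc_pz.
Qed.

Lemma calc_XX g a b v : 0 < a -> 0 < b -> n0 th g ->
  calc (fun z => g z * XX a b z)%C v = minus (qq PT b (calc g v)) (qq PT a (calc g v)).
Proof.
move=> a0 b0 ng; have na := n0_qpol _ _ a0 ng; have nb := n0_qpol _ _ b0 ng.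
have -> : (fun z => g z * XX a b z)%C = (fun z => g z * qpol (pz b z) + g z * qpol (pz a z) * RtoC (-1))%C.
  by apply: functional_extensionality => z; rewrite /XX; move: (qpol _) (qpol _) => x y; apply: injective_projections => /=; ring.
rewrite calc_add //; last exact: n0_scal.
by rewrite calc_scal // !calc_qpol //; vring.
Qed.

Lemma psi_calc_bound : exists2 K, 0 < K & forall g G t v, n0 th g -> 0 < t ->
  (forall r psi, 0 < r -> ang th psi -> Cmod (g (pol r psi)) <= G) ->
  norm (psi PT t (calc g v)) <= K * G * norm v.
Proof.
have p0 := PI_RGT_0; have hom := om_bounds.
case: (calc_bound (T := T) phi) => [|K K0 HK]; first lra.
have c0 := cth_gt0 th th0; set c := cth th in c0.
exists (K * (PI / 2 / (c * c))); first by apply: Rmult_lt_0_compat => //; apply: Rdiv_lt_0_compat; nra.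
move=> g G t v ng t0 HG; have n1 := n0_pz _ _ t0 ng; have n2 := n0_pz _ _ t0 n1.
have E : psi PT t (calc g v) = calc (fun z => g z * pz t z + g z * pz t z * pz t z * RtoC (-1))%C v.
  rewrite calc_add //; last exact: n0_scal.
  by rewrite calc_scal // !calc_pz // /psi (rf_sub _ PTF) //; vring.
have G0 : 0 <= G by apply: Rle_trans (Cmod_ge_0 _) (HG 1 phi Rlt_0_1 ang1).
have bd r psi : 0 < r -> ang th psi ->
    Cmod (g (pol r psi) * pz t (pol r psi) + g (pol r psi) * pz t (pol r psi) * pz t (pol r psi) * RtoC (-1))%C <=
    G / (c * c) * (t / (t ^ 2 + r ^ 2)) * r.
  move=> r0 hp; set z := pol r psi.
  rewrite (_ : (_ + _)%C = (g z * (pz t z * (1 - pz t z)))%C); last first.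
    by move: (g z) (pz t z) => x y; apply: injective_projections => /=; ring.
  rewrite Cmod_mult (_ : G / (c * c) * _ * r = G * (t * r / (t ^ 2 + r ^ 2) / (c * c))); last by field; nra.
  apply: Rmult_le_compat; try exact: Cmod_ge_0; first exact: HG.
  rewrite Cmod_mult; have b1 := pz_bound th th0 t r psi t0 r0 hp; have b2 := pz_compl_bound th th0 t r psi t0 r0 hp.
  rewrite -/c -/z in b1 b2.
  apply: Rle_trans (Rmult_le_compat _ _ _ _ (Cmod_ge_0 _) (Cmod_ge_0 _) b1 b2) _.
  rewrite (_ : _ * _ * _ = (t * r / (r + t) ^ 2) * (t * r / (r + t) ^ 2) / (c * c)); last by field; nra.
  apply: Rmult_le_compat_r; first by apply: Rlt_le; apply: Rinv_0_lt_compat; nra.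
  have tr : 0 < t * r by nra.
  have q1 : t * r / (r + t) ^ 2 <= 1 by apply: div_le; nra.
  have q2 : t * r / (r + t) ^ 2 <= t * r / (t ^ 2 + r ^ 2).
    by apply: Rmult_le_compat_l; [lra|apply: Rinv_le_contravar; nra].
  have q3 : 0 <= t * r / (r + t) ^ 2 by apply: Rdiv_le_0_compat; nra.
  nra.
rewrite E; case: (HK th (fun z => g z * pz t z + g z * pz t z * pz t z * RtoC (-1))%C (fun r => G / (c * c) * (t / (t ^ 2 + r ^ 2))) (G / (c * c) * (PI / 2)) _ hth' _ _ _ v).
- lra.
- by case: (n0_add _ _ _ n1 (n0_scal _ (-1) n2)).
- by move=> r r0; split; apply: bd.
- by apply: (@ii_scal R_CompleteNormedModule); exact: ii_cauchy_kernel.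
- by move=> _ h; apply: Rle_trans h _; apply: Req_le; field; lra.
Qed.

Lemma qq_bound (t : R) (y : V) : 0 < t -> norm (qq PT t y) <= 31 * norm (PT t y).
Proof.
move=> t0; have pw1 k : norm (pw PT k.+1 t y) <= norm (PT t y).
  by rewrite /pw iterSr; exact: (pw_contr PT PTF).
have h3 : norm (pw PT 3 t y) <= _ := pw1 2%N.
have h4 : norm (pw PT 4 t y) <= _ := pw1 3%N.
have h5 : norm (pw PT 5 t y) <= _ := pw1 4%N.
rewrite /qq; move: (pw PT 3 t y) (pw PT 4 t y) (pw PT 5 t y) (norm (PT t y)) h3 h4 h5 => u1 u2 u3 m h3 h4 h5.
apply: Rle_trans (norm_add_le _ _) _; apply: Rle_trans (Rplus_le_compat_l _ _ _ (norm_add_le _ _)) _.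
by rewrite !norm_scalV (Rabs_left1 (-15)) ?(Rabs_pos_eq 10) ?(Rabs_pos_eq 6); lra.
Qed.

Lemma qq_compl_bound (t : R) (y : V) : 0 < t -> norm (minus (qq PT t y) y) <= 120 * norm (minus y (PT t y)).
Proof.
move=> t0; set d := minus y (PT t y).
have pk k : norm (minus y (pw PT k t y)) <= INR k * norm d.
  elim: k => [|k IH].
    by rewrite /= (_ : minus y y = zero) ?norm_zero; [lra|vring].
  rewrite (_ : minus y _ = plus (minus y (pw PT k t y)) (pw PT k t d)); last first.
    by rewrite /d (pw_sub PT PTF) // (pw_S PT) /=; vring.
  apply: Rle_trans (norm_add_le _ _) _; rewrite S_INR.
  by have := pw_contr PT PTF k t d t0; lra.
have h3 := pk 3%N; have h4 := pk 4%N; have h5 := pk 5%N.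
rewrite /qq; move: (pw PT 3 t y) (pw PT 4 t y) (pw PT 5 t y) (norm d) h3 h4 h5 => u1 u2 u3 m h3 h4 h5.
rewrite (_ : minus _ y = plus (scal (-10) (minus y u1)) (plus (scal 15 (minus y u2)) (scal (-6) (minus y u3)))); last by vring.
apply: Rle_trans (norm_add_le _ _) _; apply: Rle_trans (Rplus_le_compat_l _ _ _ (norm_add_le _ _)) _.
by rewrite !norm_scalV (Rabs_left1 (-10)) ?(Rabs_pos_eq 15) ?(Rabs_left1 (-6)); simpl in h3, h4, h5; lra.
Qed.

Lemma PT_calc_limits g v : n0 th g -> exists2 C, 0 <= C & exists2 h, 0 < h & forall t, 0 < t ->
  norm (PT t (calc g v)) <= C * Rpower t h /\
  norm (minus (calc g v) (PT t (calc g v))) <= C * / Rpower t h.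
Proof.
move=> ng; have p0 := PI_RGT_0; have hom := om_bounds.
case: (calc_bound (T := T) phi) => [|K K0 HK]; first lra.
have c0 := cth_gt0 th th0; set c := cth th in c0.
case: (ng) => gg [a [M [ha hM H]]]; pose h := a / 2.
have nv := norm_ge_0 v.
exists (K * (2 * M / c * (PI / 2 / h)) * norm v).
  apply: Rmult_le_pos => //; apply: Rmult_le_pos; first lra.
  by apply: Rmult_le_pos; apply: Rdiv_le_0_compat; rewrite /h; lra.
exists h => [|t t0]; first by rewrite /h; lra.
have gen k s : 0 < s -> bdg th k -> (forall r psi, 0 < r -> ang th psi -> M * kk a r * Cmod (k (pol r psi)) <= 2 * M / c * s * kk h r) ->
    norm (calc (fun z => g z * k z)%C v) <= K * (2 * M / c * (PI / 2 / h)) * norm v * s.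
  move=> s0 bk Hk; have ngk := n0_bdg _ _ _ ng bk.
  have bd r psi : 0 < r -> ang th psi -> Cmod (g (pol r psi) * k (pol r psi))%C <= 2 * M / c * s * kap h r * r.
    move=> r0 hp; rewrite Cmod_mult (_ : _ * kap h r * r = 2 * M / c * s * kk h r); last by rewrite /kap; field; lra.
    apply: Rle_trans (Hk r psi r0 hp); apply: Rmult_le_compat_r; [exact: Cmod_ge_0|exact: H].
  case: (HK th (fun z => g z * k z)%C (fun r => 2 * M / c * s * kap h r) (2 * M / c * s * (PI / 2 / h)) _ hth' _ _ _ v).
  - lra.
  - by case: ngk.
  - by move=> r r0; split; apply: bd.
  - by apply: (@ii_scal R_CompleteNormedModule); apply: ii_kap; rewrite /h; lra.
  - by move=> _ hh; apply: Rle_trans hh _; apply: Req_le; rewrite /h; field; lra.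
have P0 := Rpower_gt0 t h.
have ic : 0 < / c by exact: Rinv_0_lt_compat.
split.
- rewrite -calc_pz //; apply: gen => //; first exact: bdg_pz.
  move=> r psi r0 hp; have [g1 _] := kk_gain a t r ha t0 r0; rewrite -/h in g1.
  have b := pz_bound th th0 t r psi t0 r0 hp; rewrite -/c in b.
  have k0 := kk_gt0 a r.
  apply: Rle_trans (_ : M * kk a r * (/ c * (t / (r + t)) ^ 2) <= _).
    by apply: Rmult_le_compat_l => //; apply: Rmult_le_pos; lra.
  rewrite (_ : M * _ * _ = M / c * ((t / (r + t)) ^ 2 * kk a r)); last by field; lra.
  rewrite (_ : 2 * M / c * _ * _ = M / c * (2 * Rpower t h * kk h r)); last by field; lra.
  by apply: Rmult_le_compat_l => //; apply: Rdiv_le_0_compat.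
- have n1 := n0_pz _ _ t0 ng.
  rewrite (_ : minus _ _ = calc (fun z => g z * (1 + pz t z * RtoC (-1)))%C v); last first.
    have -> : (fun z => g z * (1 + pz t z * RtoC (-1)))%C = (fun z => g z + g z * pz t z * RtoC (-1))%C.
      by apply: functional_extensionality => z; ring.
    by rewrite calc_add ?calc_scal ?calc_pz //; [vring|exact: n0_scal].
  apply: gen; first exact: Rinv_0_lt_compat.
    by apply: bdg_add; [exact: bdg_real|apply: bdg_mul; [exact: bdg_pz|exact: bdg_real]].
  move=> r psi r0 hp; have [_ g1] := kk_gain a t r ha t0 r0; rewrite -/h in g1.
  have b := pz_compl_bound th th0 t r psi t0 r0 hp; rewrite -/c in b.
  have -> : (1 + pz t (pol r psi) * RtoC (-1))%C = (1 - pz t (pol r psi))%C.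
    by move: (pz _ _) => x; apply: injective_projections => /=; ring.
  have k0 := kk_gt0 a r.
  apply: Rle_trans (_ : M * kk a r * (/ c * (r / (r + t)) ^ 2) <= _).
    by apply: Rmult_le_compat_l => //; apply: Rmult_le_pos; lra.
  rewrite (_ : M * _ * _ = M / c * ((r / (r + t)) ^ 2 * kk a r)); last by field; lra.
  rewrite (_ : 2 * M / c * _ * _ = M / c * (2 * / Rpower t h * kk h r)); last by field; lra.
  by apply: Rmult_le_compat_l => //; apply: Rdiv_le_0_compat.
Qed.

Lemma calc_XX_limit g v eps : n0 th g -> 0 < eps -> exists2 d, 0 < d & forall a b, 0 < a < d -> / d < b ->
  norm (minus (calc (fun z => g z * XX a b z)%C v) (calc g v)) < eps.
Proof.
move=> ng e0; case: (PT_calc_limits g v ng) => C C0 [h h0 H].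
pose e1 := eps / (400 * (C + 1)); have e10 : 0 < e1 by apply: Rdiv_lt_0_compat; lra.
exists (Rpower e1 (/ h)); first exact: Rpower_gt0.
move=> a b [a0 ha] hb; have d0 := Rpower_gt0 e1 (/ h).
have b0 : 0 < b by apply: Rlt_trans hb; exact: Rinv_0_lt_compat.
rewrite calc_XX //; set y := calc g v in H *.
case: (H a a0) => h1 _; case: (H b b0) => _ h2.
have k1 := Rpower_lt_small h e1 a h0 e10 a0 ha.
have k2 : / Rpower b h < e1.
  rewrite -(Rinv_inv e1); apply: Rinv_lt_contravar.
    by apply: Rmult_lt_0_compat; [exact: Rinv_0_lt_compat|exact: Rpower_gt0].
  apply: Rpower_gt_large => //; first exact: Rinv_0_lt_compat.
  suff <- : / Rpower e1 (/ h) = Rpower (/ e1) (/ h) by [].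
  by rewrite /Rpower ln_Rinv // -exp_Ropp; congr exp; ring.
have q1 := qq_bound a y a0; have q2 := qq_compl_bound b y b0.
rewrite (_ : minus _ y = minus (minus (qq PT b y) y) (qq PT a y)); last by vring.
apply: Rle_lt_trans (norm_sub_le _ _) _.
have b1 : C * Rpower a h <= C * e1 by apply: Rmult_le_compat_l; lra.
have b2 : C * / Rpower b h <= C * e1 by apply: Rmult_le_compat_l; lra.
have : C * e1 * 400 < eps.
  rewrite /e1 (_ : _ * 400 = eps * (C / (C + 1))); last by field; lra.
  rewrite -[X in _ < X]Rmult_1_r; apply: Rmult_lt_compat_l => //.
  by apply: (Rmult_lt_reg_r (C + 1)); rewrite /Rdiv ?Rmult_assoc ?Rinv_l; lra.
have : 0 <= C * e1 by apply: Rmult_le_pos; lra.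
lra.
Qed.

Lemma calc_vsub g u v : n0 th g -> calc g (minus u v) = minus (calc g u) (calc g v).
Proof.
move=> ng; have -> : minus u v = plus u (scal (-1) v) by vring.
by rewrite calc_vadd // calc_vscal //; vring.
Qed.

Lemma PT_mono a b v : 0 < a < b -> norm (PT a v) ^ 2 <= norm (PT b v) ^ 2.
Proof.
case=> a0 ab; case: (adj_family PT PTF) => PTF' A.
have z t : 0 < t -> psi PT t zero = zero.
  move=> t0; have P0 : PT t zero = zero.
    apply: ipr_eq0; rewrite ipr_norm; have := rf_contr PT PTF t zero t0; rewrite norm_zero => h.
    by have h0 := norm_ge_0 (PT t zero); rewrite (_ : norm _ = 0); [ring|lra].
  by rewrite /psi P0 (_ : minus zero zero = zero) //; vring.
have := energy PT _ PTF PTF' v zero 1 a b a0 ab ltac:(lra).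
move=> h; have h1 := pow2_ge_0 (norm (minus (qq PT b zero) (qq PT a (zero : V)))).
suff : norm (minus (qq PT b zero) (qq PT a (zero : V))) ^ 2 <= (15 * 1) ^ 2 * (norm (PT b v) ^ 2 - norm (PT a v) ^ 2) by lra.
apply: h => t w t0; rewrite !z // ipr_0l Rabs_R0 Rmult_1_l.
by apply: Rmult_le_pos; exact: norm_ge_0.
Qed.

Lemma calc_XX_energy : exists2 K, 0 < K & forall g G a b v, n0 th g -> 0 < a < b ->
  (forall r psi, 0 < r -> ang th psi -> Cmod (g (pol r psi)) <= G) ->
  norm (calc (fun z => g z * XX a b z)%C v) ^ 2 <= (K * G) ^ 2 * (norm (PT b v) ^ 2 - norm (PT a v) ^ 2).
Proof.
case: (psi_calc_bound ) => K K0 HK.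
case: (adj_family PT PTF) => PTF' A.
exists (15 * K); first lra.
move=> g G a b v ng [a0 ab] HG.
have G0 : 0 <= G.
  apply: Rle_trans (Cmod_ge_0 (g (pol 1 0))) (HG 1 0 Rlt_0_1 _); left; rewrite Rabs_R0; lra.
rewrite calc_XX //; last by lra.
rewrite Rmult_assoc; apply: (energy PT _ PTF PTF') => //; first by apply: Rmult_le_pos; lra.
move=> t w t0; rewrite (psi_adj PT _ PTF' A) //; apply: Rle_trans (ipr_CS _ _) _.
apply: Rmult_le_compat_r; first exact: norm_ge_0.
have -> : psi PT t (calc g v) = calc g (psi PT t v).
  rewrite /psi calc_PT_comm // calc_vsub // calc_PT_comm //.
exact: HK.
Qed.

Let a_ (k : nat) := / (INR k + 1).
Let b_ (k : nat) := INR k + 2.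

Lemma a_gt0 k : 0 < a_ k. Proof. by apply: Rinv_0_lt_compat; have := pos_INR k; lra. Qed.
Lemma b_gt0 k : 0 < b_ k. Proof. by rewrite /b_; have := pos_INR k; lra. Qed.
Lemma a_lt_b k : a_ k < b_ k.
Proof.
have k0 := pos_INR k; apply: Rle_lt_trans (_ : 1 < _); last by rewrite /b_; lra.
by rewrite /a_ -[X in _ <= X]Rinv_1; apply: Rinv_le_contravar; lra.
Qed.

Lemma calc_XX_seqlim g v : n0 th g -> seqlim (fun k => calc (fun z => g z * XX (a_ k) (b_ k) z)%C v) (calc g v).
Proof.
move=> ng eps e0; case: (calc_XX_limit  g v eps ng e0) => d d0 H.
case: (INR_unbounded (/ d)) => N HN; exists N => p /le_INR hp.
have i0 := Rinv_0_lt_compat _ d0.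
apply: H; last by rewrite /b_; lra.
split; first exact: a_gt0.
by rewrite /a_ -(Rinv_inv d); apply: Rinv_lt_contravar; nra.
Qed.

Lemma n0_XX_mul f M a b : good th f -> (forall r psi, 0 < r -> ang th psi -> Cmod (f (pol r psi)) <= M) ->
  0 < a -> 0 < b -> n0 th (fun z => XX a b z * f z)%C.
Proof. by move=> gf Hf a0 b0; apply: (n0_mul_bd _ _ _ M) => //; exact: n0_XX. Qed.

Lemma calc_bounded_energy : exists2 K, 0 < K & forall f M a b v, good th f ->
  (forall r psi, 0 < r -> ang th psi -> Cmod (f (pol r psi)) <= M) -> 0 < a < b ->
  norm (calc (fun z => XX a b z * f z)%C v) ^ 2 <= (K * M) ^ 2 * (norm (PT b v) ^ 2 - norm (PT a v) ^ 2).
Proof.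
case: calc_XX_energy => K K0 HK; case: (qpol_bound th th0) => Q Q0 HQ.
exists (K * (2 * Q + 1)); first by apply: Rmult_lt_0_compat; lra.
move=> f M a b v gf Hf ab; set R := _ * (_ - _).
have nf := n0_XX_mul f M a b gf Hf ltac:(lra) ltac:(lra).
have M0 : 0 <= M.
  apply: Rle_trans (Cmod_ge_0 (f (pol 1 0))) (Hf 1 0 Rlt_0_1 _); left; rewrite Rabs_R0; lra.
set y := calc _ v.
have R0 : 0 <= R.
  apply: Rmult_le_pos; first exact: pow2_ge_0.
  have := PT_mono a b v ab; lra.
suff h : norm y <= sqrt R.
  by rewrite -(pow2_sqrt R R0); apply: pow_incr; split => //; exact: norm_ge_0.
apply: (seqlim_bound (fun k => calc (fun z => XX a b z * f z * XX (a_ k) (b_ k) z)%C v)); last exact: calc_XX_seqlim.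
move=> k; have nk := n0_XX_mul f M (a_ k) (b_ k) gf Hf (a_gt0 k) (b_gt0 k).
have -> : (fun z => XX a b z * f z * XX (a_ k) (b_ k) z)%C = (fun z => XX (a_ k) (b_ k) z * f z * XX a b z)%C.
  by apply: functional_extensionality => z; ring.
rewrite -(sqrt_pow2 (norm _)); last exact: norm_ge_0.
apply: sqrt_le_1_alt; rewrite /R Rmult_assoc; apply: HK => // r psi r0 hp.
rewrite Cmod_mult; apply: Rmult_le_compat; try exact: Cmod_ge_0; last exact: Hf.
apply: Rle_trans (Cmod_triangle _ _) _; rewrite Cmod_opp.
have := HQ _ r psi (a_gt0 k) r0 hp; have := HQ _ r psi (b_gt0 k) r0 hp; lra.
Qed.

Lemma hinf_operator : exists2 C, 0 <= C & forall f M, good th f ->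
  (forall r psi, 0 < r -> ang th psi -> Cmod (f (pol r psi)) <= M) ->
  exists F : V -> V, [/\ bounded_rl F, norm_le F (C * M) &
    forall e v, n0 th e -> calc e (F v) = calc (fun z => e z * f z)%C v].
Proof.
case: calc_bounded_energy => K K0 HK; exists K; first lra.
move=> f M gf Hf.
have M0 : 0 <= M.
  apply: Rle_trans (Cmod_ge_0 (f (pol 1 0))) (Hf 1 0 Rlt_0_1 _); left; rewrite Rabs_R0; lra.
pose g k z := (XX (a_ k) (b_ k) z * f z)%C.
have ng k : n0 th (g k) by apply: (n0_XX_mul f M) => //; [exact: a_gt0|exact: b_gt0].
have a_lt k m : (k < m)%coq_nat -> a_ m < a_ k.
  by move/lt_INR => h; have k0 := pos_INR k; apply: Rinv_lt_contravar; nra.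
have b_lt k m : (k < m)%coq_nat -> b_ k < b_ m by move/lt_INR; rewrite /b_; lra.
have [F HF] : exists F : V -> V, forall v, seqlim (fun k => calc (g k) v) (F v).
  apply: (functional_choice (fun v l => seqlim (fun k => calc (g k) v) l)) => v.
  apply: (seqlim_growing _ (fun k => norm (PT (b_ k) v) ^ 2 - norm (PT (a_ k) v) ^ 2) (2 * (K * M) ^ 2) (norm v ^ 2)).
  - by have := pow2_ge_0 (K * M); lra.
  - move=> k m km; have am := a_gt0 m; have bk := b_gt0 k; have lt1 := a_lt k m km; have lt2 := b_lt k m km.
    have n1 := n0_XX_mul f M (a_ m) (a_ k) gf Hf am (a_gt0 k).
    have n2 := n0_XX_mul f M (b_ k) (b_ m) gf Hf bk (b_gt0 m).
    have h1 := HK f M (a_ m) (a_ k) v gf Hf (conj am lt1).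
    have h2 := HK f M (b_ k) (b_ m) v gf Hf (conj bk lt2).
    have E : minus (calc (g m) v) (calc (g k) v) = plus (calc (fun z => XX (a_ m) (a_ k) z * f z)%C v) (calc (fun z => XX (b_ k) (b_ m) z * f z)%C v).
      have := calc_add (g k) (fun z => XX (a_ m) (a_ k) z * f z + XX (b_ k) (b_ m) z * f z)%C v (ng k) (n0_add _ _ _ n1 n2).
      rewrite (calc_add _ _ v n1 n2) (_ : (fun z => g k z + _)%C = g m); last first.
        by apply: functional_extensionality => z; rewrite /g /XX; ring.
      by move: (calc _ _) (calc _ _) (calc _ _) (calc _ _) => x1 x2 x3 x4 ->; vring.
    rewrite E; move: h1 h2; set x := calc _ v; set y := calc _ v => h1 h2.
    have nx := norm_ge_0 x; have ny := norm_ge_0 y; have nxy := norm_ge_0 (plus x y); have tr := norm_add_le x y.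
    have : norm (plus x y) ^ 2 <= (norm x + norm y) ^ 2 by apply: pow_incr.
    have := pow2_ge_0 (norm x - norm y); lra.
  - move=> k m km; have := PT_mono (a_ m) (a_ k) v (conj (a_gt0 m) (a_lt k m km)).
    by have := PT_mono (b_ k) (b_ m) v (conj (b_gt0 k) (b_lt k m km)); lra.
  - move=> k; have := pow2_ge_0 (norm (PT (a_ k) v)).
    have : norm (PT (b_ k) v) ^ 2 <= norm v ^ 2.
      by apply: pow_incr; split; [exact: norm_ge_0|apply: (rf_contr PT PTF); exact: b_gt0].
    lra.
have FD u v : F (plus u v) = plus (F u) (F v).
  by apply: (seqlim_add (fun k => calc (g k) u) (fun k => calc (g k) v) _ _ _ _ _ (HF u) (HF v) (HF (plus u v))) => k; rewrite calc_vadd.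
have FR v s : F (rmul v s) = rmul (F v) s.
  by apply: (seqlim_rmul (fun k => calc (g k) v) _ _ _ _ _ (HF v) (HF (rmul v s))) => k; rewrite calc_rmul.
have FB : norm_le F (K * M).
  move=> v; apply: seqlim_bound (HF v) => k; have nv := norm_ge_0 v.
  apply: pow2_le_inv; first by repeat apply: Rmult_le_pos => //; lra.
  apply: Rle_trans (HK f M (a_ k) (b_ k) v gf Hf (conj (a_gt0 k) (a_lt_b k))) _.
  rewrite (Rpow_mult_distr (K * M)); apply: Rmult_le_compat_l; first exact: pow2_ge_0.
  have := pow2_ge_0 (norm (PT (a_ k) v)).
  have : norm (PT (b_ k) v) ^ 2 <= norm v ^ 2.
    by apply: pow_incr; split; [exact: norm_ge_0|apply: (rf_contr PT PTF); exact: b_gt0].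
  lra.
exists F; split => //.
  by split; [split => //|exists (K * M)].
move=> e v ne; have nef : n0 th (fun z => e z * f z)%C by apply: (n0_mul_bd _ _ _ M).
have [L HL] : exists L, norm_le (calc e) L.
  case: (ne) => ge [a [N [ha hN H]]]; have p0 := PI_RGT_0; have hom := om_bounds.
  case: (calc_bound (T := T) phi) => [|L L0 HL]; first lra.
  exists (L * (N * (PI / 2 / a))) => x.
  case: (HL th e (fun r => N * kap a r) (N * (PI / 2 / a)) _ _ ge _ _ x) => //; try lra.
  - move=> r r0; rewrite (_ : N * kap a r * r = N * kk a r); last by rewrite /kap; field; lra.
    by split; apply: H.
  - by apply: (@ii_scal R_CompleteNormedModule N (kap a)); apply: ii_kap; lra.
apply: (seqlim_uniq (fun k => calc e (calc (g k) v))).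
  by apply: (seqlim_op _ L _ _ _ HL (HF v)) => x y; rewrite calc_vsub.
have := calc_XX_seqlim _ v nef.
rewrite (_ : (fun k => calc (fun z => e z * f z * XX (a_ k) (b_ k) z)%C v) = (fun k => calc e (calc (g k) v))) //.
apply: functional_extensionality => k; rewrite (calc_mul (T := T) th) //; congr (calc _ v).
by apply: functional_extensionality => z; rewrite /g; ring.
Qed.

End Estimates.

Theorem corollary3p8 (n : nat) (n_gt0 : (0 < n)%N) (V : right_hilbert_module n)
    (T : operator V) (om : R) (om_bounds : 0 < om < PI / 2)
    (T_closed : closed_rl T) (T_inj : op_injective T)
    (T_bisect : bisectorial T om) (T2_accretive : m_accretive (op_sq T)) :
  bounded_Hinf_calculus T om.
Proof.
have HT : bisect T om by case: T_bisect => -[lin _] _ spec bd; split.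
move=> th hth; pose phi := (om + th) / 2.
have hphi : om < phi < th by rewrite /phi; lra.
have th2 : th < PI / 2 by lra.
have th0 : 0 < th < PI / 2 by lra.
case: (hinf_operator (T := T) T2_accretive th phi th2 hphi) => C C0 HC.
exists C => // f [fi [M fM]].
case: (intrinsic_hol th f th0 fi) => g [hg cg Hf].
have [J0 HJ0] := im_unit_ex n_gt0.
have Hg r psi : 0 < r -> ang th psi -> Cmod (g (pol r psi)) <= sup_norm (@dsector n th) f.
  move=> r0 hp; have D : dsec th (pol r psi) by apply: dsec_ang => //; lra.
  rewrite -(cl_norm_sl J0) // -Hf //; apply: (sup_norm_ub th f M) => //.
  exact/(dsector_sl J0).
case: (HC g _ (conj hg cg) Hg) => F [FB FM HF]; exists F; split => //.
have indep phi' e v : om < phi' < th -> n0 th e -> calc T phi' e v = calc T phi e v.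
  move=> hp ne; case: (Rle_lt_dec phi' phi) => h.
    by apply: (calc_indep (T := T) th) => //; lra.
  by symmetry; apply: (calc_indep (T := T) th) => //; lra.
have val e ge v w : slice_rep th e ge -> n0 th ge -> N0_calc T om th e v w <-> w = calc T phi ge v.
  move=> He ne; split.
    case=> phi' [J [hp HJ ->]]; rewrite (dsector_integral_calc (T := T) th phi' J e ge) //; exact: indep.
  by move=> ->; exists phi, J0; split => //; rewrite (dsector_integral_calc (T := T) th phi J0 e ge).
have nmul ge : n0 th ge -> n0 th (fun z => ge z * g z)%C.
  by move=> ne; apply: (n0_mul_bd _ _ _ _ ne (conj hg cg) Hg).
have rmul e ge : slice_rep th e ge -> slice_rep th (fun_mul e f) (fun z => ge z * g z)%C.
  by move=> He; apply: slice_rep_mul.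
move=> v w; split.
- case=> e [Ne _ inj [w' h1 h2]]; case: (N0_n0 n_gt0 th e th0 Ne) => ge ne He.
  apply: (inj _ _ w') => //; apply/(val _ ge) => //.
  by rewrite HF //; apply/(val _ _ _ _ (rmul _ _ He)) => //; exact: nmul.
- move=> ->; have ne := n0_e0 th th0; have He := slice_rep_lift (n := n) th e0 (proj2 (proj1 ne)).
  exists (lift e0); split.
  + exact: (n0_N0 n_gt0 th _ e0).
  + by apply: (n0_N0 n_gt0 th _ _ th0 (rmul _ _ He)); exact: nmul.
  + move=> v1 v2 w' /(val _ _ _ _ He ne) -> /(val _ _ _ _ He ne).
    rewrite !(calc_e0 (T := T) th) // => E.
    have Oi : outer om (0, 1)%R by apply: outer_imag; lra.
    have EN := T_inj _ _ (dom_Nz _ v1 Oi) (dom_Nz _ v2 Oi) E.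
    case: (NzP _ v1 Oi) => _ _ q1; case: (NzP _ v2 Oi) => _ _ q2.
    by rewrite -q1 EN q2.
  + exists (calc T phi (fun z => e0 z * g z)%C v).
    * by apply/(val _ _ _ _ (rmul _ _ He)) => //; exact: nmul.
    * by apply/(val _ _ _ _ He ne); rewrite HF.
Qed.
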